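(* Let $\underline{\mathbf U}$ be the profile of a periodic traveling wave solution of $\partial_t\mathbf U=\partial_x\mathbf J(\mathsf E\mathscr H[\mathbf U])$, of period $1/\underline k$ and speed $\underline c$. Assume that the set of nearby periodic traveling wave profiles $\mathbf U$ of speed $c$ close to $\underline c$ is an $(N+2)$-dimensional manifold parametrized (up to translations) by $(k,\mathbf M=\langle\mathbf U\rangle,P=\langle Q\rangle)$, where $1/k$ is their period and $Q:=\tfrac12\,\mathbf U\cdot\mathbf J^{-1}\mathbf U$. Consider the modulated system, with unknowns $(k,\mathbf M,P)$ depending on $(T,X)$, $$\left\{\begin{array}{l}\partial_T k+\partial_X(ck)=0,\\ \partial_T\langle\mathbf U\rangle=\mathbf J\,\partial_X\langle\mathbf G\rangle,\\ \partial_T\langle Q\rangle=\partial_X\langle S\rangle,\end{array}\right.$$ where $$G_\alpha:=\frac{\partial\mathscr H}{\partial U_\alpha}(\mathbf U,k\partial_\theta\mathbf U)-k\partial_\theta\left(\frac{\partial\mathscr H}{\partial U_{\alpha,x}}(\mathbf U,k\partial_\theta\mathbf U)\right),$$ $$S:=\mathbf U\cdot\mathbf G-\mathscr H(\mathbf U,k\partial_\theta\mathbf U)+\sum_{\alpha}(k\partial_\theta U_\alpha)\,\frac{\partial\mathscr H}{\partial U_{\alpha,x}}(\mathbf U,k\partial_\theta\mathbf U).$$ Here $c=c(k,\mathbf M,P)$ and $\mathbf U=\mathbf U(\theta;k,\mathbf M,P)$ are the speed and the rescaled ($1$-periodic) profile associated with $(k,\mathbf M,P)$. Assume also that the generalized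 kernel of the linearized operator $\mathscr A$ about $\underline{\mathbf U}$, in the space of $1$-periodic functions, is of dimension $N+2$. Then a necessary condition for $\underline{\mathbf U}$ to be (spectrally) stable is that the modulated system be weakly hyperbolic at $(\underline k,\underline{\mathbf M},\underline P)$ (the values of $(k,\mathbf M,P)$ for $\underline{\mathbf U}$), in the sense that all its characteristic speeds at that point are real.
   Context: **Equation.** $\mathbf U=\mathbf U(t,x)\in\mathbb R^N$; $\mathbf J$ is a real symmetric nonsingular $N\times N$ matrix with constant coefficients; $\mathscr H=\mathscr H(\mathbf U,\mathbf U_x)$ is a smooth function. The Euler operator is $$\mathsf E\mathscr H[\mathbf U]_\alpha=\frac{\partial\mathscr H}{\partial U_\alpha}(\mathbf U,\mathbf U_x)-\mathrm D_x\Big(\frac{\partial\mathscr H}{\partial U_{\alpha,x}}(\mathbf U,\mathbf U_x)\Big),\quad \alpha=1,\dots,N,$$ with $\mathrm D_x$ the total derivative. The impulse is $\mathscr Q(\mathbf U)=\tfrac12\mathbf U\cdot\mathbf J^{-1}\mathbf U$, so that $\partial_x\mathbf J\,\mathsf E\mathscr Q[\mathbf U]=\partial_x\mathbf U$. **Structural assumption on $\mathscr H$.** $\mathbb R^N=\mathbb R^n\times\mathbb R^{N-n}$ for some $0\le n\le N$, $\mathbf U=(\mathbf v,\mathbf u)^T$, $\mathscr H=\mathscr I(\mathbf v,\mathbf u)+\mathscr E(\mathbf v,\mathbf v_x)$, and $\mathscr H+c\mathscr Q$ is uniformly strongly convex in $\mathbf v_x$ and in $\mathbf u$ (the Hessians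 with respect to $\mathbf v_x$ and with respect to $\mathbf u$ are uniformly positive definite) on the range of values of $(\mathbf U,\mathbf v_x)$ and speeds $c$ under consideration. **Profiles.** A traveling wave of speed $c$ is a solution depending only on $x-ct$; its profile satisfies $\mathsf E(\mathscr H+c\mathscr Q)[\mathbf U]=\boldsymbol\lambda$ for some constant $\boldsymbol\lambda\in\mathbb R^N$. A periodic profile of period $1/k$ is viewed as a $1$-periodic function of $\theta=kx$, satisfying $$\partial_\theta\Big(\frac{\partial\mathscr H}{\partial U_\alpha}(\mathbf U,k\partial_\theta\mathbf U)-k\partial_\theta\Big(\frac{\partial\mathscr H}{\partial U_{\alpha,x}}(\mathbf U,k\partial_\theta\mathbf U)\Big)+c\,\frac{\partial\mathscr Q}{\partial U_\alpha}(\mathbf U)\Big)=0,\quad \alpha=1,\dots,N.$$ $\langle\cdot\rangle$ is the mean value over $\theta\in[0,1]$. **Parametrization assumption.** It means: for all $(k,\mathbf M,P)$ close to $(\underline k,\underline{\mathbf M},\underline P)$ there are a unique speed $c=c(k,\mathbf M,P)$ close to $\underline c$ and a unique (up to translations) $1$-periodic solution $\mathbf U(\theta;k,\mathbf M,P)$ of the profile equations which is close to $\underline{\mathbf U}$ (in sup norm up to translations) and satisfies $\langle\mathbf U\rangle=\mathbf M$, $\langle\mathscr Q(\mathbf U)\rangle=P$, with smooth dependence on $(k,\mathbf M,P)$. **Linearized operator.** In a frame moving with the wave (space rescaled by $\theta=\underline kx$), $\mathscr A=\underline k\partial_\theta\,\mathbf J\,\mathbf A(\underline k\partial_\theta)$,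 where $\mathbf A(\underline k\partial_\theta)=\mathrm{Hess}(\mathscr H+\underline c\mathscr Q)[\underline{\mathbf U}]$ with $\partial_x$ replaced by $\underline k\partial_\theta$, i.e. (summing over $\beta$) $$(\mathbf A\mathbf V)_\alpha=\frac{\partial^2\mathscr H}{\partial U_\alpha\partial U_\beta}V_\beta+\frac{\partial^2\mathscr H}{\partial U_\alpha\partial U_{\beta,x}}\underline k\partial_\theta V_\beta-\underline k\partial_\theta\Big(\frac{\partial^2\mathscr H}{\partial U_{\alpha,x}\partial U_\beta}V_\beta+\frac{\partial^2\mathscr H}{\partial U_{\alpha,x}\partial U_{\beta,x}}\underline k\partial_\theta V_\beta\Big)+\underline c\,(\mathbf J^{-1}\mathbf V)_\alpha,$$ derivatives of $\mathscr H$ being evaluated at $(\underline{\mathbf U},\underline k\partial_\theta\underline{\mathbf U})$. On $1$-periodic functions its domain is $H^3(\mathbb R/\mathbb Z;\mathbb R^n)\times H^1(\mathbb R/\mathbb Z;\mathbb R^{N-n})$ (complexified) in $L^2(\mathbb R/\mathbb Z)$. **Spectral stability.** The Bloch operators $\mathscr A^\nu$, $\nu\in\mathbb R/2\pi\mathbb Z$, are obtained from $\mathscr A$ by replacing $\partial_\theta$ by $\partial_\theta+i\nu$, acting on $1$-periodic functions; the spectrum of $\mathscr A$ on the whole space of bounded functions is $\sigma(\mathscr A)=\bigcup_\nu\sigma(\mathscr A^\nu)$. The wave is (spectrally) stable if $\sigma(\mathscr A)\subset i\mathbb R$. **Characteristic speeds.** The modulated system is a first-order quasilinear system $\partial_TW=B(W)\partial_XW$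 for $W=(k,\mathbf M,P)$, $B(W)$ being the Jacobian matrix of $(k,\mathbf M,P)\mapsto(-ck,\mathbf J\langle\mathbf G\rangle,\langle S\rangle)$; its characteristic speeds are, up to sign, the eigenvalues of $B(W)$. *)

(* Defs.v *)
From HB Require Import structures.
From mathcomp Require Import all_boot all_order all_algebra.
From mathcomp Require Import all_classical all_reals all_analysis.
From mathcomp.real_closed Require Import complex.

Set Implicit Arguments.
Unset Strict Implicit.
Unset Printing Implicit Defensive.

Import Order.TTheory GRing.Theory Num.Theory.
Import numFieldNormedType.Exports.

Local Open Scope classical_set_scope.
Local Open Scope ring_scope.
Local Open Scope complex_scope.

(* f is C^infinity on the open set A: every iterated directional derivative of
   f is Frechet differentiable at every point of A.  On finite-dimensional
   spaces, the only ones used below, this is the usual notion. *)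
Definition iter_derive (R : realType) (V W : normedModType R)
    (f : V -> W) (vs : seq V) : V -> W :=
  foldr (fun v g x => 'D_v g x) f vs.

Definition smooth_on (R : realType) (V W : normedModType R)
    (A : set V) (f : V -> W) : Prop :=
  forall (vs : seq V) (x : V), A x -> differentiable (iter_derive f vs) x.

Definition mean (R : realType) (f : R -> R) : R :=
  (\int[lebesgue_measure]_(t in `[0, 1]) f t)%R.

Definition vmean (R : realType) (N : nat) (U : R -> 'cV[R]_N) : 'cV[R]_N :=
  \col_a mean (fun t => U t a 0).

Section Hamiltonian.
Context {R : realType} {N : nat}.
Implicit Types (J : 'M[R]_N) (H : 'cV[R]_N -> 'cV[R]_N -> R)
  (U : R -> 'cV[R]_N) (k c : R) (a : 'I_N).

(* Here and below, [H U p] stands for H(U, U_x) with U_x = p; [dU a H] and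
   [dUx a H] are its partial derivatives with respect to U_a and U_{a,x}. *)
Definition dU a H : 'cV[R]_N -> 'cV[R]_N -> R :=
  fun (U p : 'cV[R]_N) => 'D_(delta_mx a 0) (fun U' : 'cV[R]_N => H U' p) U.

Definition dUx a H : 'cV[R]_N -> 'cV[R]_N -> R :=
  fun (U p : 'cV[R]_N) => 'D_(delta_mx a 0) (H U) p.

Definition impulse J (U : 'cV[R]_N) : R :=
  2^-1 * (U^T *m invmx J *m U) 0 0.

Definition waveG H k U : R -> 'cV[R]_N := fun t =>
  \col_a (dU a H (U t) (k *: derive1 U t)
          - k * derive1 (fun s : R => dUx a H (U s) (k *: derive1 U s)) t).

Definition waveS H k U : R -> R := fun t =>
  \sum_a U t a 0 * waveG H k U t a 0
  - H (U t) (k *: derive1 U t)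
  + \sum_a (k *: derive1 U t) a 0 * dUx a H (U t) (k *: derive1 U t).

Definition close_up_to_translation (e : R) (U U' : R -> 'cV[R]_N) : Prop :=
  exists s : R, forall t, `|U t - U' (t + s)| < e.

(* Coordinates of W = (k, M, P) in R^(N+2). *)
Definition pack k (M : 'cV[R]_N) (P : R) : 'cV[R]_(1 + (N + 1)) :=
  col_mx k%:M (col_mx M P%:M).
Definition wavek (W : 'cV[R]_(1 + (N + 1))) : R := usubmx W 0 0.
Definition waveM (W : 'cV[R]_(1 + (N + 1))) : 'cV[R]_N := usubmx (dsubmx W).
Definition waveP (W : 'cV[R]_(1 + (N + 1))) : R := dsubmx (dsubmx W) 0 0.

(* The modulated system reads d_T W = d_X (modflux W) = B(W) d_X W. *)
Definition modflux J H (c : 'cV[R]_(1 + (N + 1)) -> R)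
    (U : 'cV[R]_(1 + (N + 1)) -> R -> 'cV[R]_N)
    (W : 'cV[R]_(1 + (N + 1))) : 'cV[R]_(1 + (N + 1)) :=
  pack (- (c W * wavek W))
       (J *m vmean (waveG H (wavek W) (U W)))
       (mean (waveS H (wavek W) (U W))).

Definition modmatrix J H (c : 'cV[R]_(1 + (N + 1)) -> R)
    (U : 'cV[R]_(1 + (N + 1)) -> R -> 'cV[R]_N)
    (W : 'cV[R]_(1 + (N + 1))) : 'M[R]_(1 + (N + 1)) :=
  \matrix_(i, j) 'D_(delta_mx j 0) (fun W' => modflux J H c U W' i 0) W.

Definition weakly_hyperbolic_at J H (c : 'cV[R]_(1 + (N + 1)) -> R)
    (U : 'cV[R]_(1 + (N + 1)) -> R -> 'cV[R]_N)
    (W : 'cV[R]_(1 + (N + 1))) : Prop :=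
  forall z : R[i],
    eigenvalue (map_mx (real_complex R) (modmatrix J H c U W)) z ->
    complex.Im z = 0.

End Hamiltonian.

Section Profiles.
Context {R : realType} {n m : nat}.
Implicit Types (J : 'M[R]_(n + m)) (H : 'cV[R]_(n + m) -> 'cV[R]_(n + m) -> R)
  (U : R -> 'cV[R]_(n + m)) (k c : R).

(* U = (v, u) with v = [usubmx U] in R^n and u = [dsubmx U] in R^m.  The set D
   is the range of values of (U, v_x) and C the range of speeds under
   consideration; D = setT and C = setT is allowed. *)
Variant structural (D : set ('cV[R]_(n + m) * 'cV[R]_n)) (C : set R) J H : Prop :=
  Structural (HI : 'cV[R]_n -> 'cV[R]_m -> R) (HE : 'cV[R]_n -> 'cV[R]_n -> R)
    (kappa : R)
    of open D & open C
    & smooth_on [set z : 'cV[R]_(n + m) * 'cV[R]_(n + m) | D (z.1, usubmx z.2)]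
        (fun z => H z.1 z.2)
    & (forall U p : 'cV[R]_(n + m), D (U, usubmx p) ->
         H U p = HI (usubmx U) (dsubmx U) + HE (usubmx U) (usubmx p))
    & 0 < kappa
    & (forall (U p : 'cV[R]_(n + m)) c (x : 'I_n -> R), D (U, usubmx p) -> C c ->
         let Hc := fun U' p' : 'cV[R]_(n + m) => H U' p' + c * impulse J U' in
         kappa * \sum_i x i ^+ 2 <=
         \sum_i \sum_j
           dUx (lshift m j) (dUx (lshift m i) Hc) U p * x i * x j)
    & (forall (U p : 'cV[R]_(n + m)) c (x : 'I_m -> R), D (U, usubmx p) -> C c ->
         let Hc := fun U' p' : 'cV[R]_(n + m) => H U' p' + c * impulse J U' in
         kappa * \sum_i x i ^+ 2 <=
         \sum_i \sum_j
           dU (rshift n j) (dU (rshift n i) Hc) U p * x i * x j).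

Definition is_profile (D : set ('cV[R]_(n + m) * 'cV[R]_n)) (C : set R)
    J H k c U : Prop :=
  [/\ 0 < k, C c & smooth_on setT U] /\
  [/\ periodic U 1,
      (forall t, D (U t, usubmx (k *: derive1 U t))) &
      forall a t,
        derive1 (fun s : R => waveG H k U s a 0
                              + c * 'D_(delta_mx a 0) (impulse J) (U s)) t = 0].

(* Nearby profiles are parametrized, up to translations, by W = (k, M, P) near
   the value of W for the profile U0 of wavenumber k0 and speed c0. *)
Definition parametrized (D : set ('cV[R]_(n + m) * 'cV[R]_n)) (C : set R)
    J H (k0 c0 : R) (U0 : R -> 'cV[R]_(n + m))
    (c : 'cV[R]_(1 + ((n + m) + 1)) -> R)
    (U : 'cV[R]_(1 + ((n + m) + 1)) -> R -> 'cV[R]_(n + m)) : Prop :=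
  let solution e W c' U' :=
    [/\ is_profile D C J H (wavek W) c' U',
        `|c' - c0| < e,
        close_up_to_translation e U' U0,
        vmean U' = waveM W &
        mean (fun t => impulse J (U' t)) = waveP W] in
  exists (O : set 'cV[R]_(1 + ((n + m) + 1))) (e : R),
    [/\ open_nbhs (pack k0 (vmean U0) (mean (fun t => impulse J (U0 t)))) O,
        0 < e,
        (forall W, O W -> solution e W (c W) (U W)),
        (forall W c' U', O W -> solution e W c' U' ->
           c' = c W /\ exists s : R, forall t, U' t = U W (t + s)) &
        smooth_on O c /\
        smooth_on (setT `*` O)
          (fun z : R * 'cV[R]_(1 + ((n + m) + 1)) => U z.2 z.1)].

End Profiles.

Section Sobolev.
Context {R : realType}.
Implicit Types (f g : R -> R[i]).

Definition cintegral (A : set R) f : R[i] :=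
  (\int[lebesgue_measure]_(t in A) complex.Re (f t))%R
  +i* (\int[lebesgue_measure]_(t in A) complex.Im (f t))%R.

(* The square of the norm of L^2(R/Z). *)
Definition L2norm2 f : \bar R :=
  (\int[lebesgue_measure]_(t in `[0%R, 1%R]) (Normc.normc (f t) ^+ 2)%:E)%E.

Definition L2per f : Prop :=
  [/\ periodic f 1,
      measurable_fun setT (fun t => complex.Re (f t)),
      measurable_fun setT (fun t => complex.Im (f t)) &
      (L2norm2 f < +oo)%E].

(* f is the continuous representative of an element of H^1(R/Z) and g
   represents its weak derivative, which is determined almost everywhere. *)
Definition wderiv f g : Prop :=
  [/\ periodic f 1, L2per g &
      forall x : R, 0 <= x <= 1 -> f x = f 0 + cintegral `[0, x] g].

Fixpoint Hper (s : nat) f : Prop :=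
  if s is s'.+1 then exists g, wderiv f g /\ Hper s' g else L2per f.

End Sobolev.

Section Linearized.
Context {R : realType} {n m : nat}.
Local Notation N := (n + m)%N.
Implicit Types (J : 'M[R]_N) (H : 'cV[R]_N -> 'cV[R]_N -> R)
  (U : R -> 'cV[R]_N) (k c nu : R) (V Y F : R -> 'cV[R[i]]_N).

Definition vL2norm2 V : \bar R := (\sum_a L2norm2 (fun t => V t a ord0))%E.

Definition vL2per V : Prop := forall a, L2per (fun t => V t a 0).

Definition lin_domain V : Prop :=
  (forall i : 'I_n, Hper 3 (fun t => V t (lshift m i) 0)) /\
  (forall i : 'I_m, Hper 1 (fun t => V t (rshift n i) 0)).

(* V is in H^1 and V1 = (d_theta + i nu) V. *)
Definition bloch_deriv nu V (V1 : R -> 'cV[R[i]]_N) : Prop :=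
  forall a, wderiv (fun t => V t a 0) (fun t => V1 t a 0 - (0 +i* nu) * V t a 0).

(* Y = A(k (d_theta + i nu)) V, where A is the Hessian operator of H + c Q at U.
   Derivatives are existentially quantified because they are only determined
   almost everywhere; X is the vector of components between the parentheses
   in the last term of A V. *)
Definition hess_graph J H k c U nu V Y : Prop :=
  let h := fun (q : 'cV[R]_N -> 'cV[R]_N -> R) t =>
             (q (U t) (k *: derive1 U t))%:C in
  exists V1 X X1 : R -> 'cV[R[i]]_N,
    [/\ bloch_deriv nu V V1,
        (forall t a, X t a 0 =
           \sum_b (h (dU b (dUx a H)) t * V t b 0
                   + h (dUx b (dUx a H)) t * (k%:C * V1 t b 0))),
        bloch_deriv nu X X1 &
        forall t a, Y t a 0 =
           \sum_b (h (dU b (dU a H)) t * V t b 0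
                   + h (dUx b (dU a H)) t * (k%:C * V1 t b 0))
           - k%:C * X1 t a 0
           + c%:C * (map_mx (real_complex R) (invmx J) *m V t) a 0].

(* The graph of the Bloch operator A^nu = k (d_theta + i nu) J A(k (d_theta + i nu)),
   of domain H^3 x H^1 in L^2; A^0 is A on 1-periodic functions. *)
Definition bloch_graph J H k c U nu V F : Prop :=
  [/\ lin_domain V, vL2per F &
      exists Y Z : R -> 'cV[R[i]]_N,
        [/\ hess_graph J H k c U nu V Y,
            bloch_deriv nu (fun t => map_mx (real_complex R) J *m Y t) Z &
            {ae lebesgue_measure, forall t : R, F t = k%:C *: Z t}]].

(* lambda - A^nu is bijective from H^3 x H^1 onto L^2, with bounded inverse;
   (lambda - A^nu) V = F is written A^nu V = lambda V - F. *)
Definition bloch_resolvent J H k c U nu : set R[i] := [set lambda |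
  (forall F, vL2per F ->
     exists! V, bloch_graph J H k c U nu V (fun t => lambda *: V t - F t)) /\
  (exists K : R, forall V F, vL2per F ->
     bloch_graph J H k c U nu V (fun t => lambda *: V t - F t) ->
     (vL2norm2 V <= K%:E * vL2norm2 F)%E)].

Definition spectrum J H k c U : set R[i] :=
  \bigcup_(nu in [set: R]) ~` bloch_resolvent J H k c U nu.

Definition spectrally_stable J H k c U : Prop :=
  forall lambda, spectrum J H k c U lambda -> complex.Re lambda = 0.

(* V belongs to ker (A^j), for A acting on 1-periodic functions. *)
Fixpoint ker_pow J H k c U (j : nat) V : Prop :=
  if j is j'.+1 then
    exists F, bloch_graph J H k c U 0 V F /\ ker_pow J H k c U j' F
  else forall t, V t = 0.

Definition gen_kernel J H k c U V : Prop :=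
  exists j, ker_pow J H k c U j V.

Definition gen_kernel_dim J H k c U (d : nat) : Prop :=
  exists b : 'I_d -> R -> 'cV[R[i]]_N,
    (forall i, gen_kernel J H k c U (b i)) /\
    (forall V, gen_kernel J H k c U V ->
       exists! z : {ffun 'I_d -> R[i]}, forall t, V t = \sum_i z i *: b i t).

End Linearized.

(* Main.v *)
(** In the variables z = (v, H_{v_x}(V), Y), where Y = A(k (d_theta + i nu)) V,
    the eigenvalue equation (A^nu - lambda) V = 0 is the 1-periodic linear system
    z' = (A0 + eps (sigma A1 - 1)) z with eps = i nu and lambda = k eps sigma.
    The derivatives of the profiles with respect to theta and to (k, M, P) solve
    this system up to O(eps^2), while the conserved quantities M and P provide
    1-periodic solutions of the adjoint system at eps = 0; the pairing of the two
    families is B + c - sigma, where B is the matrix of the modulated system.  Hence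
    a determinant which vanishes only if the Bloch problem has a nontrivial
    solution converges to det (B + c - sigma) as nu tends to 0, uniformly for sigma
    in a disc, and it is a uniform limit of polynomials in sigma.  By Hurwitz'
    theorem a nonreal eigenvalue of B + c would be approached by nonreal sigma, that
    is by eigenvalues lambda = i k nu sigma of A^nu off the imaginary axis. *)

From HB Require Import structures.
Require Import Defs.
From mathcomp Require Import all_boot all_order perm all_algebra.
From mathcomp Require Import all_classical all_reals all_analysis.
From mathcomp.real_closed Require Import complex.
From mathcomp Require Import measurable_realfun.
From mathcomp Require Import ring lra.

Set Implicit Arguments.
Unset Strict Implicit.
Unset Printing Implicit Defensive.

Import Order.TTheory GRing.Theory Num.Theory.
Import numFieldNormedType.Exports.

Local Open Scope classical_set_scope.
Local Open Scope ring_scope.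
Local Open Scope complex_scope.

(** * Calculus on the real line, for real, complex and matrix functions *)

(** The determinant of the monodromy matrix minus 1 vanishes at [nu = 0], and the modulated system
    hides in its leading term. A variation of [k] shifts the phase linearly in space, which is not a
    periodic perturbation; in the Bloch setting this secular growth becomes the translation mode
    divided by [eps]. Initial values are therefore parametrized by the values at 0 of the
    approximate solutions and by a complement of their limit. The residue of order 0 is a multiple
    of one vector function [e]; its coefficient becomes an additional unknown, with an additional
    equation forcing it to vanish. Rows and columns of this bordered matrix are scaled so that its
    blocks decouple in the limit. The dimension of the generalized kernel says that, at [eps = 0],
    the only periodic solutions with a source proportional to [e] are the known ones, which makes
    the complementary block invertible. Complex analysis stays elementary: partial sums of Picard
    series are polynomials in [sigma], and uniform approximation by polynomials replaces holomorphy.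
    Sobolev spaces are met only through smooth functions. *)

Section RealCalculus.
Context {R : realType}.
Implicit Types (f g : R -> R).

(** A relation on the whole line: derivability travels with the value of the derivative and never
    comes back as a side condition. *)
Definition rder f g := forall t : R, is_derive t 1 f (g t).

Lemma rder_cont f g : rder f g -> continuous f.
Proof.
move=> fg t; apply/differentiable_continuous/derivable1_diffP.
by have := fg t => -[].
Qed.

Lemma rder_ext f g f' g' : rder f g -> f =1 f' -> g =1 g' -> rder f' g'.
Proof. by move=> fg /funext <- /funext <-. Qed.

Lemma rder_derive1 f g t : rder f g -> derive1 f t = g t.
Proof. by move=> /(_ t) [_ <-]; rewrite derive1E. Qed.

Lemma rder_uniq f g g' : rder f g -> rder f g' -> g =1 g'.
Proof. by move=> fg fg' t; rewrite -(rder_derive1 t fg) (rder_derive1 t fg'). Qed.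

Lemma rder_cst (a : R) : rder (fun=> a) (fun=> 0).
Proof. by move=> t; exact: is_derive_cst. Qed.

Lemma rderD f g f' g' : rder f f' -> rder g g' ->
  rder (fun t => f t + g t) (fun t => f' t + g' t).
Proof. by move=> hf hg t; apply: is_deriveD. Qed.

Lemma rderB f g f' g' : rder f f' -> rder g g' ->
  rder (fun t => f t - g t) (fun t => f' t - g' t).
Proof. by move=> hf hg t; apply: is_deriveB. Qed.

Lemma rderM f g f' g' : rder f f' -> rder g g' ->
  rder (fun t => f t * g t) (fun t => f' t * g t + f t * g' t).
Proof.
move=> hf hg t; apply: (is_derive_eq (is_deriveM (hf t) (hg t))).
by rewrite addrC [g t *: _]mulrC.
Qed.

Lemma rderZ (a : R) f f' : rder f f' -> rder (fun t => a * f t) (fun t => a * f' t).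
Proof.
move=> hf; apply: rder_ext (rderM (rder_cst a) hf) _ _ => //= t.
by rewrite mul0r add0r.
Qed.

Lemma rder_sum (I : Type) (r : seq I) (F G : I -> R -> R) :
  (forall i, rder (F i) (G i)) ->
  rder (fun t => \sum_(i <- r) F i t) (fun t => \sum_(i <- r) G i t).
Proof.
move=> FG; elim: r => [|i r IH].
  by apply: rder_ext (rder_cst 0) _ _ => t; rewrite big_nil.
by apply: rder_ext (rderD (FG i) IH) _ _ => t; rewrite big_cons.
Qed.

Lemma rder_shift f g (s : R) : rder f g -> rder (fun t => f (t + s)) (fun t => g (t + s)).
Proof.
move=> fg t; have [d1 e1] := fg (t + s).
have /derivable1_diffP dfs := d1.
have ds : is_derive t 1 (fun t : R => t + s) 1.
  by apply: (is_derive_eq (is_deriveD (is_derive_id t 1) (is_derive_cst s t 1))); rewrite addr0.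
have dsh : differentiable (fun t : R => t + s) t by apply/derivable1_diffP; case: ds.
have dc : derivable (fun t : R => f (t + s)) t 1.
  by apply/derivable1_diffP; exact: (@differentiable_comp _ _ _ _ (fun t : R => t + s) f).
apply: DeriveDef; first exact: dc.
rewrite -derive1E; have [ds1 _] := ds.
rewrite (_ : (fun t => f (t + s)) = f \o (fun t : R => t + s)) // (derive1_comp ds1 d1).
by rewrite !derive1E e1 (@derive_val _ _ _ _ _ _ _ ds) mulr1.
Qed.

Lemma rder_opp f g : rder f g -> rder (fun t => f (- t)) (fun t => - g (- t)).
Proof.
move=> fg t; have [d1 e1] := fg (- t).
have /derivable1_diffP dfs := d1.
have dn : is_derive t 1 (fun t : R => - t) (-1) by exact: is_deriveNid.
have dsh : differentiable (fun t : R => - t) t by apply/derivable1_diffP; case: dn.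
have dc : derivable (fun t : R => f (- t)) t 1.
  by apply/derivable1_diffP; exact: (@differentiable_comp _ _ _ _ (fun t : R => - t) f).
apply: DeriveDef; first exact: dc.
rewrite -derive1E; have [dn1 _] := dn.
rewrite (_ : (fun t => f (- t)) = f \o (fun t : R => - t)) // (derive1_comp dn1 d1).
by rewrite !derive1E e1 (@derive_val _ _ _ _ _ _ _ dn) mulrN1.
Qed.

Lemma rder_within f g (a b : R) : rder f g -> {within `[a, b], continuous f}.
Proof. by move=> /rder_cont fg; apply: continuous_subspaceT. Qed.

Lemma rder_MVT f g (a b : R) : rder f g -> a <= b ->
  exists2 c, a <= c <= b & f b - f a = g c * (b - a).
Proof.
move=> fg ab; have [||c] := @MVT_segment _ f g a b ab; [by move=> x _; exact: fg|exact: rder_within fg|].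
by rewrite in_itv /= => cab ->; exists c.
Qed.

Lemma rder0_cst f : rder f (fun=> 0) -> forall t, f t = f 0.
Proof.
move=> f0 t; have [t0|/ltW t0] := leP 0 t.
  by have [c _ /eqP] := rder_MVT f0 t0; rewrite mul0r subr_eq0 => /eqP.
by have [c _ /eqP] := rder_MVT f0 t0; rewrite mul0r subr_eq0 => /eqP.
Qed.

Lemma rder_eq_cst f g h : rder f h -> rder g h -> f 0 = g 0 -> f =1 g.
Proof.
move=> fh gh e t; apply/eqP; rewrite -subr_eq0; apply/eqP.
have := @rder0_cst (fun t => f t - g t) _ t; rewrite e subrr; apply.
by apply: rder_ext (rderB fh gh) _ _ => // s; rewrite subrr.
Qed.

Lemma rder_exp (k : nat) : rder (fun t => t ^+ k.+1) (fun t => k.+1%:R * t ^+ k).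
Proof.
elim: k => [|k IH].
  by move=> t; rewrite mul1r expr0; exact: is_derive_id.
have d1 : rder (fun t : R => t) (fun=> 1) by move=> t; exact: is_derive_id.
apply: rder_ext (rderM d1 IH) _ _ => t; first by rewrite -exprS.
by rewrite -[k.+2%:R]natr1 !exprS; ring.
Qed.

(** The mean value theorem is applied to K s^(k+1) / (k+1) minus and plus f, whose derivatives are
    nonnegative on [0, t]. *)
Lemma rder_pow_bound f g (K : R) (k : nat) (t : R) : rder f g ->
  (forall s, `|s| <= `|t| -> `|g s| <= K * `|s| ^+ k) ->
  `|f t - f 0| <= K * `|t| ^+ k.+1 / k.+1%:R.
Proof.
wlog t0 : f g t / 0 <= t => [hwlog fg bnd|].
  have [t0|/ltW t0] := leP 0 t; first exact: hwlog bnd.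
  have := hwlog (fun t => f (- t)) (fun t => - g (- t)) (- t).
  rewrite opprK oppr0 normrN oppr_ge0; apply => //; first exact: rder_opp.
  by move=> s st; rewrite normrN -(normrN s); apply: bnd; rewrite normrN.
move=> fg; rewrite (ger0_norm t0) => bnd.
have dpow : rder (fun s => K / k.+1%:R * s ^+ k.+1) (fun s => K * s ^+ k).
  apply: rder_ext (rderZ (K / k.+1%:R) (rder_exp k)) _ _ => // s.
  by rewrite mulrA -[_ / _ * _]mulrA mulVf ?mulr1 // pnatr_eq0.
rewrite ler_norml.
have [c1 /andP[c10 c1t] e1] := rder_MVT (rderB dpow fg) t0.
have [c2 /andP[c20 c2t] e2] := rder_MVT (rderD dpow fg) t0.
move: e1 e2; rewrite expr0n /= mulr0 subr0 => e1 e2.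
have b1 : `|g c1| <= K * c1 ^+ k.
  by have := bnd c1; rewrite (ger0_norm c10); apply.
have b2 : `|g c2| <= K * c2 ^+ k.
  by have := bnd c2; rewrite (ger0_norm c20); apply.
have p1 : 0 <= (K * c1 ^+ k - g c1) * t.
  by rewrite mulr_ge0 // subr_ge0 (le_trans (ler_norm _)).
have p2 : 0 <= (K * c2 ^+ k + g c2) * t.
  by rewrite mulr_ge0 // -lerBlDr sub0r (le_trans _ b2) // -normrN ler_norm.
have -> : K * t ^+ k.+1 / k.+1%:R = K / k.+1%:R * t ^+ k.+1 by rewrite mulrAC.
rewrite -e1 in p1; rewrite -e2 in p2; move: p1 p2; set X := _ / _ * _; clearbody X => p1 p2; apply/andP; split; lra.
Qed.

Section Primitive.
Variable f : R -> R.
Hypothesis cf : continuous f.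
(** The lower end - M is a parameter because the fundamental theorem is applied at points strictly
    above it. *)
Let G (M t : R) := (\int[lebesgue_measure]_(s in `[- M, t]) f s)%R.

Let dG (M t : R) : - M < t -> is_derive t 1 (G M) (f t).
Proof.
move=> Mt; have t1 : t < t + 1 by rewrite ltrDl.
have [||d1 d2] := @continuous_FTC1_closed _ f (- M) t (t + 1) t1 _ Mt.
- apply: continuous_compact_integrable; first exact: segment_compact.
  exact: continuous_subspaceT.
- exact: cf.
by apply: DeriveDef; [exact: d1|rewrite -derive1E; exact: d2].
Qed.

(** Subtracting the value at 0 removes the dependence on M, which glues the integrals into one
    primitive on the line. *)
Let Gindep (M M' t : R) : `|t| < M -> `|t| < M' ->
  G M t - G M 0 = G M' t - G M' 0.
Proof.
wlog : M M' t / 0 <= t => [hw tM tM'|t0].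
  have [t0|t0] := leP 0 t; first exact: hw.
  move: tM tM'; rewrite ltr0_norm // => tM tM'.
  have h (s : R) : t <= s -> is_derive s 1 (fun s => G M s - G M' s) 0.
    move=> ts; have [? ?]: - M < s /\ - M' < s by split; lra.
    have d1 := @dG M s; have d2 := @dG M' s.
    rewrite -(subrr (f s)); apply: is_deriveB; [exact: d1|exact: d2].
  have [||c _ e] := @MVT_segment _ (fun s => G M s - G M' s) (fun=> 0) t 0 (ltW t0).
  - by move=> s; rewrite in_itv /= => /andP[/ltW /h].
  - apply: derivable_within_continuous => s; rewrite in_itv /= => /andP[/h[]] //.
  - by move: e; rewrite mul0r; lra.
rewrite ger0_norm // => tM tM'.
have h (s : R) : 0 <= s -> is_derive s 1 (fun s => G M s - G M' s) 0.
  move=> ts; have [? ?]: - M < s /\ - M' < s by split; lra.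
  have d1 := @dG M s; have d2 := @dG M' s.
  rewrite -(subrr (f s)); apply: is_deriveB; [exact: d1|exact: d2].
have [||c _ e] := @MVT_segment _ (fun s => G M s - G M' s) (fun=> 0) 0 t t0.
- by move=> s; rewrite in_itv /= => /andP[/ltW /h].
- apply: derivable_within_continuous => s; rewrite in_itv /= => /andP[/h[]] //.
- by move: e; rewrite mul0r; lra.
Qed.

Lemma prim_ex : exists F : R -> R, F 0 = 0 /\ rder F f.
Proof.
exists (fun t => G (`|t| + 1) t - G (`|t| + 1) 0); split; first by rewrite subrr.
(* With this M one lower end serves all t at distance less than 1 from t0, so only one integral is
   differentiated. *)
move=> t0; pose M := `|t0| + 2.
apply: (@near_eq_is_derive _ _ _ (fun t => G M t - G M 0)).
  have := @nbhsx_ballx _ R t0 1 ltr01; apply: filterS => t.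
  rewrite /ball /= => tt0; apply: Gindep; last lra.
  rewrite /M; have := ler_normB t0 (t0 - t); rewrite opprB addrC subrK; lra.
have d1 : is_derive t0 1 (G M) (f t0).
  apply: dG; rewrite /M; have := ler_norm (- t0); rewrite normrN; lra.
by apply: (is_derive_eq (is_deriveB d1 (is_derive_cst (G M 0) t0 1))); rewrite subr0.
Qed.

End Primitive.

(** A total operator, so that primitives can be named in statements; its meaning for continuous [f]
    is [primP]. *)
Definition prim f : R -> R := xget (fun=> 0) [set F | F 0 = 0 /\ rder F f].

Lemma primP f : continuous f -> prim f 0 = 0 /\ rder (prim f) f.
Proof.
by move=> /prim_ex[F FP]; rewrite /prim; case: xgetP => [G -> //|/(_ F)].
Qed.

Lemma prim_def f F : rder F f -> continuous f -> forall t, prim f t = F t - F 0.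
Proof.
move=> Ff cf; have [p0 pd] := primP cf; apply: (rder_eq_cst pd).
  by apply: rder_ext (rderB Ff (rder_cst (F 0))) _ _ => // s; rewrite subr0.
by rewrite p0 subrr.
Qed.

Lemma mean_prim f : continuous f -> mean f = prim f 1.
Proof.
move=> cf; have [p0 pd] := primP cf.
rewrite /mean /Rintegral (@continuous_FTC2 _ f (prim f) 0 1) //=.
- by rewrite p0 subr0.
- exact: continuous_subspaceT.
- split.
  + by move=> x _; case: (pd x).
  + by apply: cvg_at_right_filter; exact: (rder_cont pd).
  + by apply: cvg_at_left_filter; exact: (rder_cont pd).
- by move=> x _; rewrite (rder_derive1 x pd).
Qed.

Lemma mean_rder F f : rder F f -> continuous f -> mean f = F 1 - F 0.
Proof. by move=> Ff cf; rewrite mean_prim // (prim_def Ff cf). Qed.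

End RealCalculus.

(** * Complex-valued functions of a real variable *)

Section ComplexCalculus.
Context {R : realType}.
Local Notation C := R[i].
Local Notation Re := (@complex.Re R).
Local Notation Im := (@complex.Im R).
Local Notation normc := (@Normc.normc R).

Lemma cReD (x y : C) : Re (x + y) = Re x + Re y. Proof. by case: x; case: y. Qed.
Lemma cImD (x y : C) : Im (x + y) = Im x + Im y. Proof. by case: x; case: y. Qed.
Lemma cReN (x : C) : Re (- x) = - Re x. Proof. by case: x. Qed.
Lemma cImN (x : C) : Im (- x) = - Im x. Proof. by case: x. Qed.
Lemma cReM (x y : C) : Re (x * y) = Re x * Re y - Im x * Im y.
Proof. by case: x; case: y. Qed.
Lemma cImM (x y : C) : Im (x * y) = Re x * Im y + Im x * Re y.
Proof. by case: x => a b; case: y => c d; rewrite /= addrC [b * c]mulrC. Qed.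

Lemma cplx_ext (x y : C) : Re x = Re y -> Im x = Im y -> x = y.
Proof. by case: x => a b; case: y => c d /= -> ->. Qed.

Lemma cRe_sum (I : Type) (r : seq I) (F : I -> C) :
  Re (\sum_(i <- r) F i) = \sum_(i <- r) Re (F i).
Proof. by elim/big_rec2: _ => // i x y _ <-; rewrite cReD. Qed.

Lemma cIm_sum (I : Type) (r : seq I) (F : I -> C) :
  Im (\sum_(i <- r) F i) = \sum_(i <- r) Im (F i).
Proof. by elim/big_rec2: _ => // i x y _ <-; rewrite cImD. Qed.

Lemma Re_le_normc (x : C) : `|Re x| <= normc x.
Proof. by case: x => a b /=; rewrite -sqrtr_sqr ler_wsqrtr // lerDl sqr_ge0. Qed.

Lemma Im_le_normc (x : C) : `|Im x| <= normc x.
Proof. by case: x => a b /=; rewrite -sqrtr_sqr ler_wsqrtr // lerDr sqr_ge0. Qed.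

Lemma normc_ge0 (x : C) : 0 <= normc x.
Proof. by case: x => a b /=; exact: sqrtr_ge0. Qed.

Lemma normc_le_ReIm (x : C) : normc x <= `|Re x| + `|Im x|.
Proof.
case: x => a b /=; rewrite -[leRHS]ger0_norm ?addr_ge0 // -sqrtr_sqr ler_wsqrtr //.
rewrite sqrrD !real_normK ?num_real // lerD2r lerDl mulrn_wge0 // mulr_ge0 //.
Qed.

Lemma normc0 : normc 0 = 0. Proof. exact: Normc.normc0. Qed.
Lemma normc1 : normc 1 = 1. Proof. exact: Normc.normc1. Qed.
Lemma normcM (x y : C) : normc (x * y) = normc x * normc y.
Proof. exact: Normc.normcM. Qed.
Lemma normcD (x y : C) : normc (x + y) <= normc x + normc y.
Proof. exact: (@le_normcD R x y). Qed.
Lemma normcB (x y : C) : normc (x - y) <= normc x + normc y.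
Proof. by rewrite -(@normcN R y) normcD. Qed.
Lemma normcX (x : C) k : normc (x ^+ k) = normc x ^+ k.
Proof. by elim: k => [|k IH]; rewrite ?normc1 // !exprS normcM IH. Qed.
Lemma normc_real (a : R) : normc a%:C = `|a|.
Proof. by rewrite /= expr0n /= addr0 sqrtr_sqr. Qed.
Lemma normc_sum (I : Type) (r : seq I) (F : I -> C) :
  normc (\sum_(i <- r) F i) <= \sum_(i <- r) normc (F i).
Proof.
elim/big_rec2: _ => [|i x y _ le]; first by rewrite normc0.
by rewrite (le_trans (normcD _ _)) // lerD2l.
Qed.
Lemma normc_eq0 (x : C) : normc x = 0 -> x = 0.
Proof. exact: Normc.eq0_normc. Qed.
Lemma normc_prod (I : Type) (r : seq I) (F : I -> C) :
  normc (\prod_(i <- r) F i) = \prod_(i <- r) normc (F i).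
Proof. by elim/big_rec2: _ => [|i x y _ <-]; rewrite ?normc1 ?normcM. Qed.

Definition cder (f g : R -> C) :=
  rder (fun t => Re (f t)) (fun t => Re (g t)) /\
  rder (fun t => Im (f t)) (fun t => Im (g t)).

Definition ccont (f : R -> C) :=
  continuous (fun t => Re (f t)) /\ continuous (fun t => Im (f t)).

Lemma cder_ext f g f' g' : cder f g -> f =1 f' -> g =1 g' -> cder f' g'.
Proof. by move=> fg /funext <- /funext <-. Qed.

Lemma cder_cont f g : cder f g -> ccont f.
Proof. by move=> [/rder_cont ? /rder_cont ?]. Qed.

Lemma cder_uniq f g g' : cder f g -> cder f g' -> g =1 g'.
Proof.
move=> [r i] [r' i'] t.
by apply: cplx_ext; [exact: rder_uniq r r' t|exact: rder_uniq i i' t].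
Qed.

Lemma cder_cst a : cder (fun=> a) (fun=> 0).
Proof. by split; exact: rder_cst. Qed.

Lemma cder_real f g : rder f g -> cder (fun t => (f t)%:C) (fun t => (g t)%:C).
Proof. by split => //=; exact: rder_cst. Qed.

Lemma cderD f g f' g' : cder f f' -> cder g g' ->
  cder (fun t => f t + g t) (fun t => f' t + g' t).
Proof.
move=> [fr fi] [gr gi]; split.
  by apply: rder_ext (rderD fr gr) _ _ => t; rewrite cReD.
by apply: rder_ext (rderD fi gi) _ _ => t; rewrite cImD.
Qed.

Lemma cderM f g f' g' : cder f f' -> cder g g' ->
  cder (fun t => f t * g t) (fun t => f' t * g t + f t * g' t).
Proof.
move=> [fr fi] [gr gi]; split.
  apply: rder_ext (rderB (rderM fr gr) (rderM fi gi)) _ _ => t.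
    by rewrite cReM.
  by rewrite cReD !cReM; ring.
apply: rder_ext (rderD (rderM fr gi) (rderM fi gr)) _ _ => t.
  by rewrite cImM.
by rewrite cImD !cImM; ring.
Qed.

Lemma cderZ a f f' : cder f f' -> cder (fun t => a * f t) (fun t => a * f' t).
Proof.
move=> hf; apply: cder_ext (cderM (cder_cst a) hf) _ _ => //= t.
by rewrite mul0r add0r.
Qed.

Lemma cder_sum (I : Type) (r : seq I) (F G : I -> R -> C) :
  (forall i, cder (F i) (G i)) ->
  cder (fun t => \sum_(i <- r) F i t) (fun t => \sum_(i <- r) G i t).
Proof.
move=> FG; elim: r => [|i r IH].
  by apply: cder_ext (cder_cst 0) _ _ => t; rewrite big_nil.
by apply: cder_ext (cderD (FG i) IH) _ _ => t; rewrite big_cons.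
Qed.

Lemma cder_shift f g s : cder f g -> cder (fun t => f (t + s)) (fun t => g (t + s)).
Proof. by move=> [r i]; split; [exact: rder_shift s r|exact: rder_shift s i]. Qed.

Lemma cder_eq_cst f g h : cder f h -> cder g h -> f 0 = g 0 -> f =1 g.
Proof.
move=> [fr fi] [gr gi] e t; apply: cplx_ext.
  by apply: (rder_eq_cst fr gr); rewrite e.
by apply: (rder_eq_cst fi gi); rewrite e.
Qed.

Lemma rcontD (T : topologicalType) (f g : T -> R) : continuous f -> continuous g ->
  continuous (fun t => f t + g t).
Proof. by move=> hf hg t; apply: (@continuousD _ _ _ f g); [exact: hf|exact: hg]. Qed.

Lemma rcontN (T : topologicalType) (f : T -> R) : continuous f -> continuous (fun t => - f t).
Proof. by move=> hf t; apply: (@continuousN _ _ _ f); exact: hf. Qed.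

Lemma rcontM (T : topologicalType) (f g : T -> R) : continuous f -> continuous g ->
  continuous (fun t => f t * g t).
Proof. by move=> hf hg t; apply: (@continuousM _ _ f g); [exact: hf|exact: hg]. Qed.

Lemma rcont_norm (T : topologicalType) (f : T -> R) : continuous f ->
  continuous (fun t => `|f t|).
Proof. by move=> hf t; apply: cvg_norm; exact: hf. Qed.

Lemma rcont_cst (T : topologicalType) (a : R) : continuous (fun _ : T => a).
Proof. exact: cst_continuous. Qed.

Lemma ccontD f g : ccont f -> ccont g -> ccont (fun t => f t + g t).
Proof.
move=> [fr fi] [gr gi]; split.
  under eq_fun do rewrite cReD.
  exact: rcontD.
under eq_fun do rewrite cImD.
exact: rcontD.
Qed.

Lemma ccontM f g : ccont f -> ccont g -> ccont (fun t => f t * g t).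
Proof.
move=> [fr fi] [gr gi]; split.
  under eq_fun do rewrite cReM.
  by apply: rcontD; [|apply: rcontN]; apply: rcontM.
under eq_fun do rewrite cImM.
by apply: rcontD; apply: rcontM.
Qed.

Lemma ccont_cst a : ccont (fun=> a).
Proof. by split; exact: cst_continuous. Qed.

Lemma ccont_sum (I : Type) (r : seq I) (F : I -> R -> C) :
  (forall i, ccont (F i)) -> ccont (fun t => \sum_(i <- r) F i t).
Proof.
move=> FG; elim: r => [|i r IH].
  by under eq_fun do rewrite big_nil; exact: ccont_cst.
by under eq_fun do rewrite big_cons; exact: ccontD.
Qed.

Definition cprim (f : R -> C) (t : R) : C :=
  prim (fun s => Re (f s)) t +i* prim (fun s => Im (f s)) t.

Lemma cprimP f : ccont f -> cprim f 0 = 0 /\ cder (cprim f) f.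
Proof.
move=> [/primP[r0 rd] /primP[i0 id]]; split; last by [].
by rewrite /cprim r0 i0.
Qed.

Lemma cprim_def f F : cder F f -> ccont f -> forall t, cprim f t = F t - F 0.
Proof.
move=> [r i] [cr ci] t; apply: cplx_ext => /=.
  by rewrite (prim_def r cr) cReD cReN.
by rewrite (prim_def i ci) cImD cImN.
Qed.

(** The factor 2 comes from bounding the modulus by |Re| + |Im|. *)
Lemma cder_pow_bound f g (K : R) (k : nat) (t : R) : cder f g ->
  (forall s, `|s| <= `|t| -> normc (g s) <= K * `|s| ^+ k) ->
  normc (f t - f 0) <= 2 * K * `|t| ^+ k.+1 / k.+1%:R.
Proof.
move=> [fr fi] bnd; apply: (le_trans (normc_le_ReIm _)).
have br := @rder_pow_bound _ _ _ K k t fr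
  (fun s st => le_trans (Re_le_normc _) (bnd s st)).
have bi := @rder_pow_bound _ _ _ K k t fi
  (fun s st => le_trans (Im_le_normc _) (bnd s st)).
rewrite cReD cImD cReN cImN; apply: (le_trans (lerD br bi)).
by rewrite le_eqVlt; apply/orP; left; apply/eqP; ring.
Qed.

End ComplexCalculus.

(** * Matrix-valued functions and an entrywise norm *)

Section MatrixCalculus.
Context {R : realType}.
Local Notation C := R[i].
Local Notation normc := (@Normc.normc R).

Definition mder m n (F G : R -> 'M[C]_(m, n)) :=
  forall i j, cder (fun t => F t i j) (fun t => G t i j).

Definition mcont m n (F : R -> 'M[C]_(m, n)) :=
  forall i j, ccont (fun t => F t i j).

(** This norm is submultiplicative and additive over blocks; the price is a factor m * n in the
    integral estimates. *)
Definition nm m n (A : 'M[C]_(m, n)) : R := \sum_i \sum_j normc (A i j).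

Lemma mder_ext m n (F G F' G' : R -> 'M[C]_(m, n)) :
  mder F G -> F =1 F' -> G =1 G' -> mder F' G'.
Proof. by move=> fg /funext <- /funext <-. Qed.

Lemma mder_uniq m n (F G G' : R -> 'M[C]_(m, n)) :
  mder F G -> mder F G' -> G =1 G'.
Proof.
by move=> FG FG' t; apply/matrixP => i j; exact: (cder_uniq (FG i j) (FG' i j)).
Qed.

Lemma mder_cont m n (F G : R -> 'M[C]_(m, n)) : mder F G -> mcont F.
Proof. by move=> FG i j; exact: cder_cont (FG i j). Qed.

Lemma mder_cst m n (A : 'M[C]_(m, n)) : mder (fun=> A) (fun=> 0).
Proof. by move=> i j; apply: cder_ext (cder_cst (A i j)) _ _ => // t; rewrite mxE. Qed.

Lemma mderD m n (F G F' G' : R -> 'M[C]_(m, n)) : mder F F' -> mder G G' ->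
  mder (fun t => F t + G t) (fun t => F' t + G' t).
Proof. by move=> hF hG i j; apply: cder_ext (cderD (hF i j) (hG i j)) _ _ => t; rewrite mxE. Qed.

Lemma mderZ m n a (F F' : R -> 'M[C]_(m, n)) : mder F F' ->
  mder (fun t => a *: F t) (fun t => a *: F' t).
Proof. by move=> hF i j; apply: cder_ext (cderZ a (hF i j)) _ _ => t; rewrite mxE. Qed.

Lemma mderN m n (F F' : R -> 'M[C]_(m, n)) : mder F F' ->
  mder (fun t => - F t) (fun t => - F' t).
Proof.
by move=> hF; apply: mder_ext (mderZ (-1) hF) _ _ => t; rewrite scaleN1r.
Qed.

Lemma mderB m n (F G F' G' : R -> 'M[C]_(m, n)) : mder F F' -> mder G G' ->
  mder (fun t => F t - G t) (fun t => F' t - G' t).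
Proof. by move=> hF /mderN; exact: mderD. Qed.

Lemma mder_sum m n (I : Type) (r : seq I) (F G : I -> R -> 'M[C]_(m, n)) :
  (forall i, mder (F i) (G i)) ->
  mder (fun t => \sum_(i <- r) F i t) (fun t => \sum_(i <- r) G i t).
Proof.
move=> FG; elim: r => [|i r IH].
  by apply: mder_ext (mder_cst 0) _ _ => t; rewrite big_nil.
by apply: mder_ext (mderD (FG i) IH) _ _ => t; rewrite big_cons.
Qed.

Lemma mderM m n p (F F' : R -> 'M[C]_(m, n)) (G G' : R -> 'M[C]_(n, p)) :
  mder F F' -> mder G G' ->
  mder (fun t => F t *m G t) (fun t => F' t *m G t + F t *m G' t).
Proof.
move=> hF hG i j.
apply: cder_ext (cder_sum _ (fun k => cderM (hF i k) (hG k j))) _ _ => t.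
  by rewrite mxE.
by rewrite !mxE -big_split.
Qed.

Lemma mder_tr m n (F G : R -> 'M[C]_(m, n)) : mder F G ->
  mder (fun t => (F t)^T) (fun t => (G t)^T).
Proof. by move=> FG i j; apply: cder_ext (FG j i) _ _ => t; rewrite mxE. Qed.

Lemma mderMl m n p (A : 'M[C]_(m, n)) (G G' : R -> 'M[C]_(n, p)) :
  mder G G' -> mder (fun t => A *m G t) (fun t => A *m G' t).
Proof.
by move=> hG; apply: mder_ext (mderM (mder_cst A) hG) _ _ => // t; rewrite mul0mx add0r.
Qed.

Lemma mderMr m n p (A : 'M[C]_(n, p)) (G G' : R -> 'M[C]_(m, n)) :
  mder G G' -> mder (fun t => G t *m A) (fun t => G' t *m A).
Proof.
by move=> hG; apply: mder_ext (mderM hG (mder_cst A)) _ _ => // t; rewrite mulmx0 addr0.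
Qed.

Lemma mder_shift m n (F G : R -> 'M[C]_(m, n)) s : mder F G ->
  mder (fun t => F (t + s)) (fun t => G (t + s)).
Proof. by move=> FG i j; exact: cder_shift s (FG i j). Qed.

Lemma mder_eq_cst m n (F G H : R -> 'M[C]_(m, n)) :
  mder F H -> mder G H -> F 0 = G 0 -> F =1 G.
Proof.
move=> FH GH e t; apply/matrixP => i j; apply: (cder_eq_cst (FH i j) (GH i j)).
by rewrite e.
Qed.

Lemma mcontM m n p (F : R -> 'M[C]_(m, n)) (G : R -> 'M[C]_(n, p)) :
  mcont F -> mcont G -> mcont (fun t => F t *m G t).
Proof.
move=> hF hG i j; under eq_fun do rewrite mxE.
by apply: ccont_sum => k; apply: ccontM.
Qed.

Lemma mcontD m n (F G : R -> 'M[C]_(m, n)) :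
  mcont F -> mcont G -> mcont (fun t => F t + G t).
Proof. by move=> hF hG i j; under eq_fun do rewrite mxE; exact: ccontD. Qed.

Lemma mcontZ m n a (F : R -> 'M[C]_(m, n)) : mcont F -> mcont (fun t => a *: F t).
Proof.
by move=> hF i j; under eq_fun do rewrite mxE; apply: ccontM => //; exact: ccont_cst.
Qed.

Lemma mcontN m n (F : R -> 'M[C]_(m, n)) : mcont F -> mcont (fun t => - F t).
Proof. by move=> /(mcontZ (-1)); under eq_fun do rewrite scaleN1r. Qed.

Lemma mcontB m n (F G : R -> 'M[C]_(m, n)) :
  mcont F -> mcont G -> mcont (fun t => F t - G t).
Proof. by move=> hF /mcontN; exact: mcontD. Qed.

Lemma mcont_cst m n (A : 'M[C]_(m, n)) : mcont (fun=> A).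
Proof. by move=> i j; exact: ccont_cst. Qed.

Definition mprim m n (F : R -> 'M[C]_(m, n)) (t : R) : 'M[C]_(m, n) :=
  \matrix_(i, j) cprim (fun s => F s i j) t.

Lemma mprimP m n (F : R -> 'M[C]_(m, n)) : mcont F ->
  mprim F 0 = 0 /\ mder (mprim F) F.
Proof.
move=> cF; split; first by apply/matrixP => i j; rewrite !mxE; case: (cprimP (cF i j)).
move=> i j; have [_ d] := cprimP (cF i j).
by apply: cder_ext d _ _ => // t; rewrite mxE.
Qed.

Lemma mprim_def m n (F G : R -> 'M[C]_(m, n)) : mder F G -> mcont G ->
  forall t, mprim G t = F t - F 0.
Proof.
by move=> FG cG t; apply/matrixP => i j; rewrite !mxE (cprim_def (FG i j) (cG i j)).
Qed.

Lemma nm_ge0 m n (A : 'M[C]_(m, n)) : 0 <= nm A.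
Proof. by apply: sumr_ge0 => i _; apply: sumr_ge0 => j _; exact: normc_ge0. Qed.

Lemma nm_entry m n (A : 'M[C]_(m, n)) i j : normc (A i j) <= nm A.
Proof.
rewrite /nm (bigD1 i) //= (bigD1 j) //= -addrA lerDl addr_ge0 //.
  by apply: sumr_ge0 => ? _; exact: normc_ge0.
by apply: sumr_ge0 => ? _; apply: sumr_ge0 => ? _; exact: normc_ge0.
Qed.

Lemma nm_le m n (A : 'M[C]_(m, n)) K :
  (forall i j, normc (A i j) <= K) -> nm A <= (m * n)%:R * K.
Proof.
move=> hK; apply: (@le_trans _ _ (\sum_(i < m) \sum_(j < n) K)).
  by apply: ler_sum => i _; apply: ler_sum => j _; exact: hK.
by rewrite !sumr_const !card_ord -mulrnA mulnC mulr_natl.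
Qed.

Lemma nm0 m n : nm (0 : 'M[C]_(m, n)) = 0.
Proof. by rewrite /nm big1 // => i _; rewrite big1 // => j _; rewrite mxE normc0. Qed.

Lemma nm_eq0 m n (A : 'M[C]_(m, n)) : nm A <= 0 -> A = 0.
Proof.
move=> h; apply/matrixP => i j; rewrite mxE; apply: normc_eq0.
by apply/eqP; rewrite eq_le normc_ge0 andbT (le_trans (nm_entry A i j)).
Qed.

Lemma nmD m n (A B : 'M[C]_(m, n)) : nm (A + B) <= nm A + nm B.
Proof.
rewrite /nm -big_split /=; apply: ler_sum => i _; rewrite -big_split /=.
by apply: ler_sum => j _; rewrite mxE normcD.
Qed.

Lemma nmZ m n a (A : 'M[C]_(m, n)) : nm (a *: A) = normc a * nm A.
Proof.
rewrite /nm mulr_sumr; apply: eq_bigr => i _; rewrite mulr_sumr.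
by apply: eq_bigr => j _; rewrite mxE normcM.
Qed.

Lemma nmN m n (A : 'M[C]_(m, n)) : nm (- A) = nm A.
Proof. by rewrite -scaleN1r nmZ (@normcN R 1) normc1 mul1r. Qed.

Lemma nmB m n (A B : 'M[C]_(m, n)) : nm (A - B) <= nm A + nm B.
Proof. by rewrite (le_trans (nmD _ _)) // nmN. Qed.

Lemma nmM m n p (A : 'M[C]_(m, n)) (B : 'M[C]_(n, p)) : nm (A *m B) <= nm A * nm B.
Proof.
apply: (@le_trans _ _ (\sum_i \sum_j \sum_k normc (A i k) * normc (B k j))).
  apply: ler_sum => i _; apply: ler_sum => j _; rewrite mxE.
  apply: (le_trans (normc_sum _ _)).
  by apply: ler_sum => k _; rewrite normcM.
rewrite /nm mulr_suml; apply: ler_sum => i _.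
rewrite exchange_big mulr_suml; apply: ler_sum => k _ /=.
rewrite -mulr_sumr; apply: ler_wpM2l; first exact: normc_ge0.
rewrite [leRHS](bigD1 k) //= lerDl.
by apply: sumr_ge0 => ? _; apply: sumr_ge0 => ? _; exact: normc_ge0.
Qed.

Lemma mder_pow_bound m n (F G : R -> 'M[C]_(m, n)) (K : R) (k : nat) (t : R) :
  mder F G -> (forall s, `|s| <= `|t| -> nm (G s) <= K * `|s| ^+ k) ->
  nm (F t - F 0) <= (m * n)%:R * (2 * K * `|t| ^+ k.+1 / k.+1%:R).
Proof.
move=> FG bnd; apply: nm_le => i j; rewrite 2!mxE.
by apply: (cder_pow_bound (FG i j)) => s /bnd; apply: le_trans; exact: nm_entry.
Qed.

Lemma mder_bound1 m n (F G : R -> 'M[C]_(m, n)) (K : R) (t : R) :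
  mder F G -> `|t| <= 1 -> (forall s, `|s| <= 1 -> nm (G s) <= K) ->
  nm (F t - F 0) <= (m * n)%:R * (2 * K).
Proof.
move=> FG t1 bnd; have := @mder_pow_bound _ _ F G K 0 t FG.
rewrite expr1 divr1 => h; apply: (le_trans (h _)).
  by move=> s st; rewrite expr0 mulr1 bnd // (le_trans st).
rewrite ler_wpM2l // -[leRHS]mulr1 ler_wpM2l // mulr_ge0 //.
by apply: le_trans (bnd 0 _); [exact: nm_ge0|rewrite normr0].
Qed.

End MatrixCalculus.

(** * Linear differential systems *)

Section LinearODE.
Context {R : realType}.
Local Notation C := R[i].

Lemma series_tail (u e : nat -> R) : (forall k, `|u k| <= e k) ->
  cvgn (series e) -> forall K,
  `|limn (series u) - series u K| <= limn (series e) - series e K.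
Proof.
move=> ue ce K.
have e0 k : 0 <= e k by rewrite (le_trans _ (ue k)).
have cu : cvgn (series u).
  by apply: normed_cvg; apply: (series_le_cvg _ e0 ue ce) => k.
have c1 : (series u n - series u K) @[n --> \oo] --> limn (series u) - series u K.
  by apply: cvgB => //; exact: cvg_cst.
rewrite -(cvg_lim _ (cvg_norm c1)) //.
apply: limr_le; first by apply/cvg_ex; eexists; exact: (cvg_norm c1).
exists K => // n /= Kn; rewrite sub_series Kn.
apply: (le_trans (ler_norm_sum _ _ _)).
apply: (@le_trans _ _ (series e n - series e K)).
  by rewrite sub_series Kn; apply: ler_sum => k _.
rewrite lerD2r; apply: nondecreasing_cvgn_le => //.
by apply: nondecreasing_series => k _ _.
Qed.

Lemma series_tail_cvg0 (e : nat -> R) : cvgn (series e) ->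
  (limn (series e) - series e K) @[K --> \oo] --> (0 : R).
Proof.
move=> ce; rewrite -(subrr (limn (series e))).
by apply: cvgB => //; exact: cvg_cst.
Qed.

Section Picard.
Variables (p : nat).
Implicit Types A : R -> 'M[C]_p.

(** Iterated integrals for F' = F A, F(0) = 1. The coefficient multiplies on the right, so the sum
    acts on columns as an integrating factor. *)
Fixpoint picard A (k : nat) : R -> 'M[C]_p :=
  if k is k'.+1 then mprim (fun s => picard A k' s *m A s) else fun=> 1%:M.

Lemma picard_cont A k : mcont A -> mcont (picard A k).
Proof.
move=> cA; elim: k => [|k IH] /=; first exact: mcont_cst.
by apply: mder_cont (mprimP _).2; exact: mcontM.
Qed.

Lemma picard_der A k : mcont A ->
  mder (picard A k.+1) (fun s => picard A k s *m A s).
Proof. by move=> cA; apply: (mprimP _).2; apply: mcontM => //; exact: picard_cont. Qed.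

Lemma picard0 A k : mcont A -> picard A k.+1 0 = 0.
Proof. by move=> cA; apply: (mprimP _).1; apply: mcontM => //; exact: picard_cont. Qed.

(** The factors p * p and 2 are the losses of [mder_pow_bound]; with them the k-th iterate is
    majorized by the k-th term of an exponential series. *)
Definition pc (a : R) : R := (p * p)%:R * (2 * a).
Definition pterm (a T : R) (k : nat) : R := (p * p)%:R * exp_coeff (pc a * T) k.

Lemma pc_ge0 a : 0 <= a -> 0 <= pc a.
Proof. by move=> a0; rewrite /pc !mulr_ge0. Qed.

Lemma picard_bound A a k t : mcont A -> (forall t, nm (A t) <= a) ->
  nm (picard A k t) <= pterm a `|t| k.
Proof.
move=> cA Aa; have a0 : 0 <= a by apply: le_trans (Aa 0); exact: nm_ge0.
rewrite /pterm /exp_coeff /=; elim: k t => [|k IH] t.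
  rewrite expr0 fact0 divr1; apply: nm_le => i j; rewrite mxE.
  by case: (i == j); rewrite ?normc1 // normc0.
pose K : R := (p * p)%:R * (pc a ^+ k / k`!%:R) * a.
have := @mder_pow_bound _ p p _ _ K k t (picard_der k cA).
rewrite picard0 // subr0 => h; apply: le_trans (h _) _.
  move=> s _; apply: (le_trans (nmM _ _)).
  apply: le_trans (ler_pM (nm_ge0 _) (nm_ge0 _) (IH s) (Aa s)) _.
  by rewrite /K exprMn le_eqVlt; apply/orP; left; apply/eqP; ring.
have qE : pc a = (p * p)%:R * (2 * a) by [].
clear h; rewrite {}/K.
move: (pc a) (p * p)%:R qE => q n0 qE.
rewrite factS [in leRHS]natrM ![(q * _) ^+ _]exprMn !exprS.
have f1 : k.+1%:R != 0 :> R by rewrite pnatr_eq0.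
have f2 : k`!%:R != 0 :> R by rewrite pnatr_eq0 -lt0n fact_gt0.
move: (k.+1%:R : R) (k`!%:R : R) f1 f2 (q ^+ k) (`|t| ^+ k) => x y x0 y0 u v.
by rewrite qE le_eqVlt; apply/orP; left; apply/eqP; field; rewrite x0 y0.
Qed.

Lemma pterm_le a T T' k : 0 <= a -> 0 <= T -> T <= T' -> pterm a T k <= pterm a T' k.
Proof.
move=> a0 T0 TT'; rewrite /pterm /exp_coeff /= ler_wpM2l // ler_wpM2r //.
rewrite lerXn2r ?nnegrE ?mulr_ge0 ?pc_ge0 //; first exact: le_trans TT'.
by rewrite ler_wpM2l // pc_ge0.
Qed.

Lemma pterm_cvg a T : cvgn (series (pterm a T)).
Proof.
have -> : pterm a T = (p * p)%:R *: exp_coeff (pc a * T) by apply/funext => k.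
by apply: is_cvg_seriesZ; exact: is_cvg_series_exp_coeff.
Qed.

Definition fund A (t : R) : 'M[C]_p := \matrix_(i, j)
  (limn (series (fun k => complex.Re (picard A k t i j))) +i*
   limn (series (fun k => complex.Im (picard A k t i j)))).

Definition ptail a T K : R := limn (series (pterm a T)) - series (pterm a T) K.

Lemma fund_tail A a K t T : mcont A -> (forall t, nm (A t) <= a) -> `|t| <= T ->
  nm (fund A t - \sum_(k < K) picard A k t) <= (p * p)%:R * (2 * ptail a T K).
Proof.
move=> cA Aa tT; have a0 : 0 <= a by apply: le_trans (Aa 0); exact: nm_ge0.
apply: nm_le => i j.
have b k : Normc.normc (picard A k t i j) <= pterm a T k.
  by rewrite (le_trans (nm_entry _ i j)) // (le_trans (picard_bound _ _ cA Aa)) // pterm_le.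
apply: (le_trans (normc_le_ReIm _)); rewrite mulr_natl mulr2n.
apply: lerD.
  have := @series_tail (fun k => complex.Re (picard A k t i j)) (pterm a T)
    (fun k => le_trans (Re_le_normc _) (b k)) (@pterm_cvg a T) K.
  by rewrite !mxE summxE cReD cReN cRe_sum [X in _ - X]big_mkord.
have := @series_tail (fun k => complex.Im (picard A k t i j)) (pterm a T)
  (fun k => le_trans (Im_le_normc _) (b k)) (@pterm_cvg a T) K.
by rewrite !mxE summxE cImD cImN cIm_sum [X in _ - X]big_mkord.
Qed.

Lemma ptail_cvg a T : ptail a T K @[K --> \oo] --> (0 : R).
Proof. exact: series_tail_cvg0 (@pterm_cvg a T). Qed.

Lemma ptail_small a T (e : R) : 0 < e -> exists K0, forall K, (K0 <= K)%N ->
  (p * p)%:R * (2 * ptail a T K) < e.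
Proof.
move=> e0.
have h : ((p * p)%:R * (2 * ptail a T K)) @[K --> \oo] --> (0 : R).
  rewrite -(mulr0 (p * p)%:R) -[X in _ * X](mulr0 2).
  by apply: cvgMr; apply: cvgMr; exact: ptail_cvg.
have [K0 _ hK] := (cvgr_lt 0 h) e e0.
by exists K0 => K /hK.
Qed.

Lemma psum_cont A K : mcont A -> mcont (fun t => \sum_(k < K) picard A k t).
Proof.
move=> cA i j; under eq_fun do rewrite summxE.
by apply: ccont_sum => k; exact: picard_cont.
Qed.

(** Continuity at t0 involves only times up to |t0| + 1, so approximation that is uniform on bounded
    sets is enough. *)
Lemma runiform_cont (f : R -> R) :
  (forall (T e : R), 0 < e -> exists2 g : R -> R, continuous g &
     forall t, `|t| <= T -> `|f t - g t| < e) -> continuous f.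
Proof.
move=> h t0; apply/cvgrPdist_lt => e e0.
have e30 : 0 < e / 3 by rewrite divr_gt0.
have [g cg gf] := h (`|t0| + 1) _ e30.
have t0T : `|t0| <= `|t0| + 1 by rewrite lerDl.
have := cg t0 => /cvgrPdist_lt /(_ _ e30) near1.
have near2 : \forall t \near t0, `|t| <= `|t0| + 1.
  have := @nbhsx_ballx _ R t0 1 ltr01; apply: filterS => t.
  rewrite /ball /= => tt0.
  have := ler_normB t0 (t0 - t); rewrite opprB addrC subrK; lra.
near=> t.
have h1 : `|g t0 - g t| < e / 3 by near: t.
have h2 : `|f t - g t| < e / 3 by apply: gf; near: t.
have h3 := gf t0 t0T.
rewrite ltr_norml in h1; rewrite ltr_norml in h2; rewrite ltr_norml in h3.
rewrite ltr_norml; apply/andP; split; lra.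
Unshelve. all: by end_near. Qed.

Lemma fund_cont A a : mcont A -> (forall t, nm (A t) <= a) -> mcont (fund A).
Proof.
move=> cA Aa i j.
have close T e : 0 < e -> exists K, forall t, `|t| <= T ->
    Normc.normc (fund A t i j - (\sum_(k < K) picard A k t) i j) < e.
  move=> e0; have [K hK] := ptail_small a T e0; exists K => t tT.
  apply: le_lt_trans (hK K (leqnn K)); apply: le_trans (fund_tail K cA Aa tT).
  by rewrite (le_trans _ (nm_entry _ i j)) // !mxE.
split; apply: runiform_cont => T e /(close T)[K hK].
  exists (fun t => complex.Re ((\sum_(k < K) picard A k t) i j)).
    by have [] := psum_cont K cA i j.
  by move=> t /hK; apply: le_lt_trans; rewrite -cReN -cReD; exact: Re_le_normc.
exists (fun t => complex.Im ((\sum_(k < K) picard A k t) i j)).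
  by have [] := psum_cont K cA i j.
by move=> t /hK; apply: le_lt_trans; rewrite -cImN -cImD; exact: Im_le_normc.
Qed.

Lemma psum_der A K : mcont A ->
  mder (fun t => \sum_(k < K.+1) picard A k t)
       (fun t => (\sum_(k < K) picard A k t) *m A t).
Proof.
move=> cA; under eq_fun do rewrite big_ord_recl.
have d0 : mder (picard A 0) (fun=> 0) by exact: mder_cst.
have ds : mder (fun t => \sum_(k < K) picard A k.+1 t)
    (fun t => \sum_(k < K) (picard A k t *m A t)).
  by apply: mder_sum => k; exact: picard_der.
apply: mder_ext (mderD d0 ds) _ _ => // t.
by rewrite add0r mulmx_suml.
Qed.

Lemma psum0 A K : mcont A -> \sum_(k < K.+1) picard A k 0 = 1%:M.
Proof.
move=> cA; rewrite big_ord_recl big1 ?addr0 // => k _.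
by rewrite lift0 picard0.
Qed.

(** No termwise differentiation of the series: the partial sums satisfy the integral equation up to
    a shift of one index, and the error tends to 0 with the tail. *)
Lemma fund_eq A a t : mcont A -> (forall t, nm (A t) <= a) ->
  fund A t = 1%:M + mprim (fun s => fund A s *m A s) t.
Proof.
move=> cA Aa; have a0 : 0 <= a by apply: le_trans (Aa 0); exact: nm_ge0.
have cF := fund_cont cA Aa.
have cFA := mcontM cF cA.
have [Y0 dY] := mprimP cFA; set Y := mprim _ in Y0 dY *.
apply/eqP; rewrite -subr_eq0; apply/eqP; apply: nm_eq0.
apply/ler_addgt0Pr => e e0; rewrite add0r.
pose T := `|t|.
pose c := (p * p)%:R * (2 * (a * T)) : R.
have c0 : 0 <= c by rewrite /c mulr_ge0 // mulr_ge0 // mulr_ge0 // normr_ge0.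
(* The series error is at most e' and the integral error at most c * e'; together they make e. *)
pose e' := e / (1 + c).
have e'0 : 0 < e' by rewrite divr_gt0 // ltr_wpDr.
have [K hK] := ptail_small a T e'0.
have tl K' t' : (K <= K')%N -> `|t'| <= T ->
    nm (fund A t' - \sum_(k < K') picard A k t') <= e'.
  by move=> KK' t'T; apply: (le_trans (fund_tail K' cA Aa t'T)); exact: ltW (hK _ KK').
have -> : fund A t - (1%:M + Y t) = (fund A t - \sum_(k < K.+1) picard A k t)
    + ((\sum_(k < K.+1) picard A k t) - Y t - 1%:M).
  by apply/matrixP => i j; rewrite !mxE; ring.
apply: (le_trans (nmD _ _)).
have -> : e = e' + c * e'.
  by rewrite -{1}[e']mul1r -mulrDl /e' mulrC divfK // gt_eqF // ltr_wpDr.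
apply: lerD; first by apply: tl.
have := @mder_pow_bound _ p p _ _ (e' * a) 0 t (mderB (psum_der K cA) dY).
rewrite Y0 subr0 psum0 // expr1 divr1 => h; apply: le_trans (h _) _.
  move=> s st; rewrite expr0 mulr1 -mulmxBl; apply: (le_trans (nmM _ _)).
  by apply: ler_pM; rewrite ?nm_ge0 // -nmN opprB; apply: tl.
by rewrite /c le_eqVlt; apply/orP; left; apply/eqP; rewrite /T; ring.
Qed.

Lemma fund_der A a : mcont A -> (forall t, nm (A t) <= a) ->
  mder (fund A) (fun t => fund A t *m A t) /\ fund A 0 = 1%:M.
Proof.
move=> cA Aa.
have [Y0 dY] := mprimP (mcontM (fund_cont cA Aa) cA).
split; last by rewrite (fund_eq 0 cA Aa) Y0 addr0.
apply: mder_ext (mderD (mder_cst 1%:M) dY) _ _ => t; last by rewrite add0r.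
by rewrite -(fund_eq t cA Aa).
Qed.

(** It depends on the system only through the bound a, which makes the estimate uniform in [eps] and
    [sigma]. *)
Definition fbound a := (p * p)%:R * (2 * ptail a 1 0).

Lemma fund_bound A a t : mcont A -> (forall t, nm (A t) <= a) -> `|t| <= 1 ->
  nm (fund A t) <= fbound a.
Proof.
by move=> cA Aa t1; have := fund_tail 0 cA Aa t1; rewrite big_ord0 subr0.
Qed.

End Picard.

(* [fund (fun s => (B s)^T)^T] solves F' = B F; composing with the row solution
   of G' = - G B gives a constant, so both are invertible. *)
Lemma fund_inv p (B : R -> 'M[C]_p) a : mcont B -> (forall t, nm (B t) <= a) ->
  exists Phi : R -> 'M[C]_p, [/\ mder Phi (fun t => B t *m Phi t),
    Phi 0 = 1%:M,
    forall t, fund (fun s => - B s) t *m Phi t = 1%:M &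
    forall t, Phi t *m fund (fun s => - B s) t = 1%:M].
Proof.
move=> cB Ba.
have nmT (M : 'M[C]_p) : nm M^T = nm M.
  by rewrite /nm exchange_big; apply: eq_bigr => i _; apply: eq_bigr => j _; rewrite mxE.
have cBT : mcont (fun s => (B s)^T).
  by move=> i j; under eq_fun do rewrite mxE; exact: cB.
have BTa t : nm (B t)^T <= a by rewrite nmT.
have [dG G0] := fund_der cBT BTa.
have [dF F0] := fund_der (mcontN cB) (fun t => eq_ind_r (fun x => x <= a) (Ba t) (nmN (B t))).
pose Phi t := (fund (fun s => (B s)^T) t)^T.
have dPhi : mder Phi (fun t => B t *m Phi t).
  by apply: mder_ext (mder_tr dG) _ _ => t //; rewrite trmx_mul trmxK.
have Phi0 : Phi 0 = 1%:M by rewrite /Phi G0 trmx1.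
have e t : fund (fun s => - B s) t *m Phi t = 1%:M.
  have d0 : mder (fun t => fund (fun s => - B s) t *m Phi t) (fun=> 0).
    apply: mder_ext (mderM dF dPhi) _ _ => // s.
    by rewrite mulmxN mulNmx mulmxA addNr.
  by rewrite (mder_eq_cst d0 (mder_cst 1%:M)) // F0 Phi0 mulmx1.
by exists Phi; split => // t; apply: mulmx1C.
Qed.

End LinearODE.

(** * Hurwitz' theorem for polynomials *)

Section Hurwitz.
Context {R : realType}.
Local Notation C := R[i].
Local Notation normc := (@Normc.normc R).

(** The powers of Q / del tend to 0 and pass below 2^-d. In the application d is the number of roots
    of a polynomial, which does not depend on m. *)
Lemma Bernoulli_contra (Q del : R) (d : nat) : 0 <= Q -> Q < del ->
  ~ (forall m, (0 < m)%N -> del ^+ m <= 2 ^+ d * Q ^+ m).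
Proof.
move=> Q0 Qd h; have del0 : 0 < del by apply: le_lt_trans Qd.
pose z := Q / del.
have z0 : 0 <= z by rewrite divr_ge0 // ltW.
have z1 : `|z| < 1 by rewrite ger0_norm // ltr_pdivrMr // mul1r.
have e0 : 0 < (2 ^+ d)^-1 :> R by rewrite invr_gt0 exprn_gt0.
have [m0 _ hm] := (cvgr_lt 0 (cvg_expr z1)) _ e0.
have /= := hm m0.+1 (leqnSn m0); rewrite ltNge => /negP; apply.
rewrite /z expr_div_n ler_pdivlMr ?exprn_gt0 // ler_pdivrMl ?exprn_gt0 //.
by apply: h.
Qed.

(* Jensen's inequality with an average over the roots of 'X^m - rho^m, using
   that the product over these roots u of (u - w) is w^m - rho^m up to sign. *)
Lemma poly_min_modulus (q : {poly C}) (s0 : C) (rho del : R) : 0 < rho ->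
  (forall s, normc (s - s0) = rho -> del <= normc q.[s]) ->
  normc q.[s0] < del ->
  exists2 s, normc (s - s0) <= rho & root q s.
Proof.
move=> rho0 hdel hs0; apply: contrapT => hno.
have Q0 := normc_ge0 q.[s0].
have [r qE] := closed_field_poly_normal q.
set a := lead_coef q in qE.
have qs s : q.[s] = a * \prod_(z <- r) (s - z).
  rewrite qE hornerZ horner_prod; congr (_ * _).
  by apply: eq_bigr => z _; rewrite hornerXsubC.
have a0 : a != 0.
  rewrite lead_coef_eq0; apply/eqP => q0.
  have := hdel (s0 + rho%:C); rewrite addrC addKr normc_real gtr0_norm // => /(_ erefl).
  by rewrite q0 horner0 normc0 => d0; have := lt_le_trans hs0 d0; rewrite ltNge Q0.
have rz z : z \in r -> rho < normc (s0 - z).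
  move=> zr; rewrite ltNge; apply/negP => zle; apply: hno; exists z.
    by rewrite -normcN opprB.
  by rewrite qE rootZ // root_prod_XsubC.
apply: (@Bernoulli_contra (normc q.[s0]) del (size r) Q0 hs0) => m m0.
pose p := 'X^m - (rho%:C ^+ m)%:P : {poly C}.
have sp : size p = m.+1 by rewrite size_XnsubC.
have pm : p \is monic by rewrite monicXnsubC.
have [u pE] := closed_field_poly_normal p.
rewrite (monicP pm) scale1r in pE.
have su : size u = m by have := sp; rewrite pE size_prod_XsubC => -[].
have ps w : \prod_(y <- u) (w - y) = w ^+ m - rho%:C ^+ m.
  transitivity p.[w]; last by rewrite hornerD hornerN hornerC hornerXn.
  by rewrite pE horner_prod; apply: eq_bigr => y _; rewrite hornerXsubC.
have un y : y \in u -> normc y = rho.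
  move=> yu; have : root p y by rewrite pE root_prod_XsubC.
  rewrite /root hornerD hornerN hornerC hornerXn subr_eq0 => /eqP ym.
  have : normc y ^+ m = rho ^+ m.
    by rewrite -normcX ym normcX normc_real gtr0_norm.
  by move/eqP; rewrite eqrXn2 ?normc_ge0 ?(ltW rho0) // => /eqP.
have lower : del ^+ m <= \prod_(y <- u) normc q.[s0 + y].
  have -> : del ^+ m = \prod_(y <- u) del by rewrite big_const_seq count_predT su -Monoid.iteropE.
  rewrite big_seq [leRHS]big_seq; apply: ler_prod => y /un yr.
  by rewrite (ltW (le_lt_trans Q0 hs0)) hdel // addrC addKr.
apply: (le_trans lower).
have -> : \prod_(y <- u) normc q.[s0 + y] =
    normc a ^+ m * \prod_(z <- r) normc ((s0 - z) ^+ m - (- rho%:C) ^+ m).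
  transitivity (\prod_(y <- u) (normc a * \prod_(z <- r) normc (s0 + y - z))).
    by apply: eq_bigr => y _; rewrite qs normcM normc_prod.
  rewrite big_split /= big_const_seq count_predT su -Monoid.iteropE; congr (_ * _).
  rewrite exchange_big; apply: eq_bigr => z _.
  rewrite -normc_prod.
  have -> : \prod_(y <- u) (s0 + y - z) = (-1) ^+ m * \prod_(y <- u) (z - s0 - y).
    have -> : (-1) ^+ m = \prod_(y <- u) (-1) :> C.
      by rewrite big_const_seq count_predT su -Monoid.iteropE.
    by rewrite -big_split; apply: eq_bigr => y _ /=; ring.
  by rewrite ps mulrBr -!exprMn !mulN1r opprB.
have -> : normc q.[s0] = normc a * \prod_(z <- r) normc (s0 - z).
  by rewrite qs normcM normc_prod.
rewrite exprMn mulrCA ler_wpM2l ?exprn_ge0 ?normc_ge0 //.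
rewrite -prodrXl.
have -> : 2 ^+ size r = \prod_(z <- r) (2 : R).
  by rewrite big_const_seq count_predT -Monoid.iteropE.
rewrite -big_split /= big_seq [leRHS]big_seq.
apply: ler_prod => z /rz zr; rewrite normc_ge0 /=.
apply: (le_trans (normcB _ _)); rewrite mulr_natl mulr2n !normcX lerD2l.
rewrite (@normcN R rho%:C) normc_real gtr0_norm //.
by rewrite lerXn2r ?nnegrE ?normc_ge0 ?(ltW rho0) // ltW.
Qed.

Lemma gcont_unif (T : topologicalType) (f : T -> R) :
  (forall e : R, 0 < e -> exists2 g : T -> R, continuous g &
     forall t, `|f t - g t| < e) -> continuous f.
Proof.
move=> h t0; apply/cvgrPdist_lt => e e0.
have e30 : 0 < e / 3 by rewrite divr_gt0.
have [g cg gf] := h _ e30.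
have := cg t0 => /cvgrPdist_lt /(_ _ e30) near1.
near=> t.
have h1 : `|g t0 - g t| < e / 3 by near: t.
have h2 := gf t; have h3 := gf t0.
rewrite ltr_norml in h1; rewrite ltr_norml in h2; rewrite ltr_norml in h3.
rewrite ltr_norml; apply/andP; split; lra.
Unshelve. all: by end_near. Qed.

Lemma poly_cont2 (T : topologicalType) (z : T -> C) (q : {poly C}) :
  continuous (fun x => complex.Re (z x)) -> continuous (fun x => complex.Im (z x)) ->
  continuous (fun x => complex.Re q.[z x]) /\ continuous (fun x => complex.Im q.[z x]).
Proof.
move=> zr zi; elim/poly_ind: q => [|q c [qr qi]].
  by split; under eq_fun do rewrite horner0; exact: cst_continuous.
split.
  under eq_fun do rewrite hornerMXaddC cReD cReM.
  by apply: rcontD; [apply: rcontD; [|apply: rcontN]; exact: rcontM|exact: rcont_cst].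
under eq_fun do rewrite hornerMXaddC cImD cImM.
by apply: rcontD; [apply: rcontD; exact: rcontM|exact: rcont_cst].
Qed.

(** If f had no zero, |Re f| + |Im f| would have a positive minimum on the closed square of
    half-side rho. A polynomial close to f has a root within rho of s0 by [poly_min_modulus], and
    there f would be smaller than this minimum. The radius 2 * rho is that of a disc containing the
    square. *)
Lemma hurwitz (f : C -> C) (s0 : C) (rho del : R) : 0 < rho ->
  (forall e : R, 0 < e -> exists q : {poly C},
     forall s, normc (s - s0) <= 2 * rho -> normc (f s - q.[s]) < e) ->
  (forall s, normc (s - s0) = rho -> del < normc (f s)) ->
  normc (f s0) < del ->
  exists2 s, normc (s - s0) <= 2 * rho & f s = 0.
Proof.
move=> rho0 happ hdel hs0; apply: contrapT => hno.
(* [kp] clamps x to [- rho, rho], so that f composed with z is continuous on the whole plane and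
   agrees with f on the square. *)
pose kp (x : R) := (`|x + rho| - `|x - rho|) / 2.
have kp_le x : `|kp x| <= rho.
  rewrite /kp normrM [`|2^-1|]ger0_norm ?invr_ge0 // ler_pdivrMr //.
  apply: (le_trans (ler_dist_dist _ _)).
  have -> : x + rho - (x - rho) = rho * 2 by ring.
  by rewrite ger0_norm // mulr_ge0 // ltW.
have kp_id x : `|x| <= rho -> kp x = x.
  rewrite ler_norml => /andP[h1 h2]; rewrite /kp ger0_norm; last lra.
  rewrite ler0_norm; last lra.
  by field.
have kp_cont : continuous kp.
  apply: rcontM; last exact: rcont_cst.
  have cid : continuous (fun x : R => x) by move=> x; exact: cvg_id.
  have h a : continuous (fun x : R => `|x + a|).
    by move=> x; apply: cvg_norm; apply: cvgD; [exact: cvg_id|exact: cvg_cst].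
  exact: (rcontD (h rho) (rcontN (h (- rho)))).
pose z (x : R * R) : C := s0 + (kp x.1 +i* kp x.2).
have zin x : normc (z x - s0) <= 2 * rho.
  rewrite /z addrC addKr; apply: (le_trans (normc_le_ReIm _)) => /=.
  by rewrite mulr_natl mulr2n lerD.
have zr : continuous (fun x => complex.Re (z x)).
  rewrite (_ : (fun x => _) = fun x => complex.Re s0 + kp x.1); last by apply/funext => x; rewrite /z cReD.
  apply: (@rcontD _ _ (fun=> _)); first exact: rcont_cst.
  by move=> x; apply: continuous_comp; [exact: cvg_fst|exact: kp_cont].
have zi : continuous (fun x => complex.Im (z x)).
  rewrite (_ : (fun x => _) = fun x => complex.Im s0 + kp x.2); last by apply/funext => x; rewrite /z cImD.
  apply: (@rcontD _ _ (fun=> _)); first exact: rcont_cst.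
  by move=> x; apply: continuous_comp; [exact: cvg_snd|exact: kp_cont].
pose N x := `|complex.Re (f (z x))| + `|complex.Im (f (z x))|.
have Nc : continuous N.
  have cr : continuous (fun x => complex.Re (f (z x))).
    apply: gcont_unif => e /happ[q hq]; exists (fun x => complex.Re q.[z x]).
      by have [] := poly_cont2 q zr zi.
    by move=> x; rewrite -cReN -cReD (le_lt_trans (Re_le_normc _)) // hq.
  have ci : continuous (fun x => complex.Im (f (z x))).
    apply: gcont_unif => e /happ[q hq]; exists (fun x => complex.Im q.[z x]).
      by have [] := poly_cont2 q zr zi.
    by move=> x; rewrite -cImN -cImD (le_lt_trans (Im_le_normc _)) // hq.
  by apply: rcontD; exact: rcont_norm.
have [x0 _ x0min] : exists2 c, c \in `[- rho, rho]%classic `*` `[- rho, rho]%classic &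
    forall t, t \in `[- rho, rho]%classic `*` `[- rho, rho]%classic -> N c <= N t.
  apply: (@compact_EVT_min _ R N).
  - by exists (0, 0); split; rewrite /= in_itv /= oppr_le0 ltW.
  - by apply: compact_setX; exact: segment_compact.
  - exact: continuous_subspaceT.
have N0 : 0 < N x0.
  rewrite lt_neqAle addr_ge0 // andbT eq_sym; apply/eqP => N0; apply: hno.
  exists (z x0) => //; apply: normc_eq0.
  by apply/eqP; rewrite eq_le normc_ge0 andbT (le_trans (normc_le_ReIm _)) // -/(N x0) N0.
pose g := del - normc (f s0).
have g0 : 0 < g by rewrite subr_gt0.
(* The first bound contradicts minimality at the root of q; the second leaves room between q on the
   circle and q at s0 for the threshold del - g / 3. *)
pose e := Num.min (N x0 / 2) (g / 3).
have e0 : 0 < e by rewrite lt_min !divr_gt0.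
have eN : e <= N x0 / 2 by rewrite /e ge_min lexx.
have eg : e <= g / 3 by rewrite /e ge_min lexx orbT.
have [q hq] := happ e e0.
have hq0 : normc (f s0 - q.[s0]) < e by apply: hq; rewrite subrr normc0 mulr_ge0 // ltW.
have [||s sr /eqP qs0] := @poly_min_modulus q s0 rho (del - g / 3) rho0.
- move=> s ss; have hqs : normc (f s - q.[s]) < e by apply: hq; rewrite ss ler_peMl ?ltW // ltr1n.
  have := hdel s ss; have := normcD (f s - q.[s]) q.[s]; rewrite subrK; lra.
- have := normcB (f s0) (f s0 - q.[s0]); rewrite opprB addrC subrK.
  have := g0; rewrite {1}/g; rewrite /g in eg *; lra.
have hqs : normc (f s - q.[s]) < e by apply: hq; rewrite (le_trans sr) // ler_peMl ?ltW // ltr1n.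
rewrite qs0 subr0 in hqs.
pose x : R * R := (complex.Re (s - s0), complex.Im (s - s0)).
have zx : z x = s.
  rewrite /z /x /= !kp_id ?(le_trans (Re_le_normc _)) ?(le_trans (Im_le_normc _)) //.
  by rewrite addrC -[RHS](subrK s0); congr (_ + _); apply: cplx_ext.
have Nx : N x0 <= N x.
  apply: x0min; rewrite inE; split; rewrite /= in_itv /= -ler_norml.
    by rewrite (le_trans (Re_le_normc _)).
  by rewrite (le_trans (Im_le_normc _)).
have N2 : N x <= 2 * normc (f s).
  by rewrite /N zx mulr_natl mulr2n lerD // ?Re_le_normc ?Im_le_normc.
lra.
Qed.

End Hurwitz.

(** * Determinants and uniform limits of polynomials *)

Section LinearAlgebra.
Variable F : fieldType.

(** Injectivity on column vectors, whereas rank calculus acts on rows; hence the transposes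
    below. *)
Definition inj_mx m n (A : 'M[F]_(m, n)) := forall x : 'cV[F]_n, A *m x = 0 -> x = 0.

Lemma inj_mx_tr m n (A : 'M[F]_(m, n)) : inj_mx A -> row_free A^T.
Proof.
move=> hA; rewrite -kermx_eq0; apply/eqP/row_matrixP => i; rewrite row0.
apply: trmx_inj; rewrite trmx0; apply: hA; apply: trmx_inj.
by rewrite trmx_mul trmxK -row_mul mulmx_ker row0 trmx0.
Qed.

Lemma inj_mx_linv m n (A : 'M[F]_(m, n)) : inj_mx A -> exists B, B *m A = 1%:M.
Proof.
move=> /inj_mx_tr /row_freeP[B hB]; exists B^T.
by apply: trmx_inj; rewrite trmx_mul trmxK trmx1.
Qed.

Lemma linv_inj_mx m n (A : 'M[F]_(m, n)) B : B *m A = 1%:M -> inj_mx A.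
Proof. by move=> hB x Ax; rewrite -[x]mul1mx -hB -mulmxA Ax mulmx0. Qed.

(** G is a base of a complement of the row space of the transpose, which it meets only in 0. *)
Lemma inj_mx_compl m n (A : 'M[F]_(m, n)) : inj_mx A ->
  exists q (G : 'M[F]_(m, q)), m = (n + q)%N /\ inj_mx (row_mx A G).
Proof.
move=> hA; have fA := inj_mx_tr hA; pose B := A^T.
exists (\rank (B^C)%MS); exists (row_base (B^C)%MS)^T; split.
  by rewrite mxrank_compl (eqP fA) subnKC // -(eqP fA) rank_leq_col.
move=> x; rewrite -[x]vsubmxK mul_row_col => e.
have e1 : (usubmx x)^T *m B + (dsubmx x)^T *m row_base (B^C)%MS = 0.
  by have := congr1 trmx e; rewrite [X in X = _ -> _]linearD /= (trmx_mul A) (trmx_mul _ (dsubmx x)) trmxK trmx0.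
have h : (usubmx x)^T *m B = 0.
  have sub1 : ((usubmx x)^T *m B <= B)%MS by exact: submxMl.
  have sub2 : ((usubmx x)^T *m B <= B^C)%MS.
    move/eqP: e1; rewrite addr_eq0 => /eqP ->.
    by rewrite -mulNmx (submx_trans (submxMl _ _)) // eq_row_base.
  apply/eqP; rewrite -submx0; have := capmx_compl B => <-.
  by rewrite sub_capmx sub1.
have hu : usubmx x = 0.
  by apply: trmx_inj; rewrite trmx0; apply: (row_free_inj fA); rewrite mul0mx h.
have hd : dsubmx x = 0.
  apply: trmx_inj; rewrite trmx0; apply: (row_free_inj (row_base_free (B^C)%MS)).
  by rewrite mul0mx; move: e1; rewrite h add0r.
by rewrite hu hd col_mx0.
Qed.

Lemma det0_ker n (A : 'M[F]_n) : \det A = 0 -> exists2 x : 'cV[F]_n, x != 0 & A *m x = 0.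
Proof.
move=> dA; apply: contrapT => hno.
have hA : inj_mx A.
  by move=> x Ax; apply/eqP; apply/negPn/negP => x0; apply: hno; exists x.
have [B hB] := inj_mx_linv hA.
have := @det1 F n; rewrite -hB det_mulmx dA mulr0 => /eqP.
by rewrite eq_sym oner_eq0.
Qed.

Lemma det_neq0_inj n (A : 'M[F]_n) : \det A != 0 -> inj_mx A.
Proof.
move=> dA; apply: (@linv_inj_mx _ _ A (invmx A)); apply: mulVmx.
by rewrite unitmxE unitfE.
Qed.

Lemma row_free_square_inj m n (A : 'M[F]_(m, n)) : m = n -> row_free A -> inj_mx A.
Proof.
move=> mn fA; have /row_fullP[B hB] : row_full A by rewrite /row_full (eqP fA) mn.
exact: linv_inj_mx hB.
Qed.

End LinearAlgebra.

(** * Lipschitz bounds for determinants, and integrals over a period *)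

Section Estimates.
Context {R : realType}.
Local Notation C := R[i].
Local Notation normc := (@Normc.normc R).

Lemma nm_col m1 m2 n (A : 'M[C]_(m1, n)) (B : 'M[C]_(m2, n)) :
  nm (col_mx A B) = nm A + nm B.
Proof.
rewrite /nm big_split_ord /=; congr (_ + _); apply: eq_bigr => i _;
  by apply: eq_bigr => j _; rewrite ?col_mxEu ?col_mxEd.
Qed.

Lemma nm_row m n1 n2 (A : 'M[C]_(m, n1)) (B : 'M[C]_(m, n2)) :
  nm (row_mx A B) = nm A + nm B.
Proof.
rewrite /nm -big_split /=; apply: eq_bigr => i _; rewrite big_split_ord /=.
by congr (_ + _); apply: eq_bigr => j _; rewrite ?row_mxEl ?row_mxEr.
Qed.

Lemma nm_block m1 m2 n1 n2 (a : 'M[C]_(m1, n1)) (b : 'M[C]_(m1, n2))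
    (c : 'M[C]_(m2, n1)) (d : 'M[C]_(m2, n2)) :
  nm (block_mx a b c d) = nm a + nm b + (nm c + nm d).
Proof. by rewrite nm_col !nm_row. Qed.

(** Telescoping: the factors are replaced one at a time. *)
Lemma prod_lip (I : Type) (r : seq I) (a b : I -> C) (M eta : R) : 1 <= M -> 0 <= eta ->
  (forall i, normc (a i) <= M) -> (forall i, normc (b i) <= M) ->
  (forall i, normc (a i - b i) <= eta) ->
  normc (\prod_(i <- r) a i - \prod_(i <- r) b i) <= (size r)%:R * M ^+ size r * eta.
Proof.
move=> M1 eta0 ha hb hab; have M0 : 0 <= M by apply: le_trans M1.
elim: r => [|i r IH]; first by rewrite !big_nil subrr normc0 mul0r mul0r.
rewrite !big_cons /=.
have -> : a i * \prod_(j <- r) a j - b i * \prod_(j <- r) b j =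
  a i * (\prod_(j <- r) a j - \prod_(j <- r) b j) + (a i - b i) * \prod_(j <- r) b j by ring.
apply: (le_trans (normcD _ _)); rewrite !normcM.
have bM : normc (\prod_(j <- r) b j) <= M ^+ size r.
  rewrite normc_prod -[in leRHS]count_predT.
  have -> : M ^+ count predT r = \prod_(j <- r) M by rewrite big_const_seq -Monoid.iteropE.
  by apply: ler_prod => j _; rewrite normc_ge0 hb.
apply: le_trans (lerD (ler_pM (normc_ge0 _) (normc_ge0 _) (ha i) IH)
  (ler_pM (normc_ge0 _) (normc_ge0 _) (hab i) bM)) _.
rewrite -natr1 mulrDl mulrDl mul1r exprS.
apply: lerD; first by rewrite le_eqVlt; apply/orP; left; apply/eqP; ring.
rewrite mulrC ler_wpM2r // -[leLHS]mul1r ler_wpM2r // exprn_ge0 //.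
Qed.

Lemma det_lip n (M : R) : 1 <= M -> exists2 K : R, 0 <= K &
  forall A B : 'M[C]_n, nm A <= M -> nm B <= M ->
  normc (\det A - \det B) <= K * nm (A - B).
Proof.
move=> M1; have M0 : 0 <= M by apply: le_trans M1.
pose D : R := \sum_(s : 'S_n) (n%:R * M ^+ n).
exists D; first by apply: sumr_ge0 => s _; rewrite mulr_ge0 // exprn_ge0.
move=> A B AM BM; rewrite /determinant -sumrB.
apply: (le_trans (normc_sum _ _)); rewrite mulr_suml; apply: ler_sum => s _.
rewrite -mulrBr normcM normcX (@normcN R 1) normc1 expr1n mul1r.
have h := @prod_lip _ (index_enum 'I_n) (fun i => A i (s i)) (fun i => B i (s i)) M (nm (A - B)) M1 (nm_ge0 _).
have sz : size (index_enum 'I_n) = n by rewrite -[RHS]card_ord cardT enumT.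
rewrite sz in h; apply: h => i.
- exact: le_trans (nm_entry A i (s i)) AM.
- exact: le_trans (nm_entry B i (s i)) BM.
- by apply: le_trans (nm_entry (A - B) i (s i)); rewrite !mxE.
Qed.

Lemma cont_bounded1 (f : R -> R) : continuous f ->
  exists2 K : R, 0 <= K & forall t, `|t| <= 1 -> `|f t| <= K.
Proof.
move=> cf; have m11 : (-1 : R) <= 1 by lra.
have cn : {within `[-1, 1]%classic, continuous (fun t => `|f t|)}.
  by apply: continuous_subspaceT; exact: rcont_norm.
have [c _ hc] := EVT_max m11 cn.
exists `|f c| => // t; rewrite ler_norml => t1.
by apply: hc; rewrite in_itv.
Qed.

Lemma mcont_bounded1 m n (F : R -> 'M[C]_(m, n)) : mcont F ->
  exists2 K : R, 0 <= K & forall t, `|t| <= 1 -> nm (F t) <= K.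
Proof.
move=> cF.
have h i j : exists K : R, forall t, `|t| <= 1 -> normc (F t i j) <= K.
  have [cr ci] := cF i j.
  have [K1 _ h1] := cont_bounded1 cr; have [K2 _ h2] := cont_bounded1 ci.
  exists (K1 + K2) => t t1; apply: (le_trans (normc_le_ReIm _)).
  by rewrite lerD // ?h1 // h2.
have [K hK] := choice (fun ij : 'I_m * 'I_n => h ij.1 ij.2).
exists (\sum_i \sum_j `|K (i, j)|).
  by apply: sumr_ge0 => i _; apply: sumr_ge0.
move=> t t1; apply: ler_sum => i _; apply: ler_sum => j _.
by rewrite (le_trans (hK (i, j) t t1)) // ler_norm.
Qed.

Lemma periodic_floor (T : Type) (f : R -> T) : (forall t, f (t + 1) = f t) ->
  forall t, exists2 s, `|s| <= 1 & f t = f s.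
Proof.
move=> pf t; have pn (k : nat) u : f (u + k%:R) = f u.
  elim: k u => [|k IH] u; first by rewrite addr0.
  by rewrite -natr1 addrA pf IH.
have pz (k : int) u : f (u + k%:~R) = f u.
  case: k => k; first exact: pn.
  by rewrite NegzE mulrNz -(pn k.+1) subrK.
exists (t - (Num.floor t)%:~R); last by rewrite -[LHS](pz (- Num.floor t)) mulrNz.
have /andP[h1 h2] := floor_itv t.
by rewrite ger0_norm ?subr_ge0 //; rewrite intrD in h2; lra.
Qed.

Lemma mcont_periodic_bounded m n (F : R -> 'M[C]_(m, n)) : mcont F ->
  (forall t, F (t + 1) = F t) -> exists2 K : R, 0 <= K & forall t, nm (F t) <= K.
Proof.
move=> /mcont_bounded1[K K0 hK] /periodic_floor pF; exists K => // t.
by have [s s1 ->] := pF t; exact: hK.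
Qed.

(** The integral over one period, read from the primitive; [mint_mcx] identifies it with [mean] on
    real data. *)
Definition mint m n (F : R -> 'M[C]_(m, n)) := mprim F 1.

Lemma mint_der m n (F G : R -> 'M[C]_(m, n)) : mder F G -> mcont G ->
  mint G = F 1 - F 0.
Proof. by move=> FG cG; rewrite /mint (mprim_def FG cG). Qed.

Lemma mintD m n (F G : R -> 'M[C]_(m, n)) : mcont F -> mcont G ->
  mint (fun t => F t + G t) = mint F + mint G.
Proof.
move=> cF cG; have [F0 dF] := mprimP cF; have [G0 dG] := mprimP cG.
by rewrite (mint_der (mderD dF dG) (mcontD cF cG)) F0 G0 addr0 subr0.
Qed.

Lemma mintZ m n a (F : R -> 'M[C]_(m, n)) : mcont F ->
  mint (fun t => a *: F t) = a *: mint F.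
Proof.
move=> cF; have [F0 dF] := mprimP cF.
by rewrite (mint_der (mderZ a dF) (mcontZ a cF)) F0 scaler0 subr0.
Qed.

Lemma mintMl m n p (A : 'M[C]_(m, n)) (F : R -> 'M[C]_(n, p)) : mcont F ->
  mint (fun t => A *m F t) = A *m mint F.
Proof.
move=> cF; have [F0 dF] := mprimP cF.
rewrite (mint_der (mderMl A dF)) ?F0 ?mulmx0 ?subr0 //.
by apply: mcontM => //; exact: mcont_cst.
Qed.

Lemma mintMr m n p (A : 'M[C]_(n, p)) (F : R -> 'M[C]_(m, n)) : mcont F ->
  mint (fun t => F t *m A) = mint F *m A.
Proof.
move=> cF; have [F0 dF] := mprimP cF.
rewrite (mint_der (mderMr A dF)) ?F0 ?mul0mx ?subr0 //.
by apply: mcontM => //; exact: mcont_cst.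
Qed.

Lemma mint_bound m n (F : R -> 'M[C]_(m, n)) K : mcont F ->
  (forall t, `|t| <= 1 -> nm (F t) <= K) -> nm (mint F) <= (m * n)%:R * (2 * K).
Proof.
move=> cF hK; have [F0 dF] := mprimP cF.
have := mder_bound1 dF _ hK; rewrite /mint => /(_ 1).
by rewrite normr1 F0 subr0; apply.
Qed.

End Estimates.

(** * Uniform limits of polynomials on a disc *)

Section PolyLimits.
Context {R : realType}.
Local Notation C := R[i].
Local Notation normc := (@Normc.normc R).
Variables (s0 : C) (rad : R).

(** This replaces holomorphy: it is stable under sums and products, hence under determinants, and it
    is the regularity that [hurwitz] asks for. *)
Definition polylim (f : C -> C) := forall e : R, 0 < e -> exists q : {poly C},
  forall s, normc (s - s0) <= rad -> normc (f s - q.[s]) < e.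

Lemma poly_bounded (q : {poly C}) : exists2 K : R, 0 <= K &
  forall s, normc (s - s0) <= rad -> normc q.[s] <= K.
Proof.
elim/poly_ind: q => [|q c [K K0 hK]].
  by exists 0 => // s _; rewrite horner0 normc0.
exists (K * (`|rad| + normc s0) + normc c).
  by rewrite addr_ge0 ?normc_ge0 // mulr_ge0 // addr_ge0 ?normc_ge0.
move=> s sr; rewrite hornerMXaddC; apply: (le_trans (normcD _ _)).
rewrite lerD2r normcM ler_pM ?normc_ge0 ?hK //.
have := normcD (s - s0) s0; rewrite subrK => /le_trans; apply.
by rewrite lerD2r (le_trans sr) // ler_norm.
Qed.

Lemma polylim_poly (q : {poly C}) : polylim (fun s => q.[s]).
Proof. by move=> e e0; exists q => s _; rewrite subrr normc0. Qed.

Lemma polylim_ext f g : f =1 g -> polylim f -> polylim g.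
Proof. by move=> /funext ->. Qed.

Lemma polylim_cst c : polylim (fun=> c).
Proof. by apply: polylim_ext (polylim_poly c%:P) => s; rewrite hornerC. Qed.

Lemma polylim_id : polylim (fun s => s).
Proof. by apply: polylim_ext (polylim_poly 'X) => s; rewrite hornerX. Qed.

Lemma polylimD f g : polylim f -> polylim g -> polylim (fun s => f s + g s).
Proof.
move=> hf hg e e0; have e20 : 0 < e / 2 by rewrite divr_gt0.
have [p hp] := hf _ e20; have [q hq] := hg _ e20; exists (p + q) => s ss.
rewrite hornerD; have -> : f s + g s - (p.[s] + q.[s]) = (f s - p.[s]) + (g s - q.[s]) by ring.
apply: (le_lt_trans (normcD _ _)); have := hp s ss; have := hq s ss; lra.
Qed.

Lemma polylimM f g : polylim f -> polylim g -> polylim (fun s => f s * g s).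
Proof.
move=> hf hg e e0.
have [p1 hp1] := hf 1 ltr01; have [K K0 hK] := poly_bounded p1.
(* A bound for f itself, inherited from an approximation to within 1. *)
have fK s : normc (s - s0) <= rad -> normc (f s) <= K + 1.
  move=> ss; have := normcD (f s - p1.[s]) p1.[s]; rewrite subrK.
  have := hp1 s ss; have := hK s ss; lra.
pose e1 := e / (2 * (K + 1)).
have K10 : 0 < 2 * (K + 1) by rewrite mulr_gt0 // ltr_wpDl.
have e10 : 0 < e1 by rewrite divr_gt0.
have [q hq] := hg _ e10; have [L L0 hL] := poly_bounded q.
pose e2 := e / (2 * (L + 1)).
have L10 : 0 < 2 * (L + 1) by rewrite mulr_gt0 // ltr_wpDl.
have e20 : 0 < e2 by rewrite divr_gt0.
have [p hp] := hf _ e20; exists (p * q) => s ss.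
rewrite hornerM; have -> : f s * g s - p.[s] * q.[s] =
  f s * (g s - q.[s]) + (f s - p.[s]) * q.[s] by ring.
apply: (le_lt_trans (normcD _ _)); rewrite !normcM.
have h1 : normc (f s) * normc (g s - q.[s]) <= e / 2.
  apply: (@le_trans _ _ ((K + 1) * e1)).
    by apply: ler_pM; rewrite ?normc_ge0 ?fK // ltW // hq.
  have K1 : K + 1 != 0 by rewrite gt_eqF // ltr_wpDl.
  by rewrite le_eqVlt; apply/orP; left; apply/eqP; rewrite /e1; field.
have h2 : normc (f s - p.[s]) * normc q.[s] < e / 2.
  apply: (@le_lt_trans _ _ (e2 * L)).
    by apply: ler_pM; rewrite ?normc_ge0 ?hL // ltW // hp.
  have -> : e / 2 = e2 * (L + 1).
    have L1 : L + 1 != 0 by rewrite gt_eqF // ltr_wpDl.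
    by rewrite /e2; field.
  by rewrite ltr_pM2l // ltrDl.
lra.
Qed.

Lemma polylim_sum (I : Type) (r : seq I) (F : I -> C -> C) :
  (forall i, polylim (F i)) -> polylim (fun s => \sum_(i <- r) F i s).
Proof.
move=> hF; elim: r => [|i r IH].
  by apply: polylim_ext (polylim_cst 0) => s; rewrite big_nil.
by apply: polylim_ext (polylimD (hF i) IH) => s; rewrite big_cons.
Qed.

Lemma polylim_prod (I : Type) (r : seq I) (F : I -> C -> C) :
  (forall i, polylim (F i)) -> polylim (fun s => \prod_(i <- r) F i s).
Proof.
move=> hF; elim: r => [|i r IH].
  by apply: polylim_ext (polylim_cst 1) => s; rewrite big_nil.
by apply: polylim_ext (polylimM (hF i) IH) => s; rewrite big_cons.
Qed.

Definition mpolylim m n (A : C -> 'M[C]_(m, n)) :=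
  forall i j, polylim (fun s => A s i j).

Lemma mpolylim_det n (A : C -> 'M[C]_n) : mpolylim A -> polylim (fun s => \det (A s)).
Proof.
move=> hA; apply: polylim_sum => s; apply: polylimM; first exact: polylim_cst.
exact: polylim_prod.
Qed.

Lemma mpolylim_ext m n (A B : C -> 'M[C]_(m, n)) : A =1 B -> mpolylim A -> mpolylim B.
Proof. by move=> /funext ->. Qed.

Lemma mpolylim_cst m n (A : 'M[C]_(m, n)) : mpolylim (fun=> A).
Proof. by move=> i j; exact: polylim_cst. Qed.

Lemma mpolylimD m n (A B : C -> 'M[C]_(m, n)) :
  mpolylim A -> mpolylim B -> mpolylim (fun s => A s + B s).
Proof.
by move=> hA hB i j; apply: polylim_ext (polylimD (hA i j) (hB i j)) => s; rewrite mxE.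
Qed.

Lemma mpolylimM m n p (A : C -> 'M[C]_(m, n)) (B : C -> 'M[C]_(n, p)) :
  mpolylim A -> mpolylim B -> mpolylim (fun s => A s *m B s).
Proof.
move=> hA hB i j; apply: polylim_ext (polylim_sum _ (fun k => polylimM (hA i k) (hB k j))) => s.
by rewrite mxE.
Qed.

Lemma mpolylimZ m n (a : C -> C) (B : C -> 'M[C]_(m, n)) :
  polylim a -> mpolylim B -> mpolylim (fun s => a s *: B s).
Proof.
by move=> ha hB i j; apply: polylim_ext (polylimM ha (hB i j)) => s; rewrite mxE.
Qed.

Lemma mpolylim_col m1 m2 n (A : C -> 'M[C]_(m1, n)) (B : C -> 'M[C]_(m2, n)) :
  mpolylim A -> mpolylim B -> mpolylim (fun s => col_mx (A s) (B s)).
Proof.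
move=> hA hB i j; rewrite -(splitK i); case: (fintype.split i) => k /=.
  by apply: polylim_ext (hA k j) => s; rewrite col_mxEu.
by apply: polylim_ext (hB k j) => s; rewrite col_mxEd.
Qed.

Lemma mpolylim_row m n1 n2 (A : C -> 'M[C]_(m, n1)) (B : C -> 'M[C]_(m, n2)) :
  mpolylim A -> mpolylim B -> mpolylim (fun s => row_mx (A s) (B s)).
Proof.
move=> hA hB i j; rewrite -(splitK j); case: (fintype.split j) => k /=.
  by apply: polylim_ext (hA i k) => s; rewrite row_mxEl.
by apply: polylim_ext (hB i k) => s; rewrite row_mxEr.
Qed.

End PolyLimits.

(** * Polynomial dependence of the Picard iterates on a parameter *)

Section PolynomialFamilies.
Context {R : realType}.
Local Notation C := R[i].

(** Polynomials in s with coefficients continuous in t, in Horner form: stability under products and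
    primitives becomes an induction. *)
Inductive pfam m n : (C -> R -> 'M[C]_(m, n)) -> Prop :=
| pfam_base M : mcont M -> pfam (fun _ => M)
| pfam_step F M : pfam F -> mcont M -> pfam (fun s t => M t + s *: F s t).

Lemma pfam_ext m n (F G : C -> R -> 'M[C]_(m, n)) :
  (forall s t, F s t = G s t) -> pfam F -> pfam G.
Proof. by move=> FG; have -> : G = F by apply/funext => s; apply/funext => t. Qed.

Lemma pfam_cont m n (F : C -> R -> 'M[C]_(m, n)) s : pfam F -> mcont (F s).
Proof.
elim=> [M cM //|G M _ cG cM].
by apply: mcontD => //; exact: mcontZ.
Qed.

Lemma pfamD m n (F G : C -> R -> 'M[C]_(m, n)) : pfam F -> pfam G ->
  pfam (fun s t => F s t + G s t).
Proof.
move=> pF; elim: pF G => [M cM|F1 M pF1 IH cM] G [M' cM'|G1 M' pG1 cM'].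
- by apply: pfam_base; exact: mcontD.
- by apply: pfam_ext (pfam_step pG1 (mcontD cM cM')) => s t; rewrite addrA.
- by apply: pfam_ext (pfam_step pF1 (mcontD cM cM')) => s t; rewrite addrAC.
- apply: pfam_ext (pfam_step (IH _ pG1) (mcontD cM cM')) => s t.
  by rewrite scalerDr addrACA.
Qed.

Lemma pfam_mulr m n p (F : C -> R -> 'M[C]_(m, n)) (A : R -> 'M[C]_(n, p)) :
  pfam F -> mcont A -> pfam (fun s t => F s t *m A t).
Proof.
move=> pF cA; elim: pF => [M cM|F1 M pF1 IH cM].
  by apply: pfam_base; exact: mcontM.
apply: pfam_ext (pfam_step IH (mcontM cM cA)) => s t.
by rewrite mulmxDl scalemxAl.
Qed.

Lemma pfam_shift m n (F : C -> R -> 'M[C]_(m, n)) : pfam F ->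
  pfam (fun s t => s *: F s t).
Proof.
move=> pF; apply: pfam_ext (pfam_step pF (mcont_cst 0)) => s t.
by rewrite add0r.
Qed.

Lemma mprimDZ m n a (F G : R -> 'M[C]_(m, n)) t : mcont F -> mcont G ->
  mprim (fun t => F t + a *: G t) t = mprim F t + a *: mprim G t.
Proof.
move=> cF cG; have [F0 dF] := mprimP cF; have [G0 dG] := mprimP cG.
rewrite (mprim_def (mderD dF (mderZ a dG))) ?F0 ?G0 ?scaler0 ?addr0 ?subr0 //.
by apply: mcontD => //; exact: mcontZ.
Qed.

Lemma pfam_mprim m n (F : C -> R -> 'M[C]_(m, n)) : pfam F ->
  pfam (fun s => mprim (F s)).
Proof.
elim=> [M cM|F1 M pF1 IH cM].
  by apply: pfam_base; apply: mder_cont (mprimP cM).2.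
apply: pfam_ext (pfam_step IH (mder_cont (mprimP cM).2)) => s t.
by rewrite mprimDZ //; exact: pfam_cont.
Qed.

Lemma pfam_poly m n (F : C -> R -> 'M[C]_(m, n)) t i j : pfam F ->
  exists q : {poly C}, forall s, F s t i j = q.[s].
Proof.
elim=> [M cM|F1 M pF1 [q hq] cM].
  by exists (M t i j)%:P => s; rewrite hornerC.
exists (q * 'X + (M t i j)%:P) => s.
by rewrite hornerMXaddC !mxE hq addrC mulrC.
Qed.

Lemma picard_pfam p (A0 A1 : R -> 'M[C]_p) k : mcont A0 -> mcont A1 ->
  pfam (fun s => picard (fun t => A0 t + s *: A1 t) k).
Proof.
move=> c0 c1; elim: k => [|k IH] /=.
  by apply: pfam_base; exact: mcont_cst.
apply: pfam_mprim.
apply: pfam_ext (pfamD (pfam_mulr IH c0) (pfam_shift (pfam_mulr IH c1))) => s t.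
by rewrite mulmxDr scalemxAr.
Qed.

Lemma psum_pfam p (A0 A1 : R -> 'M[C]_p) K : mcont A0 -> mcont A1 ->
  pfam (fun s t => \sum_(k < K) picard (fun t => A0 t + s *: A1 t) k t).
Proof.
move=> c0 c1; elim: K => [|K IH].
  apply: pfam_ext (pfam_base (mcont_cst 0)) => s t.
  by rewrite big_ord0.
apply: pfam_ext (pfamD IH (picard_pfam K c0 c1)) => s t.
by rewrite big_ord_recr.
Qed.

Section Limits.
Variables (p : nat) (A0 A1 : R -> 'M[C]_p) (s0 : C) (rad a : R).
Hypotheses (c0 : mcont A0) (c1 : mcont A1).
Hypothesis ba : forall s, Normc.normc (s - s0) <= rad -> forall t, nm (A0 t + s *: A1 t) <= a.
Let Psi (s : C) := fund (fun t => A0 t + s *: A1 t).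

Let cA s : mcont (fun t => A0 t + s *: A1 t).
Proof. by apply: mcontD => //; exact: mcontZ. Qed.

(** The partial sums of the Picard series are polynomial in s, and the tail is small uniformly for s
    in the disc. *)
Lemma fund_polylim t : `|t| <= 1 -> mpolylim s0 rad (fun s => Psi s t).
Proof.
move=> t1 i j e e0; have [K hK] := ptail_small p a 1 e0.
have [q hq] := pfam_poly t i j (psum_pfam K c0 c1).
exists q => s ss; rewrite -hq.
apply: le_lt_trans (hK K (leqnn K)).
apply: le_trans (fund_tail K (cA s) (ba ss) t1).
by apply: le_trans (nm_entry _ i j); rewrite !mxE.
Qed.

Lemma mint_fund_polylim n (g : R -> 'M[C]_(p, n)) : mcont g ->
  mpolylim s0 rad (fun s => mint (fun t => Psi s t *m g t)).
Proof.
move=> cg i j e e0; have [G G0 hG] := mcont_bounded1 cg.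
pose k : R := (p * n)%:R * (2 * (G + 1)).
(* The case k <= 0 is void, since the indices i and j show that p and n are positive. *)
have [k0|k0] := leP k 0.
  exists 0 => s ss; exfalso.
  have G10 : 0 < 2 * (G + 1) by apply: mulr_gt0 => //; exact: ltr_wpDl.
  have : (0 : R) < (p * n)%:R by rewrite ltr0n muln_gt0 (leq_ltn_trans (leq0n i) (ltn_ord i)) (leq_ltn_trans (leq0n j) (ltn_ord j)).
  by move=> pn0; have := mulr_gt0 pn0 G10; rewrite ltNge k0.
have e'0 : 0 < e / k by rewrite divr_gt0.
have [K hK] := ptail_small p a 1 e'0.
have pm := pfam_mprim (pfam_mulr (psum_pfam K c0 c1) cg).
have [q hq] := pfam_poly 1 i j pm; exists q => s ss; rewrite -hq.
have cP : mcont (Psi s) by apply: fund_cont (ba ss).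
have cS := psum_cont K (cA s).
have -> : mint (fun t => Psi s t *m g t) i j -
    mprim (fun t => (\sum_(k0 < K) picard (fun t0 => A0 t0 + s *: A1 t0) k0 t) *m g t) 1 i j =
  mint (fun t => (Psi s t - \sum_(k0 < K) picard (fun t0 => A0 t0 + s *: A1 t0) k0 t) *m g t) i j.
  have -> : (fun t => (Psi s t - \sum_(k0 < K) picard (fun t0 => A0 t0 + s *: A1 t0) k0 t) *m g t)
    = (fun t => Psi s t *m g t + (-1) *: ((\sum_(k0 < K) picard (fun t0 => A0 t0 + s *: A1 t0) k0 t) *m g t)).
    by apply/funext => t; rewrite mulmxBl scaleN1r.
  rewrite mintD ?mintZ ?mxE ?mulN1r //; try exact: mcontM.
  by apply: mcontZ; exact: mcontM.
apply: (le_lt_trans (nm_entry _ i j)).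
apply: (@le_lt_trans _ _ ((p * n)%:R * (2 * (e / k * G)))).
  apply: mint_bound; first by apply: mcontM => //; exact: mcontB.
  move=> t t1; apply: (le_trans (nmM _ _)).
  apply: ler_pM; rewrite ?nm_ge0 ?hG //.
  by apply: ltW; apply: le_lt_trans (hK K (leqnn K)); exact: (fund_tail K (cA s) (ba ss) t1).
have -> : (p * n)%:R * (2 * (e / k * G)) = e * ((p * n)%:R * (2 * G) / k) by ring.
rewrite -[ltRHS]mulr1 ltr_pM2l // ltr_pdivrMr // mul1r /k.
have pn0 : (0 : R) < (p * n)%:R.
  by rewrite lt_neqAle ler0n andbT eq_sym; apply/eqP => z; move: k0; rewrite /k z mul0r ltxx.
by rewrite ltr_pM2l // ltr_pM2l // ltrDl.
Qed.

End Limits.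

End PolynomialFamilies.

(** * Linear systems: uniqueness, variation of constants, periodicity *)

Section LinearSystems.
Context {R : realType}.
Local Notation C := R[i].
Variables (p : nat) (A : R -> 'M[C]_p) (a : R).
Hypotheses (cA : mcont A) (bA : forall t, nm (A t) <= a).

(** The inverse fundamental matrix times the difference of two solutions is constant. *)
Lemma ode_uniq n (w1 w2 g : R -> 'M[C]_(p, n)) :
  mder w1 (fun t => A t *m w1 t + g t) -> mder w2 (fun t => A t *m w2 t + g t) ->
  w1 0 = w2 0 -> w1 =1 w2.
Proof.
move=> d1 d2 e0 t; have [Phi [dPhi Phi0 PsiPhi PhiPsi]] := fund_inv cA bA.
have bN s : nm (- A s) <= a by rewrite nmN.
have [dPsi Psi0] := fund_der (mcontN cA) bN.
have dd : mder (fun t => fund (fun s => - A s) t *m (w1 t - w2 t)) (fun=> 0).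
  apply: mder_ext (mderM dPsi (mderB d1 d2)) _ _ => // s.
  by rewrite opprD addrACA subrr addr0 -mulmxBr mulmxN mulNmx mulmxA addNr.
have := mder_eq_cst dd (mder_cst 0); rewrite e0 subrr mulmx0 => /(_ erefl t) h.
by apply/eqP; rewrite -subr_eq0 -[X in X == 0]mul1mx -(PhiPsi t) -mulmxA h mulmx0.
Qed.

Lemma ode_uniq0 n (w1 w2 : R -> 'M[C]_(p, n)) :
  mder w1 (fun t => A t *m w1 t) -> mder w2 (fun t => A t *m w2 t) ->
  w1 0 = w2 0 -> w1 =1 w2.
Proof.
move=> d1 d2; apply: (@ode_uniq _ _ _ (fun=> 0)).
  by apply: mder_ext d1 _ _ => // t; rewrite addr0.
by apply: mder_ext d2 _ _ => // t; rewrite addr0.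
Qed.

Lemma row_ode_uniq n (w1 w2 : R -> 'M[C]_(n, p)) :
  mder w1 (fun t => - (w1 t *m A t)) -> mder w2 (fun t => - (w2 t *m A t)) ->
  w1 0 = w2 0 -> w1 =1 w2.
Proof.
move=> d1 d2 e0 t; have [Phi [dPhi Phi0 PsiPhi PhiPsi]] := fund_inv cA bA.
have dd : mder (fun t => (w1 t - w2 t) *m Phi t) (fun=> 0).
  apply: mder_ext (mderM (mderB d1 d2) dPhi) _ _ => // s.
  by rewrite -opprD -mulmxBl mulNmx mulmxA addNr.
have := mder_eq_cst dd (mder_cst 0); rewrite e0 subrr mul0mx => /(_ erefl t) h.
apply/eqP; rewrite -subr_eq0 -[X in X == 0]mulmx1 -(PhiPsi t) mulmxA h mul0mx //.
Qed.

(** Variation of constants. The last clause transports the value at time 1 back to time 0, which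
    turns periodicity into an algebraic condition on z0. *)
Lemma ode_solve n (g : R -> 'M[C]_(p, n)) (z0 : 'M[C]_(p, n)) : mcont g ->
  exists z, [/\ z 0 = z0, mder z (fun t => A t *m z t + g t) &
    fund (fun s => - A s) 1 *m z 1 = z0 + mint (fun t => fund (fun s => - A s) t *m g t)].
Proof.
move=> cg; have [Phi [dPhi Phi0 PsiPhi PhiPsi]] := fund_inv cA bA.
have bN s : nm (- A s) <= a by rewrite nmN.
have cPsi := fund_cont (mcontN cA) bN.
have cPg := mcontM cPsi cg.
have [I0 dI] := mprimP cPg.
exists (fun t => Phi t *m (z0 + mprim (fun t => fund (fun s => - A s) t *m g t) t)); split.
- by rewrite Phi0 mul1mx I0 addr0.
- apply: mder_ext (mderM dPhi (mderD (mder_cst z0) dI)) _ _ => // t.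
  by rewrite add0r mulmxA PhiPsi mul1mx -mulmxA.
- by rewrite mulmxA PsiPhi mul1mx.
Qed.

(** The translate of z by one period solves the same system with the same initial value. *)
Lemma ode_periodic n (z g : R -> 'M[C]_(p, n)) :
  (forall t, A (t + 1) = A t) -> (forall t, g (t + 1) = g t) ->
  mder z (fun t => A t *m z t + g t) -> z 1 = z 0 -> forall t, z (t + 1) = z t.
Proof.
move=> pA pg dz z10; apply: (@ode_uniq _ (fun t => z (t + 1)) z g) => //.
  by apply: mder_ext (mder_shift 1 dz) _ _ => // t; rewrite pA pg.
by rewrite add0r.
Qed.

End LinearSystems.

(** * Quantities bounded uniformly in the small parameter *)

Section Bounded.
Context {R : realType}.
Local Notation C := R[i].
Local Notation normc := (@Normc.normc R).
Variable M : R.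

(** Here h is the square root of [nu] and s the rescaled eigenvalue; [Ob] and [Os] mean O(1)
    uniformly over this domain. *)
Definition pdom (h : R) (s : C) := [/\ 0 < h, h <= 1 & normc s <= M].

Definition Ob m n (X : R -> C -> 'M[C]_(m, n)) :=
  exists K : R, forall h s, pdom h s -> nm (X h s) <= K.

Definition Os (x : R -> C -> C) :=
  exists K : R, forall h s, pdom h s -> normc (x h s) <= K.

Lemma Ob_cst m n (A : 'M[C]_(m, n)) : Ob (fun _ _ => A).
Proof. by exists (nm A). Qed.

Lemma ObD m n (X Y : R -> C -> 'M[C]_(m, n)) : Ob X -> Ob Y ->
  Ob (fun h s => X h s + Y h s).
Proof.
move=> [K hK] [L hL]; exists (K + L) => h s hs.
by apply: (le_trans (nmD _ _)); rewrite lerD ?hK ?hL.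
Qed.

Lemma ObM m n q (X : R -> C -> 'M[C]_(m, n)) (Y : R -> C -> 'M[C]_(n, q)) :
  Ob X -> Ob Y -> Ob (fun h s => X h s *m Y h s).
Proof.
move=> [K hK] [L hL]; exists (K * L) => h s hs.
by apply: (le_trans (nmM _ _)); apply: ler_pM; rewrite ?nm_ge0 ?hK ?hL.
Qed.

Lemma ObZ m n x (Y : R -> C -> 'M[C]_(m, n)) :
  Os x -> Ob Y -> Ob (fun h s => x h s *: Y h s).
Proof.
move=> [K hK] [L hL]; exists (K * L) => h s hs.
by rewrite nmZ; apply: ler_pM; rewrite ?nm_ge0 ?normc_ge0 ?hK ?hL.
Qed.

Lemma Ob_block m1 m2 n1 n2 (a : R -> C -> 'M[C]_(m1, n1)) b c (d : R -> C -> 'M[C]_(m2, n2)) :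
  Ob a -> Ob b -> Ob c -> Ob d ->
  Ob (fun h s => block_mx (a h s) (b h s) (c h s) (d h s)).
Proof.
move=> [K1 h1] [K2 h2] [K3 h3] [K4 h4]; exists (K1 + K2 + (K3 + K4)) => h s hs.
by rewrite nm_block; apply: lerD; apply: lerD; auto.
Qed.

Lemma Ob_col m1 m2 n (a : R -> C -> 'M[C]_(m1, n)) (b : R -> C -> 'M[C]_(m2, n)) :
  Ob a -> Ob b -> Ob (fun h s => col_mx (a h s) (b h s)).
Proof.
move=> [K1 h1] [K2 h2]; exists (K1 + K2) => h s hs.
by rewrite nm_col; apply: lerD; auto.
Qed.

Lemma Os_cst x : Os (fun _ _ => x).
Proof. by exists (normc x). Qed.

Lemma OsM x y : Os x -> Os y -> Os (fun h s => x h s * y h s).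
Proof.
move=> [K hK] [L hL]; exists (K * L) => h s hs.
by rewrite normcM; apply: ler_pM; rewrite ?normc_ge0 ?hK ?hL.
Qed.

Lemma Os_s : Os (fun _ s => s).
Proof. by exists M => h s []. Qed.

Lemma Os_h : Os (fun h _ => h%:C).
Proof. by exists 1 => h s [h0 h1 _]; rewrite normc_real gtr0_norm. Qed.

Lemma det_near m (X N : R -> C -> 'M[C]_m) (X0 : C -> 'M[C]_m) :
  Ob (fun _ => X0) -> Ob N ->
  (forall h s, pdom h s -> X h s = X0 s + h%:C *: N h s) ->
  exists K : R, forall h s, pdom h s -> normc (\det (X h s) - \det (X0 s)) <= K * h.
Proof.
move=> [K1 h1] [K2 h2] hX.
pose B := 1 + (`|K1| + `|K2|).
have B1 : 1 <= B by rewrite lerDl addr_ge0.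
have [K K0 hK] := @det_lip R m B B1.
exists (K * `|K2|) => h s hs; have [h0 hle _] := hs.
have nN : nm (h%:C *: N h s) <= h * `|K2|.
  rewrite nmZ normc_real gtr0_norm //; apply: ler_wpM2l; first exact: ltW.
  by rewrite (le_trans (h2 _ _ hs)) // ler_norm.
have nX0 : nm (X0 s) <= `|K1| by rewrite (le_trans (h1 _ _ hs)) // ler_norm.
have K20 : h * `|K2| <= `|K2| by rewrite -[leRHS]mul1r ler_wpM2r.
apply: (le_trans (hK _ _ _ _)).
- rewrite hX //; apply: (le_trans (nmD _ _)); rewrite /B; lra.
- rewrite /B; have := normr_ge0 K2; lra.
- by rewrite hX // addrC addKr -mulrA ler_wpM2l // mulrC.
Qed.

End Bounded.

(** Residue of zt dl / eps + Z0 + eps Z1 in z' = (A0 + eps (s A1 - 1)) z, the first line being its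
    derivative. Order 1 / eps cancels, and order 0 is carried by the single vector e. *)
Lemma bordered_residual (K : fieldType) p m (A0 A1 : 'M[K]_p) (zt e : 'cV[K]_p)
    (dl c : 'rV[K]_m) (Z0 Z1 S : 'M[K]_(p, m)) (eps s : K) : eps != 0 -> A1 *m zt = e ->
  (eps^-1 *: (A0 *m zt *m dl) + (A0 *m Z0 - zt *m dl - e *m c)
     + eps *: (A0 *m Z1 - Z0 + S))
   - (A0 + eps *: (s *: A1 - 1%:M)) *m (eps^-1 *: (zt *m dl) + Z0 + eps *: Z1)
  = - (e *m (c + s *: dl)) + eps *: (S - s *: (A1 *m Z0))
    + eps ^+ 2 *: (Z1 - s *: (A1 *m Z1)).
Proof.
move=> e0 <-.
rewrite mulmxDl -scalemxAl mulmxBl mul1mx -!scalemxAl !mulmxDr -!scalemxAr !mulmxA.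
move: (A0 *m zt *m dl) (A0 *m Z0) (A0 *m Z1) (A1 *m zt *m dl) (A1 *m zt *m c)
  (A1 *m Z0) (A1 *m Z1) (zt *m dl) => x1 x2 x3 x4 x5 x6 x7 x8.
by apply/matrixP => i j; rewrite !mxE; field.
Qed.

(** Used with a D that multiplies the column carrying z by ep, so that the singular term has a
    limit. *)
Lemma rescale_columns (K : fieldType) p m (z : 'cV[K]_p) (x y : 'M[K]_(p, m))
    (dl : 'rV[K]_m) (D D0 D' : 'M[K]_m) (ep : K) : ep != 0 ->
  dl *m D = ep *: dl -> D = D0 + ep *: D' ->
  (ep^-1 *: (z *m dl) + x + ep *: y) *m D =
  (z *m dl + x *m D0) + ep *: (x *m D' + y *m D).
Proof.
move=> e0 dlD DE; rewrite !mulmxDl -!scalemxAl -mulmxA dlD -scalemxAr scalerA mulVf // scale1r.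
by rewrite {1}DE mulmxDr -scalemxAr scalerDr !addrA.
Qed.

(** * Perturbation of the Floquet multiplier 1 *)

Section Floquet.
Context {R : realType}.
Local Notation C := R[i].
Local Notation normc := (@Normc.normc R).
Local Notation Im := (@complex.Im R).

(* The small parameter is eps = i nu with nu = h ^ 2, since the bordered
   determinant is rescaled by powers of the square root of nu. *)
Definition ieps (h : R) : C := h%:C ^+ 2 * 'i.

Lemma ieps_neq0 h : 0 < h -> ieps h != 0.
Proof.
move=> h0; rewrite /ieps mulf_neq0 //; last by rewrite eq_complex /= oner_eq0 andbF.
by rewrite expf_neq0 // eq_complex /= gt_eqF.
Qed.

Lemma normc_i : normc ('i : C) = 1.
Proof. by rewrite /= expr0n expr1n /= add0r sqrtr1. Qed.

Lemma normc_ieps h : 0 < h -> h <= 1 -> normc (ieps h) <= 1.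
Proof.
move=> h0 h1; rewrite /ieps normcM normc_i mulr1 normcX normc_real gtr0_norm //.
by rewrite exprn_ile1 // ltW.
Qed.

(** For the choice of a circle that avoids the finitely many roots of a characteristic
    polynomial. *)
Lemma avoid_radius (ds : seq R) (b : R) : 0 < b ->
  exists2 rho, 0 < rho < b & forall x, x \in ds -> x != rho.
Proof.
move=> b0.
suff [rho r0 hr] : exists2 rho, 0 < rho < b & forall x, x \in ds -> x <= 0 \/ rho < x.
  exists rho => // x /hr[x0|rx]; last by rewrite gt_eqF.
  by rewrite lt_eqF // (le_lt_trans x0) //; case/andP: r0.
elim: ds => [|x ds [rho /andP[r0 rb] hr]].
  by exists (b / 2) => //; rewrite divr_gt0 //= ltr_pdivrMr // ltr_pMr // ltr1n.
have [x0|x0] := leP x 0.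
  by exists rho; rewrite ?r0 // => y; rewrite inE => /predU1P[->|/hr //]; left.
exists (Num.min rho (x / 2)).
  by rewrite lt_min r0 divr_gt0 //= gt_min rb.
move=> y; rewrite inE => /predU1P[->|/hr[y0|ry]]; [right|by left|right].
  by rewrite gt_min ltr_pdivrMr // ltr_pMr // ltr1n orbT.
by rewrite gt_min ry.
Qed.

(** Abstract data, to be instantiated by the Bloch problem: zt is the translation mode and e = A1
    zt, Z0 holds the derivatives of the profiles along their parameters, Z1 is a corrector, L holds
    the adjoint solutions, and dl singles out the column of the wavenumber. *)
Variables (p d : nat) (A0 A1 : R -> 'M[C]_p).
Variables (zt e : R -> 'cV[C]_p) (Z0 Z1 S : R -> 'M[C]_(p, 1 + d)).
Variables (c : 'rV[C]_(1 + d)) (L : R -> 'M[C]_(d, p)) (Bm : 'M[C]_(d, 1 + d)).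

Local Notation dl := (row_mx 1%:M 0 : 'rV[C]_(1 + d)).
Local Notation ds := (row_mx 0 1%:M : 'M[C]_(d, 1 + d)).

Hypotheses (cA0 : mcont A0) (cA1 : mcont A1) (ce : mcont e) (cS : mcont S).
Hypotheses (pA0 : forall t, A0 (t + 1) = A0 t) (pA1 : forall t, A1 (t + 1) = A1 t).
Hypothesis pe : forall t, e (t + 1) = e t.
Hypothesis dzt : mder zt (fun t => A0 t *m zt t).
Hypothesis A1zt : forall t, A1 t *m zt t = e t.
Hypothesis dZ0 : mder Z0 (fun t => A0 t *m Z0 t - zt t *m dl - e t *m c).
Hypothesis dZ1 : mder Z1 (fun t => A0 t *m Z1 t - Z0 t + S t).
Hypothesis dL : mder L (fun t => - (L t *m A0 t)).
Hypotheses (pzt : zt 1 = zt 0) (pZ0 : Z0 1 = Z0 0) (pZ1 : Z1 1 = Z1 0) (pL : L 1 = L 0).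
Hypothesis ILe : mint (fun t => L t *m e t) = 0.
Hypothesis ILA : mint (fun t => L t *m (A1 t *m Z0 t)) = ds.
Hypothesis ILS : mint (fun t => L t *m S t) = Bm.
Hypothesis e_neq0 : exists t, e t != 0.
(** The form in which the dimension of the generalized kernel is used. *)
Hypothesis spanning : forall (z : R -> 'cV[C]_p) (x : C),
  (forall t, z (t + 1) = z t) -> mder z (fun t => A0 t *m z t + x *: e t) ->
  exists (u : 'cV[C]_1) (y : 'cV[C]_d), forall t,
    z t = zt t *m u + Z0 t *m col_mx 0 y.
(** For such nu and s the eigenvalue i k nu s is off the imaginary axis. *)
Hypothesis stable : forall (nu : R) (s : C) (z : R -> 'cV[C]_p), 0 < nu -> Im s != 0 ->
  (forall t, z (t + 1) = z t) ->
  mder z (fun t => (A0 t + (nu%:C * 'i) *: (s *: A1 t - 1%:M)) *m z t) ->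
  forall t, z t = 0.

(** Psi0 z is constant along solutions of z' = A0 z, so K0 z(0) = 0 says that such a solution is
    1-periodic; r accounts for a source e. *)
Let Psi0 := fund (fun t => - A0 t).
Let K0 := Psi0 1 - 1%:M.
Let r := mint (fun t => Psi0 t *m e t).

Lemma bounds_A : exists a0 a1 : R, (forall t, nm (A0 t) <= a0) /\ (forall t, nm (A1 t) <= a1).
Proof.
have [a0 _ h0] := mcont_periodic_bounded cA0 pA0.
by have [a1 _ h1] := mcont_periodic_bounded cA1 pA1; exists a0, a1.
Qed.

Lemma Z0_cont : mcont Z0. Proof. exact: mder_cont dZ0. Qed.
Lemma Z1_cont : mcont Z1. Proof. exact: mder_cont dZ1. Qed.
Lemma L_cont : mcont L. Proof. exact: mder_cont dL. Qed.

Lemma Psi0_der : mder Psi0 (fun t => - (Psi0 t *m A0 t)) /\ Psi0 0 = 1%:M.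
Proof.
have [a0 [_ [h0 _]]] := bounds_A.
have h0N t : nm (- A0 t) <= a0 by rewrite nmN.
have [d1 d2] := fund_der (mcontN cA0) h0N; split => //.
by apply: mder_ext d1 _ _ => // t; rewrite mulmxN.
Qed.

Lemma LPsi0 t : L 0 *m Psi0 t = L t.
Proof.
have [a0 [_ [h0 _]]] := bounds_A; have [d1 d2] := Psi0_der.
apply: (@row_ode_uniq _ _ _ _ cA0 h0 _ (fun t => L 0 *m Psi0 t) L _ dL); last by rewrite d2 mulmx1.
by apply: mder_ext (mderMl (L 0) d1) _ _ => // s; rewrite mulmxN mulmxA.
Qed.

Lemma L0K0 : L 0 *m K0 = 0.
Proof. by rewrite /K0 mulmxBr LPsi0 mulmx1 pL subrr. Qed.

Lemma L0r : L 0 *m r = 0.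
Proof.
rewrite -ILe /r -mintMl.
  by congr mint; apply/funext => t; rewrite mulmxA LPsi0.
by apply: mcontM => //; exact: mder_cont Psi0_der.1.
Qed.

(** The pairing kills the translation mode by [ILe] and reads off the remaining coordinates by
    [ILA]. *)
Lemma pairing_y (z : R -> 'cV[C]_p) u (y : 'cV[C]_d) :
  (forall t, z t = zt t *m u + Z0 t *m col_mx 0 y) ->
  mint (fun t => L t *m (A1 t *m z t)) = y.
Proof.
move=> hz.
have c1 : mcont (fun t => L t *m e t *m u).
  by apply: mcontM; [apply: mcontM => //; exact: L_cont|exact: mcont_cst].
have c2 : mcont (fun t => L t *m (A1 t *m Z0 t)).
  by apply: mcontM; [exact: L_cont|apply: mcontM => //; exact: Z0_cont].
have -> : (fun t => L t *m (A1 t *m z t)) =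
    (fun t => L t *m e t *m u + L t *m (A1 t *m Z0 t) *m col_mx 0 y).
  by apply/funext => t; rewrite hz -A1zt !mulmxDr !mulmxA.
rewrite mintD // ?mintMr ?ILe ?ILA //.
- by rewrite mul0mx add0r mul_row_col mul0mx add0r mul1mx.
- by apply: mcontM => //; exact: L_cont.
- by apply: mcontM => //; exact: mcont_cst.
Qed.

Lemma comb_der (z : R -> 'cV[C]_p) u (y : 'cV[C]_d) :
  (forall t, z t = zt t *m u + Z0 t *m col_mx 0 y) ->
  mder z (fun t => A0 t *m z t - e t *m (c *m col_mx 0 y)).
Proof.
move=> hz; apply: mder_ext (mderD (mderMr u dzt) (mderMr (col_mx 0 y) dZ0)) _ _ => t //.
rewrite hz !mulmxBl -[zt t *m dl *m _]mulmxA mul_row_col mulmx0 mul0mx addr0 mulmx0 subr0.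
by rewrite mulmxDr !mulmxA addrA.
Qed.

(** A solution that vanishes at 0 vanishes identically; the pairing then gives y = 0, and a time at
    which e is nonzero gives u = 0. *)
Lemma comb_inj (z : R -> 'cV[C]_p) u (y : 'cV[C]_d) :
  (forall t, z t = zt t *m u + Z0 t *m col_mx 0 y) -> c *m col_mx 0 y = 0 ->
  z 0 = 0 -> u = 0 /\ y = 0.
Proof.
move=> hz cy z00; have [a0 [_ [h0 _]]] := bounds_A.
have dz : mder z (fun t => A0 t *m z t).
  by apply: mder_ext (comb_der hz) _ _ => // t; rewrite cy mulmx0 subr0.
have zz : z =1 (fun=> 0).
  apply: (ode_uniq0 cA0 h0 dz) => //.
  by apply: mder_ext (mder_cst 0) _ _ => // t; rewrite mulmx0.
have y0 : y = 0.
  rewrite -(pairing_y hz).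
  have -> : (fun t => L t *m (A1 t *m z t)) = (fun=> 0).
    by apply/funext => t; rewrite zz !mulmx0.
  by rewrite (mint_der (mder_cst 0)) ?subrr //; exact: mcont_cst.
split=> //; have [t0 et0] := e_neq0.
have ztu : zt t0 *m u = 0 by have := hz t0; rewrite zz y0 col_mx0 mulmx0 addr0.
apply/eqP; apply/negPn/negP => u0; move/negP: et0; apply.
have ue : e t0 *m u = 0 by rewrite -A1zt -mulmxA ztu mulmx0.
rewrite [u]mx11_scalar mul_mx_scalar in ue.
move/eqP: ue; rewrite scaler_eq0 => /orP[/eqP h|//].
by move: u0; rewrite [u]mx11_scalar h raddf0 eqxx.
Qed.

Let D0 : 'M[C]_(1 + d) := block_mx 0 0 0 1%:M.
(** Limit, as eps tends to 0, of the order 0 coefficient stacked on the initial values of the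
    approximate solutions, once the first column is multiplied by eps. *)
Let Qh : 'M[C]_(1 + p, 1 + d) := col_mx (c *m D0) (zt 0 *m dl + Z0 0 *m D0).

Lemma D0_mul (x : 'cV[C]_(1 + d)) : D0 *m x = col_mx 0 (dsubmx x).
Proof.
by rewrite -{1}[x]vsubmxK mul_block_col !mul0mx mul1mx !add0r.
Qed.

Lemma dl_mul (x : 'cV[C]_(1 + d)) : dl *m x = usubmx x.
Proof. by rewrite -{1}[x]vsubmxK mul_row_col mul1mx mul0mx addr0. Qed.

Lemma Qh_inj : inj_mx Qh.
Proof.
move=> x; rewrite mul_col_mx mulmxDl -!mulmxA D0_mul dl_mul -[X in _ = X]col_mx0.
move=> /eq_col_mx[cx zx].
have [|u0 y0] := @comb_inj (fun t => zt t *m usubmx x + Z0 t *m col_mx 0 (dsubmx x))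
  (usubmx x) (dsubmx x) _ cx zx => //.
by rewrite -[x]vsubmxK u0 y0 col_mx0.
Qed.

(** A vector y in the kernel gives a periodic solution of z' = A0 z - e a, with (a, z(0)) = G y. By
    [spanning], G y is then in the range of Qh, which meets that of G only in 0. *)
Lemma bordered_inj q (G : 'M[C]_(1 + p, q)) : inj_mx (row_mx Qh G) ->
  inj_mx (K0 *m dsubmx G + r *m usubmx G).
Proof.
move=> hG y; rewrite mulmxDl => hy.
have [a0 [_ [h0 _]]] := bounds_A.
have [a ha] : exists a : C, a%:M = usubmx G *m y by exists ((usubmx G *m y) 0 0); rewrite -mx11_scalar.
have cg : mcont (fun t => - (e t *m (usubmx G *m y))).
  by apply: mcontN; apply: mcontM => //; exact: mcont_cst.
have [z [z0 dz z1]] := ode_solve cA0 h0 (dsubmx G *m y) cg.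
have cPe : mcont (fun t => Psi0 t *m e t).
  by apply: mcontM => //; exact: mder_cont Psi0_der.1.
have Iz : mint (fun t => Psi0 t *m - (e t *m (usubmx G *m y))) = - (r *m (usubmx G *m y)).
  have -> : (fun t => Psi0 t *m - (e t *m (usubmx G *m y))) =
      (fun t => (Psi0 t *m e t) *m (- (usubmx G *m y))).
    by apply/funext => t; rewrite !mulmxN !mulmxA.
  by rewrite mintMr // mulmxN.
have z10 : z 1 = z 0.
  have [Phi [_ _ PsiPhi PhiPsi]] := fund_inv cA0 h0.
  rewrite -[LHS]mul1mx -(PhiPsi 1) -mulmxA z1 -/Psi0 Iz.
  have -> : dsubmx G *m y - r *m (usubmx G *m y) = Psi0 1 *m (dsubmx G *m y).
    move: hy; rewrite -!mulmxA /K0 mulmxBl mul1mx => /eqP.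
    by rewrite addrAC subr_eq0 => h; apply/eqP; rewrite subr_eq eq_sym.
  by rewrite mulmxA PhiPsi mul1mx z0.
have pz : forall t, z (t + 1) = z t.
  apply: (ode_periodic cA0 h0 pA0 _ dz z10) => t.
  by rewrite pe.
have [|u [y' hz]] := @spanning z (- a) pz.
  apply: mder_ext dz _ _ => // t; congr (_ + _).
  by rewrite -ha mul_mx_scalar scaleNr.
(* z satisfies two equations with the same homogeneous part; their sources are compared at a time
   where e is nonzero. *)
have hc : usubmx G *m y = c *m col_mx 0 y'.
  have dz' := comb_der hz.
  have [t0 et0] := e_neq0.
  have := mder_uniq dz dz' t0 => /addrI /oppr_inj.
  rewrite [usubmx G *m y]mx11_scalar [c *m _ in RHS]mx11_scalar !mul_mx_scalar.
  move/eqP; rewrite -subr_eq0 -scalerBl scaler_eq0 (negbTE et0) orbF subr_eq0 => /eqP ->.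
  by rewrite -!mx11_scalar.
have := hG (col_mx (col_mx u y') (- y)).
rewrite mul_row_col mulmxN mul_col_mx -!mulmxA.
have -> : (zt 0 *m dl + Z0 0 *m D0) *m col_mx u y' = dsubmx G *m y.
  by rewrite mulmxDl -!mulmxA D0_mul dl_mul col_mxKu col_mxKd -z0 hz.
rewrite D0_mul col_mxKd -hc -{3}[G]vsubmxK mul_col_mx subrr => /(_ erefl) /eqP.
by rewrite col_mx_eq0 => /andP[_]; rewrite oppr_eq0 => /eqP.
Qed.

(** A right inverse comes from [ILA], after writing L t as L 0 times Psi0 t. *)
Lemma L0_free : row_free (L 0).
Proof.
apply/row_freeP; exists (mint (fun t => Psi0 t *m (A1 t *m Z0 t)) *m col_mx 0 1%:M).
rewrite mulmxA -mintMl.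
  have -> : (fun t => L 0 *m (Psi0 t *m (A1 t *m Z0 t))) = (fun t => L t *m (A1 t *m Z0 t)).
    by apply/funext => t; rewrite mulmxA LPsi0.
  by rewrite ILA mul_row_col mul0mx add0r mul1mx.
by apply: mcontM; [exact: mder_cont Psi0_der.1|apply: mcontM => //; exact: Z0_cont].
Qed.

(** * Dependence of the solution operator on the Floquet exponent *)

Section Perturbation.
Variable M : R.

Let A h s t := A0 t + ieps h *: (s *: A1 t - 1%:M).
Let Psi h s := fund (fun t => - A h s t).
(** The divided difference in eps, whose boundedness gives every error estimate below. *)
Let Dl h s t := (ieps h)^-1 *: (Psi h s t - Psi0 t).

Lemma A_cont h s : mcont (A h s).
Proof.
apply: mcontD => //; apply: mcontZ; apply: mcontB; last exact: mcont_cst.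
exact: mcontZ.
Qed.

Lemma A_bound : exists2 aa, 0 <= aa & forall h s, pdom M h s -> forall t, nm (A h s t) <= aa.
Proof.
have [a0 [a1 [h0 h1]]] := bounds_A.
exists (`|a0| + (`|M| * `|a1| + nm (1%:M : 'M[C]_p))).
  by rewrite !addr_ge0 ?nm_ge0 // mulr_ge0.
move=> h s [hp hle sM] t; apply: (le_trans (nmD _ _)); apply: lerD.
  by rewrite (le_trans (h0 t)) // ler_norm.
rewrite nmZ -[leRHS]mul1r; apply: ler_pM; rewrite ?nm_ge0 ?normc_ge0 ?normc_ieps //.
apply: (le_trans (nmB _ _)); rewrite lerD2r nmZ.
apply: ler_pM; rewrite ?nm_ge0 ?normc_ge0 //.
  by rewrite (le_trans sM) // ler_norm.
by rewrite (le_trans (h1 t)) // ler_norm.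
Qed.

Lemma Psi_der h s : pdom M h s ->
  mder (Psi h s) (fun t => - (Psi h s t *m A h s t)) /\ Psi h s 0 = 1%:M.
Proof.
move=> hs; have [aa _ haa] := A_bound.
have hN t : nm (- A h s t) <= aa by rewrite nmN haa.
have [d1 d2] := fund_der (mcontN (A_cont h s)) hN; split => //.
by apply: mder_ext d1 _ _ => // t; rewrite mulmxN.
Qed.

Lemma Psi_cont h s : pdom M h s -> mcont (Psi h s).
Proof. by move=> hs; exact: mder_cont (Psi_der hs).1. Qed.

Lemma Psi_bound : exists2 K, 0 <= K & forall h s, pdom M h s -> forall t, `|t| <= 1 ->
  nm (Psi h s t) <= K.
Proof.
have [aa aa0 haa] := A_bound; exists `|fbound p aa| => // h s hs t t1.
have hN u : nm (- A h s u) <= aa by rewrite nmN haa.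
by rewrite (le_trans (fund_bound (mcontN (A_cont h s)) hN t1)) // ler_norm.
Qed.

Lemma PsiE h s t : 0 < h -> Psi h s t = Psi0 t + ieps h *: Dl h s t.
Proof. by move=> h0; rewrite /Dl scalerA mulfV ?ieps_neq0 // scale1r addrC subrK. Qed.

Lemma Dl_cont h s : pdom M h s -> mcont (Dl h s).
Proof.
move=> hs; apply: mcontZ; apply: mcontB; first exact: Psi_cont.
exact: mder_cont Psi0_der.1.
Qed.

(** Psi is compared with Psi0 through Phi, the inverse of Psi0: the terms in A0 cancel in the
    derivative of Psi Phi / eps, which no longer contains 1 / eps. *)
Lemma Dl_bound : exists2 K, 0 <= K & forall h s, pdom M h s -> forall t, `|t| <= 1 ->
  nm (Dl h s t) <= K.
Proof.
have [a0 [a1 [h0 h1]]] := bounds_A.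
have [B B0 hB] := Psi_bound.
have [Phi [dPhi Phi0 PsiPhi PhiPsi]] := fund_inv cA0 h0.
have [P P0 hP] := mcont_bounded1 (mder_cont dPhi).
have [Q Q0 hQ] := mcont_bounded1 (mder_cont Psi0_der.1).
pose K1 := B * (`|M| * `|a1| + nm (1%:M : 'M[C]_p)) * P.
exists ((p * p)%:R * (2 * K1) * Q).
  by rewrite !mulr_ge0 // addr_ge0 ?nm_ge0 // mulr_ge0.
move=> h s hs t t1; have [hp hle sM] := hs.
have [dPsi Psi00] := Psi_der hs.
have dG : mder (fun t => (ieps h)^-1 *: (Psi h s t *m Phi t))
    (fun t => - (Psi h s t *m (s *: A1 t - 1%:M) *m Phi t)).
  apply: mder_ext (mderZ _ (mderM dPsi dPhi)) _ _ => // u.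
  rewrite mulmxA -mulmxDl /A mulmxDr opprD addrAC addNr add0r -scalemxAr -scaleNr.
  by rewrite -scalemxAl scalerA mulrN mulVf ?ieps_neq0 // scaleN1r.
have bG u : `|u| <= 1 -> nm (- (Psi h s u *m (s *: A1 u - 1%:M) *m Phi u)) <= K1.
  move=> u1; rewrite nmN; apply: (le_trans (nmM _ _)); apply: ler_pM; rewrite ?nm_ge0 ?hP //.
  apply: (le_trans (nmM _ _)); apply: ler_pM; rewrite ?nm_ge0 ?hB //.
  apply: (le_trans (nmB _ _)); rewrite lerD2r nmZ.
  apply: ler_pM; rewrite ?nm_ge0 ?normc_ge0 ?(le_trans sM) ?ler_norm //.
  by rewrite (le_trans (h1 u)) // ler_norm.
have := mder_bound1 dG t1 bG; rewrite Psi00 Phi0 mulmx1 => hG.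
have -> : Dl h s t = ((ieps h)^-1 *: (Psi h s t *m Phi t) - (ieps h)^-1 *: 1%:M) *m Psi0 t.
  by rewrite -scalerBr -scalemxAl mulmxBl mul1mx -mulmxA PhiPsi mulmx1.
by apply: (le_trans (nmM _ _)); apply: ler_pM; rewrite ?nm_ge0 ?hQ.
Qed.

Lemma Ob_mint m n (F : R -> C -> R -> 'M[C]_(m, n)) :
  (forall h s, pdom M h s -> mcont (F h s)) ->
  (exists2 K, 0 <= K & forall h s, pdom M h s -> forall t, `|t| <= 1 -> nm (F h s t) <= K) ->
  Ob M (fun h s => mint (F h s)).
Proof.
move=> cF [k k0 hk]; exists ((m * n)%:R * (2 * k)) => h s hs.
by apply: mint_bound; [exact: cF|exact: hk].
Qed.

Lemma bound_affine m n q (F : R -> C -> R -> 'M[C]_(m, n)) (X Y : R -> 'M[C]_(n, q)) :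
  mcont X -> mcont Y ->
  (exists2 K, 0 <= K & forall h s, pdom M h s -> forall t, `|t| <= 1 -> nm (F h s t) <= K) ->
  exists2 K, 0 <= K & forall h s, pdom M h s -> forall t, `|t| <= 1 ->
    nm (F h s t *m (X t - s *: Y t)) <= K.
Proof.
move=> cX cY [k k0 hk].
have [x x0 hx] := mcont_bounded1 cX; have [y y0 hy] := mcont_bounded1 cY.
exists (k * (x + `|M| * y)); first by rewrite mulr_ge0 // addr_ge0 // mulr_ge0.
move=> h s hs t t1; have [_ _ sM] := hs.
apply: (le_trans (nmM _ _)); apply: ler_pM; rewrite ?nm_ge0 ?hk //.
apply: (le_trans (nmB _ _)); rewrite nmZ; apply: lerD; first exact: hx.
by apply: ler_pM; rewrite ?nm_ge0 ?normc_ge0 ?hy // (le_trans sM) // ler_norm.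
Qed.

Lemma A1Z0_cont : mcont (fun t => A1 t *m Z0 t).
Proof. by apply: mcontM => //; exact: Z0_cont. Qed.
Lemma A1Z1_cont : mcont (fun t => A1 t *m Z1 t).
Proof. by apply: mcontM => //; exact: Z1_cont. Qed.

Lemma affine_cont m n (X Y : R -> 'M[C]_(m, n)) (s : C) :
  mcont X -> mcont Y -> mcont (fun t => X t - s *: Y t).
Proof. by move=> cX cY; apply: mcontB => //; exact: mcontZ. Qed.

(** The zero term gives the integrand the affine form covered by [bound_affine]. *)
Let om h s := mint (fun t => Dl h s t *m (e t - s *: (0 : 'cV[C]_p))).
Let D1 h s := Dl h s 1.
(** J1, J2 and J3 integrate Psi against the orders 0, 1 and 2 of the residue, the first up to the
    factor - b; J2' is the correction to J2 caused by Psi - Psi0. *)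
Let J1 h s := mint (fun t => Psi h s t *m e t).
Let J2 h s := mint (fun t => Psi h s t *m (S t - s *: (A1 t *m Z0 t))).
Let J2' h s := mint (fun t => Dl h s t *m (S t - s *: (A1 t *m Z0 t))).
Let J3 h s := mint (fun t => Psi h s t *m (Z1 t - s *: (A1 t *m Z1 t))).
Let K h s := Psi h s 1 - 1%:M.
Let b (s : C) := c + s *: dl.
Let Zv h := (ieps h)^-1 *: (zt 0 *m dl) + Z0 0 + ieps h *: Z1 0.

Lemma om_Ob : Ob M om.
Proof.
apply: Ob_mint => [h s hs|].
  by apply: mcontM; [exact: Dl_cont|apply: affine_cont => //; exact: mcont_cst].
by apply: bound_affine Dl_bound => //; exact: mcont_cst.
Qed.

Lemma D1_Ob : Ob M D1.
Proof.
by have [k _ hk] := Dl_bound; exists k => h s hs; apply: hk => //; rewrite normr1.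
Qed.

Lemma J2_Ob : Ob M J2.
Proof.
apply: Ob_mint => [h s hs|].
  by apply: mcontM; [exact: Psi_cont|apply: affine_cont => //; exact: A1Z0_cont].
by apply: bound_affine Psi_bound => //; exact: A1Z0_cont.
Qed.

Lemma J2'_Ob : Ob M J2'.
Proof.
apply: Ob_mint => [h s hs|].
  by apply: mcontM; [exact: Dl_cont|apply: affine_cont => //; exact: A1Z0_cont].
by apply: bound_affine Dl_bound => //; exact: A1Z0_cont.
Qed.

Lemma J3_Ob : Ob M J3.
Proof.
apply: Ob_mint => [h s hs|].
  by apply: mcontM; [exact: Psi_cont|apply: affine_cont; [exact: Z1_cont|exact: A1Z1_cont]].
by apply: bound_affine Psi_bound; [exact: Z1_cont|exact: A1Z1_cont].
Qed.

Lemma Psi0_cont : mcont Psi0. Proof. exact: mder_cont Psi0_der.1. Qed.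

Lemma mint_split h s m (g : R -> 'M[C]_(p, m)) : pdom M h s -> mcont g ->
  mint (fun t => Psi h s t *m g t) =
  mint (fun t => Psi0 t *m g t) + ieps h *: mint (fun t => Dl h s t *m g t).
Proof.
move=> hs cg; have [h0 _ _] := hs.
have c1 : mcont (fun t => Psi0 t *m g t) by apply: mcontM => //; exact: Psi0_cont.
have c2 : mcont (fun t => Dl h s t *m g t) by apply: mcontM => //; exact: Dl_cont.
rewrite -mintZ // -mintD //; last exact: mcontZ.
by congr mint; apply/funext => t; rewrite PsiE // mulmxDl scalemxAl.
Qed.

Lemma J1E h s : pdom M h s -> J1 h s = r + ieps h *: om h s.
Proof.
move=> hs; rewrite /J1 (mint_split hs ce) /om.
have -> : (fun t => Dl h s t *m (e t - s *: (0 : 'cV[C]_p))) = (fun t => Dl h s t *m e t).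
  by apply/funext => t; rewrite scaler0 subr0.
by [].
Qed.

Lemma KE h s : pdom M h s -> K h s = K0 + ieps h *: D1 h s.
Proof. by move=> [h0 _ _]; rewrite /K PsiE // /K0 addrAC. Qed.

(** L 0 Psi0 = L turns the leading part into the pairings [ILS] and [ILA]: this is where the
    modulated system appears. *)
Lemma L0J2 h s : pdom M h s -> L 0 *m J2 h s = Bm - s *: ds + ieps h *: (L 0 *m J2' h s).
Proof.
move=> hs; have cg := affine_cont s cS A1Z0_cont.
rewrite /J2 mint_split // mulmxDr -scalemxAr; congr (_ + _).
have c1 : mcont (fun t => Psi0 t *m (S t - s *: (A1 t *m Z0 t))).
  by apply: mcontM => //; exact: Psi0_cont.
rewrite -mintMl //.
have cLS : mcont (fun t => L t *m S t) by apply: mcontM => //; exact: L_cont.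
have cLA : mcont (fun t => L t *m (A1 t *m Z0 t)).
  by apply: mcontM; [exact: L_cont|exact: A1Z0_cont].
rewrite -ILS -ILA -scaleNr -mintZ // -mintD //; last exact: mcontZ.
congr mint; apply/funext => t.
by rewrite mulmxA LPsi0 mulmxBr -scalemxAr scaleNr.
Qed.

Lemma mint3 m n q (F : R -> 'M[C]_(m, n)) (B : 'M[C]_(n, q)) (G H : R -> 'M[C]_(m, q)) x y :
  mcont F -> mcont G -> mcont H ->
  mint (fun t => - (F t *m B) + x *: G t + y *: H t) =
  - (mint F *m B) + x *: mint G + y *: mint H.
Proof.
move=> cF cG cH; have [F0 dF] := mprimP cF.
have [G0 dG] := mprimP cG; have [H0 dH] := mprimP cH.
have cB : mcont (fun t => F t *m B) by apply: mcontM => //; exact: mcont_cst.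
rewrite (mint_der (mderD (mderD (mderN (mderMr B dF)) (mderZ x dG)) (mderZ y dH))).
  by rewrite F0 G0 H0 mul0mx !scaler0 oppr0 !addr0 subr0.
by apply: mcontD; [apply: mcontD; [exact: mcontN|exact: mcontZ]|exact: mcontZ].
Qed.

(** The derivative of Psi Zf is Psi times the residue. Integrated over a period it gives K Zv, since
    zt, Z0 and Z1 return to their initial values; the order 0 part is moved to the left. *)
Lemma residual h s : pdom M h s ->
  J1 h s *m b s + K h s *m Zv h = ieps h *: J2 h s + ieps h ^+ 2 *: J3 h s.
Proof.
move=> hs; have [h0 _ _] := hs; have e0 := ieps_neq0 h0.
pose Zf t := (ieps h)^-1 *: (zt t *m dl) + Z0 t + ieps h *: Z1 t.
pose Zf' t := (ieps h)^-1 *: (A0 t *m zt t *m dl) + (A0 t *m Z0 t - zt t *m dl - e t *m c)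
     + ieps h *: (A0 t *m Z1 t - Z0 t + S t).
have dZ : mder Zf Zf'.
  by apply: mderD (mderZ _ dZ1); apply: mderD dZ0; apply: mderZ; apply: mderMr.
have [dPsi Psi00] := Psi_der hs.
pose res t := - (Psi h s t *m e t *m b s) + ieps h *: (Psi h s t *m (S t - s *: (A1 t *m Z0 t)))
    + ieps h ^+ 2 *: (Psi h s t *m (Z1 t - s *: (A1 t *m Z1 t))).
have dPZ : mder (fun t => Psi h s t *m Zf t) res.
  apply: mder_ext (mderM dPsi dZ) _ _ => // t.
  rewrite mulNmx -mulmxA addrC -mulmxBr.
  rewrite (@bordered_residual _ _ _ (A0 t) (A1 t) (zt t) (e t)) //.
  rewrite /res /b; move: (Psi h s t) (e t) (S t - _) (Z1 t - _) => P x u v.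
  by rewrite 2!mulmxDr mulmxN -!scalemxAr mulmxA.
have cPsi := Psi_cont hs.
have c1 : mcont (fun t => Psi h s t *m e t) by exact: mcontM.
have c1b : mcont (fun t => Psi h s t *m e t *m b s) by apply: mcontM => //; exact: mcont_cst.
have c2 : mcont (fun t => Psi h s t *m (S t - s *: (A1 t *m Z0 t))).
  by apply: mcontM => //; apply: affine_cont => //; exact: A1Z0_cont.
have c3 : mcont (fun t => Psi h s t *m (Z1 t - s *: (A1 t *m Z1 t))).
  by apply: mcontM => //; apply: affine_cont; [exact: Z1_cont|exact: A1Z1_cont].
have cres : mcont res.
  by apply: mcontD; [apply: mcontD; [exact: mcontN|exact: mcontZ]|exact: mcontZ].
have Ires : mint res = - (J1 h s *m b s) + ieps h *: J2 h s + ieps h ^+ 2 *: J3 h s.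
  exact: mint3.
have := mint_der dPZ cres; rewrite Ires Psi00 mul1mx.
have -> : Zf 1 = Zv h by rewrite /Zf /Zv pzt pZ0 pZ1.
have -> : Zf 0 = Zv h by [].
have -> : K h s *m Zv h = Psi h s 1 *m Zv h - Zv h by rewrite /K mulmxBl mul1mx.
by move: (J1 h s *m b s) (ieps h *: _) (_ *: J3 h s) => x y z <-; rewrite addrA addrA subrr add0r.
Qed.

(** * The bordered determinant *)

Section Determinant.
Variables (q : nat) (G : 'M[C]_(1 + p, q)) (gf : 'M[C]_(q, p)).
Hypotheses (hG : inj_mx (row_mx Qh G)) (pq : (1 + p = 1 + d + q)%N).
Let F1 := dsubmx G.
Let F2 := usubmx G.
Hypothesis hgf : gf *m (K0 *m F1 + r *m F2) = 1%:M.

(** X and Y are the images of (b, Zv) and (F2, F1) under (beta, zeta) -> J1 beta + K zeta. *)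
Let X h s := J1 h s *m b s + K h s *m Zv h.
Let Y h s := J1 h s *m F2 + K h s *m F1.

(** Matrix of the equations beta = 0 and J1 beta + K zeta = 0 for (beta, zeta) = (b, Zv) x + h (F2,
    F1) y. The second one is split by L 0 and gf, and its parts are divided by eps and by h. With
    eps of order h^2 the diagonal blocks converge and the others are O(h). *)
Definition bmx h s : 'M[C]_(1 + d + q) :=
  block_mx (col_mx (b s) ((ieps h)^-1 *: (L 0 *m X h s)))
           (col_mx (h%:C *: F2) ((h%:C * (ieps h)^-1) *: (L 0 *m Y h s)))
           (h%:C^-1 *: (gf *m X h s)) (gf *m Y h s).

Definition bmx0 s : 'M[C]_(1 + d + q) :=
  block_mx (col_mx (b s) (Bm - s *: ds)) 0 0 1%:M.

(** L 0 kills the range of K0 F1 + r F2, on which gf is a left inverse; with [L0_free] this produces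
    a right inverse, and the matrix is square because p = d + q. *)
Lemma L0gf_inj : inj_mx (col_mx (L 0) gf).
Proof.
apply: row_free_square_inj; first by move: pq => /eqP; rewrite -addnA eqn_add2l => /eqP.
have /row_freeP[B1 hB1] := L0_free.
pose B2 := K0 *m F1 + r *m F2.
have LB2 : L 0 *m B2 = 0 by rewrite mulmxDr !mulmxA L0K0 L0r !mul0mx addr0.
apply/row_freeP; exists (row_mx (B1 - B2 *m (gf *m B1)) B2).
rewrite mul_col_row !mulmxBr hB1 LB2 !mulmxA LB2 !mul0mx subr0 hgf mul1mx subrr.
by rewrite -scalar_mx_block.
Qed.

Lemma hC_neq0 (h : R) : 0 < h -> h%:C != 0.
Proof. by move=> h0; rewrite eq_complex /= gt_eqF. Qed.

Lemma b_Ob : Ob M (fun _ => b).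
Proof. by apply: ObD; [exact: Ob_cst|apply: ObZ; [exact: Os_s|exact: Ob_cst]]. Qed.

Lemma Os_hi : Os M (fun h _ => h%:C * 'i).
Proof. by apply: OsM; [exact: Os_h|exact: Os_cst]. Qed.

Lemma Os_eps : Os M (fun h _ => ieps h).
Proof. by exists 1 => h s [h0 h1 _]; exact: normc_ieps. Qed.

Lemma bmx_lim : exists k : R, forall h s, pdom M h s ->
  normc (\det (bmx h s) - \det (bmx0 s)) <= k * h.
Proof.
(* The exact coefficient of h in bmx - bmx0, read off from eps = h (h i). *)
pose N h s : 'M[C]_(1 + d + q) := block_mx
  (col_mx 0 ((h%:C * 'i) *: (L 0 *m J2' h s + L 0 *m J3 h s)))
  (col_mx F2 (L 0 *m (om h s *m F2) + L 0 *m (D1 h s *m F1)))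
  ('i *: (gf *m J2 h s + ieps h *: (gf *m J3 h s)))
  ((h%:C * 'i) *: (gf *m (om h s *m F2 + D1 h s *m F1))).
apply: (@det_near _ M _ bmx N bmx0).
- apply: Ob_block; try exact: Ob_cst.
  apply: Ob_col; first exact: b_Ob.
  apply: (@ObD _ _ _ _ (fun _ _ => Bm) (fun _ s => - (s *: ds))); first exact: Ob_cst.
  have [k hk] := @ObZ _ M _ _ _ (fun _ _ => ds) (@Os_s _ M) (Ob_cst _ _).
  by exists k => h s hs; rewrite nmN; exact: (hk h s hs).
- have cst := Ob_cst M.
  have J2o := J2_Ob; have J2'o := J2'_Ob; have J3o := J3_Ob.
  have omo := om_Ob; have D1o := D1_Ob.
  apply: Ob_block.
  + apply: Ob_col; first exact: cst.
    by apply: ObZ; [exact: Os_hi|apply: ObD; apply: ObM => //; exact: cst].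
  + apply: Ob_col; first exact: cst.
    by apply: ObD; apply: ObM; try exact: cst; apply: ObM => //; exact: cst.
  + apply: ObZ; first exact: Os_cst.
    apply: ObD; first by apply: ObM => //; exact: cst.
    by apply: ObZ; [exact: Os_eps|apply: ObM => //; exact: cst].
  + apply: ObZ; first exact: Os_hi.
    by apply: ObM; [exact: cst|apply: ObD; apply: ObM => //; exact: cst].
move=> h s hs; have [h0 _ _] := hs.
have e0 := ieps_neq0 h0; have hc0 := hC_neq0 h0.
have eE : ieps h = h%:C * (h%:C * 'i) by rewrite /ieps expr2 mulrA.
rewrite /bmx /bmx0 /N scale_block_mx add_block_mx !scale_col_mx !add_col_mx.
have XE : X h s = ieps h *: (J2 h s + ieps h *: J3 h s).
  by rewrite /X (residual hs) scalerDr scalerA expr2.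
have YE : Y h s = K0 *m F1 + r *m F2 + ieps h *: (om h s *m F2 + D1 h s *m F1).
  rewrite /Y J1E // KE // !mulmxDl -!scalemxAl scalerDr.
  by rewrite addrACA [r *m _ + _]addrC.
have LJ := L0J2 hs; have LK := L0K0; have Lr := L0r; have gK := hgf.
move: (X h s) (Y h s) (J2 h s) (J2' h s) (J3 h s) (om h s) (D1 h s) XE YE LJ.
move: K0 r F1 F2 (L 0) (ieps h) (h%:C) (b s) LK Lr gK e0 hc0 eE => k0 r0 f1 f2 l ep hc bb.
move=> LK Lr gK e0 hc0 eE x y j2 j2' j3 o dd1 -> -> LJ.
congr block_mx.
- congr col_mx; first by rewrite scaler0 addr0.
  rewrite -scalemxAr scalerA mulVf // scale1r mulmxDr LJ -scalemxAr scalerA -eE.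
  by rewrite scalerDr addrA.
- rewrite add0r; congr col_mx.
  rewrite !mulmxDr -scalemxAr !mulmxA LK Lr !mul0mx !add0r scalerA divfK //.
  by rewrite !mulmxDr !mulmxA.
- rewrite -scalemxAr scalerA add0r [in X in X *: _]eE mulKf // -scalerA; congr (_ *: (_ *: _)).
  by rewrite mulmxDr -scalemxAr.
- by rewrite mulmxDr gK -scalemxAr scalerA -eE.
Qed.

(** The rows of the first block are those of s - (- c, Bm), the last d of them with the opposite
    sign; hence the moduli. *)
Lemma bmx0_det s :
  normc (\det (bmx0 s)) = normc ((char_poly (col_mx (- c) Bm : 'M[C]_(1 + d))).[s]).
Proof.
rewrite /bmx0 det_ublock det1 mulr1 /char_poly -horner_evalE -det_map_mx.
have -> : map_mx (horner_eval s) (char_poly_mx (col_mx (- c) Bm)) =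
    s%:M - (col_mx (- c) Bm : 'M[C]_(1 + d)).
  apply/matrixP => i j; rewrite !mxE /horner_eval hornerD hornerN hornerC.
  by case: (i == j); rewrite ?mulr1n ?mulr0n ?hornerX ?horner0.
have sE : s%:M = col_mx (s *: dl) (s *: ds) :> 'M[C]_(1 + d).
  by rewrite -!scale_col_mx -[RHS]/(s *: block_mx _ _ _ _) -scalar_mx_block scale_scalar_mx mulr1.
have -> : col_mx (b s) (Bm - s *: ds) = block_mx 1%:M 0 0 (- 1%:M) *m (s%:M - (col_mx (- c) Bm : 'M[C]_(1 + d))).
  rewrite sE opp_col_mx add_col_mx opprK mul_block_col !mul0mx addr0 add0r mul1mx.
  by congr col_mx; [rewrite addrC|rewrite mulNmx mul1mx opprB].
rewrite det_mulmx det_ublock det1 mul1r -scaleN1r detZ det1 mulr1 normcM normcX.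
by rewrite (@normcN R 1) normc1 expr1n mul1r.
Qed.

(** The columns are singular in eps, so they are first multiplied by D h, whose inverse is Di h. The
    result tends to (Qh, G), which has a left inverse N; the determinant of N RH is then close to
    1. *)
Lemma columns_inj : exists2 h1 : R, 0 < h1 & forall h s, pdom M h s -> h < h1 ->
  forall (x : 'cV[C]_(1 + d)) (y : 'cV[C]_q),
  b s *m x + h%:C *: (F2 *m y) = 0 -> Zv h *m x + h%:C *: (F1 *m y) = 0 -> x = 0 /\ y = 0.
Proof.
have [N hN] := inj_mx_linv hG.
pose D' : 'M[C]_(1 + d) := block_mx 1%:M 0 0 0.
pose D h := D0 + ieps h *: D'.
pose Di h : 'M[C]_(1 + d) := D0 + (ieps h)^-1 *: D'.
pose T h s := col_mx (c *m D' + s *: dl) (Z0 0 *m D' + Z1 0 *m D h).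
pose RH h s := row_mx (col_mx (b s *m D h) (Zv h *m D h)) G.
have dlD0 : dl *m D0 = 0 by rewrite /D0 mul_row_block !mulmx0 mul0mx !addr0 row_mx0.
have dlD' : dl *m D' = dl by rewrite /D' mul_row_block !mulmx0 !mul1mx !addr0.
have dlD h : dl *m D h = ieps h *: dl by rewrite mulmxDr dlD0 add0r -scalemxAr dlD'.
have DDi h : 0 < h -> D h *m Di h = 1%:M.
  move=> h0; rewrite mulmxDl !mulmxDr -!scalemxAl -!scalemxAr scalerA mulfV ?ieps_neq0 // scale1r.
  rewrite /D0 /D' !mulmx_block !mulmx0 !mul0mx !mulmx1 !addr0 !add0r block_mx0 !scaler0.
  by rewrite addr0 add0r add_block_mx !addr0 add0r -scalar_mx_block.
have RHE h s : 0 < h -> RH h s = row_mx Qh G + ieps h *: row_mx (T h s) 0.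
  move=> h0; rewrite /RH scale_row_mx add_row_mx scaler0 addr0; congr row_mx.
  rewrite /Qh /T scale_col_mx add_col_mx; congr col_mx.
    rewrite /b mulmxDl -scalemxAl dlD mulmxDr -scalemxAr scalerDr -addrA; congr (_ + (_ + _)).
    by rewrite !scalerA mulrC.
  exact: (rescale_columns (zt 0) (Z0 0) (Z1 0) (ieps_neq0 h0) (dlD h) (erefl (D h))).
have [|||k hk] := @det_near _ M _ (fun h s => N *m RH h s)
  (fun h s => (h%:C * 'i) *: (N *m row_mx (T h s) 0)) (fun=> 1%:M).
- exact: Ob_cst.
- apply: ObZ; first exact: Os_hi.
  apply: ObM; first exact: Ob_cst.
  have [k hk] : Ob M T.
    apply: Ob_col.
      by apply: ObD; [exact: Ob_cst|apply: ObZ; [exact: Os_s|exact: Ob_cst]].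
    apply: ObD; first exact: Ob_cst.
    apply: ObM; first exact: Ob_cst.
    by apply: ObD; [exact: Ob_cst|apply: ObZ; [exact: Os_eps|exact: Ob_cst]].
  by exists k => h s hs; rewrite nm_row nm0 addr0; exact: hk.
- move=> h s [h0 _ _]; rewrite RHE // mulmxDr hN -scalemxAr scalerA.
  by congr (_ + _ *: _); rewrite /ieps expr2 mulrA.
(* Below this bound |k| h < 1, so the determinant differs from 1 by less than 1. *)
exists (`|k| + 1)^-1; first by rewrite invr_gt0 ltr_wpDl.
move=> h s hs hh1 x y bx zx; have [h0 _ _] := hs.
have hinj : inj_mx (RH h s).
  have dN : \det (N *m RH h s) != 0.
    apply/eqP => d0; have := hk h s hs; rewrite d0 det1 sub0r (@normcN R 1) normc1.
    rewrite leNgt => /negP; apply.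
    apply: (@le_lt_trans _ _ (`|k| * h)); first by rewrite ler_wpM2r ?ler_norm // ltW.
    apply: (@le_lt_trans _ _ ((`|k| + 1) * h)); first by rewrite ler_wpM2r ?lerDl // ltW.
    by rewrite -ltr_pdivlMl ?mulr1 // ltr_wpDl.
  move=> v hv; apply: (det_neq0_inj dN); by rewrite -mulmxA hv mulmx0.
have := hinj (col_mx (Di h *m x) (h%:C *: y)).
rewrite mul_row_col mul_col_mx -!mulmxA (mulmxA (D h)) DDi // mul1mx -{1}[G]vsubmxK.
rewrite mul_col_mx -!scalemxAr add_col_mx bx zx col_mx0 => /(_ erefl) /eqP.
rewrite col_mx_eq0 => /andP[/eqP Dx hy]; split.
  by rewrite -[x]mul1mx -(DDi _ h0) -mulmxA Dx mulmx0.
by move: hy; rewrite scaler_eq0 (negbTE (hC_neq0 h0)) => /eqP.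
Qed.

(** A null vector gives zeta with K zeta = 0, the initial value of a 1-periodic solution. Stability
    makes zeta vanish, and [columns_inj] the null vector. *)
Lemma bmx_det_neq0 : exists2 h1 : R, 0 < h1 & forall h s, pdom M h s -> h < h1 ->
  Im s != 0 -> \det (bmx h s) != 0.
Proof.
have [h1 h10 hinj] := columns_inj; exists h1 => // h s hs hh1 is0.
apply/eqP => /det0_ker[v v0 hv]; move/negP: v0; apply.
have [h0 hle sM] := hs; have e0 := ieps_neq0 h0; have hc0 := hC_neq0 h0.
pose x := usubmx v; pose y := dsubmx v.
move: hv; rewrite -[v]vsubmxK -/x -/y mul_block_col !mul_col_mx add_col_mx.
move/eqP; rewrite !col_mx_eq0 => /andP[/andP[/eqP e1 /eqP e2] /eqP e3].
(* The second bordered equation before it is split and scaled. *)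
pose u := X h s *m x + h%:C *: (Y h s *m y).
have Lu : L 0 *m u = 0.
  apply: (can_inj (scalerK (invr_neq0 e0))); rewrite scaler0 -e2 /u.
  by rewrite mulmxDr scalerDr -!scalemxAl -!scalemxAr scalerA !mulmxA [_^-1 * _]mulrC.
have gu : gf *m u = 0.
  apply: (can_inj (scalerK (invr_neq0 hc0))); rewrite scaler0 -e3 /u.
  by rewrite mulmxDr scalerDr -!scalemxAl -!scalemxAr scalerA !mulmxA mulVf // scale1r.
have u0 : u = 0 by apply: L0gf_inj; rewrite mul_col_mx Lu gu col_mx0.
rewrite -scalemxAl in e1.
pose zeta := Zv h *m x + h%:C *: (F1 *m y).
have Kz : K h s *m zeta = 0.
  have uE : u = J1 h s *m (b s *m x + h%:C *: (F2 *m y)) + K h s *m zeta.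
    rewrite /u /X /Y /zeta; move: (J1 h s) (K h s) (b s) (Zv h) F1 F2 => j k bb zz f1 f2.
    by rewrite !mulmxDl !mulmxDr -!scalemxAr scalerDr !mulmxA addrACA.
  by move: uE; rewrite u0 e1 mulmx0 add0r.
suff z0 : zeta = 0.
  have [x0 y0] := hinj h s hs hh1 x y e1 z0.
  by rewrite x0 y0 !eqxx.
have [aa aa0 haa] := A_bound.
have [Phi [dPhi Phi0 PsiPhi PhiPsi]] := fund_inv (A_cont h s) (haa h s hs).
have pA t : A h s (t + 1) = A h s t by rewrite /A pA0 pA1.
pose z t := Phi t *m zeta.
have dz : mder z (fun t => A h s t *m z t).
  by apply: mder_ext (mderMr zeta dPhi) _ _ => // t; rewrite mulmxA.
have z10 : z 1 = z 0.
  rewrite /z Phi0 mul1mx.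
  have : Psi h s 1 *m zeta = zeta.
    by move/eqP: Kz; rewrite /K mulmxBl mul1mx subr_eq0 => /eqP.
  by move=> {1}<-; rewrite mulmxA PhiPsi mul1mx.
have pz t : z (t + 1) = z t.
  apply: (@ode_periodic _ _ _ _ (A_cont h s) (haa h s hs) _ z (fun=> 0)) => //.
  by apply: mder_ext dz _ _ => // w; rewrite addr0.
have hh0 : 0 < h * h by rewrite mulr_gt0.
have eE : ieps h = (h * h)%:C * 'i by rewrite /ieps expr2 rmorphM.
have dz' : mder z (fun t => (A0 t + ((h * h)%:C * 'i) *: (s *: A1 t - 1%:M)) *m z t).
  by rewrite -eE.
by have := stable hh0 is0 pz dz' 0; rewrite /z Phi0 mul1mx.
Qed.

(** At fixed h, s enters only through b, Psi and an integral of Psi, and the coefficients of the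
    system are affine in s. *)
Lemma bmx_polylim h s0 rad : 0 < h -> h <= 1 ->
  (forall s, normc (s - s0) <= rad -> normc s <= M) ->
  polylim s0 rad (fun s => \det (bmx h s)).
Proof.
move=> h0 h1 hrad; apply: mpolylim_det.
have PsiF s : Psi h s = fund (fun t => (- A0 t + ieps h *: 1%:M) + s *: (- (ieps h *: A1 t))).
  rewrite /Psi; congr fund; apply/funext => t; rewrite /A.
  move: (A0 t) (A1 t) (1%:M : 'M[C]_p) => x y o.
  by apply/matrixP => i j; rewrite !mxE; ring.
have c0 : mcont (fun t => - A0 t + ieps h *: 1%:M).
  by apply: mcontD; [exact: mcontN|exact: mcont_cst].
have c1 : mcont (fun t => - (ieps h *: A1 t)) by apply: mcontN; exact: mcontZ.
have [aa _ haa] := A_bound.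
have ba s : normc (s - s0) <= rad -> forall t,
    nm ((- A0 t + ieps h *: 1%:M) + s *: (- (ieps h *: A1 t))) <= aa.
  move=> ss t; have hs : pdom M h s by split => //; exact: hrad.
  apply: le_trans (haa h s hs t); rewrite -(nmN (A h s t)) le_eqVlt.
  apply/orP; left; apply/eqP; congr nm; rewrite /A.
  move: (A0 t) (A1 t) (1%:M : 'M[C]_p) => x y o.
  by apply/matrixP => i j; rewrite !mxE; ring.
have P1 : mpolylim s0 rad (fun s => Psi h s 1).
  apply: mpolylim_ext (fund_polylim c0 c1 ba _) => [s|]; first by rewrite PsiF.
  by rewrite normr1.
have PJ : mpolylim s0 rad (fun s => J1 h s).
  apply: mpolylim_ext (mint_fund_polylim c0 c1 ba ce) => s.
  by rewrite /J1 PsiF.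
have cst := @mpolylim_cst _ s0 rad.
have PK : mpolylim s0 rad (fun s => K h s) by apply: mpolylimD => //; exact: cst.
have Pb : mpolylim s0 rad b.
  apply: mpolylimD; first exact: cst.
  by apply: mpolylimZ; [exact: polylim_id|exact: cst].
have PX : mpolylim s0 rad (X h).
  by apply: mpolylimD; apply: mpolylimM => //; exact: cst.
have PY : mpolylim s0 rad (Y h).
  by apply: mpolylimD; apply: mpolylimM => //; exact: cst.
apply: mpolylim_col; apply: mpolylim_row.
- apply: mpolylim_col => //; apply: mpolylimZ; first exact: polylim_cst.
  by apply: mpolylimM => //; exact: cst.
- apply: mpolylim_col; first exact: cst.
  apply: mpolylimZ; first exact: polylim_cst.
  by apply: mpolylimM => //; exact: cst.
- by apply: mpolylimZ; [exact: polylim_cst|apply: mpolylimM => //; exact: cst].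
- by apply: mpolylimM => //; exact: cst.
Qed.

End Determinant.

End Perturbation.

(** The condition rho < |Im s0| / 2 keeps the disc of radius 2 * rho off the real axis. For small h,
    [hurwitz] would produce in it a zero of the bordered determinant, against [bmx_det_neq0]. *)
Lemma floquet_real (s0 : C) :
  eigenvalue (col_mx (- c) Bm : 'M[C]_(1 + d)) s0 -> Im s0 = 0.
Proof.
rewrite eigenvalue_root_char => rs0; apply/eqP; apply/negPn/negP => is0.
have [q [G [pq hG]]] := inj_mx_compl Qh_inj.
have [gf hgf] := inj_mx_linv (bordered_inj hG).
pose Bc := col_mx (- c) Bm : 'M[C]_(1 + d).
have [rs rsE] := closed_field_poly_normal (char_poly Bc).
have ia0 : 0 < `|Im s0| / 2 by rewrite divr_gt0 // normr_gt0.
have [rho /andP[rho0 rhob] hrho] := avoid_radius [seq normc (z - s0) | z <- rs] ia0.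
pose M := normc s0 + 2 * rho.
have inM s : normc (s - s0) <= 2 * rho -> normc s <= M.
  by move=> ss; have := normcD (s - s0) s0; rewrite subrK /M; lra.
have imne s : normc (s - s0) <= 2 * rho -> Im s != 0.
  move=> ss; apply/eqP => s0'; have := Im_le_normc (s - s0).
  rewrite cImD cImN s0' sub0r normrN; lra.
(* A lower bound for the characteristic polynomial on the circle, each factor being at least the
   difference of the two distances to s0. *)
pose dd := \prod_(z <- rs) `|rho - normc (z - s0)|.
have dd0 : 0 < dd.
  rewrite /dd big_seq; elim/big_ind: _ => // [x y|z zr]; first exact: mulr_gt0.
  by rewrite normr_gt0 subr_eq0 eq_sym; apply: hrho; apply/mapP; exists z.
have low s : normc (s - s0) = rho -> dd <= normc ((char_poly Bc).[s]).
  move=> ss; rewrite rsE hornerZ (monicP (char_poly_monic _)) mul1r horner_prod normc_prod.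
  apply: ler_prod => z _; rewrite normr_ge0 hornerXsubC /= -ss ler_norml.
  have := normcB (s - s0) (s - z); have := normcB (z - s0) (z - s).
  have -> : s - s0 - (s - z) = z - s0 by ring.
  have -> : z - s0 - (z - s) = s - s0 by ring.
  rewrite -(@normcN R (z - s)) opprB; lra.
have [k hk] := bmx_lim M hgf.
have [h1 h10 hdet] := @bmx_det_neq0 M q G gf hG pq hgf.
(* The three bounds serve [bmx_det_neq0], the domain [pdom], and an error k * h below dd / 3. *)
pose h := Num.min (h1 / 2) (Num.min 1 (dd / (4 * (`|k| + 1)))).
have k40 : 0 < 4 * (`|k| + 1) by rewrite mulr_gt0 // ltr_wpDl.
have h0 : 0 < h by rewrite !lt_min !divr_gt0 //= ltr01.
have hle : h <= 1 by rewrite /h !ge_min lexx !orbT.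
have hh1 : h < h1.
  by apply: (@le_lt_trans _ _ (h1 / 2)); [rewrite /h ge_min lexx|rewrite ltr_pdivrMr // ltr_pMr // ltr1n].
have hkd : k * h < dd / 3.
  have hd : h <= dd / (4 * (`|k| + 1)) by rewrite /h !ge_min lexx !orbT.
  apply: (@le_lt_trans _ _ (dd / 4)); last by rewrite ltr_pM2l // ltf_pV2 ?posrE // ltr_nat.
  apply: (@le_trans _ _ ((`|k| + 1) * h)).
    by rewrite ler_wpM2r ?(ltW h0) // (le_trans (ler_norm _)) // lerDl.
  rewrite ler_pdivlMr // in hd; rewrite ler_pdivlMr //; lra.
have hs s : normc (s - s0) <= 2 * rho -> pdom M h s by move=> ss; split => //; exact: inM.
have [|||s ss] := @hurwitz R (fun s => \det (@bmx q G gf h s)) s0 rho (dd / 2) rho0.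
- by apply: (@bmx_polylim M) => // s ss; exact: inM.
- move=> s ss; have sd : normc (s - s0) <= 2 * rho by rewrite ss ler_peMl ?ltW // ltr1n.
  have h2 := hk h s (hs s sd); have h3 := low s ss; rewrite -(bmx0_det q) in h3.
  have := normcB (\det (@bmx q G gf h s)) (\det (@bmx q G gf h s) - \det (@bmx0 q s)).
  rewrite opprB addrC subrK; lra.
- have sd : normc (s0 - s0) <= 2 * rho by rewrite subrr normc0 mulr_ge0 // ltW.
  have h2 := hk h s0 (hs s0 sd).
  have z0 : normc (\det (@bmx0 q s0)) = 0.
    by rewrite bmx0_det; move/eqP: rs0 => ->; rewrite normc0.
  have := normcD (\det (@bmx q G gf h s0) - \det (@bmx0 q s0)) (\det (@bmx0 q s0)).
  rewrite subrK z0; lra.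
by move=> dz; have := hdet h s (hs s ss) hh1 (imne s ss); rewrite dz eqxx.
Qed.

End Floquet.

(** * Smooth functions *)

Section Smooth.
Context {R : realType} {V : normedModType R}.
Implicit Types (f g : V -> R) (x v : V).

Lemma derive_ext (W : normedModType R) (f g : V -> W) v x : f =1 g -> 'D_v f x = 'D_v g x.
Proof. by move=> /funext ->. Qed.

Lemma diff_shift (c x : V) : differentiable (fun y : V => y + c) x.
Proof. exact: (@differentiableD _ _ _ id (cst c)). Qed.

Lemma differentiable_near (W : normedModType R) (f g : V -> W) x :
  (\near x, f x = g x) -> differentiable f x -> differentiable g x.
Proof.
move=> fg /diff_locallyP[cd e].
have fgx : f x = g x := nbhs_singleton fg.
have ge : g \o shift x = cst (g x) + 'd f x +o_ 0 id.
  apply/eqaddoP => eps eps0; rewrite -fgx.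
  have := e => /eqaddoP /(_ eps eps0).
  have ns : \forall h \near 0, f (h + x) = g (h + x).
    have : shift x h @[h --> 0] --> x.
      rewrite -[X in _ --> X]add0r; apply: cvgD; [exact: cvg_id|exact: cvg_cst].
    by move=> /(_ _ fg).
  move=> h1; near=> h.
  have -> : ((g \o shift x) - (cst (f x) + 'd f x)) h = ((f \o shift x) - (cst (f x) + 'd f x)) h.
    rewrite /= /GRing.add /= /GRing.opp /=; congr (_ + _); apply/esym.
    by near: h.
  by near: h.
have dd : 'd g x = 'd f x :> (V -> W) by apply: diff_unique.
by apply/diff_locallyP; rewrite dd.
Unshelve. all: by end_near. Qed.

Section OnSet.
Variable A : set V.
Hypothesis oA : open A.

(** A recursive form of [smooth_on] for which stability under products, compositions and inverses is
    an induction on the order. *)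
Fixpoint smn (n : nat) f : Prop :=
  (forall x, A x -> differentiable f x) /\
  (if n is n'.+1 then forall v, smn n' (fun x => 'D_v f x) else True).

Definition SM f := forall n, smn n f.

Lemma near_open x (P : V -> Prop) : A x -> (forall y, A y -> P y) -> \near x, P x.
Proof. by move=> Ax AP; have := open_nbhs_nbhs (conj oA Ax); apply: filterS. Qed.

Lemma smn_diff n f x : smn n f -> A x -> differentiable f x.
Proof. by case: n => [|n] [h _]; exact: h. Qed.

Lemma smn_eq n f g : (forall x, A x -> f x = g x) -> smn n f -> smn n g.
Proof.
elim: n f g => [|n IH] f g fg [df hf]; split => //.
- by move=> x Ax; apply: differentiable_near (df x Ax); exact: near_open.
- by move=> x Ax; apply: differentiable_near (df x Ax); exact: near_open.
move=> v; apply: IH (hf v) => x Ax; apply: near_eq_derive; exact: near_open.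
Qed.

Lemma smnW n f : smn n.+1 f -> smn n f.
Proof.
elim: n f => [|n IH] f [df hf]; split => // v.
by apply: IH; exact: hf.
Qed.

Lemma smn_cst n (a : R) : smn n (fun=> a).
Proof.
elim: n a => [|n IH] a; split => //.
by move=> v; apply: smn_eq (IH 0) => x _; rewrite derive_cst.
Qed.

Lemma smnD n f g : smn n f -> smn n g -> smn n (fun x => f x + g x).
Proof.
elim: n f g => [|n IH] f g [df hf] [dg hg]; split => //.
- by move=> x Ax; apply: differentiableD; [exact: df|exact: dg].
- by move=> x Ax; apply: differentiableD; [exact: df|exact: dg].
move=> v; apply: smn_eq (IH _ _ (hf v) (hg v)) => x Ax.
by rewrite (@deriveD _ _ _ f g) //; apply: diff_derivable; [exact: df|exact: dg].
Qed.

Lemma smnM n f g : smn n f -> smn n g -> smn n (fun x => f x * g x).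
Proof.
elim: n f g => [|n IH] f g hf hg.
  by split=> // x Ax; apply: differentiableM; [exact: smn_diff hf Ax|exact: smn_diff hg Ax].
have [df hf'] := hf; have [dg hg'] := hg; split.
  by move=> x Ax; apply: differentiableM; [exact: df|exact: dg].
move=> v; apply: smn_eq (smnD (IH _ _ (smnW hf) (hg' v)) (IH _ _ (smnW hg) (hf' v))) => x Ax.
by rewrite (@deriveM _ _ f g) //; apply: diff_derivable; [exact: df|exact: dg].
Qed.

Lemma SM_diff f x : SM f -> A x -> differentiable f x.
Proof. by move=> /(_ 0%N)[+ _]; apply. Qed.
Lemma SM_derivable f x v : SM f -> A x -> derivable f x v.
Proof. by move=> sf Ax; apply: diff_derivable; exact: SM_diff. Qed.
Lemma SM_D f v : SM f -> SM (fun x => 'D_v f x).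
Proof. by move=> sf n; have [_ +] := sf n.+1; apply. Qed.
Lemma SM_eq f g : (forall x, A x -> f x = g x) -> SM f -> SM g.
Proof. by move=> fg sf n; exact: smn_eq fg (sf n). Qed.
Lemma SM_cst a : SM (fun=> a). Proof. by move=> n; exact: smn_cst. Qed.
Lemma SMD f g : SM f -> SM g -> SM (fun x => f x + g x).
Proof. by move=> sf sg n; exact: smnD. Qed.
Lemma SMM f g : SM f -> SM g -> SM (fun x => f x * g x).
Proof. by move=> sf sg n; exact: smnM. Qed.
Lemma SMZ a f : SM f -> SM (fun x => a * f x).
Proof. by move=> sf; apply: SMM => //; exact: SM_cst. Qed.
Lemma SMN f : SM f -> SM (fun x => - f x).
Proof. by move=> /(SMZ (-1)); apply: SM_eq => x _; rewrite mulN1r. Qed.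
Lemma SMB f g : SM f -> SM g -> SM (fun x => f x - g x).
Proof. by move=> sf /SMN; exact: SMD. Qed.

Lemma SM_sum (I : Type) (r : seq I) (F : I -> V -> R) : (forall i, SM (F i)) ->
  SM (fun x => \sum_(i <- r) F i x).
Proof.
move=> sF; elim: r => [|i r IH].
  by apply: SM_eq (SM_cst 0) => x _; rewrite big_nil.
by apply: SM_eq (SMD (sF i) IH) => x _; rewrite big_cons.
Qed.

Lemma SM_DD f g v x : SM f -> SM g -> A x ->
  'D_v (fun x => f x + g x) x = 'D_v f x + 'D_v g x.
Proof. by move=> sf sg Ax; rewrite (@deriveD _ _ _ f g) //; exact: SM_derivable. Qed.

Lemma SM_DM f g v x : SM f -> SM g -> A x ->
  'D_v (fun x => f x * g x) x = 'D_v f x * g x + f x * 'D_v g x.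
Proof.
move=> sf sg Ax; rewrite (@deriveM _ _ f g) //; try exact: SM_derivable.
by rewrite addrC [g x *: _]mulrC.
Qed.

Lemma SM_DZ a f v x : SM f -> A x -> 'D_v (fun x => a * f x) x = a * 'D_v f x.
Proof.
by move=> sf Ax; rewrite (SM_DM v (SM_cst a) sf Ax) derive_cst mul0r add0r.
Qed.

Lemma SM_DN f v x : SM f -> A x -> 'D_v (fun x => - f x) x = - 'D_v f x.
Proof. by move=> sf Ax; rewrite (@deriveN _ _ _ f) //; exact: SM_derivable. Qed.

Lemma SM_DB f g v x : SM f -> SM g -> A x ->
  'D_v (fun x => f x - g x) x = 'D_v f x - 'D_v g x.
Proof. by move=> sf sg Ax; rewrite (SM_DD v sf (SMN sg) Ax) SM_DN. Qed.

Lemma SM_Dsum (I : Type) (r : seq I) (F : I -> V -> R) v x : (forall i, SM (F i)) -> A x ->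
  'D_v (fun x => \sum_(i <- r) F i x) x = \sum_(i <- r) 'D_v (F i) x.
Proof.
move=> sF Ax; elim: r => [|i r IH].
  rewrite big_nil -[RHS](derive_cst 0 x v); apply: derive_ext => y.
  by rewrite big_nil.
rewrite big_cons -IH -(SM_DD v (sF i) (SM_sum r sF) Ax); apply: derive_ext => y.
by rewrite big_cons.
Qed.

Lemma SM_Deq f g v x : (forall x, A x -> f x = g x) -> A x -> 'D_v f x = 'D_v g x.
Proof. by move=> fg Ax; apply: near_eq_derive; exact: near_open. Qed.

Lemma smooth_on_D (W : normedModType R) (f : V -> W) v :
  smooth_on A f -> smooth_on A (fun x => 'D_v f x).
Proof.
move=> sf vs x Ax; have := sf (rcons vs v) x Ax.
by rewrite /iter_derive foldr_rcons.
Qed.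

Lemma smooth_SM f : smooth_on A f -> SM f.
Proof.
move=> sf n; elim: n f sf => [|n IH] f sf; split => //.
- by move=> x Ax; exact: (sf [::] x Ax).
- by move=> x Ax; exact: (sf [::] x Ax).
by move=> v; apply: IH; exact: smooth_on_D.
Qed.

Lemma smooth_SM_coord m n (f : V -> 'M[R]_(m, n)) i j : smooth_on A f ->
  SM (fun x => f x i j).
Proof.
move=> sf k; elim: k f sf => [|k IH] f sf.
  split => // x Ax.
  exact: (@differentiable_comp _ _ _ _ f (fun N : 'M[R]_(m, n) => N i j) x
    (sf [::] x Ax) (differentiable_coord _ _ _)).
split.
  move=> x Ax; exact: (@differentiable_comp _ _ _ _ f (fun N : 'M[R]_(m, n) => N i j) x
    (sf [::] x Ax) (differentiable_coord _ _ _)).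
move=> v; apply: smn_eq (IH _ (smooth_on_D v sf)) => x Ax.
by rewrite derive_mx ?mxE //; apply: diff_derivable; exact: (sf [::] x Ax).
Qed.

Lemma derive_shiftE (W : normedModType R) (f : V -> W) c v x :
  'D_v (fun x => f (x + c)) x = 'D_v f (x + c).
Proof.
rewrite /derive; set F := fun h : R => _; set G := fun h : R => _.
by suff -> : F = G by []; apply/funext => h; rewrite /F /G /= addrA.
Qed.

Lemma SM_shift f c : (forall x, A x -> A (x + c)) -> SM f -> SM (fun x => f (x + c)).
Proof.
move=> Ac sf n; elim: n f sf => [|n IH] f sf.
  split => // x Ax; apply: (@differentiable_comp _ _ _ _ (fun x => x + c) f).
    exact: diff_shift.
  exact: (SM_diff sf (Ac _ Ax)).
split.
  move=> x Ax; apply: (@differentiable_comp _ _ _ _ (fun x => x + c) f).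
    exact: diff_shift.
  exact: (SM_diff sf (Ac _ Ax)).
move=> v; apply: smn_eq (IH _ (SM_D v sf)) => x Ax.
by rewrite derive_shiftE.
Qed.

End OnSet.

Lemma line_derive f x v (t : R) : differentiable f (x + t *: v) ->
  is_derive t 1 (fun s : R => f (x + s *: v)) ('D_v f (x + t *: v)).
Proof.
move=> df; pose l (s : R) := x + s *: v.
have [dl dv] : is_diff t l ( *:%R^~ v).
  have : is_diff t (cst x + *:%R^~ v) (0 + *:%R^~ v) by apply: is_diffD.
  by rewrite add0r.
have dc : differentiable (f \o l) t by exact: differentiable_comp.
apply: DeriveDef; first exact/derivable1_diffP.
rewrite deriveE // (@diff_comp _ _ _ _ l f) //= dv /= scale1r deriveE //.
Qed.

Lemma line_MVT A f x v (h : R) : (forall y, A y -> differentiable f y) -> 0 <= h ->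
  (forall s, 0 <= s <= h -> A (x + s *: v)) ->
  exists2 s, 0 <= s <= h & f (x + h *: v) - f x = h * 'D_v f (x + s *: v).
Proof.
move=> df h0 hA.
have d s : 0 <= s <= h -> is_derive s 1 (fun s : R => f (x + s *: v)) ('D_v f (x + s *: v)).
  by move=> hs; apply: line_derive; apply: df; exact: hA.
have [||s sh e] := @MVT_segment _ (fun s : R => f (x + s *: v)) (fun s => 'D_v f (x + s *: v)) 0 h h0.
- by move=> s; rewrite in_itv /= => /andP[/ltW s0 /ltW s1]; apply: d; rewrite s0.
- by apply: derivable_within_continuous => s; rewrite in_itv /= => /d[].
exists s; first by move: sh; rewrite in_itv.
by move: e; rewrite scale0r addr0 subr0 mulrC.
Qed.

(** The mean value theorem is used twice: along v for f(y + h w) - f(y), then along w for the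
    derivative along v. *)
Lemma mixed_second_difference A f x v w (h : R) : SM A f -> 0 < h ->
  (forall s t, 0 <= s <= h -> 0 <= t <= h -> A (x + s *: v + t *: w)) ->
  exists s t, [/\ 0 <= s <= h, 0 <= t <= h &
    f (x + h *: v + h *: w) - f (x + h *: v) - (f (x + h *: w) - f x) =
    h * h * 'D_w (fun y => 'D_v f y) (x + s *: v + t *: w)].
Proof.
move=> sf h0 hA; have h0' := ltW h0.
have zh : 0 <= (0 : R) <= h by rewrite lexx.
have hh : 0 <= h <= h by rewrite lexx h0'.
pose B := [set y | exists2 s, 0 <= s <= h & y = x + s *: v].
pose g y := f (y + h *: w) - f y.
have BA y : B y -> A y /\ A (y + h *: w).
  move=> [s sh ->]; split; last exact: hA.
  by have := hA s 0 sh zh; rewrite scale0r addr0.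
have dsh y : differentiable f (y + h *: w) -> differentiable (fun y => f (y + h *: w)) y.
  move=> d; exact: (@differentiable_comp _ _ _ _ (fun x : V => x + h *: w) f y (diff_shift _ _) d).
have dB y : B y -> differentiable g y.
  move=> /BA[Ay Ayw]; apply: (@differentiableB _ _ _ (fun y => f (y + h *: w)) f).
    by apply: dsh; exact: SM_diff sf Ayw.
  exact: SM_diff sf Ay.
have Bs s : 0 <= s <= h -> B (x + s *: v) by move=> sh; exact: (ex_intro2 _ _ s sh erefl).
have [s sh e] := line_MVT dB h0' Bs.
have By := Bs s sh.
have [Ay Ayw] := BA _ By.
have Dg : 'D_v g (x + s *: v) = 'D_v f (x + s *: v + h *: w) - 'D_v f (x + s *: v).
  rewrite (@deriveB _ _ _ (fun y => f (y + h *: w)) f); first by rewrite derive_shiftE.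
    by apply: diff_derivable; apply: dsh; exact: SM_diff sf Ayw.
  by apply: diff_derivable; exact: SM_diff sf Ay.
have dA y : A y -> differentiable (fun y => 'D_v f y) y by move=> Ay'; exact: SM_diff (SM_D v sf) Ay'.
have [t th e'] := line_MVT dA h0' (fun t th => hA s t sh th).
by exists s, t; split => //; rewrite -mulrA -e' -Dg -e /g.
Qed.

(** The second difference is symmetric in v and w, so both mixed derivatives take a common value at
    points arbitrarily close to x; they are continuous at x. *)
Lemma Schwarz A f x v w : open A -> SM A f -> A x ->
  'D_w (fun y => 'D_v f y) x = 'D_v (fun y => 'D_w f y) x.
Proof.
move=> oA sf Ax; apply/eqP; rewrite -subr_eq0; apply/negPn/negP => ne0.
set F := fun y => 'D_w (fun y => 'D_v f y) y; set G := fun y => 'D_v (fun y => 'D_w f y) y.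
rewrite -/(F x) -/(G x) in ne0.
pose e := `|F x - G x| / 2; have e0 : 0 < e by rewrite divr_gt0 // normr_gt0.
have cF : {for x, continuous F}.
  by apply: differentiable_continuous; exact: SM_diff (SM_D w (SM_D v sf)) Ax.
have cG : {for x, continuous G}.
  by apply: differentiable_continuous; exact: SM_diff (SM_D v (SM_D w sf)) Ax.
have /cvgrPdist_lt /(_ e e0) nF' := cF; have /cvgrPdist_lt /(_ e e0) nG' := cG.
have nA : nbhs x A by exact: open_nbhs_nbhs.
have [d /= d0 hd] := (nbhs_ballP _ _).1 (filterI nA (filterI nF' nG')).
(* Small enough for the whole parallelogram to stay in the ball of radius d. *)
pose h := d / (2 * (`|v| + `|w| + 1)).
have vw0 : 0 < `|v| + `|w| + 1 by rewrite ltr_wpDl // addr_ge0.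
have h0 : 0 < h by rewrite divr_gt0 // mulr_gt0.
have inB s t : 0 <= s <= h -> 0 <= t <= h -> ball x d (x + s *: v + t *: w).
  move=> /andP[s0 sh] /andP[t0 th].
  rewrite -ball_normE /= -addrA opprD addrA subrr add0r normrN.
  apply: (le_lt_trans (ler_normD _ _)); rewrite !normrZ !ger0_norm //.
  apply: (@le_lt_trans _ _ (h * (`|v| + `|w| + 1))).
    have lv : s * `|v| <= h * `|v| by rewrite ler_wpM2r.
    have lw : t * `|w| <= h * `|w| by rewrite ler_wpM2r.
    rewrite !mulrDr mulr1; lra.
  rewrite /h invfM mulrA -mulrA mulVf ?gt_eqF // mulr1 ltr_pdivrMr // ltr_pMr //.
  by rewrite ltr1n.
have [|s [t [sh th e1]]] := @mixed_second_difference A f x v w h sf h0.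
  by move=> s t sh th; have [] := hd _ (inB s t sh th).
have [|s' [t' [sh' th' e2]]] := @mixed_second_difference A f x w v h sf h0.
  move=> s' t' sh' th'; rewrite addrAC; by have [] := hd _ (inB t' s' th' sh').
have hne : h * h != 0 by rewrite mulf_neq0 // gt_eqF.
have e2' : f (x + h *: w + h *: v) - f (x + h *: w) - (f (x + h *: v) - f x) =
    h * h * G (x + t' *: v + s' *: w) by rewrite [x + t' *: v + _]addrAC.
have l12 : f (x + h *: v + h *: w) - f (x + h *: v) - (f (x + h *: w) - f x) =
    f (x + h *: w + h *: v) - f (x + h *: w) - (f (x + h *: v) - f x).
  rewrite [x + h *: w + _]addrAC.
  by move: (f _) (f _) (f _) (f _) => a b c d'; ring.
have eq : F (x + s *: v + t *: w) = G (x + t' *: v + s' *: w).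
  by apply: (mulfI hne); exact: etrans (esym e1) (etrans l12 e2').
have [_ [f1 _]] := hd _ (inB _ _ sh th).
have [_ [_ g1]] := hd _ (inB _ _ th' sh').
have f1' : `|F x - F (x + s *: v + t *: w)| < e := f1.
have g1' : `|G x - F (x + s *: v + t *: w)| < e by rewrite eq; exact: g1.
have lt2 (a b c : R) : `|a - c| < e -> `|b - c| < e -> `|a - b| < e + e.
  move=> h1 h2; have -> : a - b = (a - c) - (b - c) by ring.
  by apply: (le_lt_trans (ler_normB _ _)); rewrite ltrD.
have := lt2 _ _ _ f1' g1'.
by rewrite /e -mulr2n -[_ *+ 2]mulr_natr divfK ?ltxx // pnatr_eq0.
Qed.

End Smooth.

(** * Chain rule for maps with finitely many coordinates *)

Section Chain.
Context {R : realType} {V E : normedModType R} {I : finType}.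
Variables (e : I -> E) (qi : I -> V -> R) (q : V -> E).
Hypothesis qE : forall x, q x = \sum_i qi i x *: e i.

Lemma fsum_diff (r : seq I) x : (forall i, differentiable (qi i) x) ->
  differentiable (fun y => \sum_(i <- r) qi i y *: e i) x /\
  forall v, 'D_v (fun y => \sum_(i <- r) qi i y *: e i) x = \sum_(i <- r) 'D_v (qi i) x *: e i.
Proof.
move=> dq; elim: r => [|i r [d1 d2]].
  have -> : (fun y => \sum_(i <- [::]) qi i y *: e i) = cst 0.
    by apply/funext => y; rewrite big_nil.
  by split=> [|v]; [exact: differentiable_cst|rewrite derive_cst big_nil].
have -> : (fun y => \sum_(j <- i :: r) qi j y *: e j) =
    (fun y => qi i y *: e i) + (fun y => \sum_(j <- r) qi j y *: e j).
  by apply/funext => y; rewrite big_cons.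
have di : differentiable (fun y => qi i y *: e i) x by exact: differentiableZl.
split=> [|v]; first exact: differentiableD.
rewrite deriveD ?d2 ?big_cons; try exact: diff_derivable.
by congr (_ + _); rewrite deriveE // diffZl // -deriveE.
Qed.

Lemma chain_rule (g : E -> R) x v : (forall i, differentiable (qi i) x) ->
  differentiable g (q x) ->
  differentiable (g \o q) x /\
  'D_v (fun y => g (q y)) x = \sum_i 'D_v (qi i) x * 'D_(e i) g (q x).
Proof.
move=> dqi dg.
have [d1 d2] := fsum_diff (index_enum I) dqi.
have qf : q = (fun y => \sum_i qi i y *: e i) by apply/funext.
have dq : differentiable q x by rewrite qf.
have dgq : differentiable (g \o q) x by exact: differentiable_comp.
have Dq : 'D_v q x = \sum_i 'D_v (qi i) x *: e i by rewrite -d2; apply: derive_ext.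
split=> //; rewrite (deriveE v dgq) diff_comp //= -(deriveE v dq) Dq linear_sum.
by apply: eq_bigr => i _; rewrite linearZ /= (deriveE (e i) dg).
Qed.

Variables (A : set V) (O : set E).
Hypothesis oA : open A.
Hypothesis qO : forall x, A x -> O (q x).

(** The chain rule expresses derivatives of the composite by composites with derivatives of g, to
    which the induction hypothesis applies. *)
Lemma SM_comp (g : E -> R) : SM O g -> (forall i, SM A (qi i)) -> SM A (fun x => g (q x)).
Proof.
move=> sg sq n; elim: n g sg => [|n IH] g sg.
  split => // x Ax.
  by have [] := @chain_rule g x 0 (fun i => SM_diff (sq i) Ax) (SM_diff sg (qO Ax)).
split.
  move=> x Ax.
  by have [] := @chain_rule g x 0 (fun i => SM_diff (sq i) Ax) (SM_diff sg (qO Ax)).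
move=> v.
have h : smn A n (fun x => \sum_i 'D_v (qi i) x * 'D_(e i) g (q x)).
  have : forall r : seq I, smn A n (fun x => \sum_(i <- r) 'D_v (qi i) x * 'D_(e i) g (q x)).
    elim=> [|i r IHr].
      by apply: (smn_eq oA _ (smn_cst oA n 0)) => x _; rewrite big_nil.
    apply: (smn_eq oA _ (smnD oA (smnM oA (SM_D v (sq i) n) (IH _ (SM_D (e i) sg))) IHr)) => x _.
    by rewrite big_cons.
  by apply.
apply: (smn_eq oA _ h) => x Ax; apply/esym.
by have [] := @chain_rule g x v (fun i => SM_diff (sq i) Ax) (SM_diff sg (qO Ax)).
Qed.

Lemma SM_comp_D (g : E -> R) x v : SM O g -> (forall i, SM A (qi i)) -> A x ->
  'D_v (fun y => g (q y)) x = \sum_i 'D_v (qi i) x * 'D_(e i) g (q x).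
Proof.
move=> sg sq Ax.
by have [] := @chain_rule g x v (fun i => SM_diff (sq i) Ax) (SM_diff sg (qO Ax)).
Qed.

End Chain.

(** * Partial derivatives of the Hamiltonian density *)

Section PartialDerivatives.
Context {R : realType} {N : nat}.
Implicit Types (G : 'cV[R]_N -> 'cV[R]_N -> R).
Local Notation E := ('cV[R]_N * 'cV[R]_N)%type.

(** With it [dU] and [dUx] become directional derivatives along the basis [dir], and results on
    functions of one vector variable apply. *)
Definition unc G : E -> R := fun z => G z.1 z.2.
Definition dir (i : 'I_N + 'I_N) : E :=
  match i with inl a => (delta_mx a 0, 0) | inr a => (0, delta_mx a 0) end.

Lemma dUE a G z : unc (dU a G) z = 'D_(dir (inl a)) (unc G) z.
Proof.
case: z => u p; rewrite /unc /dU /derive /=.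
set F := fun h : R => _; set F' := fun h : R => _.
by suff -> : F = F' by []; apply/funext => h; rewrite /F /F' /= scaler0 add0r.
Qed.

Lemma dUxE a G z : unc (dUx a G) z = 'D_(dir (inr a)) (unc G) z.
Proof.
case: z => u p; rewrite /unc /dUx /derive /=.
set F := fun h : R => _; set F' := fun h : R => _.
by suff -> : F = F' by []; apply/funext => h; rewrite /F /F' /= scaler0 add0r.
Qed.

Lemma pair_dirE (u p : 'cV[R]_N) : (u, p) = \sum_(i : 'I_N + 'I_N)
  (match i with inl a => u a 0 | inr a => p a 0 end) *: dir i.
Proof.
have vE (v : 'cV[R]_N) : v = \sum_a v a 0 *: delta_mx a 0.
  by rewrite {1}[v]matrix_sum_delta; apply: eq_bigr => a _; rewrite big_ord1.
have s1 (v : 'cV[R]_N) : \sum_a v a 0 *: (delta_mx a 0, 0) = (v, 0) :> E.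
  rewrite {2}[v]vE; elim/big_rec2: _ => // a y1 y2 _ ->.
  by congr pair; rewrite /= scaler0 add0r.
have s2 (v : 'cV[R]_N) : \sum_a v a 0 *: (0, delta_mx a 0) = (0, v) :> E.
  rewrite {2}[v]vE; elim/big_rec2: _ => // a y1 y2 _ ->.
  by congr pair; rewrite /= scaler0 add0r.
by rewrite big_sumType /= s1 s2; congr pair; rewrite /= ?addr0 ?add0r.
Qed.

Lemma SM_dU (Om : set E) a G : SM Om (unc G) -> SM Om (unc (dU a G)).
Proof.
have -> : unc (dU a G) = (fun z => 'D_(dir (inl a)) (unc G) z).
  by apply/funext => z; exact: dUE.
exact: SM_D.
Qed.

Lemma SM_dUx (Om : set E) a G : SM Om (unc G) -> SM Om (unc (dUx a G)).
Proof.
have -> : unc (dUx a G) = (fun z => 'D_(dir (inr a)) (unc G) z).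
  by apply/funext => z; exact: dUxE.
exact: SM_D.
Qed.

Lemma dUdUxE a b G z : unc (dU b (dUx a G)) z =
  'D_(dir (inl b)) (fun y => 'D_(dir (inr a)) (unc G) y) z.
Proof.
have h : unc (dUx a G) = (fun y => 'D_(dir (inr a)) (unc G) y).
  by apply/funext => y; exact: dUxE.
by rewrite -h; exact: dUE.
Qed.

Lemma dUdUE a b G z : unc (dU b (dU a G)) z =
  'D_(dir (inl b)) (fun y => 'D_(dir (inl a)) (unc G) y) z.
Proof.
have h : unc (dU a G) = (fun y => 'D_(dir (inl a)) (unc G) y).
  by apply/funext => y; exact: dUE.
by rewrite -h; exact: dUE.
Qed.

Lemma dUxdUE a b G z : unc (dUx b (dU a G)) z =
  'D_(dir (inr b)) (fun y => 'D_(dir (inl a)) (unc G) y) z.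
Proof.
have h : unc (dU a G) = (fun y => 'D_(dir (inl a)) (unc G) y).
  by apply/funext => y; exact: dUE.
by rewrite -h; exact: dUxE.
Qed.

Lemma dUxdUxE a b G z : unc (dUx b (dUx a G)) z =
  'D_(dir (inr b)) (fun y => 'D_(dir (inr a)) (unc G) y) z.
Proof.
have h : unc (dUx a G) = (fun y => 'D_(dir (inr a)) (unc G) y).
  by apply/funext => y; exact: dUxE.
by rewrite -h; exact: dUxE.
Qed.

Lemma dUdUx_sym (Om : set E) a b G z : open Om -> SM Om (unc G) -> Om z ->
  unc (dU b (dUx a G)) z = unc (dUx a (dU b G)) z.
Proof.
move=> oOm sG Oz; have h := Schwarz (dir (inr a)) (dir (inl b)) oOm sG Oz.
apply: (etrans (dUdUxE a b G z)); apply: esym; apply: (etrans (dUxdUE b a G z)); apply: esym.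
exact: h.
Qed.

Lemma dUdU_sym (Om : set E) a b G z : open Om -> SM Om (unc G) -> Om z ->
  unc (dU b (dU a G)) z = unc (dU a (dU b G)) z.
Proof.
move=> oOm sG Oz; have h := Schwarz (dir (inl a)) (dir (inl b)) oOm sG Oz.
apply: (etrans (dUdUE a b G z)); apply: esym; apply: (etrans (dUdUE b a G z)); apply: esym.
exact: h.
Qed.

Lemma dUxdUx_sym (Om : set E) a b G z : open Om -> SM Om (unc G) -> Om z ->
  unc (dUx b (dUx a G)) z = unc (dUx a (dUx b G)) z.
Proof.
move=> oOm sG Oz; have h := Schwarz (dir (inr a)) (dir (inr b)) oOm sG Oz.
apply: (etrans (dUxdUxE a b G z)); apply: esym; apply: (etrans (dUxdUxE b a G z)); apply: esym.
exact: h.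
Qed.

Lemma usubmx_continuous n m k : continuous (usubmx : 'M[R]_(n + m, k) -> 'M[R]_(n, k)).
Proof.
move=> u B /nbhs_ballP[e e0 eB]; apply/nbhs_ballP; exists e => // v [_ uv].
by apply: eB; split=> // i j; rewrite !mxE; exact: uv.
Qed.

(** The difference quotient is al + h be. *)
Lemma derive_quad (V : normedModType R) (f : V -> R) x v (al be : R) :
  (forall h : R, f (h *: v + x) = f x + h * al + h * h * be) -> is_derive x v f al.
Proof.
move=> hf.
have h1 : (fun h : R => al + h * be) @ 0^' --> al.
  have cid : continuous (fun h : R => h) by move=> h; exact: cvg_id.
  have c : continuous (fun h : R => al + h * be).
    by apply: rcontD; [exact: rcont_cst|apply: rcontM => //; exact: rcont_cst].
  have := c 0; rewrite /continuous_at mul0r addr0 => c0 B /c0 hB.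
  exact: nbhs_dnbhs.
have h2 : (fun h : R => h^-1 *: (f (h *: v + x) - f x)) @ 0^' --> al.
  apply: cvg_trans h1; apply: near_eq_cvg; near=> h.
  have h0 : h != 0 by near: h; exact: nbhs_dnbhs_neq.
  by rewrite hf /GRing.scale /=; field.
apply: DeriveDef; first by apply/cvg_ex; exists al.
exact: cvg_lim h2.
Unshelve. all: by end_near. Qed.

End PartialDerivatives.

(** * Functions of phase and parameters, and derivatives of their means *)

Section TimeSlice.
Context {R : realType} {K : nat}.
Local Notation T := (R * 'cV[R]_K)%type.
Variable O : set 'cV[R]_K.
Hypothesis oO : open O.

Definition tdom : set T := setT `*` O.
Definition Dt : T := (1, 0).
Definition Dj (j : 'I_K) : T := (0, delta_mx j 0).

Lemma DtE (h t : R) (W : 'cV[R]_K) : h *: Dt + (t, W) = (h *: 1 + t, W).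
Proof. by rewrite /Dt; congr pair; rewrite /= scaler0 add0r. Qed.

Lemma DjE (h t : R) j (W : 'cV[R]_K) :
  h *: Dj j + (t, W) = (t, h *: delta_mx j 0 + W).
Proof. by rewrite /Dj; congr pair; rewrite /= scaler0 add0r. Qed.

Lemma tdom_open : open tdom.
Proof.
have -> : tdom = snd @^-1` O by apply/seteqP; split=> z; [case|].
by apply: open_comp => // z _; exact: cvg_snd.
Qed.

Lemma tdomP t W : O W -> tdom (t, W). Proof. by []. Qed.

Lemma SM_rder (f : T -> R) W : SM tdom f -> O W ->
  rder (fun t => f (t, W)) (fun t => 'D_Dt f (t, W)).
Proof.
move=> sf OW t; have d : derivable f (t, W) Dt by apply: SM_derivable sf _.
suff [e1 e2] : derivable (fun t => f (t, W)) t 1 = derivable f (t, W) Dt /\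
    'D_1 (fun t => f (t, W)) t = 'D_Dt f (t, W).
  by apply: DeriveDef; rewrite ?e1 ?e2.
rewrite /derivable /derive; set F := fun h : R => _; set F' := fun h : R => _.
by have -> : F = F' by apply/funext => h; rewrite /F /F' /= ?DtE ?DjE.
Qed.

Lemma SM_cont_t (f : T -> R) W : SM tdom f -> O W -> continuous (fun t => f (t, W)).
Proof. by move=> sf OW; exact: rder_cont (SM_rder sf OW). Qed.

Lemma derive_slice (f : T -> R) t j W :
  'D_(delta_mx j 0) (fun W' => f (t, W')) W = 'D_(Dj j) f (t, W).
Proof.
rewrite /derive; set F := fun h : R => _; set F' := fun h : R => _.
by suff -> : F = F' by []; apply/funext => h; rewrite /F /F' /= ?DtE ?DjE.
Qed.

Lemma SM_param (g : 'cV[R]_K -> R) : SM O g -> SM tdom (fun z => g z.2).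
Proof.
have dsnd (z : T) : differentiable (snd : T -> 'cV[R]_K) z.
  by apply: (@linear_differentiable _ _ _ (snd : {linear T -> 'cV[R]_K})) => y; exact: cvg_snd.
have Dsnd (f : 'cV[R]_K -> R) (v z : T) : 'D_v (fun z => f z.2) z = 'D_(v.2) f z.2.
  by rewrite /derive; set F := fun h : R => _.
move=> sg k; elim: k g sg => [|k IH] g sg.
  split=> // z [_ Oz]; apply: (@differentiable_comp _ _ _ _ snd g) => //.
  exact: SM_diff sg Oz.
split.
  move=> z [_ Oz]; apply: (@differentiable_comp _ _ _ _ snd g) => //.
  exact: SM_diff sg Oz.
move=> v; apply: (smn_eq tdom_open _ (IH _ (SM_D v.2 sg))) => z _.
by rewrite Dsnd.
Qed.

Lemma Dt_param (g : 'cV[R]_K -> R) z : 'D_Dt (fun z : T => g z.2) z = 0.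
Proof.
have d : is_derive z Dt (fun z : T => g z.2) 0.
  case: z => t W; apply: (@derive_quad _ _ _ _ _ 0 0) => h.
  by rewrite DtE !mulr0 !addr0.
by rewrite derive_val.
Qed.

Lemma coord_SM (A : set 'cV[R]_K) i : open A -> SM A (fun W => W i 0).
Proof.
move=> oA k; case: k => [|k]; split => //; try by move=> x _; exact: differentiable_coord.
move=> v; apply: (smn_eq oA _ (smn_cst oA k (v i 0))) => x _.
have d : is_derive x v (fun W : 'cV[R]_K => W i 0) (v i 0).
  by apply: (@derive_quad _ _ _ _ _ _ 0) => h; rewrite !mxE mulr0 addr0 addrC.
by rewrite derive_val.
Qed.

Lemma coord_D i j W : 'D_(delta_mx j 0) (fun W : 'cV[R]_K => W i 0) W = (i == j)%:R.
Proof.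
have d : is_derive W (delta_mx j 0) (fun W : 'cV[R]_K => W i 0) ((i == j)%:R).
  by apply: (@derive_quad _ _ _ _ _ _ 0) => h; rewrite !mxE eqxx andbT mulr0 addr0 addrC.
by rewrite derive_val.
Qed.

(** Differentiation under the integral with a constant majorant: the derivative is continuous, hence
    bounded on the compact set [0, 1] x [- d2, d2]. *)
Lemma mean_diff (f : T -> R) j W0 : SM tdom f -> O W0 ->
  'D_(delta_mx j 0) (fun W => mean (fun t => f (t, W))) W0 =
  mean (fun t => 'D_(Dj j) f (t, W0)).
Proof.
move=> sf OW0; set dl : 'cV[R]_K := delta_mx j 0.
pose l (x : R) := x *: dl + W0.
have lc : continuous l.
  move=> x; apply: cvgD; last exact: cvg_cst.
  by apply: cvgZr_tmp || apply: scalel_continuous.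
have : nbhs (0 : R) (l @^-1` O).
  by apply: lc; rewrite /l scale0r add0r; exact: open_nbhs_nbhs.
move=> /nbhs_ballP[d /= d0 hd].
have Ol x : `|x| < d -> O (l x).
  by move=> xd; apply: hd; rewrite -ball_normE /= sub0r normrN.
have dline x t : O (l x) -> is_derive x 1 (fun x => f (t, l x)) ('D_(Dj j) f (t, l x)).
  move=> Ox; have e y : (t, l y) = (t, W0) + y *: Dj j.
    by rewrite /l /Dj; congr pair; rewrite /= ?scaler0 ?addr0 // addrC.
  have h := @line_derive _ _ f (t, W0) (Dj j) x.
  rewrite -e in h; have Td : tdom (t, l x) by [].
  have := h (SM_diff sf Td).
  by congr (is_derive _ _ _ _); apply/funext => y; rewrite e.
pose d2 := d / 2; have d20 : 0 < d2 by rewrite divr_gt0.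
have d2d : d2 < d by rewrite ltr_pdivrMr // ltr_pMr // ltr1n.
pose F2 (y : R * R) := `|'D_(Dj j) f (y.1, l y.2)|.
pose Kc : set (R * R) := `[0, 1]%classic `*` `[- d2, d2]%classic.
have KO y : y \in Kc -> O (l y.2).
  rewrite inE => -[_ /=]; rewrite in_itv /= => h2; apply: Ol.
  by apply: le_lt_trans d2d; rewrite ler_norml.
have [|||y0 _ hy0] := @compact_EVT_max _ R F2 Kc.
- by exists (0, 0); split; rewrite /= in_itv /= ?lexx ?ler01 // oppr_le0 ltW.
- by apply: compact_setX; exact: segment_compact.
- apply: continuous_in_subspaceT => y /KO Oy.
  have c1 : {for (y.1, l y.2), continuous (fun z => 'D_(Dj j) f z)}.
    by apply: differentiable_continuous; exact: SM_diff (SM_D (Dj j) sf) _.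
  have c2 : {for y, continuous (fun y : R * R => (y.1, l y.2))}.
    have l2 : {for y, continuous (fun y : R * R => l y.2)}.
      by apply: (@continuous_comp _ _ _ snd l); [exact: cvg_snd|exact: lc].
    have f1 : (fun y : R * R => y.1) @ y --> y.1 by exact: cvg_fst.
    exact: (cvg_pair f1 l2).
  apply: cvg_norm.
  exact: (@continuous_comp _ _ _ (fun y : R * R => (y.1, l y.2)) (fun z => 'D_(Dj j) f z) y c2 c1).
pose M := F2 y0.
have M0 : 0 <= M by exact: normr_ge0.
have hM x t : x \in `]- d2, d2[ -> t \in `[0, 1] -> `|'D_(Dj j) f (t, l x)| <= M.
  move=> xd td; apply: (hy0 (t, x)); rewrite inE; split => //=.
  by move: xd; rewrite !in_itv /= => /andP[/ltW -> /ltW ->].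
have KO' x : x \in `]- d2, d2[ -> O (l x).
  rewrite in_itv /= => /andP[h1 h2]; apply: Ol; apply: lt_trans d2d.
  by rewrite ltr_norml h1.
pose g (x t : R) := f (t, l x).
have Dg x t : x \in `]- d2, d2[ -> (g ^~ t)^`()%classic x = 'D_(Dj j) f (t, l x).
  by move=> /KO' Ox; rewrite derive1E; have [_ ->] := dline x t Ox.
have ci (h : R -> R) : continuous h -> lebesgue_measure.-integrable `[0, 1] (EFin \o h).
  move=> ch; apply: continuous_compact_integrable; first exact: segment_compact.
  exact: continuous_subspaceT.
have z0 : (0 : R) \in `]- d2, d2[ by rewrite in_itv /= oppr_lt0 d20.
have key := @cvg_differentiation_under_integral R _ _ lebesgue_measure g `[0, 1]
  (measurable_itv _) 0 (- d2) d2 z0 _ _ (fun=> M) (fun=> M0) _ _.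
have {key} : h^-1 *: (mean (g (h + 0)) - mean (g 0)) @[h --> 0^'] -->
    \int[lebesgue_measure]_(y in `[0, 1]) 'D_(Dj j) f (y, W0).
  have -> : \int[lebesgue_measure]_(y in `[0, 1]) 'D_(Dj j) f (y, W0) =
      \int[lebesgue_measure]_(y in `[0, 1]) partial1of2 g 0 y.
    apply: eq_Rintegral => y _; rewrite /partial1of2 Dg // /l scale0r add0r //.
  apply: key.
  - by move=> x xI; apply: ci; apply: SM_cont_t sf (KO' x xI).
  - by move=> x t xI _; have [] := dline x t (KO' x xI).
  - by apply: ci; exact: cst_continuous.
  - by move=> x t xI tI; rewrite /partial1of2 Dg //; exact: hM.
move=> key; rewrite /derive /=.
have -> : (fun h : R => h^-1 *: (mean (fun t => f (t, h *: dl + W0)) - mean (fun t => f (t, W0)))) =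
    (fun h => h^-1 *: (mean (g (h + 0)) - mean (g 0))).
  apply/funext => h; congr (_ *: (_ - _)); first by rewrite addr0.
  by congr mean; apply/funext => t; rewrite /g /l scale0r add0r.
exact: cvg_lim key.
Qed.

End TimeSlice.

(** * Consequences of the structural assumption *)

Section Structure.
Context {R : realType} {n m : nat}.
Local Notation N := (n + m)%N.
Local Notation E := ('cV[R]_N * 'cV[R]_N)%type.

(** Only H is assumed smooth, not the two terms of its decomposition; they are compared with H
    through difference quotients. *)
Lemma derive_quot (V : normedModType R) (f g : V -> R) v x :
  (forall h : R, f (h *: v + x) - f x = g (h *: v + x) - g x) -> 'D_v f x = 'D_v g x.
Proof.
move=> fg; rewrite /derive; set F := fun h : R => _; set G := fun h : R => _.
by suff -> : F = G by []; apply/funext => h; rewrite /F /G /= fg.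
Qed.

Lemma derive_invariant (V : normedModType R) (f : V -> R) v x :
  (forall h : R, f (h *: v + x) = f x) -> 'D_v f x = 0.
Proof.
move=> fv; rewrite (@derive_quot _ f (cst 0) v x) ?derive_cst // => h.
by rewrite fv /cst !subrr.
Qed.

Lemma dirl1 (h : R) (a : 'I_N) (z : E) : (h *: dir (inl a) + z).1 = h *: delta_mx a 0 + z.1.
Proof. by []. Qed.
Lemma dirl2 (h : R) (a : 'I_N) (z : E) : (h *: dir (inl a) + z).2 = z.2.
Proof. by rewrite /= scaler0 add0r. Qed.
Lemma dirr1 (h : R) (a : 'I_N) (z : E) : (h *: dir (inr a) + z).1 = z.1.
Proof. by rewrite /= scaler0 add0r. Qed.
Lemma dirr2 (h : R) (a : 'I_N) (z : E) : (h *: dir (inr a) + z).2 = h *: delta_mx a 0 + z.2.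
Proof. by []. Qed.

Lemma usub_delta_r (a : 'I_m) (h : R) (x : 'cV[R]_N) :
  usubmx (h *: delta_mx (rshift n a) 0 + x) = usubmx x.
Proof.
apply/matrixP => i j; rewrite !mxE.
by rewrite eq_sym eq_rlshift mulr0 add0r.
Qed.

(** A row vector killed by A makes the quadratic form vanish. *)
Lemma posdef_unit d (A : 'M[R]_d) (ka : R) : 0 < ka ->
  (forall x : 'I_d -> R, ka * \sum_i x i ^+ 2 <= \sum_i \sum_j A i j * x i * x j) ->
  A \in unitmx.
Proof.
move=> ka0 hA; rewrite -row_free_unit; apply/row_freeP.
suff inj : forall x : 'rV[R]_d, x *m A = 0 -> x = 0.
  have : kermx A == 0.
    apply/eqP/row_matrixP => i; rewrite row0; apply: inj.
    by rewrite -row_mul mulmx_ker row0.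
  by rewrite kermx_eq0 => /row_freeP.
move=> x xA; have := hA (fun i => x 0 i).
have -> : \sum_i \sum_j A i j * x 0 i * x 0 j = 0.
  rewrite exchange_big big1 //= => j _; rewrite -mulr_suml.
  have := congr1 (fun B : 'rV[R]_d => B 0 j) xA; rewrite !mxE => e.
  suff -> : \sum_i A i j * x 0 i = 0 by rewrite mul0r.
  by rewrite -[RHS]e; apply: eq_bigr => i _; rewrite mulrC.
rewrite pmulr_rle0 // => h; apply/rowP => i; rewrite mxE; apply/eqP.
rewrite -sqrf_eq0; have h0 : \sum_i x 0 i ^+ 2 == 0.
  by rewrite eq_le h sumr_ge0 // => j _; exact: sqr_ge0.
by move: h0; rewrite psumr_eq0 ?[in X in X -> _]/= => [/allP/(_ i (mem_index_enum i))|j _]; rewrite ?sqr_ge0.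
Qed.

Variables (J : 'M[R]_N) (H : 'cV[R]_N -> 'cV[R]_N -> R).
Hypothesis J_sym : J^T = J.

Lemma invJ_sym a b : invmx J a b = invmx J b a.
Proof.
have h : (invmx J)^T = invmx J by rewrite trmx_inv J_sym.
by rewrite -{1}h mxE.
Qed.

Lemma impulse_quad a (x : 'cV[R]_N) (h : R) :
  impulse J (h *: delta_mx a 0 + x) =
  impulse J x + h * (\sum_b invmx J a b * x b 0) + h * h * impulse J (delta_mx a 0).
Proof.
pose B (x y : 'cV[R]_N) : R := (x^T *m invmx J *m y) 0 0.
have BD x' y z : B (x' + y) z = B x' z + B y z by rewrite /B linearD /= !mulmxDl mxE.
have BD' x' y z : B x' (y + z) = B x' y + B x' z by rewrite /B mulmxDr mxE.
have BZ k x' y : B (k *: x') y = k * B x' y by rewrite /B linearZ /= -!scalemxAl mxE.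
have BZ' k x' y : B x' (k *: y) = k * B x' y by rewrite /B -scalemxAr mxE.
have BC x' y : B x' y = B y x'.
  have JT : (invmx J)^T = invmx J by rewrite trmx_inv J_sym.
  by rewrite /B -[x'^T *m _ *m y]trmxK mxE !trmx_mul trmxK JT mulmxA.
have Bd x' : B (delta_mx a 0) x' = \sum_b invmx J a b * x' b 0.
  rewrite /B -mulmxA trmx_delta -rowE mxE.
  by rewrite mxE.
rewrite /impulse -/(B _ _) -/(B _ _) -/(B _ _) -Bd BD !BD' !BZ !BZ' (BC x).
by field.
Qed.

Variables (D : set ('cV[R]_N * 'cV[R]_n)) (C : set R).
Definition profile_dom : set E := [set z | D (z.1, usubmx z.2)].
Local Notation Om := profile_dom.

Lemma Om_open : open D -> open Om.
Proof.
move=> oD.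
have -> : Om = (fun z : E => (z.1, usubmx z.2)) @^-1` D by [].
apply: open_comp => // z _.
have f1 : (fun z : E => z.1) @ z --> z.1 by exact: cvg_fst.
have f2 : {for z, continuous (fun z : E => usubmx z.2 : 'cV[R]_n)}.
  apply: (@continuous_comp _ _ _ snd (usubmx : 'cV[R]_N -> 'cV[R]_n)); first exact: cvg_snd.
  exact: usubmx_continuous.
exact: (cvg_pair f1 f2).
Qed.

Hypothesis H_struct : structural D C J H.

Lemma structural_SM : open Om /\ SM Om (unc H).
Proof.
case: H_struct => HI HE ka oD _ sH _ _ _ _.
by split; [exact: Om_open|exact: (smooth_SM sH)].
Qed.

Lemma structural_dUx (a : 'I_m) z : Om z -> unc (dUx (rshift n a) H) z = 0.
Proof.
have [oOm _] := structural_SM; case: H_struct => HI HE ka _ _ _ hH _ _ _ Oz.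
pose F (y : E) := HI (usubmx y.1) (dsubmx y.1) + HE (usubmx y.1) (usubmx y.2).
have uF y : Om y -> unc H y = F y by move=> Oy; exact: hH.
rewrite dUxE (SM_Deq oOm _ uF Oz); apply: derive_invariant => h.
by rewrite /F dirr1 dirr2 usub_delta_r.
Qed.

(** The term E(v, v_x) cancels in the difference quotient of H along u, so the u-derivative does not
    see U_x. *)
Lemma structural_dUxdU (a : 'I_m) b z : Om z -> unc (dUx b (dU (rshift n a) H)) z = 0.
Proof.
have [oOm _] := structural_SM; case: H_struct => HI HE ka _ _ _ hH _ _ _ Oz.
pose F (y : E) := HI (usubmx y.1) (dsubmx y.1) + HE (usubmx y.1) (usubmx y.2).
have uF y : Om y -> unc H y = F y by move=> Oy; exact: hH.
pose F1 (y : E) := HI (usubmx y.1) (dsubmx y.1).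
have uF1 y : Om y -> 'D_(dir (inl (rshift n a))) (unc H) y = 'D_(dir (inl (rshift n a))) F1 y.
  move=> Oy; rewrite (SM_Deq oOm _ uF Oy); apply: derive_quot => h.
  by rewrite /F dirl1 dirl2 usub_delta_r -/(F1 y) /F1 dirl1 usub_delta_r; ring.
rewrite dUxdUE (SM_Deq oOm _ uF1 Oz); apply: derive_invariant => h.
rewrite /derive; set G := fun h : R => _; set G' := fun h : R => _.
suff -> : G = G' by [].
have e1 (y y' : E) : y.1 = y'.1 -> F1 y = F1 y' by rewrite /F1 => ->.
by apply/funext => h'; congr (_ *: (_ - _)); apply: e1; rewrite /= scaler0 add0r.
Qed.

(** The impulse does not involve U_x, so convexity of H + c Q in v_x is convexity of H. *)
Lemma structural_dv z : (exists c, C c) -> Om z ->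
  \matrix_(i, j) unc (dUx (lshift m j) (dUx (lshift m i) H)) z \in unitmx.
Proof.
move=> [c Cc] Oz; case: H_struct => HI HE ka _ _ _ hH ka0 hv _.
apply: (posdef_unit ka0) => x.
have := hv z.1 z.2 c x Oz Cc; move=> /le_trans; apply.
rewrite le_eqVlt; apply/orP; left; apply/eqP.
apply: eq_bigr => i _; apply: eq_bigr => j _; apply: (congr1 (fun y => y * x i * x j)).
rewrite mxE.
pose Hc (U' p' : 'cV[R]_N) := H U' p' + c * impulse J U'.
transitivity (unc (dUx (lshift m j) (dUx (lshift m i) Hc)) z); first by [].
apply: (etrans (dUxdUxE _ _ _ _)); apply: (etrans _ (esym (dUxdUxE _ _ _ _))).
apply: derive_ext => y; apply: derive_quot => h.
by rewrite /unc /Hc !dirr1; ring.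
Qed.

(** This is the Hessian of H + c Q in u; its invertibility allows u to be eliminated from the
    first-order system. *)
Lemma structural_auu z c : C c -> Om z ->
  \matrix_(i, j) (unc (dU (rshift n j) (dU (rshift n i) H)) z
    + c * invmx J (rshift n i) (rshift n j)) \in unitmx.
Proof.
have [oOm sH] := structural_SM.
move=> Cc Oz; case: H_struct => HI HE ka _ _ _ hH ka0 _ hu.
apply: (posdef_unit ka0) => x.
have := hu z.1 z.2 c x Oz Cc; move=> /le_trans; apply.
rewrite le_eqVlt; apply/orP; left; apply/eqP.
apply: eq_bigr => i _; apply: eq_bigr => j _; apply: (congr1 (fun y => y * x i * x j)).
rewrite mxE.
pose Hc (U' p' : 'cV[R]_N) := H U' p' + c * impulse J U'.
transitivity (unc (dU (rshift n j) (dU (rshift n i) Hc)) z); first by [].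
apply: (etrans (dUdUE _ _ _ _)); apply: (etrans _ (congr1 (fun y => y + _) (esym (dUdUE _ _ _ _)))).
set a := rshift n i; set b := rshift n j.
have h1 y : Om y -> 'D_(dir (inl a)) (unc Hc) y =
    'D_(dir (inl a)) (unc H) y + c * (\sum_b invmx J a b * y.1 b 0).
  move=> Oy.
  have d1 : derivable (unc H) y (dir (inl a)) by exact: (SM_derivable sH Oy).
  have d2 : is_derive y (dir (inl a)) (fun y : E => c * impulse J y.1)
      (c * (\sum_b invmx J a b * y.1 b 0)).
    apply: (@derive_quad _ _ _ _ _ _ (c * impulse J (delta_mx a 0))) => h.
    by rewrite dirl1 impulse_quad; ring.
  rewrite (_ : unc Hc = unc H + (fun y : E => c * impulse J y.1)) //.
  by rewrite deriveD // derive_val.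
rewrite (SM_Deq oOm _ h1 Oz).
have d1 : derivable ('D_(dir (inl a)) (unc H)) z (dir (inl b)).
  exact: (SM_derivable (SM_D (dir (inl a)) sH) Oz).
have d2 : is_derive z (dir (inl b)) (fun y : E => c * (\sum_b invmx J a b * y.1 b 0)) (c * invmx J a b).
  apply: (@derive_quad _ _ _ _ _ _ 0) => h.
  have -> : \sum_b0 invmx J a b0 * (h *: dir (inl b) + z).1 b0 0 =
      h * invmx J a b + \sum_b0 invmx J a b0 * z.1 b0 0.
    rewrite (eq_bigr (fun b0 => h * (invmx J a b0 * (b0 == b)%:R) + invmx J a b0 * z.1 b0 0)).
      rewrite big_split /= -mulr_sumr; congr (_ * _ + _).
      by rewrite (bigD1 b) //= eqxx mulr1 big1 ?addr0 // => b' /negPf ->; rewrite mulr0.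
    by move=> b0 _; rewrite dirl1 !mxE andbT; ring.
  by ring.
rewrite (_ : (fun y : E => _) = ('D_(dir (inl a)) (unc H)) + (fun y : E => c * (\sum_b invmx J a b * y.1 b 0))) //.
by rewrite deriveD // derive_val.
Qed.

Definition dvm z : 'M[R]_n := \matrix_(i, j) unc (dUx (lshift m j) (dUx (lshift m i) H)) z.
Definition bvm z : 'M[R]_n := \matrix_(i, j) unc (dUx (lshift m j) (dU (lshift m i) H)) z.

Lemma dUxdUx_block i j z : Om z ->
  unc (dUx j (dUx i H)) z = (block_mx (dvm z) 0 0 0 : 'M[R]_N) i j.
Proof.
move=> Oz; have [oOm sH] := structural_SM.
have e0 i' j' : unc (dUx j' (dUx (rshift n i') H)) z = 0.
  apply: (etrans (dUxdUxE _ _ _ _)).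
  have e y : Om y -> 'D_(dir (inr (rshift n i'))) (unc H) y = 0.
    by move=> Oy; rewrite -dUxE; exact: structural_dUx.
  by rewrite (SM_Deq oOm _ e Oz) derive_cst.
case: (split_ordP i) => i' ->; case: (split_ordP j) => j' ->.
- by rewrite block_mxEul mxE.
- by rewrite block_mxEur mxE (dUxdUx_sym _ _ oOm sH Oz) e0.
- by rewrite block_mxEdl mxE e0.
- by rewrite block_mxEdr mxE e0.
Qed.

Lemma dUxdU_block i j z : Om z ->
  unc (dUx j (dU i H)) z = (block_mx (bvm z) 0 0 0 : 'M[R]_N) i j.
Proof.
move=> Oz; have [oOm sH] := structural_SM.
have e0 i' j' : unc (dU j' (dUx (rshift n i') H)) z = 0.
  apply: (etrans (dUdUxE _ _ _ _)).
  have e y : Om y -> 'D_(dir (inr (rshift n i'))) (unc H) y = 0.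
    by move=> Oy; rewrite -dUxE; exact: structural_dUx.
  by rewrite (SM_Deq oOm _ e Oz) derive_cst.
case: (split_ordP i) => i' ->; case: (split_ordP j) => j' ->.
- by rewrite block_mxEul mxE.
- by rewrite block_mxEur mxE -(dUdUx_sym _ _ oOm sH Oz) e0.
- by rewrite block_mxEdl mxE structural_dUxdU.
- by rewrite block_mxEdr mxE structural_dUxdU.
Qed.

Lemma dUdUx_block i j z : Om z ->
  unc (dU j (dUx i H)) z = (block_mx (bvm z)^T 0 0 0 : 'M[R]_N) i j.
Proof.
move=> Oz; have [oOm sH] := structural_SM.
rewrite (dUdUx_sym _ _ oOm sH Oz) dUxdU_block //.
case: (split_ordP i) => i' ->; case: (split_ordP j) => j' ->.
- by rewrite !block_mxEul [RHS]mxE.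
- by rewrite block_mxEur block_mxEdl !mxE.
- by rewrite block_mxEur block_mxEdl !mxE.
- by rewrite !block_mxEdr !mxE.
Qed.

End Structure.

(** * Smoothness of inverse matrices *)

Section SmoothMatrix.
Context {R : realType} {V : normedModType R}.
Variable A : set V.
Hypothesis oA : open A.
Implicit Types f g : V -> R.

Lemma smnV k f : SM A f -> (forall x, A x -> f x != 0) -> smn A k (fun x => (f x)^-1).
Proof.
move=> sf f0; elim: k => [|k IH]; split => //.
- by move=> x Ax; apply: differentiableV; [exact: SM_diff sf Ax|exact: f0].
- by move=> x Ax; apply: differentiableV; [exact: SM_diff sf Ax|exact: f0].
move=> v; have s2 := smnM oA (smnM oA (smn_cst oA k (-1)) (SM_D v sf k)) (smnM oA IH IH).
apply: (smn_eq oA _ s2) => x Ax.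
rewrite deriveV ?f0 //; last exact: (SM_derivable sf Ax).
by rewrite /GRing.scale /= -exprVn expr2; ring.
Qed.

Lemma SMV f : SM A f -> (forall x, A x -> f x != 0) -> SM A (fun x => (f x)^-1).
Proof. by move=> sf f0 k; exact: smnV. Qed.

Lemma SM_prod (I : Type) (r : seq I) (F : I -> V -> R) : (forall i, SM A (F i)) ->
  SM A (fun x => \prod_(i <- r) F i x).
Proof.
move=> sF; elim: r => [|i r IH].
  by apply: (SM_eq oA _ (SM_cst oA 1)) => x _; rewrite big_nil.
by apply: (SM_eq oA _ (SMM oA (sF i) IH)) => x _; rewrite big_cons.
Qed.

Definition mSM m n (F : V -> 'M[R]_(m, n)) := forall i j, SM A (fun x => F x i j).

Lemma SM_det n (F : V -> 'M[R]_n) : mSM F -> SM A (fun x => \det (F x)).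
Proof.
move=> sF; apply: (SM_sum oA) => s; apply: (SMM oA); first exact: SM_cst.
by apply: SM_prod => i; exact: sF.
Qed.

Lemma mSM_invmx n (F : V -> 'M[R]_n) : mSM F -> (forall x, A x -> F x \in unitmx) ->
  mSM (fun x => invmx (F x)).
Proof.
move=> sF uF i j.
have s1 : SM A (fun x => (\det (F x))^-1).
  by apply: SMV; [exact: SM_det|move=> x /uF; rewrite unitmxE unitfE].
have s2 : SM A (fun x => cofactor (F x) j i).
  apply: (SMM oA); first exact: SM_cst.
  by apply: SM_det => a b; apply: (SM_eq oA _ (sF (lift j a) (lift i b))) => x _; rewrite !mxE.
apply: (SM_eq oA _ (SMM oA s1 s2)) => x Ax.
by rewrite /invmx uF // !mxE.
Qed.

End SmoothMatrix.

(** * Smooth functions on the line and periodic Sobolev spaces *)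

Section SmoothLine.
Context {R : realType}.
Local Notation C := R[i].
Local Notation Re := (@complex.Re R).
Local Notation Im := (@complex.Im R).
Local Notation SMR := (@SM R R setT).

Lemma SMR_rder (f : R -> R) : SMR f -> rder f (fun t => 'D_1 f t).
Proof.
by move=> sf t; apply: DeriveDef => //; exact: (SM_derivable sf I).
Qed.

(** On the line every directional derivative is a multiple of the derivative. *)
Lemma smn_rder k (f g : R -> R) : rder f g -> @smn R R setT k g -> @smn R R setT k.+1 f.
Proof.
move=> fg sg; have df x : differentiable f x.
  by apply/derivable1_diffP; case: (fg x).
split => [x _ //|v]; apply: (smn_eq openT _ (smnM openT (smn_cst openT k v) sg)) => x _.
by rewrite deriveE // -[v in 'd f x v]mulr1 linearZ /= -deriveE // (@derive_val _ _ _ _ _ _ _ (fg x)).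
Qed.

Lemma SM_slice K (O : set 'cV[R]_K) (f : R * 'cV[R]_K -> R) W : SM (tdom O) f -> O W ->
  SMR (fun t => f (t, W)).
Proof.
move=> sf OW k; elim: k f sf => [|k IH] f sf.
  split=> // x _; apply/derivable1_diffP; by case: (SM_rder sf OW x).
by apply: smn_rder (SM_rder sf OW) _; apply: (IH (fun z => 'D_Dt f z)); exact: SM_D.
Qed.

Definition csm (f : R -> C) := SMR (fun t => Re (f t)) /\ SMR (fun t => Im (f t)).

Lemma csm_ext (f g : R -> C) : f =1 g -> csm f -> csm g.
Proof. by move=> /funext ->. Qed.

Lemma csm_cont (f : R -> C) : csm f -> ccont f.
Proof. by move=> [s1 s2]; split; exact: rder_cont (SMR_rder _). Qed.

Lemma csm_der (f : R -> C) : csm f -> exists2 g, cder f g & csm g.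
Proof.
move=> [s1 s2]; exists (fun t => 'D_1 (fun t => Re (f t)) t +i* 'D_1 (fun t => Im (f t)) t).
  by split; exact: SMR_rder.
by split; exact: SM_D.
Qed.

Lemma csmD (f g : R -> C) : csm f -> csm g -> csm (fun t => f t + g t).
Proof.
move=> [f1 f2] [g1 g2]; split.
  by apply: (SM_eq openT _ (SMD openT f1 g1)) => t _; rewrite cReD.
by apply: (SM_eq openT _ (SMD openT f2 g2)) => t _; rewrite cImD.
Qed.

Lemma csm_cst a : csm (fun=> a).
Proof. by split; exact: (SM_cst openT). Qed.

Lemma csmM (f g : R -> C) : csm f -> csm g -> csm (fun t => f t * g t).
Proof.
move=> [f1 f2] [g1 g2]; split.
  by apply: (SM_eq openT _ (SMB openT (SMM openT f1 g1) (SMM openT f2 g2))) => t _; rewrite cReM.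
by apply: (SM_eq openT _ (SMD openT (SMM openT f1 g2) (SMM openT f2 g1))) => t _; rewrite cImM.
Qed.

Lemma csm_real (f : R -> R) : SMR f -> csm (fun t => (f t)%:C).
Proof. by move=> sf; split => //; exact: (SM_cst openT). Qed.

Definition mcsm m n (F : R -> 'M[C]_(m, n)) := forall i j, csm (fun t => F t i j).

Lemma mcsm_cont m n (F : R -> 'M[C]_(m, n)) : mcsm F -> mcont F.
Proof. by move=> sF i j; exact: csm_cont. Qed.

Lemma mcsmD m n (F G : R -> 'M[C]_(m, n)) : mcsm F -> mcsm G -> mcsm (fun t => F t + G t).
Proof. by move=> sF sG i j; apply: (csm_ext _ (csmD (sF i j) (sG i j))) => t; rewrite mxE. Qed.

Lemma mcsm_cst m n (M : 'M[C]_(m, n)) : mcsm (fun=> M).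
Proof. by move=> i j; exact: csm_cst. Qed.

Lemma mcsmZ m n a (F : R -> 'M[C]_(m, n)) : mcsm F -> mcsm (fun t => a *: F t).
Proof. by move=> sF i j; apply: (csm_ext _ (csmM (csm_cst a) (sF i j))) => t; rewrite mxE. Qed.

Lemma csm_sum (I : Type) (r : seq I) (F : I -> R -> C) : (forall i, csm (F i)) ->
  csm (fun t => \sum_(i <- r) F i t).
Proof.
move=> sF; elim: r => [|i r IH].
  by apply: (csm_ext _ (csm_cst 0)) => t; rewrite big_nil.
by apply: (csm_ext _ (csmD (sF i) IH)) => t; rewrite big_cons.
Qed.

Lemma mcsmM m n p (F : R -> 'M[C]_(m, n)) (G : R -> 'M[C]_(n, p)) :
  mcsm F -> mcsm G -> mcsm (fun t => F t *m G t).
Proof.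
move=> sF sG i j.
have s := csm_sum (index_enum 'I_n) (fun l => csmM (sF i l) (sG l j)).
by apply: (csm_ext _ s) => t; rewrite mxE.
Qed.

Definition mcx m n (F : R -> 'M[R]_(m, n)) t : 'M[C]_(m, n) := map_mx (real_complex R) (F t).

Lemma mcsm_cx m n (F : R -> 'M[R]_(m, n)) : @mSM R R setT m n F -> mcsm (mcx F).
Proof. by move=> sF i j; apply: (csm_ext _ (csm_real (sF i j))) => t; rewrite mxE. Qed.

(** Bootstrap: regularity of order k for z passes to A z + B, which is the derivative of z. *)
Lemma ode_mcsm p n (A : R -> 'M[C]_p) (B z : R -> 'M[C]_(p, n)) : mcsm A -> mcsm B ->
  mder z (fun t => A t *m z t + B t) -> mcsm z.
Proof.
move=> sA sB dz.
pose ck k (f : R -> C) := @smn R R setT k (fun t => Re (f t)) /\ @smn R R setT k (fun t => Im (f t)).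
have ck_ext k f g : f =1 g -> ck k f -> ck k g by move=> /funext ->.
have ckD k f g : ck k f -> ck k g -> ck k (fun t => f t + g t).
  move=> [f1 f2] [g1 g2]; split.
    by apply: (smn_eq openT _ (smnD openT f1 g1)) => t _; rewrite cReD.
  by apply: (smn_eq openT _ (smnD openT f2 g2)) => t _; rewrite cImD.
have ckM k f g : csm f -> ck k g -> ck k (fun t => f t * g t).
  move=> [/(_ k) f1 /(_ k) f2] [g1 g2]; split.
    have h := smnD openT (smnM openT f1 g1) (smnM openT (smnM openT (smn_cst openT k (-1)) f2) g2).
    by apply: (smn_eq openT _ h) => t _; rewrite cReM; ring.
  by apply: (smn_eq openT _ (smnD openT (smnM openT f1 g2) (smnM openT f2 g1))) => t _; rewrite cImM.
have ck0 k : ck k (fun=> 0) by split; exact: (smn_cst openT).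
have ck_sum k (F : 'I_p -> R -> C) : (forall i, ck k (F i)) -> ck k (fun t => \sum_i F i t).
  move=> sF; elim: (index_enum 'I_p) => [|i r IH].
    by apply: (ck_ext _ _ _ _ (ck0 k)) => t; rewrite big_nil.
  by apply: (ck_ext _ _ _ _ (ckD _ _ _ (sF i) IH)) => t; rewrite big_cons.
have h k : forall i j, ck k (fun t => z t i j).
  elim: k => [|k IH] i j.
    by case: (dz i j) => d1 d2; split; split=> // x _; apply/derivable1_diffP;
      [case: (d1 x)|case: (d2 x)].
  have hg : ck k (fun t => (A t *m z t + B t) i j).
    have h1 := ck_sum k _ (fun l => ckM k _ _ (sA i l) (IH l j)).
    have h2 : ck k (fun t => B t i j) by case: (sB i j) => s1 s2; split.
    by apply: (ck_ext _ _ _ _ (ckD _ _ _ h1 h2)) => t; rewrite !mxE.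
  by case: (dz i j) => d1 d2; case: hg => g1 g2; split; [exact: smn_rder d1 g1|exact: smn_rder d2 g2].
by move=> i j; split=> k; case: (h k i j).
Qed.

Lemma csm_L2 (f : R -> C) : periodic f 1 -> csm f -> L2per f.
Proof.
move=> pf /csm_cont[c1 c2]; split => //; [exact: continuous_measurable_fun..|].
pose g t := Re (f t) ^+ 2 + Im (f t) ^+ 2.
have cg : continuous g by apply: rcontD; rewrite /g; apply: (rcontM (f := fun t => _ (f t))).
have fg : L2norm2 f = (\int[lebesgue_measure]_(t in `[0%R, 1%R]) (g t)%:E)%E.
  apply: eq_integral => t _; congr EFin; rewrite /g; case: (f t) => x y /=.
  by rewrite sqr_sqrtr // addr_ge0 // sqr_ge0.
rewrite fg; apply: integrable_lty => //.
by apply: continuous_compact_integrable; [exact: segment_compact|exact: continuous_subspaceT].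
Qed.

Lemma rint_FTC (F f : R -> R) (x : R) : rder F f -> continuous f -> 0 <= x ->
  (\int[lebesgue_measure]_(t in `[0, x]) f t)%R = F x - F 0.
Proof.
move=> Ff cf; rewrite le_eqVlt => /predU1P[<-|x0].
  by rewrite subrr set_itv1 /Rintegral integral_set1.
rewrite /Rintegral (@continuous_FTC2 _ f F 0 x) //=.
- exact: continuous_subspaceT.
- split.
  + by move=> y _; case: (Ff y).
  + by apply: cvg_at_right_filter; exact: (rder_cont Ff).
  + by apply: cvg_at_left_filter; exact: (rder_cont Ff).
- by move=> y _; rewrite (rder_derive1 y Ff).
Qed.

Lemma cder_periodic (f g : R -> C) : periodic f 1 -> cder f g -> periodic g 1.
Proof.
move=> pf fg; have h := cder_shift 1 fg.
have h' : cder f (fun t => g (t + 1)) by apply: (cder_ext h _ (fun=> erefl)) => s; rewrite pf.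
exact: (cder_uniq h' fg).
Qed.

Lemma cder_wderiv (f g : R -> C) : periodic f 1 -> cder f g -> csm g -> wderiv f g.
Proof.
move=> pf fg sg; have cg := csm_cont sg.
split => //; first by apply: csm_L2 => //; exact: cder_periodic fg.
move=> x /andP[x0 _]; case: fg => d1 d2; case: cg => c1 c2.
rewrite /cintegral (rint_FTC d1 c1 x0) (rint_FTC d2 c2 x0).
have alg (a b : C) : a = b + ((Re a - Re b) +i* (Im a - Im b)).
  by apply: cplx_ext; rewrite ?cReD ?cImD /=; ring.
exact: alg.
Qed.

(** This is how solutions of the first-order system enter the domain of the Bloch operators: their
    weak derivatives are classical ones. *)
Lemma csm_Hper k (f : R -> C) : periodic f 1 -> csm f -> Hper k f.
Proof.
elim: k f => [|k IH] f pf sf; first exact: csm_L2.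
have [g fg sg] := csm_der sf; exists g; split; first exact: cder_wderiv.
by apply: IH => //; exact: cder_periodic fg.
Qed.

End SmoothLine.

(** * Block matrices of smooth functions *)

Section BlockCalculus.
Context {R : realType}.
Local Notation C := R[i].

Lemma mder_col m1 m2 n (F F' : R -> 'M[C]_(m1, n)) (G G' : R -> 'M[C]_(m2, n)) :
  mder F F' -> mder G G' ->
  mder (fun t => col_mx (F t) (G t)) (fun t => col_mx (F' t) (G' t)).
Proof.
move=> dF dG i j; case: (splitP i) => l il.
  have -> : i = lshift m2 l by exact: val_inj.
  by apply: cder_ext (dF l j) _ _ => t; rewrite col_mxEu.
have -> : i = rshift m1 l by exact: val_inj.
by apply: cder_ext (dG l j) _ _ => t; rewrite col_mxEd.
Qed.

Lemma mder_row m n1 n2 (F F' : R -> 'M[C]_(m, n1)) (G G' : R -> 'M[C]_(m, n2)) :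
  mder F F' -> mder G G' ->
  mder (fun t => row_mx (F t) (G t)) (fun t => row_mx (F' t) (G' t)).
Proof.
move=> dF dG i j; case: (splitP j) => l jl.
  have -> : j = lshift n2 l by exact: val_inj.
  by apply: cder_ext (dF i l) _ _ => t; rewrite row_mxEl.
have -> : j = rshift n1 l by exact: val_inj.
by apply: cder_ext (dG i l) _ _ => t; rewrite row_mxEr.
Qed.

Lemma mder_usub m1 m2 n (F F' : R -> 'M[C]_(m1 + m2, n)) : mder F F' ->
  mder (fun t => usubmx (F t)) (fun t => usubmx (F' t)).
Proof. by move=> dF i j; apply: cder_ext (dF (lshift m2 i) j) _ _ => t; rewrite mxE. Qed.

Lemma mcsm_ext m n (F G : R -> 'M[C]_(m, n)) : F =1 G -> mcsm F -> mcsm G.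
Proof. by move=> /funext ->. Qed.

Lemma mcsmN m n (F : R -> 'M[C]_(m, n)) : mcsm F -> mcsm (fun t => - F t).
Proof. by move=> sF; apply: mcsm_ext (mcsmZ (-1) sF) => t; rewrite scaleN1r. Qed.

Lemma mcsmB m n (F G : R -> 'M[C]_(m, n)) : mcsm F -> mcsm G -> mcsm (fun t => F t - G t).
Proof. by move=> sF sG; exact: mcsmD (mcsmN sG). Qed.

Lemma mcsm_tr m n (F : R -> 'M[C]_(m, n)) : mcsm F -> mcsm (fun t => (F t)^T).
Proof. by move=> sF i j; apply: csm_ext (sF j i) => t; rewrite mxE. Qed.

Lemma mcsm_col m1 m2 n (F : R -> 'M[C]_(m1, n)) (G : R -> 'M[C]_(m2, n)) :
  mcsm F -> mcsm G -> mcsm (fun t => col_mx (F t) (G t)).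
Proof.
move=> dF dG i j; case: (splitP i) => l il.
  have -> : i = lshift m2 l by exact: val_inj.
  by apply: csm_ext (dF l j) => t; rewrite col_mxEu.
have -> : i = rshift m1 l by exact: val_inj.
by apply: csm_ext (dG l j) => t; rewrite col_mxEd.
Qed.

Lemma mcsm_usub m1 m2 n (F : R -> 'M[C]_(m1 + m2, n)) : mcsm F -> mcsm (fun t => usubmx (F t)).
Proof. by move=> dF i j; apply: csm_ext (dF (lshift m2 i) j) => t; rewrite mxE. Qed.

Lemma mcsm_submx m1 m2 n1 n2 (F : R -> 'M[C]_(m1 + m2, n1 + n2)) : mcsm F ->
  mcsm (fun t => dlsubmx (F t)).
Proof.
by move=> dF i j; apply: csm_ext (dF (rshift m1 i) (lshift n2 j)) => t; rewrite !mxE.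
Qed.

Definition mD m n (F : R -> 'M[C]_(m, n)) t : 'M[C]_(m, n) :=
  \matrix_(i, j) ('D_1 (fun t => complex.Re (F t i j)) t +i* 'D_1 (fun t => complex.Im (F t i j)) t).

Lemma mD_der m n (F : R -> 'M[C]_(m, n)) : mcsm F -> mder F (mD F).
Proof.
move=> sF i j; have [s1 s2] := sF i j.
by split; [apply: rder_ext (SMR_rder s1) _ _ => t|apply: rder_ext (SMR_rder s2) _ _ => t]; rewrite ?mxE.
Qed.

Lemma mcsm_mD m n (F : R -> 'M[C]_(m, n)) : mcsm F -> mcsm (mD F).
Proof.
move=> sF i j; have [s1 s2] := sF i j.
apply: (@csm_ext _ (fun t => _ +i* _)); first by move=> t; rewrite mxE.
by split; exact: SM_D.
Qed.

Lemma mder_mcsm m n (F F' : R -> 'M[C]_(m, n)) : mcsm F -> mder F F' -> mcsm F'.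
Proof.
move=> sF dF; apply: mcsm_ext (mcsm_mD sF) => t.
exact: (mder_uniq (mD_der sF) dF t).
Qed.

Lemma mder_per m n (F F' : R -> 'M[C]_(m, n)) : (forall t, F (t + 1) = F t) -> mder F F' ->
  forall t, F' (t + 1) = F' t.
Proof.
move=> pF dF; have h : mder F (fun t => F' (t + 1)).
  by apply: mder_ext (mder_shift 1 dF) _ _ => // t; rewrite pF.
exact: (mder_uniq h dF).
Qed.

Lemma mcsm_wderiv n (V V' : R -> 'cV[C]_n) a : (forall t, V (t + 1) = V t) -> mcsm V ->
  mder V V' -> wderiv (fun t => V t a 0) (fun t => V' t a 0).
Proof.
move=> pV sV dV; apply: cder_wderiv.
- by move=> t; rewrite pV.
- exact: dV.
- exact: (mder_mcsm sV dV).
Qed.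

Lemma csm_lin_domain n m (V : R -> 'cV[C]_(n + m)) : (forall t, V (t + 1) = V t) -> mcsm V ->
  lin_domain V.
Proof.
move=> pV sV; have h i : periodic (fun t => V t i 0) 1 by move=> t; rewrite pV.
by split=> i; apply: csm_Hper; [exact: h|exact: sV|exact: h|exact: sV].
Qed.

Lemma csm_vL2per n m (V : R -> 'cV[C]_(n + m)) : (forall t, V (t + 1) = V t) -> mcsm V ->
  vL2per V.
Proof. by move=> pV sV i; apply: csm_L2; [move=> t; rewrite pV|exact: sV]. Qed.

End BlockCalculus.

(** * The Bloch problem as a first-order system *)

Section System.
Context {R : realType} {n m : nat}.
Local Notation C := R[i].
Local Notation N := (n + m)%N.
Local Notation p := (n + (n + N))%N.
Local Notation K := (1 + (N + 1))%N.
Local Notation dl := (row_mx 1%:M 0 : 'rV[C]_(1 + (N + 1))).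

(** In the application a is H_UU + c J^-1, while b and dv are the blocks of mixed derivatives in (v,
    v_x) and of second derivatives in v_x, along the profile. The index 1 marks derivatives in
    theta, the index j derivatives in (k, M, P); cr and Lj are the derivatives of the speed and of
    the integration constants. *)
Variables (k : R) (Jc Jic : 'M[C]_N) (a : R -> 'M[C]_N) (b dv : R -> 'M[C]_n).
Variables (U U1 : R -> 'cV[C]_N) (P1 X1 : R -> 'cV[C]_n).
Variables (Uj : R -> 'M[C]_(N, K)) (Pj Xj : R -> 'M[C]_(n, K)) (cr : 'rV[C]_K) (Lj : 'M[C]_(N, K)).
Variables (E1 R1 : R -> 'M[C]_(n, K)).

Local Notation kC := k%:C.
Let JU t := Jic *m U t.
Let E t := dv t *m usubmx (Uj t).
Let Rj t := b t *m usubmx (Uj t) - Xj t - kC *: E1 t.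
Let auv t := dlsubmx (a t).
Let auu t := drsubmx (a t).

Hypothesis k_gt0 : 0 < k.
Hypotheses (JJi : Jc *m Jic = 1%:M) (Jic_sym : Jic^T = Jic).
Hypotheses (a_sym : forall t, (a t)^T = a t) (dv_sym : forall t, (dv t)^T = dv t).
Hypotheses (auu_unit : forall t, auu t \in unitmx) (dv_unit : forall t, dv t \in unitmx).
Hypotheses (sa : mcsm a) (sb : mcsm b) (sd : mcsm dv) (sdi : mcsm (fun t => invmx (dv t)))
  (saui : mcsm (fun t => invmx (auu t))) (sU : mcsm U) (sXj : mcsm Xj) (sUj : mcsm Uj)
  (sX1 : mcsm X1).
Hypotheses (pera : forall t, a (t + 1) = a t) (perb : forall t, b (t + 1) = b t)
  (perd : forall t, dv (t + 1) = dv t) (perU : forall t, U (t + 1) = U t)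
  (perX1 : forall t, X1 (t + 1) = X1 t)
  (perUj : forall t, Uj (t + 1) = Uj t) (perXj : forall t, Xj (t + 1) = Xj t).
Hypothesis derU : mder U U1.
Hypothesis dU1 : mder (fun t => usubmx (U1 t)) (fun t => kC^-1 *: P1 t).
Hypothesis X1E : forall t, X1 t = (b t)^T *m usubmx (U1 t) + dv t *m P1 t.
Hypothesis dX1 : mder X1 (fun t => kC^-1 *: (usubmx (a t *m U1 t) + b t *m P1 t)).
Hypothesis aU1 : forall t, dsubmx (a t *m U1 t) = 0.
Hypothesis dUj : mder (fun t => usubmx (Uj t)) (fun t => kC^-1 *: (Pj t - usubmx (U1 t) *m dl)).
Hypothesis XjE : forall t, Xj t = (b t)^T *m usubmx (Uj t) + dv t *m Pj t.
Hypothesis dXj : mder Xj (fun t => kC^-1 *: (usubmx (a t *m Uj t) + b t *m Pj t - X1 t *m dl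
  - usubmx (Lj - JU t *m cr))).
Hypothesis aUj : forall t, dsubmx (a t *m Uj t) = dsubmx (Lj - JU t *m cr).
Hypotheses (dE : mder E E1) (dRj : mder Rj R1).
Hypothesis mUj : mint Uj = row_mx 0 (row_mx 1%:M 0).
Hypothesis mUJUj : mint (fun t => (U t)^T *m (Jic *m Uj t)) = row_mx 0 (row_mx 0 1%:M).

Let di t := invmx (dv t).
Let aui t := invmx (auu t).
Definition Pw : 'M[C]_(n, p) := row_mx 1%:M 0.
Definition PX : 'M[C]_(n, p) := row_mx 0 (row_mx 1%:M 0).
Definition PY : 'M[C]_(N, p) := row_mx 0 (row_mx 0 1%:M).
(* [VM t] recovers V from z: its u-component is the solution of the algebraic
   equation Y_u = (A V)_u. *)
Definition VM t : 'M[C]_(N, p) := col_mx Pw (aui t *m (dsubmx PY - auv t *m Pw)).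
(** Recovers P = k (d_theta + i nu) v from X = b^T v + dv P. *)
Definition W1 t : 'M[C]_(n, p) := di t *m (PX - (b t)^T *m Pw).
(** At eps = 0 the component Y is constant. The eigenvalue enters only the equation k J (d_theta +
    eps) Y = lambda V, hence only [A1]. *)
Definition A0 t : 'M[C]_p := col_mx (kC^-1 *: W1 t)
  (col_mx (kC^-1 *: (usubmx (a t *m VM t) + b t *m W1 t - usubmx PY)) 0).
Definition A1 t : 'M[C]_p := col_mx 0 (col_mx 0 (Jic *m VM t)).

(** The translation mode; its normalization by 1 / k is dictated by the source in [Z0_der]. *)
Definition zt t : 'cV[C]_p := kC^-1 *: col_mx (usubmx (U1 t)) (col_mx (X1 t) 0).
Definition ev t : 'cV[C]_p := kC^-1 *: col_mx 0 (col_mx 0 (Jic *m U1 t)).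
(** The last block comes from differentiating E(H + c Q)[U] = lambda along the parameters. *)
Definition Z0 t : 'M[C]_(p, K) := col_mx (usubmx (Uj t)) (col_mx (Xj t) (Lj - JU t *m cr)).
(* Second-order correctors, which make [zt / eps + Z0 + eps * Z1] an approximate
   solution, with residue of order 1 equal to [SS]. *)
Definition Z1 t : 'M[C]_(p, K) := col_mx 0 (col_mx (kC *: E t) (kC *: col_mx (Rj t) 0)).
Definition SS t : 'M[C]_(p, K) := col_mx 0 (col_mx 0 (Lj - JU t *m cr + kC *: col_mx (R1 t) 0)).
(* Rows of adjoint solutions: the first N ones come from the conservation of M,
   the last one from the conservation of P. *)
Definition LL t : 'M[C]_(N + 1, p) := col_mx (row_mx 0 (row_mx 0 Jc))
  (row_mx (- kC *: (X1 t)^T) (row_mx (kC *: (usubmx (U1 t))^T) (U t)^T)).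

Lemma usub0 m1 m2 q : usubmx (0 : 'M[C]_(m1 + m2, q)) = 0.
Proof. exact: linear0. Qed.
Lemma dsub0 m1 m2 q : dsubmx (0 : 'M[C]_(m1 + m2, q)) = 0.
Proof. exact: linear0. Qed.

Lemma usubD m1 m2 q (x y : 'M[C]_(m1 + m2, q)) : usubmx (x + y) = usubmx x + usubmx y.
Proof. exact: linearD. Qed.
Lemma usubZ m1 m2 q s (x : 'M[C]_(m1 + m2, q)) : usubmx (s *: x) = s *: usubmx x.
Proof. exact: linearZ. Qed.

Lemma kC0 : kC != 0.
Proof. by rewrite eq_complex /= gt_eqF. Qed.

Section Columns.
Variables (q : nat) (w X : 'M[C]_(n, q)) (Y : 'M[C]_(N, q)).
Local Notation z := (col_mx w (col_mx X Y)).

Lemma Pw_col : Pw *m z = w.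
Proof. by rewrite mul_row_col mul1mx mul0mx addr0. Qed.

Lemma PX_col : PX *m z = X.
Proof. by rewrite !mul_row_col mul1mx !mul0mx addr0 add0r. Qed.

Lemma PY_col : PY *m z = Y.
Proof. by rewrite !mul_row_col mul1mx !mul0mx !add0r. Qed.

Lemma VM_col t : VM t *m z = col_mx w (aui t *m (dsubmx Y - auv t *m w)).
Proof. by rewrite mul_col_mx Pw_col -mulmxA mulmxBl mul_dsub_mx PY_col -mulmxA Pw_col. Qed.

Lemma W1_col t : W1 t *m z = di t *m (X - (b t)^T *m w).
Proof. by rewrite -mulmxA mulmxBl PX_col -mulmxA Pw_col. Qed.

Lemma A0_col t : A0 t *m z = col_mx (kC^-1 *: (W1 t *m z))
  (col_mx (kC^-1 *: (usubmx (a t *m (VM t *m z)) + b t *m (W1 t *m z) - usubmx Y)) 0).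
Proof.
rewrite /A0; move: (VM t) (W1 t) => V W.
rewrite mul_col_mx -scalemxAl mul_col_mx -scalemxAl mul0mx mulmxBl mulmxDl.
rewrite mul_usub_mx mul_usub_mx PY_col mulmxA mulmxA.
reflexivity.
Qed.

Lemma A1_col t : A1 t *m z = col_mx 0 (col_mx 0 (Jic *m (VM t *m z))).
Proof. by rewrite /A1; move: (VM t) => V; rewrite !mul_col_mx !mul0mx mulmxA. Qed.
End Columns.

Lemma col_split q (z : 'M[C]_(p, q)) :
  z = col_mx (Pw *m z) (col_mx (PX *m z) (PY *m z)).
Proof. by rewrite -[z]vsubmxK -[dsubmx z]vsubmxK Pw_col PX_col PY_col. Qed.

Lemma a_dsub q t (V : 'M[C]_(N, q)) :
  dsubmx (a t *m V) = auv t *m usubmx V + auu t *m dsubmx V.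
Proof. by rewrite -{1}[a t]submxK -{1}[V]vsubmxK mul_block_col col_mxKd. Qed.

Lemma VM_eq q t w X (Y V : 'M[C]_(N, q)) : usubmx V = w -> dsubmx (a t *m V) = dsubmx Y ->
  VM t *m col_mx w (col_mx X Y) = V.
Proof.
move=> <- e; rewrite VM_col -e a_dsub addrC addKr mulKmx ?vsubmxK //.
Qed.

Lemma VM_dsub q t (z : 'M[C]_(p, q)) : dsubmx (a t *m (VM t *m z)) = dsubmx (PY *m z).
Proof.
rewrite [z]col_split VM_col a_dsub col_mxKu col_mxKd mulKVmx // PY_col.
by rewrite addrC subrK.
Qed.

Arguments VM_eq [q t w X Y] V _ _.

Lemma W1_eq q t w (X P : 'M[C]_(n, q)) Y : X = (b t)^T *m w + dv t *m P ->
  W1 t *m col_mx w (col_mx X Y) = P.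
Proof. by move=> ->; rewrite W1_col [_ + dv t *m P]addrC addrK mulKmx. Qed.

Arguments W1_eq [q t w X P Y] _.

(** To apply A0 it suffices to exhibit P and V satisfying the algebraic relations that define
    them. *)
Lemma A0_eq q t w (X P : 'M[C]_(n, q)) (Y V : 'M[C]_(N, q)) :
  X = (b t)^T *m w + dv t *m P -> usubmx V = w -> dsubmx (a t *m V) = dsubmx Y ->
  A0 t *m col_mx w (col_mx X Y) = col_mx (kC^-1 *: P)
    (col_mx (kC^-1 *: (usubmx (a t *m V) + b t *m P - usubmx Y)) 0).
Proof. by move=> hX hV hY; apply: (etrans (A0_col _ _ _ _)); rewrite (W1_eq hX) (VM_eq V). Qed.

Lemma VM_usub t : usubmx (VM t) = Pw.
Proof. exact: col_mxKu. Qed.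

Lemma VM_dsub1 t : dsubmx (a t *m VM t) = dsubmx PY.
Proof. by have := VM_dsub t 1%:M; rewrite !mulmx1. Qed.

Lemma LA0 t q (x : 'M[C]_(q, N)) (r : 'M[C]_(q, n)) (s : 'M[C]_(q, n)) :
  row_mx r (row_mx s x) *m A0 t = r *m (kC^-1 *: W1 t) +
    s *m (kC^-1 *: (usubmx (a t *m VM t) + b t *m W1 t - usubmx PY)).
Proof. by rewrite /A0; move: (VM t) (W1 t) => V W; rewrite !mul_row_col mulmx0 addr0. Qed.

Lemma dv_W1 t : dv t *m W1 t = PX - (b t)^T *m Pw.
Proof. by rewrite /W1 mulKVmx. Qed.

Arguments A0_eq [q t w X] P [Y] V _ _ _.

Lemma sVM : mcsm VM.
Proof.
apply: mcsm_col; first exact: mcsm_cst.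
apply: mcsmM => //; apply: mcsmB; first exact: mcsm_cst.
by apply: mcsmM; [exact: mcsm_submx|exact: mcsm_cst].
Qed.

Lemma sW1 : mcsm W1.
Proof.
apply: mcsmM => //; apply: mcsmB; first exact: mcsm_cst.
by apply: mcsmM; [exact: mcsm_tr|exact: mcsm_cst].
Qed.

Lemma sA0 : mcsm A0.
Proof.
apply: mcsm_col; first by apply: mcsmZ; exact: sW1.
apply: mcsm_col; last exact: mcsm_cst.
apply: mcsmZ; apply: mcsmB; last exact: mcsm_cst.
apply: mcsmD; last by apply: mcsmM => //; exact: sW1.
by apply: mcsm_usub; apply: mcsmM => //; exact: sVM.
Qed.

Lemma sA1 : mcsm A1.
Proof.
apply: mcsm_col; first exact: mcsm_cst.
apply: mcsm_col; first exact: mcsm_cst.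
by apply: mcsmM; [exact: mcsm_cst|exact: sVM].
Qed.

Lemma perVM t : VM (t + 1) = VM t. Proof. by rewrite /VM /aui /auu /auv pera. Qed.
Lemma perW1 t : W1 (t + 1) = W1 t. Proof. by rewrite /W1 /di perd perb. Qed.
Lemma perA0 t : A0 (t + 1) = A0 t. Proof. by rewrite /A0 pera perVM perW1 perb. Qed.
Lemma perA1 t : A1 (t + 1) = A1 t. Proof. by rewrite /A1 perVM. Qed.

Local Opaque VM W1 A0 A1.

Lemma VM_zt t : VM t *m zt t = kC^-1 *: U1 t.
Proof. by rewrite -scalemxAr (VM_eq (U1 t)) // aU1 dsub0. Qed.

Lemma VM_Z0 t : VM t *m Z0 t = Uj t.
Proof. exact: (VM_eq (Uj t)). Qed.

Lemma zt_der : mder zt (fun t => A0 t *m zt t).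
Proof.
apply: mder_ext (mderZ kC^-1 (mder_col dU1 (mder_col dX1 (mder_cst 0)))) _ _ => // t.
apply: (etrans _ (scalemxAr _ _ _)); apply: (congr1 (fun x => _ *: x)).
have h : dsubmx (a t *m U1 t) = dsubmx (0 : 'cV[C]_N) by rewrite aU1; exact/esym/dsub0.
by rewrite (A0_eq (P1 t) (U1 t) (X1E t) erefl h) usub0 subr0.
Qed.

Lemma A1_zt t : A1 t *m zt t = ev t.
Proof. by rewrite /zt -scalemxAr A1_col (VM_eq (U1 t)) // aU1 dsub0. Qed.

Lemma JU_der : mder (fun t => Lj - JU t *m cr) (fun t => - (Jic *m U1 t *m cr)).
Proof.
apply: mder_ext (mderB (mder_cst Lj) (mderMr cr (mderMl Jic derU))) _ _ => // t.
by rewrite sub0r.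
Qed.

(** Differentiation in k also hits the factors k in front of d_theta, which gives the source zt dl;
    the change of speed gives the other one. *)
Lemma Z0_der : mder Z0 (fun t => A0 t *m Z0 t - zt t *m dl - ev t *m (kC *: cr)).
Proof.
apply: mder_ext (mder_col dUj (mder_col dXj JU_der)) _ _ => // t.
rewrite /Z0 (A0_eq (Pj t) (Uj t)) ?XjE //.
rewrite /zt /ev -!scalemxAl -scalemxAr scalerA mulVf ?kC0 // scale1r.
rewrite !mul_col_mx !mul0mx !scale_col_mx !scaler0 !opp_col_mx !oppr0 !add_col_mx !addr0 !add0r.
congr col_mx; first by rewrite -scalerBr.
by congr col_mx; rewrite -scalerBr addrAC.
Qed.

(** Z1 has V = 0 and P = k v_j, so that it absorbs the first block of Z0; absorbing the second one
    forces Rj, and the residue is left in the Y-block alone. *)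
Lemma Z1_der : mder Z1 (fun t => A0 t *m Z1 t - Z0 t + SS t).
Proof.
have d1 : mder (fun t => kC *: col_mx (Rj t) 0 : 'M[C]_(N, K)) (fun t => kC *: col_mx (R1 t) 0).
  exact: mderZ (mder_col dRj (mder_cst 0)).
apply: mder_ext (mder_col (mder_cst 0) (mder_col (mderZ kC dE) d1)) _ _ => // t.
rewrite /Z1 (A0_eq (kC *: usubmx (Uj t)) 0); first last.
- by rewrite mulmx0 dsub0 scale_col_mx col_mxKd scaler0.
- exact: usub0.
- by rewrite mulmx0 add0r -scalemxAr.
rewrite /Z0 /SS !opp_col_mx !add_col_mx mulmx0 usub0 add0r addr0.
rewrite scalerA mulVf ?kC0 // scale1r subrr sub0r addKr; congr col_mx; congr col_mx.
rewrite addr0 scale_col_mx col_mxKu -scalemxAr -scalerBr scalerA mulVf ?kC0 // scale1r.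
by rewrite /Rj !opprD !opprK !addrA subrr add0r addrAC subrr add0r.
Qed.

Lemma dotE q r (V : 'M[C]_(N, q)) (W : 'M[C]_(N, r)) :
  V^T *m W = (usubmx V)^T *m usubmx W + (dsubmx V)^T *m dsubmx W.
Proof. by rewrite -{1}[V]vsubmxK -{1}[W]vsubmxK tr_col_mx mul_row_col. Qed.

Lemma row_rows q (x : 'M[C]_(q, n)) (y : 'M[C]_(q, n)) (w : 'M[C]_(q, N)) :
  row_mx x (row_mx y w) = x *m Pw + (y *m PX + w *m PY).
Proof.
rewrite /Pw /PX /PY !mul_mx_row !mulmx1 !mulmx0 !add_row_mx !addr0 !add0r.
by [].
Qed.

(** The first rows are constant because A0 has zero Y-block. The last one is the translation mode
    read through the symplectic form of the pair (v, X) and completed by U; symmetry of a and dv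
    makes it an adjoint solution. *)
Lemma LL_der : mder LL (fun t => - (LL t *m A0 t)).
Proof.
have h : mder (fun t => row_mx (- kC *: (X1 t)^T) (row_mx (kC *: (usubmx (U1 t))^T) (U t)^T))
    (fun t => row_mx (- (usubmx (a t *m U1 t) + b t *m P1 t)^T) (row_mx (P1 t)^T (U1 t)^T)).
  have hk x y (B : 'M[C]_(x, y)) : kC *: (kC^-1 *: B) = B by rewrite scalerA mulfV ?kC0 // scale1r.
  apply: mder_row.
    apply: mder_ext (mderZ (- kC) (mder_tr dX1)) _ _ => // t.
    by rewrite linearZ /= scaleNr hk.
  apply: mder_row; last exact: mder_tr.
  by apply: mder_ext (mderZ kC (mder_tr dU1)) _ _ => // t; rewrite linearZ /= hk.
apply: mder_ext (mder_col (mder_cst _) h) _ _ => // t.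
rewrite /LL mul_col_mx !LA0 !mul0mx !addr0 opp_col_mx oppr0; congr col_mx.
rewrite -!scalemxAl -!scalemxAr !scalerA mulNr mulfV ?kC0 // scaleN1r scale1r opprD opprK.
have e1 : (usubmx (U1 t))^T *m usubmx (a t *m VM t) =
    (usubmx (a t *m U1 t))^T *m Pw - (dsubmx (U1 t))^T *m dsubmx PY.
  have := dotE (U1 t) (a t *m VM t); rewrite VM_dsub1 mulmxA.
  have -> : (U1 t)^T *m a t = (a t *m U1 t)^T by rewrite trmx_mul a_sym.
  by rewrite dotE aU1 trmx0 mul0mx addr0 VM_usub => ->; rewrite addrK.
have e2 : (X1 t)^T *m W1 t = (usubmx (U1 t))^T *m (b t *m W1 t) +
    (P1 t)^T *m PX - (b t *m P1 t)^T *m Pw.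
  rewrite X1E linearD /= !trmx_mul trmxK dv_sym mulmxDl -!mulmxA dv_W1 mulmxBr mulmxA addrA.
  by [].
rewrite e2 mulmxBr mulmxDr e1 row_rows (dotE (U1 t) PY).
rewrite mulNmx linearD /= mulmxDl.
move: (_ *m PX) ((b t *m P1 t)^T *m Pw) (_ *m Pw) (_ *m (b t *m W1 t)) ((usubmx (U1 t))^T *m _)
  ((dsubmx (U1 t))^T *m _) => x1 x2 x3 x4 x5 x6.
apply/matrixP => i j; rewrite !mxE; ring.
Qed.

Lemma per10 (T : Type) (F : R -> T) : (forall t, F (t + 1) = F t) -> F 1 = F 0.
Proof. by move=> pF; rewrite -(pF 0) add0r. Qed.

Lemma mint_col m1 m2 q (F : R -> 'M[C]_(m1, q)) (G : R -> 'M[C]_(m2, q)) :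
  mint (fun t => col_mx (F t) (G t)) = col_mx (mint F) (mint G).
Proof.
apply/matrixP => i j; rewrite [LHS]mxE; case: (splitP i) => l il.
  have -> : i = lshift m2 l by exact: val_inj.
  rewrite col_mxEu mxE; congr cprim; apply/funext => t; exact: col_mxEu.
have -> : i = rshift m1 l by exact: val_inj.
rewrite col_mxEd mxE; congr cprim; apply/funext => t; exact: col_mxEd.
Qed.

Lemma mint_cst q r (B : 'M[C]_(q, r)) : mint (fun=> B) = B.
Proof.
have dB : mder (fun t : R => t%:C *: B) (fun=> B).
  move=> i j; have h : cder (fun t : R => t%:C) (fun=> 1 : C).
    have h1 : rder (fun t : R => t) (fun=> 1) by move=> t; exact: is_derive_id.
 exact: cder_real h1.
  by apply: cder_ext (cderM h (cder_cst (B i j))) _ _ => t; rewrite ?mxE //= mulr0 addr0 mul1r.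
by rewrite (mint_der dB (mcont_cst _)) scale1r scale0r subr0.
Qed.

Lemma sU1 : mcsm U1. Proof. exact: mder_mcsm derU. Qed.
Lemma perU1 t : U1 (t + 1) = U1 t. Proof. exact: (mder_per perU derU). Qed.

Lemma LLcol t q (Y : 'M[C]_(N, q)) :
  LL t *m col_mx 0 (col_mx 0 Y) = col_mx (Jc *m Y) ((U t)^T *m Y).
Proof. by rewrite mul_col_mx !mul_row_col !mulmx0 !add0r. Qed.

Lemma JcK q (Y : 'M[C]_(N, q)) : Jc *m (Jic *m Y) = Y.
Proof. by rewrite mulmxA JJi mul1mx. Qed.

(** The integrand is the derivative of the periodic function (U, Q(U)) / k. *)
Lemma LL_ev : mint (fun t => LL t *m ev t) = 0.
Proof.
pose F t := kC^-1 *: col_mx (U t) (2^-1 *: ((U t)^T *m (Jic *m U t))).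
have dF : mder F (fun t => LL t *m ev t).
  have d2 := mderM (mder_tr derU) (mderMl Jic derU).
  apply: mder_ext (mderZ kC^-1 (mder_col derU (mderZ 2^-1 d2))) _ _ => // t.
  rewrite /ev -scalemxAr LLcol JcK; congr (_ *: col_mx _ _).
  have -> : (U1 t)^T *m (Jic *m U t) = (U t)^T *m (Jic *m U1 t).
    have t11 (x : 'M[C]_1) : x = x^T by apply/matrixP => i j; rewrite (ord1 i) (ord1 j) mxE.
    by rewrite [LHS]t11 !trmx_mul trmxK Jic_sym mulmxA.
  have half (x : 'M[C]_1) : 2^-1 *: (x + x) = x.
    by apply/matrixP => i j; rewrite !mxE; field.
  exact: half.
rewrite (mint_der dF) ?/F ?(per10 perU) ?subrr //.
apply: mcsm_cont; apply: (@mcsm_ext _ _ _ (fun t => kC^-1 *: col_mx (U1 t) ((U t)^T *m (Jic *m U1 t)))).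
  by move=> t; rewrite /ev -scalemxAr LLcol JcK.
apply: mcsmZ; apply: mcsm_col; first exact: sU1.
by apply: mcsmM; [exact: mcsm_tr|apply: mcsmM; [exact: mcsm_cst|exact: sU1]].
Qed.

(** The pairing is the derivative of (M, P) with respect to (k, M, P). *)
Lemma LL_A1Z0 : mint (fun t => LL t *m (A1 t *m Z0 t)) = row_mx 0 1%:M.
Proof.
have -> : (fun t => LL t *m (A1 t *m Z0 t)) = (fun t => col_mx (Uj t) ((U t)^T *m (Jic *m Uj t))).
  by apply/funext => t; rewrite A1_col VM_Z0 LLcol JcK.
by rewrite mint_col mUj mUJUj -block_mxEv block_mxEh col_mx0 -block_mxEv -scalar_mx_block.
Qed.

Lemma sE : mcsm E.
Proof. by apply: mcsmM => //; exact: mcsm_usub. Qed.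
Lemma sRj : mcsm Rj.
Proof.
apply: mcsmB; last by apply: mcsmZ; exact: mder_mcsm sE dE.
by apply: mcsmB => //; apply: mcsmM => //; exact: mcsm_usub.
Qed.
Lemma sR1 : mcsm R1. Proof. exact: mder_mcsm sRj dRj. Qed.

Lemma SL_csm : mcsm (fun t => Lj - JU t *m cr).
Proof.
apply: mcsmB; first exact: mcsm_cst.
by apply: mcsmM; [apply: mcsmM => //|]; exact: mcsm_cst.
Qed.

Lemma SS_csm : mcsm (fun t => Lj - JU t *m cr + kC *: col_mx (R1 t) 0).
Proof.
apply: mcsmD; first exact: SL_csm.
by apply: mcsmZ; apply: mcsm_col; [exact: sR1|exact: mcsm_cst].
Qed.

(** [BPR_mu] recognizes it as the derivative of the first integral [mu] minus Q times that of the
    speed. *)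
Definition BmP t := (U t)^T *m (Lj - JU t *m cr) +
  kC *: ((usubmx (U1 t))^T *m Xj t - (X1 t)^T *m usubmx (Uj t)).
Definition Bm := col_mx (Jc *m Lj - mint U *m cr) (mint BmP).

Lemma per_E t : E (t + 1) = E t. Proof. by rewrite /E perd perUj. Qed.
Lemma per_Rj t : Rj (t + 1) = Rj t.
Proof. by rewrite /Rj perb perUj perXj (mder_per per_E dE). Qed.

Lemma BmP_csm : mcsm BmP.
Proof.
apply: mcsmD; first by apply: mcsmM; [exact: mcsm_tr|exact: SL_csm].
apply: mcsmZ; apply: mcsmB; apply: mcsmM => //; try by apply: mcsm_usub.
  by apply: mcsm_tr; apply: mcsm_usub; exact: sU1.
exact: mcsm_tr.
Qed.

Lemma LL_SS : mint (fun t => LL t *m SS t) = Bm.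
Proof.
have -> : (fun t => LL t *m SS t) = (fun t => col_mx
    (Jc *m (Lj - JU t *m cr + kC *: col_mx (R1 t) 0))
    ((U t)^T *m (Lj - JU t *m cr + kC *: col_mx (R1 t) 0))).
  by apply/funext => t; rewrite LLcol.
rewrite mint_col; congr col_mx.
  pose G t := Jc *m (kC *: (col_mx (Rj t) 0 : 'M[C]_(N, K))).
  have dG : mder G (fun t => Jc *m (kC *: col_mx (R1 t) 0)).
    exact: mderMl (mderZ kC (mder_col dRj (mder_cst 0))).
  have cG : mcont (fun t => Jc *m (kC *: (col_mx (R1 t) 0 : 'M[C]_(N, K)))).
    apply: mcsm_cont; apply: mcsmM; first exact: mcsm_cst.
    by apply: mcsmZ; apply: mcsm_col; [exact: sR1|exact: mcsm_cst].
  have -> : (fun t => Jc *m (Lj - JU t *m cr + kC *: col_mx (R1 t) 0)) =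
      (fun t => (Jc *m Lj + -1 *: (U t *m cr)) + Jc *m (kC *: col_mx (R1 t) 0)).
    by apply/funext => t; rewrite mulmxDr mulmxBr -[JU t *m cr]mulmxA JcK scaleN1r.
  have cU : mcont U := mcsm_cont sU.
  have c1 : mcont (fun t => U t *m cr) by apply: mcontM => //; exact: mcont_cst.
  rewrite mintD //; last by apply: mcontD; [exact: mcont_cst|exact: mcontZ].
  rewrite (mint_der dG) // /G (per10 per_Rj) subrr addr0.
  rewrite mintD; [|exact: mcont_cst|exact: mcontZ].
  by rewrite mint_cst mintZ // mintMr // scaleN1r.
(* The boundary terms of two integrations by parts, of U against R1 and of U1 against E1; G is
   periodic and drops out. *)
pose G t := kC *: ((usubmx (U t))^T *m Rj t + kC *: ((usubmx (U1 t))^T *m E t)).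
have dG : mder G (fun t => kC *: ((usubmx (U1 t))^T *m Rj t + (usubmx (U t))^T *m R1 t +
    ((P1 t)^T *m E t + kC *: ((usubmx (U1 t))^T *m E1 t)))).
  apply: mderZ; apply: mderD; first exact: mderM (mder_tr (mder_usub derU)) dRj.
  apply: mder_ext (mderZ kC (mderM (mder_tr dU1) dE)) _ _ => // t.
  rewrite scalerDr linearZ /= -scalemxAl scalerA mulfV ?kC0 // scale1r.
  by [].
have -> : (fun t => (U t)^T *m (Lj - JU t *m cr + kC *: col_mx (R1 t) 0)) =
    (fun t => BmP t + kC *: ((usubmx (U1 t))^T *m Rj t + (usubmx (U t))^T *m R1 t +
    ((P1 t)^T *m E t + kC *: ((usubmx (U1 t))^T *m E1 t)))).
  apply/funext => t; rewrite mulmxDr /BmP -addrA; congr (_ + _).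
  rewrite -scalerDr -scalemxAr; congr (_ *: _).
  rewrite dotE col_mxKu col_mxKd mulmx0 addr0 X1E linearD /= !trmx_mul trmxK dv_sym mulmxDl.
  rewrite /Rj !mulmxBr -!scalemxAr !mulmxA.
  move: (_ *m Xj t) (_ *m R1 t) (_ *m E1 t) => x1 x2 x3.
  move: (_ *m b t *m _) => x4.
  move: (_ *m usubmx (Uj t)) => x5.
  by apply/matrixP => i j; rewrite !mxE; ring.
have sG : mcsm G.
  have sU1v := mcsm_tr (mcsm_usub sU1).
  by apply: mcsmZ; apply: mcsmD; [|apply: mcsmZ]; apply: mcsmM;
    [exact: mcsm_tr (mcsm_usub sU)|exact: sRj|exact: sU1v|exact: sE].
have cG := mcsm_cont (mder_mcsm sG dG).
rewrite mintD //; last exact: mcsm_cont BmP_csm.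
rewrite (mint_der dG) // /G (per10 per_Rj) (per10 perU) (per10 perU1) (per10 per_E) subrr addr0.
by [].
Qed.

(** * From the first-order system to the Bloch operators *)

Variables (J : 'M[R]_N) (H : 'cV[R]_N -> 'cV[R]_N -> R) (c0 : R) (U0 : R -> 'cV[R]_N).
Hypotheses (JcE : Jc = map_mx (real_complex R) J) (JicE : Jic = map_mx (real_complex R) (invmx J)).
Local Notation hh q t := ((q (U0 t) (k *: derive1 U0 t))%:C).
Hypothesis hUU : forall t i j, hh (dU j (dU i H)) t + c0%:C * Jic i j = a t i j.
Hypothesis hUUx : forall t i j, hh (dUx j (dU i H)) t = (block_mx (b t) 0 0 0 : 'M[C]_N) i j.
Hypothesis hUxU : forall t i j, hh (dU j (dUx i H)) t = (block_mx (b t)^T 0 0 0 : 'M[C]_N) i j.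
Hypothesis hUxUx : forall t i j, hh (dUx j (dUx i H)) t = (block_mx (dv t) 0 0 0 : 'M[C]_N) i j.

Lemma blocks_alg (w x1 x2 X : 'cV[C]_n) (y y1 y2 : 'cV[C]_N) (l ep sg x : C) :
  col_mx (l *: x1) (col_mx (l *: x2) 0) + (ep *: (sg *: col_mx 0 (col_mx 0 y1))
    - col_mx (ep *: w) (col_mx (ep *: X) (ep *: y))) + x *: (l *: col_mx 0 (col_mx 0 y2)) =
  col_mx (l *: x1 - ep *: w) (col_mx (l *: x2 - ep *: X)
    (ep *: (sg *: y1) + x *: (l *: y2) - ep *: y)).
Proof.
rewrite !scale_col_mx !scaler0 !opp_col_mx !add_col_mx !addr0 !add0r.
by do 2 congr col_mx; rewrite addrAC.
Qed.

Lemma sys_rhs t (z : 'cV[C]_p) (ep sg x : C) :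
  (A0 t + ep *: (sg *: A1 t - 1%:M)) *m z + x *: ev t =
  col_mx (kC^-1 *: (W1 t *m z) - ep *: (Pw *m z))
    (col_mx (kC^-1 *: (usubmx (a t *m (VM t *m z)) + b t *m (W1 t *m z) - usubmx (PY *m z))
        - ep *: (PX *m z))
      (ep *: (sg *: (Jic *m (VM t *m z))) + x *: (kC^-1 *: (Jic *m U1 t)) - ep *: (PY *m z))).
Proof.
have e0 := A0_col (Pw *m z) (PX *m z) (PY *m z) t; rewrite -col_split in e0.
have e1 := A1_col (Pw *m z) (PX *m z) (PY *m z) t; rewrite -col_split in e1.
have e2 : ep *: z = col_mx (ep *: (Pw *m z)) (col_mx (ep *: (PX *m z)) (ep *: (PY *m z))).
  by rewrite {1}[z]col_split !scale_col_mx.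
have e3 : (ep *: (sg *: A1 t - 1%:M)) *m z = ep *: (sg *: (A1 t *m z)) - ep *: z.
  by rewrite -scalemxAl mulmxBl -scalemxAl mul1mx scalerBr.
rewrite mulmxDl e3 e2 e0 e1 /ev.
exact: blocks_alg.
Qed.

Lemma ieq (nu : R) : (0 +i* nu) = nu%:C * 'i :> C.
Proof. by apply: cplx_ext; rewrite ?cReM ?cImM /=; ring. Qed.

Lemma bloch_intro nu (V V1 : R -> 'cV[C]_N) : (forall t, V (t + 1) = V t) -> mcsm V ->
  mder V (fun t => V1 t - (nu%:C * 'i) *: V t) -> bloch_deriv nu V V1.
Proof.
move=> pV sV dV i; have := mcsm_wderiv i pV sV dV.
suff -> : (fun t => V1 t i 0 - (0 +i* nu) * V t i 0) =
    (fun t => (V1 t - (nu%:C * 'i) *: V t) i 0) by [].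
by apply/funext => t; rewrite !mxE ieq.
Qed.

Lemma block1 (B : 'M[C]_n) (V : 'cV[C]_N) :
  (block_mx B 0 0 0 : 'M[C]_N) *m V = (col_mx (B *m usubmx V) 0 : 'cV[C]_N).
Proof. by rewrite -{1}[V]vsubmxK mul_block_col !mul0mx !addr0. Qed.

Lemma sum_mulmx (A B : 'M[C]_N) (V W : 'cV[C]_N) i :
  \sum_j (A i j * V j 0 + B i j * (kC * W j 0)) = (A *m V + B *m (kC *: W)) i 0.
Proof. by rewrite big_split !mxE; congr (_ + _); apply: eq_bigr => j _; rewrite mxE. Qed.

Lemma scale_alg (ep sg x : C) (V W : 'cV[C]_N) : (kC * ep * sg) *: V + x *: W =
  kC *: (Jc *m (ep *: (sg *: (Jic *m V)) + x *: (kC^-1 *: (Jic *m W)))).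
Proof.
have alg (l : C) (V' W' : 'cV[C]_N) : l != 0 -> (l * ep * sg) *: V' + x *: W' =
    l *: (ep *: (sg *: V') + x *: (l^-1 *: W')).
  move=> l0; rewrite scalerDr !scalerA; congr (_ + _ *: _).
  by rewrite mulrAC mulfV ?mul1r.
apply: etrans (alg _ _ _ kC0) _; apply: (congr1 (fun y => kC *: y)).
by rewrite mulmxDr -!scalemxAr !JcK.
Qed.

(** Solutions are smooth by [ode_mcsm], so every derivative required by the graph is classical. The
    source x U1 serves the generalized kernel, at nu = 0. *)
Lemma sys_graph (nu : R) (sg x : C) (z : R -> 'cV[C]_p) : (forall t, z (t + 1) = z t) ->
  mder z (fun t => (A0 t + (nu%:C * 'i) *: (sg *: A1 t - 1%:M)) *m z t + x *: ev t) ->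
  bloch_graph J H k c0 U0 nu (fun t => VM t *m z t)
    (fun t => (kC * (nu%:C * 'i) * sg) *: (VM t *m z t) + x *: U1 t).
Proof.
set ep := nu%:C * 'i => pz dz.
have sev : mcsm ev.
  apply: mcsmZ; apply: mcsm_col; first exact: mcsm_cst.
  apply: mcsm_col; first exact: mcsm_cst.
  by apply: mcsmM; [exact: mcsm_cst|exact: sU1].
have sz : mcsm z.
  apply: ode_mcsm (mcsmZ x sev) dz.
  apply: mcsmD; first exact: sA0.
  by apply: mcsmZ; apply: mcsmB; [apply: mcsmZ; exact: sA1|exact: mcsm_cst].
have sV : mcsm (fun t => VM t *m z t) by apply: mcsmM => //; exact: sVM.
have pV t : VM (t + 1) *m z (t + 1) = VM t *m z t by rewrite perVM pz.
have dw := mderMl Pw dz; have dX := mderMl PX dz; have dY := mderMl PY dz.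
have dV := mD_der sV.
pose V1 t := mD (fun t => VM t *m z t) t + ep *: (VM t *m z t).
have uV1 t : kC *: usubmx (V1 t) = W1 t *m z t.
  have h := mder_usub dV.
  have h' : mder (fun t => usubmx (VM t *m z t)) (fun t => kC^-1 *: (W1 t *m z t) - ep *: (Pw *m z t)).
    apply: mder_ext dw _ _ => s; first by rewrite -mul_usub_mx VM_usub.
    by rewrite sys_rhs Pw_col.
  rewrite /V1 usubD (mder_uniq h h' t) usubZ -mul_usub_mx VM_usub subrK.
  by rewrite scalerA mulfV ?scale1r ?kC0.
have sPY : mcsm (fun t => PY *m z t) by apply: mcsmM => //; exact: mcsm_cst.
have sPX : mcsm (fun t => PX *m z t) by apply: mcsmM => //; exact: mcsm_cst.
split.
- exact: csm_lin_domain.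
- apply: csm_vL2per.
    by move=> t; apply: f_equal2; [exact: (congr1 (fun y => _ *: y) (pV t))|
      exact: (congr1 (fun y => _ *: y) (perU1 t))].
  exact: mcsmD (mcsmZ (kC * ep * sg) sV) (mcsmZ x sU1).
pose Y t := PY *m z t.
pose Z t : 'cV[C]_N := Jc *m (ep *: (sg *: (Jic *m (VM t *m z t))) + x *: (kC^-1 *: (Jic *m U1 t))).
exists Y, Z; split.
- pose X t : 'cV[C]_N := col_mx (PX *m z t) 0.
  pose X1' t : 'cV[C]_N := col_mx (kC^-1 *:
    (usubmx (a t *m (VM t *m z t)) + b t *m (W1 t *m z t) - usubmx (PY *m z t))) 0.
  exists V1, X, X1'; split.
  + apply: bloch_intro => //; rewrite -/ep.
    by apply: mder_ext dV _ _ => // t; rewrite /V1 addrK.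
  + have alg (h1 y1 h2 y2 u w : C) : h1 = u -> h2 = w -> h1 * y1 + h2 * y2 = u * y1 + w * y2.
      by move=> -> ->.
    move=> t i; transitivity (\sum_j ((block_mx (b t)^T 0 0 0 : 'M[C]_N) i j * (VM t *m z t) j 0 +
        (block_mx (dv t) 0 0 0 : 'M[C]_N) i j * (kC * V1 t j 0))); last first.
      apply: eq_bigr => j _; exact: esym (alg _ _ _ _ _ _ (hUxU t i j) (hUxUx t i j)).
    rewrite sum_mulmx !block1 add_col_mx addr0 usubZ uV1 -mul_usub_mx VM_usub.
    rewrite [dv t *m _]mulmxA dv_W1 mulmxBl -mulmxA addrC subrK.
    by [].
  + apply: bloch_intro.
    * by move=> t; rewrite /X pz.
    * by apply: mcsm_col => //; exact: mcsm_cst.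
    rewrite -/ep; apply: mder_ext (mder_col dX (mder_cst 0)) _ _ => // t.
    by rewrite sys_rhs PX_col /X1' /X scale_col_mx opp_col_mx add_col_mx scaler0 subr0.
  + move=> t i.
    have alg (h1 y1 h2 y2 l v u w : C) : h1 + l * v = u -> h2 = w ->
        h1 * y1 + h2 * y2 = u * y1 + w * y2 - l * (v * y1) by move=> <- ->; ring.
    have -> : \sum_j (hh (dU j (dU i H)) t * (VM t *m z t) j 0 +
        hh (dUx j (dU i H)) t * (kC * V1 t j 0)) =
        \sum_j (a t i j * (VM t *m z t) j 0 + (block_mx (b t) 0 0 0 : 'M[C]_N) i j * (kC * V1 t j 0))
        - c0%:C * (Jic *m (VM t *m z t)) i 0.
      rewrite [in RHS]mxE mulr_sumr -sumrB; apply: eq_bigr => j _.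
      exact: (alg _ _ _ _ _ _ _ _ (hUU t i j) (hUUx t i j)).
    rewrite sum_mulmx -JicE addrAC subrK.
    have -> : Y t = a t *m (VM t *m z t) + block_mx (b t) 0 0 0 *m (kC *: V1 t) - kC *: X1' t.
      rewrite block1 usubZ uV1 /X1' scale_col_mx scalerA mulfV ?kC0 // scale1r scaler0.
      rewrite -[a t *m _]vsubmxK VM_dsub opp_col_mx !add_col_mx subr0 addr0.
      by rewrite -[LHS]vsubmxK; congr col_mx; rewrite col_mxKu opprB addrC subrK.
    have alg2 (A B : 'cV[C]_N) : (A - kC *: B) i 0 = A i 0 - kC * B i 0 by rewrite !mxE.
    exact: alg2.
- apply: bloch_intro; rewrite -JcE.
  + by move=> t; rewrite /Y pz.
  + by apply: mcsmM => //; exact: mcsm_cst.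
  rewrite -/ep; apply: mder_ext (mderMl Jc dY) _ _ => // t.
  by rewrite sys_rhs PY_col mulmxBr -scalemxAr.
- by apply: aeW => t; exact: scale_alg.
Qed.

(** V determines z: its v-part is w, the derivative of w gives X, that of X gives Y_v, and the
    algebraic equation gives Y_u. *)
Lemma sys_zero (ep sg x : C) (z : R -> 'cV[C]_p) :
  mder z (fun t => (A0 t + ep *: (sg *: A1 t - 1%:M)) *m z t + x *: ev t) ->
  (forall t, VM t *m z t = 0) -> forall t, z t = 0.
Proof.
move=> dz V0.
have w0 t : Pw *m z t = 0 by rewrite -(VM_usub t) mul_usub_mx V0 usub0.
have W0 t : W1 t *m z t = 0.
  have d1 : mder (fun t => Pw *m z t) (fun t => kC^-1 *: (W1 t *m z t)).
    apply: mder_ext (mderMl Pw dz) _ _ => // s.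
    by rewrite sys_rhs Pw_col w0 scaler0 subr0.
  have d0 : mder (fun t => Pw *m z t) (fun=> 0).
    by apply: mder_ext (mder_cst 0) _ _ => // s; rewrite w0.
  have := mder_uniq d1 d0 t => /eqP; rewrite scaler_eq0 invr_eq0 (negPf kC0) /=.
  by move/eqP.
have X0 t : PX *m z t = 0.
  have := congr1 (fun y => y *m z t) (dv_W1 t).
  by rewrite /= -mulmxA W0 mulmx0 mulmxBl -mulmxA w0 mulmx0 subr0.
have Yu t : usubmx (PY *m z t) = 0.
  have d1 : mder (fun t => PX *m z t) (fun t => - (kC^-1 *: usubmx (PY *m z t))).
    apply: mder_ext (mderMl PX dz) _ _ => // s.
    by rewrite sys_rhs PX_col V0 W0 X0 !mulmx0 usub0 scaler0 subr0 addr0 sub0r scalerN.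
  have d0 : mder (fun t => PX *m z t) (fun=> 0).
    by apply: mder_ext (mder_cst 0) _ _ => // s; rewrite X0.
  have := mder_uniq d1 d0 t => /eqP; rewrite oppr_eq0 scaler_eq0 invr_eq0 (negPf kC0) /=.
  by move/eqP.
move=> t; have Yd : dsubmx (PY *m z t) = 0 by rewrite -(VM_dsub t) V0 mulmx0 dsub0.
by rewrite [z t]col_split w0 X0 -[PY *m z t]vsubmxK Yu Yd !col_mx0.
Qed.

Lemma ev_cont : mcont ev.
Proof.
apply: mcsm_cont; apply: mcsmZ; apply: mcsm_col; first exact: mcsm_cst.
apply: mcsm_col; first exact: mcsm_cst.
by apply: mcsmM; [exact: mcsm_cst|exact: sU1].
Qed.

Lemma ev_per t : ev (t + 1) = ev t. Proof. by rewrite /ev perU1. Qed.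
Lemma zt_per t : zt (t + 1) = zt t. Proof. by rewrite /zt perU1 perX1. Qed.
Lemma Z0_per t : Z0 (t + 1) = Z0 t. Proof. by rewrite /Z0 perUj perXj /JU perU. Qed.

(** For a constant profile the derivative of P would be a linear image of that of M, which
    contradicts [mUj] and [mUJUj] in the column of P. *)
Lemma ev_neq0 : exists t, ev t != 0.
Proof.
apply/not_existsP => h.
have U10 t : U1 t = 0.
  have /negP := h t; rewrite negbK /ev scaler_eq0 invr_eq0 (negPf kC0) /= => /eqP e.
  have := PY_col 0 0 (Jic *m U1 t); rewrite e mulmx0 => /esym e'.
  by rewrite -[U1 t]JcK e' mulmx0.
have cU t : U t = U 0.
  apply: (mder_eq_cst (G := fun=> U 0) derU) => //.
  by apply: mder_ext (mder_cst (U 0)) _ _ => // s; rewrite U10.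
have := mUJUj; have -> : (fun t => (U t)^T *m (Jic *m Uj t)) = (fun t => ((U 0)^T *m Jic) *m Uj t).
  by apply/funext => t; rewrite cU mulmxA.
rewrite mintMl; last exact: mcsm_cont.
rewrite mUj !mul_mx_row !mulmx0 => /(congr1 rsubmx); rewrite !row_mxKr => /(congr1 rsubmx).
rewrite !row_mxKr => /matrixP/(_ 0 0); rewrite !mxE => /eqP.
by rewrite eq_sym oner_eq0.
Qed.

Lemma sys_graph0 (x : C) (z : R -> 'cV[C]_p) : (forall t, z (t + 1) = z t) ->
  mder z (fun t => A0 t *m z t + x *: ev t) ->
  bloch_graph J H k c0 U0 0 (fun t => VM t *m z t) (fun t => x *: U1 t).
Proof.
move=> pz dz; have := @sys_graph 0 0 x z pz.
have -> : (fun t => (kC * (0%:C * 'i) * 0) *: (VM t *m z t) + x *: U1 t) = (fun t => x *: U1 t).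
  by apply/funext => t; rewrite mulr0 scale0r add0r.
apply; apply: mder_ext dz _ _ => // t.
by rewrite mul0r scale0r addr0.
Qed.

(** The linearized operator maps V to x U1, and U1 to 0 by translation invariance. *)
Lemma sys_gen_kernel (x : C) (z : R -> 'cV[C]_p) : (forall t, z (t + 1) = z t) ->
  mder z (fun t => A0 t *m z t + x *: ev t) -> gen_kernel J H k c0 U0 (fun t => VM t *m z t).
Proof.
move=> pz dz; exists 2%N => /=; exists (fun t => x *: U1 t); split; first exact: sys_graph0.
have g : bloch_graph J H k c0 U0 0 (fun t => VM t *m ((x * kC) *: zt t)) (fun t => 0 *: U1 t).
  apply: sys_graph0; first by move=> t; rewrite zt_per.
  apply: mder_ext (mderZ (x * kC) zt_der) _ _ => // t.
  by rewrite scale0r addr0 scalemxAr.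
have e : (fun t => VM t *m ((x * kC) *: zt t)) = (fun t => x *: U1 t).
  by apply/funext => t; rewrite -scalemxAr VM_zt scalerA mulfK ?kC0.
rewrite e in g; exists (fun t => 0 *: U1 t); split => // t; exact: scale0r.
Qed.

Lemma mulmx11 q (e : 'cV[C]_q) (y : 'M[C]_1) : e *m y = y 0 0 *: e.
Proof. by rewrite {1}[y]mx11_scalar mul_mx_scalar. Qed.

Hypothesis kernel_dim : gen_kernel_dim J H k c0 U0 N.+2.

(** The translation mode and the derivatives along M and P. The derivative along k is excluded by
    its source zt. *)
Definition GM t : 'M[C]_(p, K) := row_mx (zt t) (Z0 t *m col_mx 0 1%:M).
Local Notation Gm t y := (GM t *m y).

Lemma GM_mul t (y : 'cV[C]_K) : GM t *m y = zt t *m usubmx y + Z0 t *m col_mx 0 (dsubmx y).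
Proof.
have e : (col_mx 0 1%:M : 'M[C]_(1 + (N + 1), N + 1)) *m dsubmx y = col_mx 0 (dsubmx y).
  by rewrite mul_col_mx mul0mx mul1mx.
by rewrite -{1}[y]vsubmxK mul_row_col -mulmxA e.
Qed.

Lemma Gm_der (y : 'cV[C]_K) : mder (fun t => Gm t y)
  (fun t => A0 t *m Gm t y + (- (kC *: cr *m col_mx 0 (dsubmx y)) 0 0) *: ev t).
Proof.
have h := comb_der zt_der Z0_der (fun t => GM_mul t y).
by apply: mder_ext h _ _ => // t; rewrite scaleNr mulmx11.
Qed.

Lemma Gm_per (y : 'cV[C]_K) t : Gm (t + 1) y = Gm t y.
Proof. by rewrite /GM zt_per Z0_per. Qed.

Lemma Gm_lin t (y : 'cV[C]_K) : Gm t y = \sum_j y j 0 *: Gm t (delta_mx j 0).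
Proof.
have hy : y = \sum_j y j 0 *: delta_mx j 0.
  by rewrite {1}[y]matrix_sum_delta; apply: eq_bigr => j _; rewrite big_ord1.
by rewrite {1}hy mulmx_sumr; apply: eq_bigr => j _; rewrite scalemxAr.
Qed.

(** Q holds the coordinates of the N + 2 known elements in a basis of the generalized kernel;
    injective and square, it is onto, and [sys_zero] passes from V back to z. *)
Lemma sys_spanning (z : R -> 'cV[C]_p) (x : C) : (forall t, z (t + 1) = z t) ->
  mder z (fun t => A0 t *m z t + x *: ev t) ->
  exists (u : 'cV[C]_1) (y : 'cV[C]_(N + 1)), forall t, z t = zt t *m u + Z0 t *m col_mx 0 y.
Proof.
move=> pz dz; have [bb [_ hb]] := kernel_dim.
have [zc hzc] : exists zc : 'I_K -> {ffun 'I_N.+2 -> C}, forall j t,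
    VM t *m Gm t (delta_mx j 0) = \sum_i zc j i *: bb i t.
  apply: (@fin_all_exists _ (fun=> {ffun 'I_N.+2 -> C}) (fun j zj => forall t,
    VM t *m Gm t (delta_mx j 0) = \sum_i zj i *: bb i t)) => j.
  have [zj [hj _]] := hb _ (sys_gen_kernel (Gm_per (delta_mx j 0)) (@Gm_der (delta_mx j 0))).
  by exists zj.
pose Q : 'M[C]_(N.+2, K) := \matrix_(i, j) zc j i.
have VMG t y : VM t *m Gm t y = \sum_i (Q *m y) i 0 *: bb i t.
  rewrite Gm_lin mulmx_sumr.
  under eq_bigr do rewrite -scalemxAr hzc scaler_sumr.
  rewrite exchange_big; apply: eq_bigr => i _ /=; rewrite mxE scaler_suml.
  by apply: eq_bigr => j _; rewrite scalerA mxE mulrC.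
have Qinj : inj_mx Q.
  move=> y Qy; have V0 t : VM t *m Gm t y = 0.
    by rewrite VMG Qy big1 // => i _; rewrite mxE scale0r.
  have A1G t : A1 t *m Gm t y = 0.
    by rewrite [Gm t y]col_split A1_col -col_split V0 mulmx0 !col_mx0.
  have dy : dsubmx y = 0.
    rewrite -(pairing_y (mcsm_cont sA1) ev_cont A1_zt Z0_der LL_der LL_ev LL_A1Z0
      (fun t => GM_mul t y)).
    rewrite -[RHS](mint_cst (0 : 'cV[C]_(N + 1))); congr mint; apply/funext => t.
    by rewrite A1G mulmx0.
  have [t et] := ev_neq0.
  have uy : usubmx y = 0.
    have := A1G t; rewrite GM_mul dy col_mx0 mulmx0 addr0 mulmxA A1_zt mulmx11 => /eqP.
    rewrite scaler_eq0 (negPf et) orbF => /eqP e.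
    by apply/matrixP => i j; rewrite (ord1 i) (ord1 j) e mxE.
  by rewrite -[y]vsubmxK uy dy col_mx0.
have [w [hw _]] := hb _ (sys_gen_kernel pz dz).
have [y hy] : exists y, Q *m y = \col_i w i.
  have fr := inj_mx_tr Qinj.
  have fu : row_full Q^T by rewrite /row_full (eqP fr) add1n addn1.
  have /submxP[D hD] := submx_full (\col_i w i)^T fu.
  by exists D^T; rewrite -[LHS]trmxK trmx_mul trmxK -hD trmxK.
exists (usubmx y), (dsubmx y) => t; rewrite -GM_mul.
have dd : mder (fun t => z t - Gm t y) (fun t => (A0 t + 0 *: (0 *: A1 t - 1%:M)) *m (z t - Gm t y)
    + (x + (kC *: cr *m col_mx 0 (dsubmx y)) 0 0) *: ev t).
  apply: mder_ext (mderB dz (@Gm_der y)) _ _ => // s.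
  by rewrite scale0r addr0 mulmxBr scaleNr scalerDl opprD opprK addrACA.
apply/eqP; rewrite -subr_eq0; apply/eqP.
apply: (sys_zero dd) => s; rewrite mulmxBr VMG hy hw; apply/eqP; rewrite subr_eq0; apply/eqP.
by apply: eq_bigr => i _; rewrite mxE.
Qed.

Hypothesis stab : spectrally_stable J H k c0 U0.

(** Since Re lambda = - k nu Im s is nonzero, lambda is in the resolvent set; the equation with F =
    0 then has only one solution, so V = 0. *)
Lemma sys_stable (nu : R) (s : C) (z : R -> 'cV[C]_p) : 0 < nu -> complex.Im s != 0 ->
  (forall t, z (t + 1) = z t) ->
  mder z (fun t => (A0 t + (nu%:C * 'i) *: (s *: A1 t - 1%:M)) *m z t) ->
  forall t, z t = 0.
Proof.
move=> nu0 is0 pz dz; pose la := kC * (nu%:C * 'i) * s.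
have Rla : complex.Re la != 0.
  have -> : complex.Re la = - (k * nu * complex.Im s) by rewrite /la !(cReM, cImM) /=; ring.
  by rewrite oppr_eq0 !mulf_neq0 // gt_eqF.
have gr z' : (forall t, z' (t + 1) = z' t) ->
    mder z' (fun t => (A0 t + (nu%:C * 'i) *: (s *: A1 t - 1%:M)) *m z' t) ->
    bloch_graph J H k c0 U0 nu (fun t => VM t *m z' t) (fun t => la *: (VM t *m z' t) - 0).
  move=> pz' dz'; have := @sys_graph nu s 0 z' pz'.
  have -> : (fun t => (kC * (nu%:C * 'i) * s) *: (VM t *m z' t) + 0 *: U1 t) =
      (fun t => la *: (VM t *m z' t) - 0).
    by apply/funext => t; rewrite scale0r addr0 subr0.
  apply; apply: mder_ext dz' _ _ => // t.
  by rewrite scale0r addr0.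
have [[hr _]|nr] := pselect (bloch_resolvent J H k c0 U0 nu la); last first.
  by have := stab (ex_intro2 _ _ nu I nr); move/eqP; rewrite (negPf Rla).
have L0 : vL2per (fun _ : R => 0 : 'cV[C]_N) by apply: csm_vL2per => //; exact: mcsm_cst.
have [V [_ hV]] := hr _ L0.
have e1 := hV _ (gr z pz dz).
have e2 : V = (fun t => VM t *m 0).
  apply: hV; apply: (gr (fun=> 0)) => //.
  by apply: mder_ext (mder_cst 0) _ _ => // t; rewrite mulmx0.
have dz' : mder z (fun t => (A0 t + (nu%:C * 'i) *: (s *: A1 t - 1%:M)) *m z t + 0 *: ev t).
  by apply: mder_ext dz _ _ => // t; rewrite scale0r addr0.
apply: (sys_zero dz') => t.
have := congr1 (fun f => f t) (etrans (esym e1) e2).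
by rewrite /= mulmx0.
Qed.

Lemma system_real (s0 : C) :
  eigenvalue (col_mx (- (kC *: cr)) Bm : 'M[C]_(1 + (N + 1))) s0 -> complex.Im s0 = 0.
Proof.
have cS : mcont SS.
  apply: mcsm_cont; apply: mcsm_col; first exact: mcsm_cst.
  by apply: mcsm_col; [exact: mcsm_cst|exact: SS_csm].
apply: (floquet_real (mcsm_cont sA0) (mcsm_cont sA1) ev_cont cS perA0 perA1 ev_per zt_der A1_zt
  Z0_der Z1_der LL_der (per10 zt_per) (per10 Z0_per) _ _ LL_ev LL_A1Z0 LL_SS ev_neq0
  sys_spanning sys_stable).
  by rewrite /Z1 (per10 per_E) (per10 per_Rj).
by rewrite /LL (per10 perX1) (per10 perU1) (per10 perU).
Qed.

End System.

(** * Identities along the family of profiles *)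

Section Wave.
Context {R : realType} {n m : nat}.
Local Notation N := (n + m)%N.
Local Notation K := (1 + (N + 1))%N.
Local Notation T := (R * 'cV[R]_K)%type.
Local Notation E := ('cV[R]_N * 'cV[R]_N)%type.

Variables (J : 'M[R]_N) (H : 'cV[R]_N -> 'cV[R]_N -> R).
Variables (D : set ('cV[R]_N * 'cV[R]_n)) (C : set R).
Variables (c : 'cV[R]_K -> R) (U : 'cV[R]_K -> R -> 'cV[R]_N).
Variables (O : set 'cV[R]_K) (s : R).

Local Notation Om := (profile_dom D).
Local Notation A := (tdom O).

Hypothesis oO : open O.
Hypotheses (J_sym : J^T = J) (J_unit : J \in unitmx).
Hypothesis H_struct : structural D C J H.
Hypothesis sU : smooth_on A (fun z : T => U z.2 z.1).
Hypothesis sc : smooth_on O c.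
Hypothesis prof : forall W, O W -> is_profile D C J H (wavek W) (c W) (U W).

Definition i0 : 'I_K := lshift (N + 1) ord0.
Definition iM (a : 'I_N) : 'I_K := rshift 1 (lshift 1 a).
Definition iP : 'I_K := rshift 1 (rshift N ord0).

Let Ji := invmx J.
Let raw a (z : T) := U z.2 z.1 a 0.
(* The shift [s] makes the profile at W0 coincide with U0, see [U0E]. *)
Definition u a (z : T) : R := U z.2 (z.1 + s) a 0.
Definition kk (z : T) : R := wavek z.2.
Definition p a (z : T) : R := kk z * 'D_Dt (u a) z.
Definition q (z : T) : E := (\col_a u a z, \col_a p a z).
Definition comp (G : 'cV[R]_N -> 'cV[R]_N -> R) (z : T) : R := unc G (q z).
Definition X a := comp (dUx a H).
Definition HU a := comp (dU a H).
Definition fG a z := HU a z - kk z * 'D_Dt (X a) z.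
Definition cc (z : T) : R := c z.2.
Definition JU a (z : T) : R := \sum_b Ji a b * u b z.
(* [lam] and [mu] are the constants of integration of the profile equations. *)
Definition lam a z := fG a z + cc z * JU a z.
Definition Qf z := 2^-1 * \sum_a u a z * JU a z.
Definition mu z := \sum_a p a z * X a z - comp H z + \sum_a lam a z * u a z - cc z * Qf z.

Let Om_open : open Om := (structural_SM H_struct).1.
Let SM_H : SM Om (unc H) := (structural_SM H_struct).2.

Lemma A_open : open A. Proof. exact: tdom_open. Qed.

Lemma raw_SM a : SM A (raw a).
Proof. exact: (smooth_SM_coord A_open a 0 sU). Qed.

Lemma shiftE (z : T) : z + ((s, 0) : T) = (z.1 + s, z.2).
Proof. by case: z => t W; congr pair; rewrite /= addr0. Qed.

Lemma u_SM a : SM A (u a).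
Proof.
apply: (SM_eq A_open _ (@SM_shift _ _ _ A_open (raw a) (s, 0) _ (raw_SM a))).
  by move=> z _; rewrite shiftE.
by move=> z [_ Oz]; rewrite shiftE.
Qed.

Lemma kkE z : kk z = z.2 i0 0. Proof. by rewrite /kk /wavek mxE. Qed.

Lemma kk_SM : SM A kk.
Proof.
apply: (SM_eq A_open _ (SM_param oO (coord_SM i0 oO))) => z _; by rewrite kkE.
Qed.

Lemma cc_SM : SM A cc.
Proof. exact: (SM_param oO (smooth_SM sc)). Qed.

Lemma p_SM a : SM A (p a).
Proof. exact: (SMM A_open kk_SM (SM_D Dt (u_SM a))). Qed.

Lemma raw_derive a t W : O W -> derive1 (U W) t a 0 = 'D_Dt (raw a) (t, W).
Proof.
move=> OW; have [[_ _ sUW] _] := prof OW.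
rewrite derive1E derive_mx ?mxE; last first.
  by apply: diff_derivable; exact: (sUW [::] t I).
have [_ <-] := SM_rder (raw_SM a) OW t.
by [].
Qed.

Lemma u_derive a t W : 'D_Dt (u a) (t, W) = 'D_Dt (raw a) (t + s, W).
Proof.
have := derive_shiftE (raw a) (s, 0) Dt (t, W); rewrite shiftE /= => <-.
by apply: derive_ext => z; rewrite shiftE.
Qed.

Lemma qE t W : O W -> q (t, W) = (U W (t + s), wavek W *: derive1 (U W) (t + s)).
Proof.
move=> OW; congr pair; apply/matrixP => a i; rewrite (ord1 i) !mxE //.
by rewrite /p /kk /= u_derive raw_derive.
Qed.

Lemma qOm z : A z -> Om (q z).
Proof.
case: z => t W [_ OW]; rewrite (qE t OW); have [_ [_ hD _]] := prof OW.
exact: hD.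
Qed.

Let qi (i : 'I_N + 'I_N) : T -> R := match i with inl a => u a | inr a => p a end.

Lemma q_dir z : q z = \sum_i qi i z *: dir i.
Proof. by rewrite /q pair_dirE; apply: eq_bigr => -[a|a] _; rewrite mxE. Qed.

Lemma qi_SM i : SM A (qi i).
Proof. by case: i => a; [exact: u_SM|exact: p_SM]. Qed.

Lemma comp_SM G : SM Om (unc G) -> SM A (comp G).
Proof. by move=> sG; exact: (SM_comp q_dir A_open qOm sG qi_SM). Qed.

Lemma comp_D G v z : SM Om (unc G) -> A z -> 'D_v (comp G) z =
  \sum_a 'D_v (u a) z * comp (dU a G) z + \sum_a 'D_v (p a) z * comp (dUx a G) z.
Proof.
move=> sG Az; have := SM_comp_D q_dir qOm v sG qi_SM Az.
rewrite big_sumType /= => e; apply: (etrans e).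
by apply: f_equal2; apply: eq_bigr => a _; apply: (congr1 (fun x => _ * x)); apply: esym;
  [exact: dUE|exact: dUxE].
Qed.

Lemma X_SM a : SM A (X a). Proof. exact: comp_SM (SM_dUx _ SM_H). Qed.
Lemma HU_SM a : SM A (HU a). Proof. exact: comp_SM (SM_dU _ SM_H). Qed.
Lemma compH_SM : SM A (comp H). Proof. exact: comp_SM SM_H. Qed.
Lemma fG_SM a : SM A (fG a).
Proof. exact: (SMB A_open (HU_SM a) (SMM A_open kk_SM (SM_D Dt (X_SM a)))). Qed.
Lemma JU_SM a : SM A (JU a).
Proof. by apply: (SM_sum A_open) => b; exact: (SMZ A_open _ (u_SM b)). Qed.
Lemma lam_SM a : SM A (lam a).
Proof. exact: (SMD A_open (fG_SM a) (SMM A_open cc_SM (JU_SM a))). Qed.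
Lemma Qf_SM : SM A Qf.
Proof.
apply: (SMZ A_open); apply: (SM_sum A_open) => a.
exact: (SMM A_open (u_SM a) (JU_SM a)).
Qed.
Lemma mu_SM : SM A mu.
Proof.
apply: (SMB A_open); last exact: (SMM A_open cc_SM Qf_SM).
apply: (SMD A_open); last by apply: (SM_sum A_open) => a; exact: (SMM A_open (lam_SM a) (u_SM a)).
apply: (SMB A_open); last exact: compH_SM.
by apply: (SM_sum A_open) => a; exact: (SMM A_open (p_SM a) (X_SM a)).
Qed.

Lemma impulse_sum (V : 'cV[R]_N) : impulse J V = 2^-1 * \sum_a V a 0 * \sum_b Ji a b * V b 0.
Proof.
rewrite /impulse -mulmxA mxE; congr (_ * _); apply: eq_bigr => a _.
by rewrite !mxE.
Qed.

Lemma impulse_D a (V : 'cV[R]_N) : 'D_(delta_mx a 0) (impulse J) V = \sum_b Ji a b * V b 0.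
Proof.
have d : is_derive V (delta_mx a 0) (impulse J) (\sum_b Ji a b * V b 0).
  apply: (@derive_quad _ _ _ _ _ _ (impulse J (delta_mx a 0))) => h.
  exact: impulse_quad.
by rewrite derive_val.
Qed.

Lemma impulse_u t W : impulse J (U W (t + s)) = Qf (t, W).
Proof. by rewrite impulse_sum. Qed.

Lemma waveG_eq a r W : O W -> waveG H (wavek W) (U W) r a 0 = fG a (r - s, W).
Proof.
move=> OW; have rs : r - s + s = r by rewrite subrK.
have hu : dU a H (U W r) (wavek W *: derive1 (U W) r) = HU a (r - s, W).
  have qe := qE (r - s) OW; rewrite rs in qe.
  by rewrite /HU /comp qe.
have hx : (fun r => dUx a H (U W r) (wavek W *: derive1 (U W) r)) = (fun r => X a (r - s, W)).
  by apply/funext => r'; rewrite /X /comp /unc (qE _ OW) subrK.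
have hd := rder_derive1 r (rder_shift (- s) (SM_rder (X_SM a) OW)).
rewrite -hx in hd.
transitivity (dU a H (U W r) (wavek W *: derive1 (U W) r) - wavek W *
    derive1 (fun r => dUx a H (U W r) (wavek W *: derive1 (U W) r)) r).
  by rewrite /waveG mxE.
by rewrite hu hd.
Qed.

Lemma lam_Dt a z : A z -> 'D_Dt (lam a) z = 0.
Proof.
case: z => t W [_ OW]; have [_ [_ _ /(_ a (t + s)) h]] := prof OW.
have hl : (fun r => waveG H (wavek W) (U W) r a 0 + c W * 'D_(delta_mx a 0) (impulse J) (U W r))
    = (fun r => lam a (r - s, W)).
  apply/funext => r; rewrite (waveG_eq _ _ OW) impulse_D /lam; congr (_ + _ * _).
  by apply: eq_bigr => b _; rewrite /u subrK.
rewrite hl (rder_derive1 _ (rder_shift (- s) (SM_rder (lam_SM a) OW))) in h.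
by rewrite addrK in h.
Qed.

Lemma lam_cst a t W : O W -> lam a (t, W) = lam a (0, W).
Proof.
move=> OW; apply: (@rder0_cst _ (fun t => lam a (t, W))).
by apply: rder_ext (SM_rder (lam_SM a) OW) _ _ => // r; exact: lam_Dt.
Qed.

Lemma kk_Dt z : 'D_Dt kk z = 0. Proof. exact: (Dt_param wavek). Qed.
Lemma cc_Dt z : 'D_Dt cc z = 0. Proof. exact: (Dt_param c). Qed.

Lemma D_JU a v z : A z -> 'D_v (JU a) z = \sum_b Ji a b * 'D_v (u b) z.
Proof.
move=> Az; rewrite (SM_Dsum A_open _ v (fun b => SMZ A_open (Ji a b) (u_SM b)) Az).
by apply: eq_bigr => b _; exact: (SM_DZ A_open _ v (u_SM b) Az).
Qed.

Lemma D_Q v z : A z -> 'D_v Qf z = \sum_a JU a z * 'D_v (u a) z.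
Proof.
move=> Az; have s1 a : SM A (fun z => u a z * JU a z) := SMM A_open (u_SM a) (JU_SM a).
rewrite (SM_DZ A_open _ v (SM_sum A_open _ s1) Az) (SM_Dsum A_open _ v s1 Az).
have -> : \sum_a 'D_v (fun z => u a z * JU a z) z =
    \sum_a JU a z * 'D_v (u a) z + \sum_a u a z * 'D_v (JU a) z.
  rewrite -big_split; apply: eq_bigr => a _ /=.
  by rewrite (SM_DM v (u_SM a) (JU_SM a) Az) [JU a z * _]mulrC.
have -> : \sum_a u a z * 'D_v (JU a) z = \sum_a JU a z * 'D_v (u a) z.
  under eq_bigr do rewrite D_JU // mulr_sumr.
  rewrite exchange_big /=; apply: eq_bigr => b _; rewrite mulr_suml.
  by apply: eq_bigr => a _; rewrite (invJ_sym J_sym a b : Ji a b = Ji b a); ring.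
by field.
Qed.

Lemma p_D a v z : A z -> 'D_v (p a) z =
  'D_v kk z * 'D_Dt (u a) z + kk z * 'D_v (fun y => 'D_Dt (u a) y) z.
Proof. by move=> Az; exact: (SM_DM v kk_SM (SM_D Dt (u_SM a)) Az). Qed.

Lemma X_D a v z : A z -> 'D_v (X a) z =
  \sum_b 'D_v (u b) z * comp (dUx a (dU b H)) z + \sum_b 'D_v (p b) z * comp (dUx b (dUx a H)) z.
Proof.
move=> Az; apply: (etrans (comp_D v (SM_dUx a SM_H) Az)).
apply: (congr1 (fun x => x + _)); apply: eq_bigr => b _; apply: (congr1 (fun x => _ * x)).
exact: (dUdUx_sym a b Om_open SM_H (qOm Az)).
Qed.

Lemma HU_D a v z : A z -> 'D_v (HU a) z =
  \sum_b 'D_v (u b) z * comp (dU b (dU a H)) z + \sum_b 'D_v (p b) z * comp (dUx b (dU a H)) z.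
Proof. by move=> Az; exact: (comp_D v (SM_dU _ SM_H) Az). Qed.

Lemma fG_D a v z : A z -> 'D_v (fG a) z = 'D_v (HU a) z -
  ('D_v kk z * 'D_Dt (X a) z + kk z * 'D_v (fun y => 'D_Dt (X a) y) z).
Proof.
move=> Az; have sx := SM_D Dt (X_SM a).
rewrite (SM_DB A_open v (HU_SM a) (SMM A_open kk_SM sx) Az).
by rewrite (SM_DM v kk_SM sx Az).
Qed.

Lemma lam_D a v z : A z -> 'D_v (lam a) z =
  'D_v (fG a) z + ('D_v cc z * JU a z + cc z * 'D_v (JU a) z).
Proof.
move=> Az; rewrite (SM_DD v (fG_SM a) (SMM A_open cc_SM (JU_SM a)) Az).
by rewrite (SM_DM v cc_SM (JU_SM a) Az).
Qed.

(** [mu] is a Legendre transform in p: derivatives of p cancel, and the definition of [lam] trades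
    those of H in U for theta-derivatives of X. *)
Lemma mu_D v z : A z -> 'D_v mu z = \sum_a p a z * 'D_v (X a) z
  - kk z * (\sum_a 'D_v (u a) z * 'D_Dt (X a) z) + \sum_a 'D_v (lam a) z * u a z - 'D_v cc z * Qf z.
Proof.
move=> Az.
have s1 a : SM A (fun z => p a z * X a z) := SMM A_open (p_SM a) (X_SM a).
have s2 a : SM A (fun z => lam a z * u a z) := SMM A_open (lam_SM a) (u_SM a).
have t1 := SM_sum A_open (index_enum 'I_N) s1; have t2 := SM_sum A_open (index_enum 'I_N) s2.
have t3 := SMM A_open cc_SM Qf_SM; have t4 := SMB A_open t1 compH_SM.
rewrite (SM_DB A_open v (SMD A_open t4 t2) t3 Az) (SM_DD v t4 t2 Az).
rewrite (SM_DB A_open v t1 compH_SM Az) (SM_Dsum A_open _ v s1 Az) (SM_Dsum A_open _ v s2 Az).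
rewrite (SM_DM v cc_SM Qf_SM Az) (D_Q v Az) (comp_D v SM_H Az).
have -> : \sum_a 'D_v (fun z => p a z * X a z) z =
    \sum_a p a z * 'D_v (X a) z + \sum_a 'D_v (p a) z * comp (dUx a H) z.
  rewrite -big_split; apply: eq_bigr => a _ /=.
  by rewrite (SM_DM v (p_SM a) (X_SM a) Az) addrC.
have -> : \sum_a 'D_v (fun z => lam a z * u a z) z =
    \sum_a 'D_v (lam a) z * u a z + (\sum_a 'D_v (u a) z * comp (dU a H) z
      - kk z * (\sum_a 'D_v (u a) z * 'D_Dt (X a) z) + cc z * \sum_a JU a z * 'D_v (u a) z).
  rewrite !mulr_sumr -sumrB -!big_split; apply: eq_bigr => a _ /=.
  by rewrite (SM_DM v (lam_SM a) (u_SM a) Az) {2}/lam /fG /HU; ring.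
have alg (S1 S2 Su k Sx Sl k' Sq dk Q : R) :
    S1 + S2 - (Su + S2) + (Sl + (Su - k * Sx + k' * Sq)) - (dk * Q + k' * Sq) =
    S1 - k * Sx + Sl - dk * Q by ring.
exact: alg.
Qed.

(** Along theta the two sums of [mu_D] cancel because p is k times the derivative of u, and [lam] is
    constant. *)
Lemma mu_Dt z : A z -> 'D_Dt mu z = 0.
Proof.
move=> Az; rewrite (mu_D _ Az) cc_Dt mul0r subr0.
rewrite [\sum_a 'D_Dt (lam a) z * u a z]big1 ?addr0; last first.
  by move=> a _; rewrite lam_Dt // mul0r.
apply/eqP; rewrite subr_eq0 mulr_sumr; apply/eqP; apply: eq_bigr => a _.
by rewrite /p mulrA.
Qed.

Lemma mu_cst t W : O W -> mu (t, W) = mu (0, W).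
Proof.
move=> OW; apply: (@rder0_cst _ (fun t => mu (t, W))).
by apply: rder_ext (SM_rder mu_SM OW) _ _ => // r; exact: mu_Dt.
Qed.

(** From U . lam = U . G + 2 c Q. *)
Lemma waveS_eq r W : O W -> waveS H (wavek W) (U W) r = mu (r - s, W) - c W * impulse J (U W r).
Proof.
move=> OW; have ue a : U W r a 0 = u a (r - s, W) by rewrite /u subrK.
have Qe : impulse J (U W r) = Qf (r - s, W) by rewrite -impulse_u subrK.
have qe := qE (r - s) OW; rewrite subrK in qe.
rewrite Qe /waveS.
have -> : \sum_a U W r a 0 * waveG H (wavek W) (U W) r a 0 = \sum_a u a (r - s, W) * fG a (r - s, W).
  by apply: eq_bigr => a _; rewrite ue waveG_eq.
have -> : H (U W r) (wavek W *: derive1 (U W) r) = comp H (r - s, W) by rewrite /comp /unc qe.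
have -> : \sum_a (wavek W *: derive1 (U W) r) a 0 * dUx a H (U W r) (wavek W *: derive1 (U W) r)
    = \sum_a p a (r - s, W) * X a (r - s, W).
  apply: eq_bigr => a _; rewrite /X /comp /unc qe; congr (_ * _).
  by have := congr1 (fun x : E => x.2 a 0) qe; rewrite mxE => ->.
have -> : mu (r - s, W) = \sum_a p a (r - s, W) * X a (r - s, W) - comp H (r - s, W)
    + (\sum_a u a (r - s, W) * fG a (r - s, W) + c W * (2 * Qf (r - s, W))) - c W * Qf (r - s, W).
  rewrite /mu /cc /=; congr (_ + _ - _).
  rewrite /Qf mulrA divff ?mul1r ?pnatr_eq0 // mulr_sumr -big_split; apply: eq_bigr => a _ /=.
  by rewrite /lam /cc /=; ring.
by ring.
Qed.

Lemma Dj_kk j z : A z -> 'D_(Dj j) kk z = (i0 == j)%:R.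
Proof.
case: z => t W [_ OW]; rewrite -derive_slice -(coord_D _ _ W).
by apply: derive_ext => W'; rewrite kkE.
Qed.

Lemma dUdotE a v z : A z -> kk z * 'D_v (fun y => 'D_Dt (u a) y) z =
  'D_v (p a) z - 'D_v kk z * 'D_Dt (u a) z.
Proof. by move=> Az; rewrite (p_D _ _ Az); ring. Qed.

(** The profile equation linearized along v, a phase or a parameter direction alike, and solved for
    the term with X. *)
Lemma dXdotE a v z : A z -> kk z * 'D_v (fun y => 'D_Dt (X a) y) z =
  \sum_b (comp (dU b (dU a H)) z + cc z * Ji a b) * 'D_v (u b) z
  + \sum_b comp (dUx b (dU a H)) z * 'D_v (p b) z - 'D_v kk z * 'D_Dt (X a) z
  - ('D_v (lam a) z - 'D_v cc z * JU a z).
Proof.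
move=> Az.
have -> : \sum_b (comp (dU b (dU a H)) z + cc z * Ji a b) * 'D_v (u b) z =
    \sum_b 'D_v (u b) z * comp (dU b (dU a H)) z + \sum_b cc z * (Ji a b * 'D_v (u b) z).
  rewrite -big_split; apply: eq_bigr => b _ /=; ring.
have -> : \sum_b comp (dUx b (dU a H)) z * 'D_v (p b) z = \sum_b 'D_v (p b) z * comp (dUx b (dU a H)) z.
  by apply: eq_bigr => b _; rewrite mulrC.
have alg (l x S1 S2 S3 dx dc L F G cj : R) : L = F + (dc + cj) -> F = G - (dx + l * x) ->
    G = S1 + S3 -> cj = S2 -> l * x = S1 + S2 + S3 - dx - (L - dc).
  by move=> -> -> -> ->; ring.
apply: (alg _ _ _ _ _ _ _ _ _ _ _ (lam_D a v Az) (fG_D a v Az) (HU_D a v Az)).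
by rewrite D_JU // mulr_sumr.
Qed.

Lemma X_r0 (i : 'I_m) z : A z -> X (rshift n i) z = 0.
Proof. by move=> Az; exact: (structural_dUx H_struct _ (qOm Az)). Qed.

Lemma DX_r0 (i : 'I_m) v z : A z -> 'D_v (X (rshift n i)) z = 0.
Proof.
by move=> Az; rewrite (SM_Deq A_open _ (fun y (Ay : A y) => X_r0 i Ay) Az) derive_cst.
Qed.

Lemma DDX_r0 (i : 'I_m) v w z : A z -> 'D_v (fun y => 'D_w (X (rshift n i)) y) z = 0.
Proof.
by move=> Az; rewrite (SM_Deq A_open _ (fun y (Ay : A y) => DX_r0 i w Ay) Az) derive_cst.
Qed.

Definition per1 (f : T -> R) := forall z, A z -> f (z + ((1, 0) : T)) = f z.

Lemma per_D v f : per1 f -> per1 (fun z => 'D_v f z).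
Proof.
move=> pf z Az; rewrite -(derive_shiftE f (1, 0) v z).
exact: (SM_Deq A_open v pf Az).
Qed.

Lemma per_u a : per1 (u a).
Proof.
case=> t W [_ OW]; have [_ [pU _ _]] := prof OW.
by rewrite /u /= addr0 addrAC pU.
Qed.

Lemma per_kk : per1 kk.
Proof. by move=> [t W] _; rewrite /kk /= addr0. Qed.

Lemma per_cc : per1 cc.
Proof. by move=> [t W] _; rewrite /cc /= addr0. Qed.

Lemma perM f g : per1 f -> per1 g -> per1 (fun z => f z * g z).
Proof. by move=> pf pg z Az; rewrite pf // pg. Qed.

Lemma perB f g : per1 f -> per1 g -> per1 (fun z => f z - g z).
Proof. by move=> pf pg z Az; rewrite pf // pg. Qed.

Lemma per_comp G : per1 (comp G).
Proof.
move=> z Az; rewrite /comp; congr (unc G _); congr pair; apply/matrixP => a i; rewrite !mxE.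
  exact: per_u.
exact: (perM per_kk (per_D Dt (@per_u a)) Az).
Qed.

Lemma per_slice (f : T -> R) W t : per1 f -> O W -> f (t + 1, W) = f (t, W).
Proof. by move=> pf OW; rewrite -(pf (t, W)) //; congr f; congr pair; rewrite /= addr0. Qed.

(** * The linearized data at the given parameters *)

Variable W0 : 'cV[R]_K.
Hypothesis OW0 : O W0.
Local Notation k0 := (wavek W0).
Local Notation c0 := (c W0).

(** Keeps W0 inside matrices of functions of (t, W), so that parameter derivatives are taken before
    W is frozen. *)
Definition mxw r l (F : 'I_r -> 'I_l -> T -> R) (t : R) : 'M[R]_(r, l) :=
  \matrix_(i, j) F i j (t, W0).

Lemma mxwE r l (F : 'I_r -> 'I_l -> T -> R) t i j : mxw F t i j = F i j (t, W0).
Proof. by rewrite mxE. Qed.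
Local Opaque mxw invmx.

Definition fa (i j : 'I_N) z := comp (dU j (dU i H)) z + cc z * Ji i j.
Definition fb (i j : 'I_n) := comp (dUx (lshift m j) (dU (lshift m i) H)).
Definition fd (i j : 'I_n) := comp (dUx (lshift m j) (dUx (lshift m i) H)).
Definition fu (i : 'I_N) (_ : 'I_1) := u i.
Definition fu1 (i : 'I_N) (_ : 'I_1) z := 'D_Dt (u i) z.
Definition fp1 (i : 'I_n) (_ : 'I_1) z := 'D_Dt (p (lshift m i)) z.
Definition fx1 (i : 'I_n) (_ : 'I_1) z := 'D_Dt (X (lshift m i)) z.
Definition fuj (i : 'I_N) (j : 'I_K) z := 'D_(Dj j) (u i) z.
Definition fpj (i : 'I_n) (j : 'I_K) z := 'D_(Dj j) (p (lshift m i)) z.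
Definition fxj (i : 'I_n) (j : 'I_K) z := 'D_(Dj j) (X (lshift m i)) z.
Definition fe (i : 'I_n) (j : 'I_K) z := \sum_l fd i l z * fuj (lshift m l) j z.
Definition fr (i : 'I_n) (j : 'I_K) z := \sum_l fb i l z * fuj (lshift m l) j z - fxj i j z
  - kk z * 'D_Dt (fe i j) z.
Definition crR : 'rV[R]_K := \row_j 'D_(Dj j) cc (0, W0).
Definition ljR : 'M[R]_(N, K) := \matrix_(a, j) 'D_(Dj j) (lam a) (0, W0).

Definition smp r l (F : 'I_r -> 'I_l -> T -> R) := forall i j, SM A (F i j) /\ per1 (F i j).

Lemma smp_mcsm r l (F : 'I_r -> 'I_l -> T -> R) : smp F -> mcsm (mcx (mxw F)).
Proof.
move=> sF; apply: mcsm_cx => i j; have := SM_slice (sF i j).1 OW0.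
by apply: SM_eq; [exact: openT|move=> t _; rewrite mxwE].
Qed.

Lemma smp_per r l (F : 'I_r -> 'I_l -> T -> R) : smp F -> forall t, mcx (mxw F) (t + 1) = mcx (mxw F) t.
Proof.
move=> sF t; congr map_mx; apply/matrixP => i j; rewrite !mxwE.
exact: per_slice (sF i j).2 OW0.
Qed.

Lemma smp_der r l (F : 'I_r -> 'I_l -> T -> R) : smp F ->
  mder (mcx (mxw F)) (mcx (mxw (fun i j z => 'D_Dt (F i j) z))).
Proof.
move=> sF i j; apply: cder_ext (cder_real (SM_rder (sF i j).1 OW0)) _ _ => t; by rewrite mxE mxwE.
Qed.

Lemma smp_D v r l (F : 'I_r -> 'I_l -> T -> R) : smp F -> smp (fun i j z => 'D_v (F i j) z).
Proof. by move=> sF i j; split; [exact: SM_D (sF i j).1|exact: per_D (sF i j).2]. Qed.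

Lemma comp_smp G : SM Om (unc G) -> SM A (comp G) /\ per1 (comp G).
Proof. by move=> sG; split; [exact: comp_SM|exact: per_comp]. Qed.

Lemma smp_fa : smp fa.
Proof.
move=> i j; split; last by move=> z Az; rewrite /fa per_comp // per_cc.
apply: (SMD A_open); first by apply: comp_SM; do 2 apply: SM_dU.
exact: (SMM A_open cc_SM (SM_cst A_open _)).
Qed.
Lemma smp_fb : smp fb.
Proof. by move=> i j; apply: comp_smp; apply: SM_dUx; exact: SM_dU. Qed.
Lemma smp_fd : smp fd.
Proof. by move=> i j; apply: comp_smp; do 2 apply: SM_dUx. Qed.
Lemma smp_fu : smp fu.
Proof. by move=> i j; split; [exact: u_SM|exact: per_u]. Qed.
Lemma smp_X : smp (fun (i : 'I_n) (_ : 'I_1) => X (lshift m i)).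
Proof. by move=> i j; apply: comp_smp; exact: SM_dUx. Qed.
Lemma smp_fuj : smp fuj.
Proof. by move=> i j; split; [exact: SM_D (u_SM i)|exact: per_D (@per_u i)]. Qed.
Lemma smp_fxj : smp fxj.
Proof. by move=> i j; have [s1 s2] := smp_X i 0; split; [exact: SM_D s1|exact: per_D s2]. Qed.

Lemma smp_sum (F : 'I_n -> 'I_n -> T -> R) (G : 'I_n -> 'I_K -> T -> R) i j :
  smp F -> smp G -> SM A (fun z => \sum_l F i l z * G l j z) /\ per1 (fun z => \sum_l F i l z * G l j z).
Proof.
move=> sF sG; split; first by apply: (SM_sum A_open) => l'; exact: (SMM A_open (sF i l').1 (sG l' j).1).
by move=> z Az; apply: eq_bigr => l' _; rewrite (sF i l').2 // (sG l' j).2.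
Qed.

Lemma smp_fe : smp fe.
Proof. by move=> i j; exact: (smp_sum i j smp_fd (fun l => smp_fuj (lshift m l))). Qed.

Lemma smp_fr : smp fr.
Proof.
move=> i j; have [s1 p1] := smp_sum i j smp_fb (fun l => smp_fuj (lshift m l)).
have [s2 p2] := smp_fxj i j; have [s3 p3] := smp_D Dt smp_fe i j; split.
  exact: (SMB A_open (SMB A_open s1 s2) (SMM A_open kk_SM s3)).
exact: (perB (perB p1 p2) (perM per_kk p3)).
Qed.

Lemma sum_r0 (F : 'I_N -> R) : (forall l, F (rshift n l) = 0) -> \sum_b F b = \sum_l F (lshift m l).
Proof. by move=> F0; rewrite big_split_ord /= [X in _ + X]big1 ?addr0. Qed.

Lemma comp_bl0 z l j : A z -> comp (dUx j (dU (rshift n l) H)) z = 0.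
Proof.
move=> Az; apply: etrans (dUxdU_block H_struct _ _ (qOm Az)) _.
by case: (split_ordP j) => j' ->; rewrite ?block_mxEdl ?block_mxEdr mxE.
Qed.

Lemma comp_br0 z i l : A z -> comp (dUx (rshift n l) (dU i H)) z = 0.
Proof.
move=> Az; apply: etrans (dUxdU_block H_struct _ _ (qOm Az)) _.
by case: (split_ordP i) => j' ->; rewrite ?block_mxEur ?block_mxEdr mxE.
Qed.

Lemma comp_dr0 z i l : A z -> comp (dUx (rshift n l) (dUx i H)) z = 0.
Proof.
move=> Az; apply: etrans (dUxdUx_block H_struct _ _ (qOm Az)) _.
by case: (split_ordP i) => j' ->; rewrite ?block_mxEur ?block_mxEdr mxE.
Qed.

Lemma mul0e (x y : R) : x = 0 -> x * y = 0. Proof. by move=> ->; rewrite mul0r. Qed.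
Lemma mulr0e (x y : R) : y = 0 -> x * y = 0. Proof. by move=> ->; rewrite mulr0. Qed.

Lemma DXE v z (i : 'I_n) : A z -> 'D_v (X (lshift m i)) z =
  \sum_l fb l i z * 'D_v (u (lshift m l)) z + \sum_l fd i l z * 'D_v (p (lshift m l)) z.
Proof.
move=> Az; apply: etrans (X_D (lshift m i) v Az) _; apply: f_equal2.
  apply: etrans (sum_r0 _) _; first by move=> l; apply: mulr0e; exact: comp_bl0.
  by apply: eq_bigr => l _; exact: mulrC.
apply: etrans (sum_r0 _) _; first by move=> l; apply: mulr0e; exact: comp_dr0.
by apply: eq_bigr => l _; exact: mulrC.
Qed.

Lemma DDXE v z (i : 'I_n) : A z -> kk z * 'D_v (fun y => 'D_Dt (X (lshift m i)) y) z =
  \sum_b fa (lshift m i) b z * 'D_v (u b) z + \sum_l fb i l z * 'D_v (p (lshift m l)) z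
  - 'D_v kk z * 'D_Dt (X (lshift m i)) z
  - ('D_v (lam (lshift m i)) z - 'D_v cc z * JU (lshift m i) z).
Proof.
move=> Az; apply: etrans (dXdotE (lshift m i) v Az) _.
have e : \sum_b comp (dUx b (dU (lshift m i) H)) z * 'D_v (p b) z =
    \sum_l fb i l z * 'D_v (p (lshift m l)) z.
  by apply: sum_r0 => l; apply: mul0e; exact: comp_br0.
by rewrite e.
Qed.

(** The u-components of the profile equations are algebraic, because X vanishes there; this is their
    linearization. *)
Lemma aDuE v z (i : 'I_m) : A z ->
  \sum_b fa (rshift n i) b z * 'D_v (u b) z = 'D_v (lam (rshift n i)) z - 'D_v cc z * JU (rshift n i) z.
Proof.
move=> Az; have e := dXdotE (rshift n i) v Az.
have e1 : \sum_b comp (dUx b (dU (rshift n i) H)) z * 'D_v (p b) z = 0.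
  by apply: big1 => b _; apply: mul0e; exact: comp_bl0.
have alg (k x w t dk y r : R) : k * x = w + t - dk * y - r -> x = 0 -> y = 0 -> t = 0 -> w = r.
  by move=> h x0 y0 t0; move/esym/eqP: h; rewrite x0 y0 t0 !mulr0 addr0 subr0 subr_eq0 => /eqP.
exact: (alg _ _ _ _ _ _ _ e (DDX_r0 i v Dt Az) (DX_r0 i Dt Az) e1).
Qed.

Lemma fa_sym t : (mxw fa t)^T = mxw fa t.
Proof.
apply/matrixP => i j; rewrite mxE !mxwE.
have e := dUdU_sym j i Om_open SM_H (qOm (tdomP t OW0)).
have alg (x y l w w' : R) : x = y -> w = w' -> x + l * w = y + l * w' by move=> -> ->.
exact: (alg _ _ _ _ _ e (invJ_sym J_sym j i)).
Qed.

Lemma fd_sym t : (mxw fd t)^T = mxw fd t.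
Proof.
apply/matrixP => i j; rewrite mxE !mxwE.
exact: (dUxdUx_sym (lshift m j) (lshift m i) Om_open SM_H (qOm (tdomP t OW0))).
Qed.

Lemma Cc0 : C c0. Proof. by have [[_ ? _] _] := prof OW0. Qed.
Lemma k0_gt0 : 0 < k0. Proof. by have [[? _ _] _] := prof OW0. Qed.
Lemma k0_neq0 : k0 != 0. Proof. by rewrite gt_eqF // k0_gt0. Qed.

Lemma fauu_unit t : drsubmx (mxw fa t) \in unitmx.
Proof.
have := structural_auu J_sym H_struct Cc0 (qOm (tdomP t OW0)).
congr (_ \in unitmx); apply/matrixP => i j; rewrite [LHS]mxE [RHS]mxE [RHS]mxE mxwE.
by [].
Qed.

Lemma fd_unit t : mxw fd t \in unitmx.
Proof.
have := structural_dv H_struct (ex_intro _ _ Cc0) (qOm (tdomP t OW0)).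
by congr (_ \in unitmx); apply/matrixP => i j; rewrite [LHS]mxE mxwE.
Qed.

Lemma smp_mSM r l (F : 'I_r -> 'I_l -> T -> R) : smp F -> @mSM R R setT r l (mxw F).
Proof.
move=> sF i j; have := SM_slice (sF i j).1 OW0.
by apply: SM_eq; [exact: openT|move=> t _; rewrite mxwE].
Qed.

Lemma inv_fd_mcsm : mcsm (fun t => invmx (mcx (mxw fd) t)).
Proof.
have h := mSM_invmx (@openT R) (smp_mSM smp_fd) (fun t _ => fd_unit t).
by apply: mcsm_ext (mcsm_cx h) => t; rewrite /mcx map_invmx.
Qed.

Lemma inv_fauu_mcsm : mcsm (fun t => invmx (drsubmx (mcx (mxw fa) t))).
Proof.
have sd : @mSM R R setT m m (fun t => drsubmx (mxw fa t)).
  move=> i j; have := smp_mSM smp_fa (rshift n i) (rshift n j).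
  by apply: SM_eq; [exact: openT|move=> t _; rewrite [RHS]mxE [RHS]mxE].
have h := mSM_invmx (@openT R) sd (fun t _ => fauu_unit t).
by apply: mcsm_ext (mcsm_cx h) => t; rewrite /mcx map_invmx map_drsubmx.
Qed.

Lemma param_const (f : T -> R) j t : SM A f -> (forall t W, O W -> f (t, W) = f (0, W)) ->
  'D_(Dj j) f (t, W0) = 'D_(Dj j) f (0, W0).
Proof.
move=> sf hf; rewrite -!derive_slice.
exact: (SM_Deq oO _ (fun W OW => hf t W OW) OW0).
Qed.

Lemma ljE i j t : 'D_(Dj j) (lam i) (t, W0) = ljR i j.
Proof. by rewrite mxE; apply: param_const; [exact: lam_SM|move=> *; exact: lam_cst]. Qed.

Lemma crE j t : 'D_(Dj j) cc (t, W0) = crR 0 j.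
Proof. by rewrite mxE; apply: param_const => //; exact: cc_SM. Qed.

Lemma mul_dl r (x : 'M[R]_(r, 1)) i j :
  (x *m (row_mx 1%:M 0 : 'rV[R]_(1 + (N + 1)))) i j = x i 0 * (i0 == j)%:R.
Proof.
rewrite mul_mx_row mulmx1 mulmx0; case: (split_ordP j) => l ->.
  by rewrite row_mxEl (ord1 l) eqxx mulr1.
by rewrite row_mxEr mxE eq_lrshift mulr0.
Qed.

Lemma real_dU1 t : usubmx (mxw (fun i j z => 'D_Dt (fu1 i j) z) t) = k0^-1 *: mxw fp1 t.
Proof.
apply/matrixP => i j; rewrite mxE mxwE mxE mxwE.
have e := dUdotE (lshift m i) Dt (tdomP t OW0); rewrite kk_Dt mul0r subr0 in e.
by rewrite -[LHS](mulKf k0_neq0); congr (_ * _); exact: e.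
Qed.

Lemma real_X1E t : mxw fx1 t = (mxw fb t)^T *m usubmx (mxw fu1 t) + mxw fd t *m mxw fp1 t.
Proof.
apply/matrixP => i j; rewrite mxwE [RHS]mxE [X in _ = X + _]mxE [X in _ = _ + X]mxE.
apply: etrans (DXE Dt i (tdomP t OW0)) _.
by apply: f_equal2; apply: eq_bigr => l _; rewrite !(mxE, mxwE).
Qed.

Lemma real_dX1 t : mxw (fun i j z => 'D_Dt (fx1 i j) z) t =
  k0^-1 *: (usubmx (mxw fa t *m mxw fu1 t) + mxw fb t *m mxw fp1 t).
Proof.
apply/matrixP => i j; rewrite mxwE mxE mxE mxE mxE [X in _ + X]mxE.
have := DDXE Dt i (tdomP t OW0); rewrite kk_Dt cc_Dt lam_Dt // !mul0r !subr0 => e.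
rewrite -[LHS](mulKf k0_neq0); congr (_ * _); apply: etrans e _.
by congr (_ + _); apply: eq_bigr => l _; rewrite !(mxE, mxwE).
Qed.

Lemma real_aU1 t : dsubmx (mxw fa t *m mxw fu1 t) = 0.
Proof.
apply/matrixP => i j; rewrite mxE mxE [RHS]mxE.
have := aDuE Dt i (tdomP t OW0); rewrite cc_Dt lam_Dt // mul0r subr0 => e.
by rewrite -[RHS]e; apply: eq_bigr => l _; rewrite !mxwE.
Qed.

(** Differentiating p = k u' along the parameter k leaves an additional u', which is the term on the
    right of the minus sign. *)
Lemma real_dUj t : usubmx (mxw (fun i j z => 'D_Dt (fuj i j) z) t) =
  k0^-1 *: (mxw fpj t - usubmx (mxw fu1 t) *m (row_mx 1%:M 0 : 'rV[R]_(1 + (N + 1)))).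
Proof.
apply/matrixP => i j; rewrite mxE mxwE [RHS]mxE [X in _ = _ * X]mxE [X in _ = _ * (_ + X)]mxE.
rewrite mul_dl mxwE mxE mxwE.
have e := dUdotE (lshift m i) (Dj j) (tdomP t OW0).
rewrite (Dj_kk _ (tdomP t OW0)) in e.
rewrite /fuj (Schwarz _ _ A_open (u_SM _) (tdomP t OW0)) -[LHS](mulKf k0_neq0); congr (_ * _).
by apply: etrans e _; rewrite /fu1 mulrC.
Qed.

Lemma real_XjE t : mxw fxj t = (mxw fb t)^T *m usubmx (mxw fuj t) + mxw fd t *m mxw fpj t.
Proof.
apply/matrixP => i j; rewrite mxwE [RHS]mxE [X in _ = X + _]mxE [X in _ = _ + X]mxE.
apply: etrans (DXE (Dj j) i (tdomP t OW0)) _.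
by apply: f_equal2; apply: eq_bigr => l _; rewrite !(mxE, mxwE).
Qed.

Lemma JU_col t i : (Ji *m mxw fu t) i 0 = JU i (t, W0).
Proof. by rewrite mxE; apply: eq_bigr => l _; rewrite mxwE. Qed.

Lemma lj_JU t i j : (ljR - Ji *m mxw fu t *m crR) i j =
  'D_(Dj j) (lam i) (t, W0) - 'D_(Dj j) cc (t, W0) * JU i (t, W0).
Proof. by rewrite mxE [X in _ + X]mxE [X in _ - X]mxE big_ord1 JU_col ljE crE mulrC. Qed.

Lemma real_dXj t : mxw (fun i j z => 'D_Dt (fxj i j) z) t =
  k0^-1 *: (usubmx (mxw fa t *m mxw fuj t) + mxw fb t *m mxw fpj t
    - mxw fx1 t *m (row_mx 1%:M 0 : 'rV[R]_(1 + (N + 1))) - usubmx (ljR - Ji *m mxw fu t *m crR)).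
Proof.
apply/matrixP => i j; rewrite mxwE [RHS]mxE.
have e := DDXE (Dj j) i (tdomP t OW0); rewrite (Dj_kk _ (tdomP t OW0)) in e.
rewrite /fxj (Schwarz _ _ A_open (X_SM _) (tdomP t OW0)) -[LHS](mulKf k0_neq0); congr (_ * _).
apply: etrans e _.
have alg (P L : 'M[R]_(N, K)) (Q S : 'M[R]_(n, K)) :
    (usubmx P + Q - S - usubmx L) i j = P (lshift m i) j + Q i j - S i j - L (lshift m i) j.
  by rewrite !mxE.
apply: (etrans _ (esym (alg _ _ _ _))).
rewrite lj_JU mul_dl mxwE mxE [X in _ = _ + X - _ - _]mxE mulrC.
have eb : \sum_l mxw fa t (lshift m i) l * mxw fuj t l j =
    \sum_b fa (lshift m i) b (t, W0) * 'D_(Dj j) (u b) (t, W0).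
  by apply: eq_bigr => l _; rewrite !mxwE.
have ep : \sum_l mxw fb t i l * mxw fpj t l j =
    \sum_l fb i l (t, W0) * 'D_(Dj j) (p (lshift m l)) (t, W0).
  by apply: eq_bigr => l _; rewrite !mxwE.
by rewrite eb ep.
Qed.

Lemma real_aUj t : dsubmx (mxw fa t *m mxw fuj t) = dsubmx (ljR - Ji *m mxw fu t *m crR).
Proof.
apply/matrixP => i j; rewrite mxE [RHS]mxE lj_JU -(aDuE (Dj j) i (tdomP t OW0)) mxE.
by apply: eq_bigr => l _; rewrite !(mxE, mxwE).
Qed.

Lemma real_E t : mxw fe t = mxw fd t *m usubmx (mxw fuj t).
Proof.
apply/matrixP => i j; rewrite mxwE [RHS]mxE /fe; apply: eq_bigr => l _.
by rewrite mxwE [X in _ = _ * X]mxE mxwE.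
Qed.

Lemma real_R t : mxw fr t = mxw fb t *m usubmx (mxw fuj t) - mxw fxj t
  - k0 *: mxw (fun i j z => 'D_Dt (fe i j) z) t.
Proof.
have alg (x : R) (P Q S : 'M[R]_(n, K)) i j : (P - Q - x *: S) i j = P i j - Q i j - x * S i j.
  by rewrite !mxE.
apply/matrixP => i j; rewrite mxwE alg mxE !mxwE.
have eb : \sum_l mxw fb t i l * usubmx (mxw fuj t) l j =
    \sum_l fb i l (t, W0) * fuj (lshift m l) j (t, W0).
  by apply: eq_bigr => l _; rewrite [X in _ * X]mxE !mxwE.
by rewrite eb.
Qed.

Lemma cx_Z r l (x : R) (M : 'M[R]_(r, l)) :
  map_mx (real_complex R) (x *: M) = x%:C *: map_mx (real_complex R) M.
Proof. exact: map_mxZ. Qed.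

Lemma cx_tr r l (M : 'M[R]_(r, l)) :
  (map_mx (real_complex R) M)^T = map_mx (real_complex R) M^T.
Proof. by apply/matrixP => i j; rewrite !mxE. Qed.

Lemma cx_kV : (k0^-1)%:C = k0%:C^-1 :> R[i].
Proof. exact: fmorphV. Qed.

Lemma cx_dl : map_mx (real_complex R) (row_mx 1%:M 0 : 'rV[R]_(1 + (N + 1))) = row_mx 1%:M 0.
Proof. by rewrite map_row_mx map_mx1 map_mx0. Qed.

Local Notation cx := (map_mx (real_complex R)).

Lemma cx_smp r l (F : 'I_r -> 'I_l -> T -> R) (G : R -> 'M[R]_(r, l)) : smp F ->
  (forall t, mxw (fun i j z => 'D_Dt (F i j) z) t = G t) -> mder (mcx (mxw F)) (mcx G).
Proof. by move=> sF FG; apply: mder_ext (smp_der sF) _ _ => // t; rewrite /mcx FG. Qed.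

Lemma mint_mcx r l (F : R -> 'M[R]_(r, l)) : (forall i j, continuous (fun t => F t i j)) ->
  mint (mcx F) = cx (\matrix_(i, j) mean (fun t => F t i j)).
Proof.
move=> cF; apply/matrixP => i j; rewrite !mxE /cprim.
have e1 : (fun t => complex.Re (mcx F t i j)) = (fun t => F t i j).
  by apply/funext => t; rewrite mxE.
have e2 : (fun t => complex.Im (mcx F t i j)) = (fun=> 0).
  by apply/funext => t; rewrite mxE.
rewrite e1 e2 (mean_prim (cF i j)).
have c0' : continuous (fun _ : R => 0 : R) by exact: rcont_cst.
by rewrite (prim_def (rder_cst 0) c0') subrr.
Qed.

Lemma smp_cont r l (F : 'I_r -> 'I_l -> T -> R) : smp F -> forall i j, continuous (fun t => mxw F t i j).
Proof. by move=> sF i j; exact: rder_cont (SMR_rder (smp_mSM sF i j)). Qed.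

Definition meanP := forall W, O W -> vmean (U W) = waveM W /\ mean (fun t => impulse J (U W t)) = waveP W.
Hypothesis hmean : meanP.

(** For periodic f the increment of the primitive over one period does not depend on the starting
    point. *)
Lemma mean_shift (f : R -> R) (r : R) : continuous f -> (forall t, f (t + 1) = f t) ->
  mean (fun t => f (t + r)) = mean f.
Proof.
move=> cf pf; have [F0 dF] := primP cf.
have dr := rder_shift r dF; have d1 := rder_shift 1 dF.
have cfr : continuous (fun t => f (t + r)).
  move=> t; apply: (@continuous_comp _ _ _ (fun t => t + r) f); last exact: cf.
  by apply: cvgD; [exact: cvg_id|exact: cvg_cst].
rewrite (mean_rder dr cfr) (mean_rder dF cf) add0r.
have d2 : rder (fun t => prim f (t + 1) - prim f t) (fun=> 0).
  by apply: rder_ext (rderB d1 dF) _ _ => // t; rewrite pf subrr.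
by have := rder0_cst d2 r; rewrite /= add0r [r + 1]addrC.
Qed.

Lemma mean_u a W : O W -> mean (fun t => u a (t, W)) = W (iM a) 0.
Proof.
move=> OW; have [_ [pU _ _]] := prof OW.
rewrite (@mean_shift (fun t => U W t a 0) s).
- by have [/matrixP/(_ a 0) + _] := hmean OW; rewrite !mxE.
- exact: (SM_cont_t (raw_SM a) OW).
- by move=> t; rewrite pU.
Qed.

Lemma mean_Qf W : O W -> mean (fun t => Qf (t, W)) = W iP 0.
Proof.
move=> OW; have [_ [pU _ _]] := prof OW.
have e : (fun t => Qf (t, W)) = (fun t => impulse J (U W (t + s))).
  by apply/funext => t; rewrite impulse_u.
rewrite e (@mean_shift (fun t => impulse J (U W t)) s).
- by have [_ ->] := hmean OW; rewrite /waveP !mxE.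
- have h : (fun t => impulse J (U W t)) = (fun t => Qf (t - s, W)).
    by apply/funext => t; rewrite -impulse_u subrK.
  rewrite h => t; apply: (@continuous_comp _ _ _ (fun t => t - s) (fun t => Qf (t, W))).
    by apply: cvgD; [exact: cvg_id|exact: cvg_cst].
  exact: (SM_cont_t Qf_SM OW).
- by move=> t; rewrite pU.
Qed.

(** The normalization of the mean of U by M holds for all nearby parameters, so it can be
    differentiated under the integral. *)
Lemma mean_fuj i j : mean (fun t => mxw fuj t i j) = (iM i == j)%:R.
Proof.
rewrite -(coord_D _ _ W0) -(SM_Deq oO _ (fun W OW => mean_u i OW) OW0).
rewrite (mean_diff oO j (u_SM i) OW0); congr mean; apply/funext => t; exact: mxwE.
Qed.

Lemma mean_QJ j : mean (fun t => \sum_a JU a (t, W0) * 'D_(Dj j) (u a) (t, W0)) = (iP == j)%:R.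
Proof.
rewrite -(coord_D _ _ W0) -(SM_Deq oO _ (fun W OW => mean_Qf OW) OW0).
rewrite (mean_diff oO j Qf_SM OW0); congr mean; apply/funext => t.
exact: (esym (D_Q _ (tdomP t OW0))).
Qed.

Lemma mean_lin (I : finType) (x : R) (l : I -> R) (f : I -> R -> R) :
  (forall i, continuous (f i)) ->
  mean (fun t => x + \sum_i l i * f i t) = x + \sum_i l i * mean (f i).
Proof.
move=> cf; have dI : rder (fun t : R => t) (fun=> 1) by move=> t; exact: is_derive_id.
have dF : rder (fun t => x * t + \sum_i l i * prim (f i) t) (fun t => x + \sum_i l i * f i t).
  have d1 := rder_sum (index_enum I) (fun i => rderZ (l i) (primP (cf i)).2).
  by apply: rder_ext (rderD (rderZ x dI) d1) _ _ => // t; rewrite mulr1.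
have cg : continuous (fun t => x + \sum_i l i * f i t).
  apply: rcontD; first exact: rcont_cst.
  elim: (index_enum I) => [|i r IH].
    have -> : (fun t : R => \sum_(i <- [::]) l i * f i t) = (fun=> 0) by apply/funext => t; rewrite big_nil.
    exact: rcont_cst.
  have -> : (fun t : R => \sum_(i0 <- i :: r) l i0 * f i0 t) =
      (fun t => l i * f i t + \sum_(i0 <- r) l i0 * f i0 t) by apply/funext => t; rewrite big_cons.
  by apply: rcontD => //; apply: rcontM => //; exact: rcont_cst.
rewrite (mean_rder dF cg) mulr1 mulr0 add0r -addrA -sumrB; congr (_ + _); apply: eq_bigr => i _.
by rewrite (primP (cf i)).1 mulr0 subr0 mean_prim.
Qed.

Variable U0 : R -> 'cV[R]_N.
Hypothesis U0E : forall t, U0 t = U W0 (t + s).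

Lemma q_U0 t : q (t, W0) = (U0 t, k0 *: derive1 U0 t).
Proof.
rewrite (qE t OW0) -U0E; congr (_, _ *: _).
have -> : U0 = (fun t => U W0 (t + s)) by apply/funext.
by rewrite !derive1E derive_shiftE.
Qed.

Definition BPR t : 'rV[R]_K := (mxw fu t)^T *m (ljR - Ji *m mxw fu t *m crR)
  + k0 *: ((usubmx (mxw fu1 t))^T *m mxw fxj t - (mxw fx1 t)^T *m usubmx (mxw fuj t)).

(** [mu_D] along a parameter: the u-components drop out because X vanishes there, and U . J^-1 U = 2
    Q accounts for the remaining Q. *)
Lemma BPR_mu t j : BPR t 0 j = 'D_(Dj j) mu (t, W0) - crR 0 j * Qf (t, W0).
Proof.
have Az := tdomP t OW0.
have alg (P Q S : 'rV[R]_K) (x : R) : (P + x *: (Q - S)) 0 j = P 0 j + x * (Q 0 j - S 0 j).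
  by rewrite !mxE.
apply: etrans (alg _ _ _ _) _.
have e1 : ((mxw fu t)^T *m (ljR - Ji *m mxw fu t *m crR)) 0 j =
    \sum_a 'D_(Dj j) (lam a) (t, W0) * u a (t, W0) - crR 0 j * (2 * Qf (t, W0)).
  rewrite mxE /Qf mulrA divff ?mul1r ?pnatr_eq0 // mulr_sumr -sumrB; apply: eq_bigr => a _.
  rewrite lj_JU crE mxE mxwE /fu; ring.
have e2 : ((usubmx (mxw fu1 t))^T *m mxw fxj t) 0 j =
    \sum_l 'D_Dt (u (lshift m l)) (t, W0) * 'D_(Dj j) (X (lshift m l)) (t, W0).
  by rewrite mxE; apply: eq_bigr => l _; rewrite !(mxE, mxwE).
have e3 : ((mxw fx1 t)^T *m usubmx (mxw fuj t)) 0 j =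
    \sum_l 'D_(Dj j) (u (lshift m l)) (t, W0) * 'D_Dt (X (lshift m l)) (t, W0).
  by rewrite mxE; apply: eq_bigr => l _; rewrite !(mxE, mxwE) mulrC.
have e4 : \sum_a p a (t, W0) * 'D_(Dj j) (X a) (t, W0) =
    k0 * \sum_l 'D_Dt (u (lshift m l)) (t, W0) * 'D_(Dj j) (X (lshift m l)) (t, W0).
  rewrite mulr_sumr; apply: etrans (sum_r0 _) _.
    by move=> l; apply: mulr0e; exact: DX_r0.
  by apply: eq_bigr => l _; rewrite mulrA.
have e5 : \sum_a 'D_(Dj j) (u a) (t, W0) * 'D_Dt (X a) (t, W0) =
    \sum_l 'D_(Dj j) (u (lshift m l)) (t, W0) * 'D_Dt (X (lshift m l)) (t, W0).
  by apply: sum_r0 => l; apply: mulr0e; exact: DX_r0.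
have fin (x1 x2 x3 x4 x5 x6 D1 D2 D3 l r dc w : R) : x1 = D1 - r * (2 * w) -> x2 = D2 ->
    x3 = D3 -> x5 = l * D2 -> x6 = D3 -> dc = r -> x4 = x5 - l * x6 + D1 - dc * w ->
    x1 + l * (x2 - x3) = x4 - r * w.
  by move=> -> -> -> -> -> -> ->; ring.
exact: (fin _ _ _ _ _ _ _ _ _ _ _ _ _ e1 e2 e3 e4 e5 (crE j t) (mu_D (Dj j) Az)).
Qed.

Lemma Dj_mu j t : 'D_(Dj j) mu (t, W0) = 'D_(Dj j) mu (0, W0).
Proof. by apply: param_const; [exact: mu_SM|move=> *; exact: mu_cst]. Qed.

(** By [modmatrixE] this is B + c0, with B the matrix of the modulated system. *)
Definition BR : 'M[R]_K := col_mx (- (k0 *: crR)) (col_mx (J *m ljR - waveM W0 *m crR)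
  (\row_j ('D_(Dj j) mu (0, W0) - crR 0 j * W0 iP 0))).

Lemma BPR_cont i j : continuous (fun t => BPR t i j).
Proof.
have -> : (fun t => BPR t i j) = (fun t => 'D_(Dj j) mu (0, W0) - crR 0 j * Qf (t, W0)).
  by apply/funext => t; rewrite (ord1 i) BPR_mu Dj_mu.
apply: rcontD; first exact: rcont_cst.
apply: rcontN; apply: rcontM; first exact: rcont_cst.
exact: (SM_cont_t Qf_SM OW0).
Qed.

Lemma mean_BPR j : mean (fun t => BPR t 0 j) = 'D_(Dj j) mu (0, W0) - crR 0 j * W0 iP 0.
Proof.
have -> : (fun t => BPR t 0 j) = (fun t => 'D_(Dj j) mu (0, W0) + \sum_(l : 'I_1) (- crR 0 j) * Qf (t, W0)).
  by apply/funext => t; rewrite BPR_mu Dj_mu big_ord1 mulNr.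
rewrite (@mean_lin 'I_1 _ (fun=> - crR 0 j) (fun _ t => Qf (t, W0))).
  by rewrite big_ord1 mean_Qf // mulNr.
by move=> _; exact: (SM_cont_t Qf_SM OW0).
Qed.

Hypothesis kernel_dim : gen_kernel_dim J H k0 c0 U0 N.+2.
Hypothesis stab : spectrally_stable J H k0 c0 U0.

Lemma BR_real (z : R[i]) : eigenvalue (cx BR) z -> complex.Im z = 0.
Proof.
have JJi : cx J *m cx Ji = 1%:M by rewrite -map_mxM mulmxV // map_mx1.
have bE t : mxw fb t = bvm H (q (t, W0)) by apply/matrixP => i j; rewrite !mxwE.
have dE t : mxw fd t = dvm H (q (t, W0)) by apply/matrixP => i j; rewrite !mxwE.
have blk (B : 'M[R]_n) i j : (block_mx (cx B) 0 0 0 : 'M[R[i]]_N) i j = ((block_mx B 0 0 0 : 'M[R]_N) i j)%:C.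
  have -> : block_mx (cx B) 0 0 0 = cx (block_mx B 0 0 0 : 'M[R]_N) by rewrite map_block_mx !map_mx0.
  by rewrite mxE.
have h := @system_real R n m k0 (cx J) (cx Ji) (mcx (mxw fa)) (mcx (mxw fb)) (mcx (mxw fd))
  (mcx (mxw fu)) (mcx (mxw fu1)) (mcx (mxw fp1)) (mcx (mxw fx1))
  (mcx (mxw fuj)) (mcx (mxw fpj)) (mcx (mxw fxj)) (cx crR) (cx ljR)
  (mcx (mxw (fun i j z => 'D_Dt (fe i j) z))) (mcx (mxw (fun i j z => 'D_Dt (fr i j) z))).
have {}h := h k0_gt0 JJi.
have s1 : (cx Ji)^T = cx Ji by rewrite cx_tr /Ji trmx_inv J_sym.
have s2 t : (mcx (mxw fa) t)^T = mcx (mxw fa) t by rewrite /mcx cx_tr fa_sym.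
have s3 t : (mcx (mxw fd) t)^T = mcx (mxw fd) t by rewrite /mcx cx_tr fd_sym.
have {}h := h s1 s2 s3.
have u1 t : drsubmx (mcx (mxw fa) t) \in unitmx by rewrite -map_drsubmx map_unitmx fauu_unit.
have u2 t : mcx (mxw fd) t \in unitmx by rewrite map_unitmx fd_unit.
have {}h := h u1 u2 (smp_mcsm smp_fa) (smp_mcsm smp_fb) (smp_mcsm smp_fd) inv_fd_mcsm inv_fauu_mcsm
  (smp_mcsm smp_fu) (smp_mcsm smp_fxj) (smp_mcsm smp_fuj) (smp_mcsm (smp_D Dt smp_X))
  (smp_per smp_fa) (smp_per smp_fb) (smp_per smp_fd) (smp_per smp_fu) (smp_per (smp_D Dt smp_X))
  (smp_per smp_fuj) (smp_per smp_fxj) (smp_der smp_fu).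
have f1 : mder (fun t => usubmx (mcx (mxw fu1) t)) (fun t => k0%:C^-1 *: mcx (mxw fp1) t).
  apply: mder_ext (mder_usub (smp_der (smp_D Dt smp_fu))) _ _ => // t.
  by rewrite /mcx -map_usubmx real_dU1 cx_Z cx_kV.
have f2 t : mcx (mxw fx1) t = (mcx (mxw fb) t)^T *m usubmx (mcx (mxw fu1) t) + mcx (mxw fd) t *m mcx (mxw fp1) t.
  by rewrite /mcx real_X1E map_mxD !map_mxM -cx_tr map_usubmx.
have f3 : mder (mcx (mxw fx1)) (fun t => k0%:C^-1 *: (usubmx (mcx (mxw fa) t *m mcx (mxw fu1) t)
    + mcx (mxw fb) t *m mcx (mxw fp1) t)).
  apply: (mder_ext (cx_smp (smp_D Dt smp_X) real_dX1) (fun=> erefl)) => t.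
  by rewrite /mcx cx_Z cx_kV map_mxD map_usubmx !map_mxM.
have f4 t : dsubmx (mcx (mxw fa) t *m mcx (mxw fu1) t) = 0.
  by rewrite /mcx -map_mxM -map_dsubmx real_aU1 map_mx0.
have f5 : mder (fun t => usubmx (mcx (mxw fuj) t)) (fun t => k0%:C^-1 *: (mcx (mxw fpj) t
    - usubmx (mcx (mxw fu1) t) *m row_mx 1%:M 0)).
  apply: mder_ext (mder_usub (smp_der smp_fuj)) _ _ => // t.
  by rewrite /mcx -map_usubmx real_dUj cx_Z cx_kV map_mxB map_mxM cx_dl map_usubmx.
have f6 t : mcx (mxw fxj) t = (mcx (mxw fb) t)^T *m usubmx (mcx (mxw fuj) t) + mcx (mxw fd) t *m mcx (mxw fpj) t.
  by rewrite /mcx real_XjE map_mxD !map_mxM -cx_tr map_usubmx.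
have {}h := h f1 f2 f3 f4 f5 f6.
have ljc t : cx (ljR - Ji *m mxw fu t *m crR) = cx ljR - cx Ji *m mcx (mxw fu) t *m cx crR.
  by rewrite map_mxB !map_mxM.
have f7 : mder (mcx (mxw fxj)) (fun t => k0%:C^-1 *: (usubmx (mcx (mxw fa) t *m mcx (mxw fuj) t)
    + mcx (mxw fb) t *m mcx (mxw fpj) t - mcx (mxw fx1) t *m row_mx 1%:M 0
    - usubmx (cx ljR - cx Ji *m mcx (mxw fu) t *m cx crR))).
  apply: (mder_ext (cx_smp smp_fxj real_dXj) (fun=> erefl)) => t.
  rewrite -ljc /mcx cx_Z cx_kV 2!map_mxB map_mxD !map_usubmx !map_mxM cx_dl.
  by [].
have f8 t : dsubmx (mcx (mxw fa) t *m mcx (mxw fuj) t) =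
    dsubmx (cx ljR - cx Ji *m mcx (mxw fu) t *m cx crR).
  by rewrite -ljc /mcx -map_mxM -!map_dsubmx real_aUj.
have f9 : mder (fun t => mcx (mxw fd) t *m usubmx (mcx (mxw fuj) t))
    (mcx (mxw (fun i j z => 'D_Dt (fe i j) z))).
  apply: mder_ext (smp_der smp_fe) _ _ => // t.
  by rewrite /mcx real_E map_mxM map_usubmx.
have f10 : mder (fun t => mcx (mxw fb) t *m usubmx (mcx (mxw fuj) t) - mcx (mxw fxj) t
    - k0%:C *: mcx (mxw (fun i j z => 'D_Dt (fe i j) z)) t) (mcx (mxw (fun i j z => 'D_Dt (fr i j) z))).
  apply: mder_ext (smp_der smp_fr) _ _ => // t.
  by rewrite /mcx real_R 2!map_mxB map_mxM map_usubmx cx_Z.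
have f11 : mint (mcx (mxw fuj)) = row_mx 0 (row_mx 1%:M 0).
  rewrite (mint_mcx (smp_cont smp_fuj)).
  have -> : (row_mx 0 (row_mx 1%:M 0) : 'M[R[i]]_(N, K)) = cx (row_mx 0 (row_mx 1%:M 0)).
    by rewrite !map_row_mx !map_mx0 map_mx1.
  congr map_mx; apply/matrixP => i j; rewrite mxE mean_fuj.
  case: (split_ordP j) => j' ->; first by rewrite row_mxEl mxE eq_rlshift.
  rewrite row_mxEr (inj_eq (@rshift_inj _ _)); case: (split_ordP j') => j'' ->.
    by rewrite row_mxEl mxE (inj_eq (@lshift_inj _ _)).
  by rewrite row_mxEr mxE eq_lrshift.
have f12 : mint (fun t => (mcx (mxw fu) t)^T *m (cx Ji *m mcx (mxw fuj) t)) = row_mx 0 (row_mx 0 1%:M).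
  have -> : (fun t => (mcx (mxw fu) t)^T *m (cx Ji *m mcx (mxw fuj) t)) =
      mcx (fun t => \row_j \sum_a JU a (t, W0) * 'D_(Dj j) (u a) (t, W0)).
    apply/funext => t; rewrite /mcx cx_tr -!map_mxM; congr map_mx.
    apply/matrixP => i j; rewrite (ord1 i) mulmxA [RHS]mxE mxE; apply: eq_bigr => a _.
    have -> : ((mxw fu t)^T *m Ji) 0 a = JU a (t, W0).
      rewrite -JU_col mxE [RHS]mxE; apply: eq_bigr => b _.
      by rewrite mxE mulrC; congr (_ * _); exact: invJ_sym.
    by rewrite mxwE.
  rewrite mint_mcx; last first.
    move=> i j; have sQ := SM_cont_t (SM_D (Dj j) Qf_SM) OW0.
    have -> : (fun t => (\row_j0 \sum_a JU a (t, W0) * 'D_(Dj j0) (u a) (t, W0)) i j) =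
        (fun t => 'D_(Dj j) Qf (t, W0)); last exact: sQ.
    by apply/funext => t; rewrite mxE; exact: (esym (D_Q _ (tdomP t OW0))).
  have -> : (row_mx 0 (row_mx 0 1%:M) : 'M[R[i]]_(1, K)) = cx (row_mx 0 (row_mx 0 1%:M)).
    by rewrite !map_row_mx !map_mx0 map_mx1.
  congr map_mx; apply/matrixP => i j; rewrite (ord1 i) mxE.
  have -> : (fun t => (\row_j0 \sum_a JU a (t, W0) * 'D_(Dj j0) (u a) (t, W0)) 0 j) =
      (fun t => \sum_a JU a (t, W0) * 'D_(Dj j) (u a) (t, W0)) by apply/funext => t; rewrite mxE.
  rewrite mean_QJ.
  case: (split_ordP j) => j' ->; first by rewrite row_mxEl mxE eq_rlshift.
  rewrite row_mxEr (inj_eq (@rshift_inj _ _)); case: (split_ordP j') => j'' ->.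
    by rewrite row_mxEl mxE eq_rlshift.
  by rewrite row_mxEr mxE (inj_eq (@rshift_inj _ _)).
have {}h := h f7 f8 f9 f10 f11 f12 J H c0 U0 erefl erefl.
have pt (G : 'cV[R]_N -> 'cV[R]_N -> R) t : G (U0 t) (k0 *: derive1 U0 t) = unc G (q (t, W0)).
  by rewrite q_U0.
have g1 t i j : (dU j (dU i H) (U0 t) (k0 *: derive1 U0 t))%:C + c0%:C * cx Ji i j = mcx (mxw fa) t i j.
  by rewrite pt [in RHS]mxE mxwE [cx Ji i j]mxE -rmorphM -rmorphD.
have g2 t i j : (dUx j (dU i H) (U0 t) (k0 *: derive1 U0 t))%:C =
    (block_mx (mcx (mxw fb) t) 0 0 0 : 'M[R[i]]_N) i j.
  by rewrite pt blk bE (dUxdU_block H_struct i j (qOm (tdomP t OW0))).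
have g3 t i j : (dU j (dUx i H) (U0 t) (k0 *: derive1 U0 t))%:C =
    (block_mx (mcx (mxw fb) t)^T 0 0 0 : 'M[R[i]]_N) i j.
  by rewrite pt cx_tr blk bE (dUdUx_block H_struct i j (qOm (tdomP t OW0))).
have g4 t i j : (dUx j (dUx i H) (U0 t) (k0 *: derive1 U0 t))%:C =
    (block_mx (mcx (mxw fd) t) 0 0 0 : 'M[R[i]]_N) i j.
  by rewrite pt blk dE (dUxdUx_block H_struct i j (qOm (tdomP t OW0))).
have {}h := h g1 g2 g3 g4 kernel_dim stab z.
suff e : cx BR = col_mx (- (k0%:C *: cx crR)) (Bm k0 (cx J) (cx Ji) (mcx (mxw fu)) (mcx (mxw fu1))
    (mcx (mxw fx1)) (mcx (mxw fuj)) (mcx (mxw fxj)) (cx crR) (cx ljR)) by rewrite e.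
rewrite /BR map_col_mx map_mxN cx_Z; congr col_mx; rewrite map_col_mx; congr col_mx.
  rewrite map_mxB !map_mxM (mint_mcx (smp_cont smp_fu)); congr (_ - map_mx _ _ *m _).
  apply/matrixP => i j; rewrite (ord1 j) [RHS]mxE.
  have -> : (fun t => mxw fu t i 0) = (fun t => u i (t, W0)) by apply/funext => t; rewrite mxwE.
  by rewrite mean_u // !mxE.
have -> : BmP k0 (cx Ji) (mcx (mxw fu)) (mcx (mxw fu1)) (mcx (mxw fx1)) (mcx (mxw fuj))
    (mcx (mxw fxj)) (cx crR) (cx ljR) = mcx BPR.
  apply/funext => t; rewrite /BmP /mcx /BPR -!map_usubmx !cx_tr.
  by rewrite map_mxD cx_Z !map_mxM !map_mxB !map_mxM.
rewrite mint_mcx; last exact: BPR_cont.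
by congr map_mx; apply/matrixP => i j; rewrite (ord1 i) mxE [RHS]mxE mean_BPR.
Qed.

(** * The matrix of the modulated system *)

Lemma Dj_coord i j t : 'D_(Dj j) (fun z : T => z.2 i 0) (t, W0) = (i == j)%:R.
Proof. by rewrite -derive_slice -(coord_D _ _ W0). Qed.

Lemma coord_SMt i : SM A (fun z : T => z.2 i 0).
Proof. exact: (SM_eq A_open (fun _ _ => erefl) (SM_param oO (coord_SM i oO))). Qed.

(** The modulated flux written (0, J lam, mu) - c W; since [lam] and [mu] are constant in t, no mean
    value is left in it. *)
Definition flux (i : 'I_K) (z : T) : R :=
  (col_mx (0 : 'M[R]_1) (col_mx (J *m \col_a lam a z) (mu z)%:M) : 'cV[R]_K) i 0 - cc z * z.2 i 0.

Lemma mean_waveG a W : O W -> mean (fun t => waveG H (wavek W) (U W) t a 0) =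
  lam a (0, W) - c W * (Ji *m waveM W) a 0.
Proof.
move=> OW; have cU b := @SM_cont_t _ _ _ _ _ (raw_SM b) OW.
have -> : (fun t => waveG H (wavek W) (U W) t a 0) =
    (fun t => lam a (0, W) + \sum_b (- (c W * Ji a b)) * U W t b 0).
  apply/funext => t; rewrite waveG_eq // -(lam_cst a (t - s) OW) /lam.
  have -> : \sum_b (- (c W * Ji a b)) * U W t b 0 = - (cc (t - s, W) * JU a (t - s, W)).
    rewrite mulr_sumr -sumrN; apply: eq_bigr => b _.
    by rewrite /u /cc /= subrK; ring.
  by rewrite addrK.
rewrite (@mean_lin _ _ (fun b => - (c W * Ji a b)) (fun b t => U W t b 0) cU).
congr (_ + _); rewrite mxE mulr_sumr -sumrN; apply: eq_bigr => b _.
have [/matrixP/(_ b 0) + _] := hmean OW; rewrite mxE => ->.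
ring.
Qed.

Lemma mean_waveS W : O W -> mean (waveS H (wavek W) (U W)) = mu (0, W) - c W * waveP W.
Proof.
move=> OW; have [_ [pU _ _]] := prof OW; have [_ eP] := hmean OW.
have cI : continuous (fun t => impulse J (U W t)).
  have -> : (fun t => impulse J (U W t)) = (fun t => Qf (t - s, W)).
    by apply/funext => t; rewrite -impulse_u subrK.
  move=> t; apply: (@continuous_comp _ _ _ (fun t => t - s) (fun t => Qf (t, W))).
    by apply: cvgD; [exact: cvg_id|exact: cvg_cst].
  exact: (SM_cont_t Qf_SM OW).
have -> : waveS H (wavek W) (U W) = (fun t => mu (0, W) + \sum_(i : 'I_1) (- c W) * impulse J (U W t)).
  by apply/funext => t; rewrite (waveS_eq _ OW) mu_cst // big_ord1 mulNr.
rewrite (@mean_lin 'I_1 _ (fun=> - c W) (fun _ t => impulse J (U W t))) //.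
by rewrite big_ord1 eP mulNr.
Qed.

Lemma modfluxE i W : O W -> modflux J H c U W i 0 = flux i (0, W).
Proof.
move=> OW; rewrite /modflux /pack /flux /cc /=.
case: (split_ordP i) => i' ->.
  by rewrite !col_mxEu !mxE (ord1 i') eqxx mulr1n sub0r /wavek mxE.
rewrite !col_mxEd; case: (split_ordP i') => a ->.
  rewrite !col_mxEu.
  have -> : vmean (waveG H (wavek W) (U W)) = \col_a lam a (0, W) - c W *: (Ji *m waveM W).
    apply/matrixP => b l; rewrite (ord1 l) [LHS]mxE mean_waveG // [RHS]mxE.
    by congr (_ + _); rewrite ?mxE // [X in _ = - X]mxE.
  by rewrite mulmxBr -scalemxAr mulKVmx // !mxE.
by rewrite !col_mxEd !mxE (ord1 a) !eqxx !mulr1n mean_waveS // /waveP !mxE.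
Qed.

(** The term - c W contributes - c0 on the diagonal: BR is the flux matrix in the frame moving with
    the wave. *)
Lemma D_flux i j : 'D_(Dj j) (flux i) (0, W0) = (BR - c0%:M) i j.
Proof.
have Az := tdomP 0 OW0.
have sx : SM A (fun z : T => (col_mx (0 : 'M[R]_1) (col_mx (J *m \col_a lam a z) (mu z)%:M) : 'cV[R]_K) i 0).
  case: (split_ordP i) => i' ->.
    by apply: (SM_eq A_open _ (SM_cst A_open 0)) => z _; rewrite col_mxEu mxE.
  case: (split_ordP i') => a ->.
    apply: (SM_eq A_open _ (SM_sum A_open (index_enum 'I_N) (fun b => SMZ A_open (J a b) (lam_SM b)))).
    by move=> z _; rewrite col_mxEd col_mxEu mxE; apply: eq_bigr => b _; rewrite mxE.
  apply: (SM_eq A_open _ mu_SM) => z _.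
  by rewrite !col_mxEd mxE (ord1 a) eqxx mulr1n.
apply: etrans (SM_DB A_open _ sx (SMM A_open cc_SM (coord_SMt i)) Az) _.
rewrite (SM_DM (Dj j) cc_SM (coord_SMt i) Az) Dj_coord crE.
have alg (M : 'M[R]_K) : (M - c0%:M) i j = M i j - c0 * (i == j)%:R.
  by rewrite !mxE mulr_natr.
rewrite alg opprD addrA; congr (_ - _).
have e0 (F : T -> R) (G : T -> R) : (forall z, A z -> F z = G z) ->
    'D_(Dj j) F (0, W0) = 'D_(Dj j) G (0, W0) by move=> FG; exact: (SM_Deq A_open _ FG Az).
rewrite /BR; case: (split_ordP i) => i' ->.
  rewrite col_mxEu (e0 _ (fun=> 0)); last by move=> z _; rewrite col_mxEu mxE.
  rewrite derive_cst sub0r [RHS]mxE [in RHS]mxE (ord1 i') mulrC; congr (- (_ * _)).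
  by rewrite /wavek mxE.
rewrite col_mxEd; case: (split_ordP i') => a ->.
  rewrite col_mxEu (e0 _ (fun z => \sum_b J a b * lam b z)); last first.
    by move=> z _; rewrite col_mxEd col_mxEu mxE; apply: eq_bigr => b _; rewrite mxE.
  rewrite (SM_Dsum A_open _ _ (fun b => SMZ A_open (J a b) (lam_SM b)) Az).
  rewrite [RHS]mxE [X in _ = X + _]mxE [X in _ = _ + X]mxE [X in _ = _ - X]mxE big_ord1 !mxE mulrC.
  congr (_ - _); apply: eq_bigr => b _.
  by rewrite (SM_DZ A_open _ _ (lam_SM b) Az) mxE.
rewrite col_mxEd (e0 _ mu); last by move=> z _; rewrite !col_mxEd mxE (ord1 a) eqxx mulr1n.
by rewrite [RHS]mxE (ord1 a).
Qed.

Lemma modmatrixE : modmatrix J H c U W0 = BR - c0%:M.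
Proof.
apply/matrixP => i j; rewrite mxE -D_flux -derive_slice.
exact: (SM_Deq oO _ (fun W OW => modfluxE i OW) OW0).
Qed.

(** The shift by the real number c0 leaves imaginary parts of eigenvalues unchanged. *)
Lemma modmatrix_real : weakly_hyperbolic_at J H c U W0.
Proof.
move=> z /eigenvalueP[v hv v0].
have : eigenvalue (cx BR) (z + c0%:C).
  apply/eigenvalueP; exists v => //.
  have -> : BR = modmatrix J H c U W0 + c0%:M by rewrite modmatrixE subrK.
  by rewrite map_mxD map_scalar_mx mulmxDr hv mul_mx_scalar scalerDl.
by move/BR_real; rewrite cImD /= addr0.
Qed.

End Wave.

Theorem theorem1 (R : realType) (n m : nat)
    (J : 'M[R]_(n + m)) (H : 'cV[R]_(n + m) -> 'cV[R]_(n + m) -> R)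
    (D : set ('cV[R]_(n + m) * 'cV[R]_n)) (C : set R)
    (k0 c0 : R) (U0 : R -> 'cV[R]_(n + m))
    (c : 'cV[R]_(1 + ((n + m) + 1)) -> R)
    (U : 'cV[R]_(1 + ((n + m) + 1)) -> R -> 'cV[R]_(n + m))
    (J_sym : J^T = J) (J_unit : J \in unitmx)
    (H_struct : structural D C J H)
    (U0_profile : is_profile D C J H k0 c0 U0)
    (U_param : parametrized D C J H k0 c0 U0 c U)
    (gen_kernel_dimE : gen_kernel_dim J H k0 c0 U0 (n + m).+2) :
  spectrally_stable J H k0 c0 U0 ->
  weakly_hyperbolic_at J H c U
    (pack k0 (vmean U0) (mean (fun t => impulse J (U0 t)))).
Proof.
move=> stab; have [ O [ e [[oO OW0] e0 sol uniqs [sc sU]]]] := U_param.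
set W0 := pack _ _ _ in OW0 *.
have kW : wavek W0 = k0 by rewrite /wavek /W0 /pack col_mxKu mxE eqxx mulr1n.
have MW : waveM W0 = vmean U0 by rewrite /waveM /W0 /pack col_mxKd col_mxKu.
have PW : waveP W0 = mean (fun t => impulse J (U0 t)).
  by rewrite /waveP /W0 /pack !col_mxKd mxE eqxx mulr1n.
(* Uniqueness, applied to the given wave itself, identifies c0 with c W0 and U0 with a translate by
   s of the parametrized profile. *)
have [] := uniqs W0 c0 U0 OW0.
  split; rewrite ?kW //; first by rewrite subrr normr0.
  by exists 0 => t; rewrite addr0 subrr normr0.
move=> cE [s sE].
have prof W : O W -> is_profile D C J H (wavek W) (c W) (U W) by move=> /sol[].
have hm : meanP J U O by move=> W /sol[].
rewrite -kW cE in gen_kernel_dimE stab.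
exact: (modmatrix_real oO J_sym J_unit H_struct sU sc prof OW0 hm sE gen_kernel_dimE stab).
Qed.
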